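(* Let $T>0$, $q\in(1,\infty)$ and let $$\mathcal{Z}_q:=L^q_w(0,T;V)\cap L^q(0,T;H_{loc})\cap\mathbb{D}([0,T];U')\cap\mathbb{D}([0,T];H_w),$$ and let $\mathcal{T}$ be the supremum of the corresponding four topologies. Then a set $\mathcal{K}\subset\mathcal{Z}_q$ is $\mathcal{T}$-relatively compact if the following three conditions hold: (a) for all $u\in\mathcal{K}$ and all $t\in[0,T]$, $u(t)\in H$, and $\sup_{u\in\mathcal{K}}\sup_{s\in[0,T]}|u(s)|_H<\infty$; (b) $\sup_{u\in\mathcal{K}}\int_0^T\|u(s)\|_V^q\,ds<\infty$, i.e. $\mathcal{K}$ is bounded in $L^q(0,T;V)$; (c) $\lim_{\delta\to0}\sup_{u\in\mathcal{K}}w_{[0,T],U'}(u,\delta)=0$.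
   Context: $d\in\{2,3\}$ and $\mathcal{O}\subset\mathbb{R}^d$ is an open connected (possibly unbounded) set with smooth boundary. $\mathcal{V}:=\{u\in C_c^\infty(\mathcal{O},\mathbb{R}^d):\operatorname{div}u=0\}$; $H$ is the closure of $\mathcal{V}$ in $L^2(\mathcal{O},\mathbb{R}^d)$ (norm $|\cdot|_H$), $V$ the closure of $\mathcal{V}$ in $H^1(\mathcal{O},\mathbb{R}^d)$ with $\|u\|_V^2=|u|_H^2+\|\nabla u\|_{L^2}^2$, and, for $m>0$, $V_m$ the closure of $\mathcal{V}$ in $H^m(\mathcal{O},\mathbb{R}^d)$. Fix $m>1$ and a Hilbert space $U\subset V_m$, dense in $V_m$, with compact embedding $U\hookrightarrow V_m$ (such $U$ exists). With $H\cong H'$ one has $U\hookrightarrow V\hookrightarrow H\cong H'\hookrightarrow U'$, and the embedding $H\hookrightarrow U'$ is compact. $(\mathcal{O}_R)_{R\in\mathbb{N}}$ is a sequence of bounded open subsets of $\mathcal{O}$ with regular boundaries, $\mathcal{O}_R\subset\mathcal{O}_{R+1}$, $\bigcup_R\mathcal{O}_R=\mathcal{O}$. $H_{\mathcal{O}_R}$ and $V_{\mathcal{O}_R}$ are the spaces of restrictions to $\mathcal{O}_R$ of elements of $H$, $V$, with the $L^2(\mathcal{O}_R)$ and $H^1(\mathcal{O}_R)$ norms respectively; the embeddings $V_{\mathcal{O}_R}\hookrightarrow H_{\mathcal{O}_R}$ are compact. Function spaces: - $\mathbb{D}([0,T];U')$: càdlàg functions $[0,T]\to U'$ with the Skorokhod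 topology ($u_n\to u$ iff there are increasing homeomorphisms $\lambda_n$ of $[0,T]$ with $\lambda_n\to\mathrm{id}$ and $u_n\circ\lambda_n\to u$ in $U'$, both uniformly on $[0,T]$). - $L^q_w(0,T;V)$: the space $L^q(0,T;V)$ with its weak topology. - $L^q(0,T;H_{loc})$: measurable $u:[0,T]\to H$ such that for all $R$, $p_{T,R}(u):=\|u\|_{L^q(0,T;H_{\mathcal{O}_R})}=\bigl(\int_0^T|u(t)|_{H_{\mathcal{O}_R}}^q\,dt\bigr)^{1/q}<\infty$, with the topology generated by the seminorms $(p_{T,R})_{R\in\mathbb{N}}$. - $\mathbb{D}([0,T];H_w)$: weakly càdlàg functions $u:[0,T]\to H$, with the weakest topology such that for all $h\in H$ the map $u\mapsto(u(\cdot)|h)_H\in\mathbb{D}([0,T];\mathbb{R})$ (Skorokhod topology) is continuous. Modulus: for $u\in\mathbb{D}([0,T];U')$ and $\delta>0$, $$w_{[0,T],U'}(u,\delta):=\inf_{\Pi_\delta}\max_{i}\sup_{t_i\le s<t<t_{i+1}\le T}\|u(t)-u(s)\|_{U'},$$ where $\Pi_\delta$ is the set of all finite sequences $0=t_0<t_1<\dots<t_n=T$ with $t_{i+1}-t_i\ge\delta$ for $i=0,\dots,n-1$. *)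

(* Defs.v *)
From HB Require Import structures.
From mathcomp Require Import all_boot all_order all_algebra.
From mathcomp Require Import all_classical all_reals all_analysis.

Set Implicit Arguments.
Unset Strict Implicit.
Unset Printing Implicit Defensive.

Import Order.TTheory GRing.Theory Num.Theory.
Import numFieldNormedType.Exports.

Local Open Scope classical_set_scope.
Local Open Scope ring_scope.

Definition rV_display : measure_display -> measure_display.
Proof. exact. Qed.

Section rV_measurable.
Context (R : realType) (n : nat).

Definition rV_coord (i : 'I_n) (x : 'rV[R]_n) : measurableTypeR R := x ord0 i.

Let mrV := g_sigma_preimage rV_coord.

Let mrV0 : mrV set0.
Proof. exact: sigma_algebra0. Qed.

Let mrVC A : mrV A -> mrV (~` A).
Proof. exact: sigma_algebraC. Qed.

Let mrV_bigcup (F : (set 'rV[R]_n)^nat) :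
  (forall i, mrV (F i)) -> mrV (\bigcup_i F i).
Proof. exact: sigma_algebra_bigcup. Qed.

(* The product sigma-algebra, i.e. the Borel sigma-algebra of R^n. *)
HB.instance Definition _ := @isMeasurable.Build
  (rV_display (measure_tuple_display default_measure_display))
  'rV[R]_n mrV mrV0 mrVC mrV_bigcup.

Lemma measurable_rV_coord (i : 'I_n) : measurable_fun [set: 'rV[R]_n] (rV_coord i).
Proof.
move=> _ Y mY; rewrite setTI; apply: sub_sigma_algebra => /=.
rewrite -bigcup_seq/=; exists i => /=; first by rewrite mem_index_enum.
by exists Y => //; rewrite setTI.
Qed.

End rV_measurable.

Section lebesgue_rV.
Context (R : realType).

Definition cons_rV n (p : measurableTypeR R * 'rV[R]_n) : 'rV[R]_n.+1 :=
  \row_i (if unlift ord0 i is Some j then p.2 ord0 j else p.1).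

Lemma measurable_cons_rV n : measurable_fun [set: _] (@cons_rV n).
Proof.
apply: (@measurability _ _ _ _ _ _ (\big[setU/set0]_(i < n.+1)
  preimage_set_system setT (@rV_coord R n.+1 i) measurable)) => //.
move=> _ [Z + <-]; rewrite -bigcup_seq => -[i _ [Y mY <-]].
rewrite setTI setTI -comp_preimage.
case: (unliftP ord0 i) => [j|] ->.
- rewrite (_ : _ \o _ = @rV_coord R n j \o snd); last first.
    by apply/funext => p /=; rewrite /rV_coord mxE liftK.
  rewrite -[X in measurable X]setTI.
  exact: (measurableT_comp (measurable_rV_coord j) measurable_snd).
- rewrite (_ : _ \o _ = fst); last first.
    by apply/funext => p /=; rewrite /rV_coord mxE unlift_none.
  by rewrite -[X in measurable X]setTI; exact: measurable_fst.
Qed.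

(* [\x^] is the product measure that needs no sigma-finiteness of its second
   factor. *)
Fixpoint lebesgue_rV n : {measure set 'rV[R]_n -> \bar R} :=
  if n is n'.+1 return {measure set 'rV[R]_n -> \bar R} then
    measure_function_pushforward__canonical__measure_function_Measure
      (lebesgue_measure \x^ lebesgue_rV n')%E (@measurable_cons_rV n')
  else \d_(0 : 'rV[R]_0).

End lebesgue_rV.

Notation vfield R d := ('rV[R]_d -> 'rV[R]_d).

Section domains.
Context (R : realType) (d : nat).
Implicit Types (A : set 'rV[R]_d) (f : 'rV[R]_d -> R) (u : vfield R d).

Definition dot (x y : 'rV[R]_d) : R := \sum_(i < d) x ord0 i * y ord0 i.

Definition pderiv (i : 'I_d) f : 'rV[R]_d -> R :=
  fun x => 'D_(delta_mx ord0 i) f x.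

(* A word [i1; ...; ik] of directions stands for d_{i1} ... d_{ik}. *)
Definition pderivs (w : seq 'I_d) f : 'rV[R]_d -> R := foldr pderiv f w.

Definition smooth f := forall w : seq 'I_d,
  continuous (pderivs w f) /\
  forall (i : 'I_d) x, derivable (pderivs w f) x (delta_mx ord0 i).

Definition boundary A := closure A `\` interior A.

Definition smooth_boundary A := forall x, boundary A x ->
  exists (W : set 'rV[R]_d) (rho : 'rV[R]_d -> R),
    [/\ open_nbhs x W, smooth rho, exists i, pderiv i rho x != 0 &
        A `&` W = [set y | rho y < 0] `&` W].

(* Locally A is the region below the graph of a Lipschitz function; g is a
   function on the hyperplane orthogonal to e, extended constantly along e. *)
Definition lipschitz_boundary A := forall x, boundary A x ->
  exists (W : set 'rV[R]_d) (e : 'rV[R]_d) (g : 'rV[R]_d -> R^o) (k : R),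
    [/\ open_nbhs x W, dot e e = 1,
        k.-lipschitz g,
        forall y a, g (y + a *: e) = g y &
        A `&` W = [set y | dot y e < g y] `&` W].

End domains.

Section flow_spaces.
Context (R : realType) (d : nat) (Om : set 'rV[R]_d).
Implicit Types (f : 'rV[R]_d -> R) (u v g h : vfield R d).
Local Notation mu := (lebesgue_rV R d).

(* Functions on Om are represented by functions on R^d, whose values outside Om
   play no role; for C_c^oo(Om) they are the extensions by zero. *)
Definition test_function f :=
  [/\ smooth f, compact (closure [set x | f x != 0]) &
      closure [set x | f x != 0] `<=` Om].

Definition test_field : set (vfield R d) := [set u |
  (forall i, test_function (fun x => u x ord0 i)) /\
  (forall x, \sum_(i < d) pderiv i (fun y => u y ord0 i) x = 0)].

Definition ae_eq_on u v := {ae mu, forall x, Om x -> u x = v x}.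

Definition measurable_field u :=
  forall i, measurable_fun Om (fun x => u x ord0 i : measurableTypeR R).

Definition L2sq (A : set 'rV[R]_d) u : \bar R :=
  \int[mu]_(x in A) (dot (u x) (u x))%:E.

Definition L2ip u v : R := \int[mu]_(x in Om) dot (u x) (v x).

Definition L2 : set (vfield R d) :=
  [set u | measurable_field u /\ (L2sq Om u < +oo)%E].

Definition weak_deriv (w : seq 'I_d) u g := forall f, test_function f ->
  forall i, \int[mu]_(x in Om) (u x ord0 i * pderivs w f x) =
    (-1) ^+ size w * \int[mu]_(x in Om) (g x ord0 i * f x).

(* The weak derivative is unique up to a.e. equality, so the infimum below is
   its squared L^2 norm, or +oo when there is no weak derivative in L^2. *)
Definition weak_deriv_sq (w : seq 'I_d) u : \bar R :=
  ereal_inf [set L2sq Om g | g in [set g | L2 g /\ weak_deriv w u g]].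

Definition H1sq u : \bar R :=
  (L2sq Om u + \sum_(i < d) weak_deriv_sq [:: i] u)%E.

Definition slobodeckij_sq (s : R) g : \bar R :=
  \int[mu]_(x in Om) \int[mu]_(y in Om)
    (dot (g x - g y) (g x - g y) /
     Num.sqrt (dot (x - y) (x - y)) `^ (d%:R + 2 * s))%:E.

Definition weak_deriv_slobodeckij_sq (s : R) (w : seq 'I_d) u : \bar R :=
  ereal_inf [set slobodeckij_sq s g | g in [set g | L2 g /\ weak_deriv w u g]].

(* Squared norm of H^m(Om, R^d) for real m > 0: with k the integer part of m,
   the sum of |D^j u|^2 for j <= k, plus the Slobodeckij seminorm of order m - k of
   the derivatives of order k when m is not an integer. *)
Definition Hmsq (m : R) u : \bar R :=
  let k := Num.truncn m in
  (L2sq Om u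
   + \sum_(1 <= j < k.+1) \sum_(w : j.-tuple 'I_d) weak_deriv_sq w u
   + (if m == k%:R then 0
      else \sum_(w : k.-tuple 'I_d) weak_deriv_slobodeckij_sq (m - k%:R) w u))%E.

(* Closure of the divergence-free test fields in the subspace of L^2(Om, R^d)
   where the squared norm N is finite *)
Definition closure_test (N : vfield R d -> \bar R) : set (vfield R d) :=
  [set u | [/\ L2 u, (N u < +oo)%E &
    forall eps : R, 0 < eps ->
      exists2 v, test_field v & (N (u \- v)%R < eps%:E)%E]].

Definition Hsp := closure_test (L2sq Om).
Definition Vsp := closure_test H1sq.
Definition Vmsp (m : R) := closure_test (Hmsq m).

Definition L2norm (A : set 'rV[R]_d) u : \bar R := (L2sq A u `^ 2^-1)%E.
Definition Hnorm u : \bar R := L2norm Om u.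
Definition Vnorm u : \bar R := (H1sq u `^ 2^-1)%E.

End flow_spaces.

Definition is_hilbert (R : realType) (U : completeNormedModType R) :=
  exists ip : U -> U -> R,
  [/\ forall x y, ip x y = ip y x,
      forall (a : R) x y z, ip (a *: x + y) z = a * ip x z + ip y z &
      forall x, ip x x = `|x| ^+ 2].

(* U is identified with a subspace of V_m through j. *)
Definition dense_compact_embedding (R : realType) (d : nat) (Om : set 'rV[R]_d)
    (m : R) (U : normedModType R) (j : U -> vfield R d) :=
  [/\ forall x, Vmsp Om m (j x),
      (forall (a : R) x y, ae_eq_on Om (j (a *: x + y)) (a *: j x + j y)) /\
      (forall x, ae_eq_on Om (j x) (fun=> 0) -> x = 0),
      forall u, Vmsp Om m u -> forall eps : R, 0 < eps ->
        exists x, (Hmsq Om m (u \- j x)%R < eps%:E)%E &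
      forall x : nat -> U, (exists M : R, forall n, `|x n| <= M) ->
        exists (s : nat -> nat) (u : vfield R d),
          [/\ forall n, (s n < s n.+1)%N, Vmsp Om m u &
              Hmsq Om m (j (x (s n)) \- u)%R @[n --> \oo] --> 0%E]].

Definition generated_topology (X : Type) (B : set (set X)) : Type := X.

HB.instance Definition _ (X : choiceType) (B : set (set X)) :=
  Choice.on (generated_topology B).
HB.instance Definition _ (X : choiceType) (B : set (set X)) :=
  isSubBaseTopological.Build (generated_topology B) B id.

Section skorokhod.
Context (R : realType) (T : R) (E : zmodType).
Variables (S : set E) (N : E -> \bar R).
Implicit Types (u v : R -> E).

(* Cadlag functions from [0,T] to the normed space S with norm N. *)
Definition cadlag u :=
  [/\ forall t : R, 0 <= t <= T -> S (u t),
      forall t : R, 0 <= t < T -> N (u s - u t) @[s --> t^'+] --> 0%E &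
      forall t : R, 0 < t <= T ->
        exists2 l, S l & N (u s - l) @[s --> t^'-] --> 0%E].

Definition time_change (lam : R -> R) :=
  [/\ set_bij `[0, T] `[0, T] lam,
      {in `[0, T]%R &, {homo lam : s t / s < t}} &
      {within `[0, T], continuous lam}].

(* Zero limit of this (extended) metric is exactly convergence in the sense of
   time changes: lam_n -> id and u_n o lam_n -> u, both uniformly on [0,T]. *)
Definition skorokhod_dist u v : \bar R :=
  ereal_inf [set ereal_sup [set maxe `|lam t - t|%:E (N (u t - v (lam t)))
                           | t in `[0, T]]
            | lam in time_change].

Definition skorokhod_balls : set (set (R -> E)) :=
  [set B | exists (u : R -> E) (r : R), 0 < r /\
     B = [set v | (skorokhod_dist u v < r%:E)%E]].

Definition skorokhod : Type := generated_topology skorokhod_balls.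
HB.instance Definition _ := Topological.on skorokhod.

Definition subdivision (delta : R) (n : nat) (t : nat -> R) :=
  [/\ t 0%N = 0, t n = T &
      forall i, (i < n)%N -> t i < t i.+1 /\ delta <= t i.+1 - t i].

Definition cadlag_modulus u (delta : R) : \bar R :=
  ereal_inf [set a | exists n t, subdivision delta n t /\
    a = \big[maxe/0%E]_(i < n)
          ereal_sup [set N (u p.2 - u p.1) | p in
            [set p : R * R | t i <= p.1 /\ p.1 < p.2 /\ p.2 < t i.+1]]].

End skorokhod.

Variant Zq_factor := F_LqwV | F_LqHloc | F_DU' | F_DHw.

Section Zq.
Context (R : realType) (d : nat) (Om : set 'rV[R]_d) (Om_ : nat -> set 'rV[R]_d).
Context (U : normedModType R) (j : U -> vfield R d) (T q : R).
Local Notation leb := (@lebesgue_measure R).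

Definition dual_norm (l : U -> R) : \bar R :=
  ereal_sup [set `|l x|%:E | x in [set x | `|x| <= 1]].

Definition dual : set (U -> R) := [set l |
  (forall (a : R) x y, l (a *: x + y) = a * l x + l y) /\
  (dual_norm l < +oo)%E].

(* The inclusion of H = H' into U'. All four factors of Z_q are sets of functions
   from [0,T] to U', and membership in H or V is read through emb. *)
Definition emb (h : vfield R d) : U -> R := fun x => L2ip Om h (j x).

Definition in_H (l : U -> R) := exists2 h, Hsp Om h & l = emb h.

(* The element of H, unique up to a.e. equality, that is identified with l *)
Definition rep (l : U -> R) : vfield R d :=
  xget (fun=> 0) [set h | Hsp Om h /\ l = emb h].

(* v : [0,T] -> S is Borel measurable for the topology of the norm N on S. *)
Definition borel_valued (S : set (vfield R d)) (N : vfield R d -> \bar R)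
    (v : R -> vfield R d) :=
  (forall t : R, 0 <= t <= T -> S (v t)) /\
  forall A : set (vfield R d),
    (forall h, S h -> A h -> exists2 r : R, 0 < r &
       forall g, S g -> (N (g \- h)%R < r%:E)%E -> A g) ->
    measurable ([set t : measurableTypeR R | 0 <= (t : R) <= T /\ A (v t)]).

Definition LqV : set (R -> U -> R) := [set u | exists v,
  [/\ borel_valued (Vsp Om) (Vnorm Om) v,
      {ae leb, forall t : R, 0 <= t <= T -> u t = emb (v t)} &
      (\int[leb]_(t in `[0%R, T]) (Vnorm Om (v t) `^ q) < +oo)%E]].

Definition LqV_norm (u : R -> U -> R) : \bar R :=
  ((\int[leb]_(t in `[0%R, T]) (Vnorm Om (rep (u t)) `^ q)) `^ q^-1)%E.

Definition LqV_dual (Phi : (R -> U -> R) -> R) :=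
  (forall (a : R) u v, LqV u -> LqV v -> Phi (a *: u + v) = a * Phi u + Phi v) /\
  exists C : R, forall u, LqV u -> (`|Phi u|%:E <= C%:E * LqV_norm u)%E.

Definition p_TR (n : nat) (u : R -> U -> R) : \bar R :=
  ((\int[leb]_(t in `[0%R, T]) (L2norm (Om_ n) (rep (u t)) `^ q)) `^ q^-1)%E.

Definition LqHloc : set (R -> U -> R) := [set u |
  (exists2 v, borel_valued (Hsp Om) (Hnorm Om) v &
     {ae leb, forall t : R, 0 <= t <= T -> u t = emb (v t)}) /\
  forall n, (p_TR n u < +oo)%E].

Definition DU' : set (R -> U -> R) := [set u | cadlag T dual dual_norm u].

Definition ipH (l : U -> R) (h : vfield R d) : R := L2ip Om (rep l) h.

Definition DHw : set (R -> U -> R) := [set u |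
  [/\ forall t : R, 0 <= t <= T -> in_H (u t),
      forall t : R, 0 <= t < T -> forall h, Hsp Om h ->
        ipH (u s) h @[s --> t^'+] --> ipH (u t) h &
      forall t : R, 0 < t <= T -> exists2 l, Hsp Om l & forall h, Hsp Om h ->
        ipH (u s) h @[s --> t^'-] --> L2ip Om l h]].

(* A function on [0,T] is represented by its extension by zero to R. *)
Definition Zq_set : set (R -> U -> R) := [set u |
  [/\ LqV u, LqHloc u, DU' u, DHw u & forall t : R, ~~ (0 <= t <= T) -> u t = 0]].

Definition Zq_elt : Type := {u : R -> U -> R | u \in Zq_set}.
HB.instance Definition _ := Choice.on Zq_elt.

Definition top_LqwV : Type := sup_topology
  (fun Phi : {Phi | LqV_dual Phi} => Topological.class
    (initial_topology (fun u : Zq_elt => sval Phi (val u)))).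
HB.instance Definition _ := Topological.on top_LqwV.

Definition top_LqHloc : Type := generated_topology
  [set B : set Zq_elt | exists (n : nat) (v : Zq_elt) (r : R), 0 < r /\
     B = [set u : Zq_elt | (p_TR n (val u - val v)%R < r%:E)%E]].
HB.instance Definition _ := Topological.on top_LqHloc.

Definition top_DU' : Type :=
  initial_topology (fun u : Zq_elt => val u : skorokhod T dual_norm).
HB.instance Definition _ := Topological.on top_DU'.

Definition top_DHw : Type := sup_topology
  (fun h : {h | Hsp Om h} => Topological.class
    (initial_topology (fun u : Zq_elt =>
       (fun t => ipH (val u t) (sval h)) :
         skorokhod T (fun x : R => `|x|%:E)))).
HB.instance Definition _ := Topological.on top_DHw.

Definition Zq_topologies (c : Zq_factor) : Topological Zq_elt :=
  match c with
  | F_LqwV => Topological.class top_LqwV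
  | F_LqHloc => Topological.class top_LqHloc
  | F_DU' => Topological.class top_DU'
  | F_DHw => Topological.class top_DHw
  end.

Definition Zq : Type := sup_topology Zq_topologies.
HB.instance Definition _ := Topological.on Zq.

Definition Zq_fun (u : Zq) : R -> U -> R := val (u : Zq_elt).

End Zq.

(* Main.v *)
(** An ultrafilter F containing the closure of K has a pointwise limit g with values in H: on bounded
    sets of H the norm of U' is governed by finitely many evaluations, because U embeds compactly in
    L^2, so v(t) -> g(t) in U' along F for each t. Condition (c) provides partitions with uniform gaps,
    which converge along F; the right limits of g form a cadlag path u, and piecewise affine changes of
    time matching the partitions give Skorokhod convergence of F to u.

    On paths bounded as in (a) and (b), Skorokhod convergence in U' implies the three other ones.
    For D([0,T];H_w), approximate a test vector of H by elements of U. For L^q(0,T;H_loc), combine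
    Lions' inequality |h|^2_{L^2(O_R)} <= e |h|_V^2 + C |h|_{U'}^2 with dominated convergence, as
    v_n(t) -> u(t) in U' off a countable set. For L^q_w(0,T;V), a sequence on which a functional stays
    away from its value at u has convex combinations converging to u in L^q(0,T;V), by Mazur's argument
    in the uniformly convex space L^q(0,T;V).

    Lions' inequality is proved for divergence-free test fields by the Poincare inequality on small
    cubes and by approximating the averages over the cubes by elements of U, so that no Rellich
    theorem and no regularity of the boundaries is involved. *)
Require Import Defs.
From HB Require Import structures.
From mathcomp Require Import all_boot all_order all_algebra.
From mathcomp Require finmap.
From mathcomp Require Import all_classical all_reals all_analysis.
From mathcomp Require Import measurable_realfun ring lra.
Set Implicit Arguments.
Unset Strict Implicit.
Unset Printing Implicit Defensive.
Import Order.TTheory GRing.Theory Num.Theory.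
Import numFieldNormedType.Exports.
Local Open Scope classical_set_scope.
Local Open Scope ring_scope.

(** The topology is handled through ultrafilters because nothing makes it metrizable. Sequences
    enter only once a target path [u] is fixed: if some neighbourhood of [u] failed to contain all
    bounded paths close to [u], there would be a sequence of such paths outside it, at Skorokhod
    distances [1/(k+1)] from [u].

    Every norm is carried over to functionals on [U] as a squared seminorm with values in [0, +oo],
    an infimum over representatives. What matters about those of H and V is that their sublevels are
    closed under pointwise convergence on [U]. This one property yields measurability of the norms
    along right-continuous paths, lower semicontinuity of the energy by Fatou's lemma, and the
    passage of the bounds (a) and (b) to limits. The local norms on [O_R] need not have it and are
    recovered as differences of two seminorms that do.

    Condition (c) is kept as one gap [D p] for each oscillation level [1/(p+1)]. A Skorokhod limit
    satisfies it with the gap [D (2p+1) / 2], so the form of the bound survives both limits taken: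
    from [K] to its closure, and along the ultrafilter. *)

Lemma exists_natSinv_lt {R : archiRealFieldType} (e : R) : 0 < e ->
  exists k : nat, k.+1%:R^-1 < e.
Proof.
move=> e0; exists (Num.truncn e^-1).
by rewrite invf_plt ?posrE// truncnS_gt.
Qed.

(** * Lebesgue measure and calculus on R^d *)

Section lebesgue_rV_theory.
Context {R : realType}.
Implicit Types n : nat.

Definition rbox n (I : 'I_n -> set R) : set 'rV[R]_n :=
  [set x | forall i, I i (x ord0 i)].

Lemma measurable_rbox n (I : 'I_n -> set R) :
  (forall i, measurable (I i : set (measurableTypeR R))) -> measurable (rbox I).
Proof.
move=> mI.
have -> : rbox I = \bigcap_(i in setT) (@rV_coord R n i @^-1` I i).
  by apply/seteqP; split=> [x Ix i _|x Ix i]; [exact: Ix|exact: (Ix i)].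
apply: fin_bigcap_measurable => [|i _]; first exact: finite_finset.
rewrite -[X in measurable X]setTI; exact: measurable_rV_coord.
Qed.

Lemma rV_ballP n (x y : 'rV[R]_n) (e : R) : 0 < e ->
  ball x e y <-> forall i, `|x ord0 i - y ord0 i| < e.
Proof.
move=> e0; split=> [[_ xy] i|xy]; first exact: xy.
by split=> // i k; rewrite (ord1 i); exact: xy.
Qed.

(** The sigma-algebra is generated by the coordinates, so openness has to be turned into countable
    operations on them: an open set is the union of the boxes with rational centre and radius
    [1/(k+1)] that it contains. *)
Lemma open_measurable_rV n (A : set 'rV[R]_n) : open A -> measurable A.
Proof.
move=> oA.
pose B (p : {ffun 'I_n -> rat} * nat) :=
  rbox (fun i => [set s : R | `|ratr (p.1 i) - s| < p.2.+1%:R^-1]).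
have mB p : measurable (B p).
  apply: measurable_rbox => i.
  rewrite (_ : mkset _ = ball (ratr (p.1 i) : R) p.2.+1%:R^-1) //.
  exact: measurable_ball.
have -> : A = \bigcup_(p in setT) (if `[< B p `<=` A >] then B p else set0).
  apply/seteqP; split=> [x Ax|x [p _]]; last by case: asboolP => // BA Bx; exact: BA.
  have /nbhs_ballP[e /= e0 xeA] : nbhs x A by exact: open_nbhs_nbhs.
  have [k ke] := exists_natSinv_lt (divr_gt0 e0 (ltr0Sn R 1)).
  have k0 : (0 : R) < k.+1%:R^-1 by rewrite invr_gt0.
  have /choice[c xc] (i : 'I_n) : exists q : rat, `|ratr q - x ord0 i| < k.+1%:R^-1.
    have [|q] := @rat_in_itvoo R (x ord0 i - k.+1%:R^-1) (x ord0 i + k.+1%:R^-1).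
      by rewrite ltrBlDr -addrA ltrDl addr_gt0.
    by rewrite in_itv /= => /andP[q1 q2]; exists q; rewrite distrC ltr_distlC q1.
  exists ([ffun i => c i], k) => //.
  case: asboolP => [_ i /=|]; first by rewrite ffunE.
  move=> nBA; case: nBA => y By; apply: xeA; apply/rV_ballP => // i.
  rewrite (splitr e) -(subrKA (ratr (c i))) (le_lt_trans (ler_normD _ _))// ltrD//.
    by rewrite distrC (lt_trans (xc i)).
  by apply: lt_trans ke; have := By i; rewrite /= ffunE.
apply: countable_bigcupT_measurable => // p.
by case: asboolP.
Qed.

Lemma continuous_measurable_rV n (f : 'rV[R]_n -> R) :
  continuous f -> measurable_fun setT (f : 'rV[R]_n -> measurableTypeR R).
Proof.
move=> cf; apply: (measurability _ (RGenOpens.measurableE R)).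
move=> _ [_ [a [b ->] <-]].
rewrite setTI; apply: open_measurable_rV.
by move/continuousP : cf; apply; exact: interval_open.
Qed.

Lemma lebesgue_rV_cube n (I : 'I_n -> set R) (a : R) :
  (forall i, measurable (I i : set (measurableTypeR R))) ->
  (forall i, lebesgue_measure (I i) = a%:E) ->
  lebesgue_rV R n (rbox I) = (a ^+ n)%:E.
Proof.
elim: n I => [I mI aI|n IH I mI aI].
  by rewrite /= diracE expr0 mem_set// => -[].
rewrite /= /pushforward.
have -> : @cons_rV R n @^-1` rbox I =
    I ord0 `*` rbox (fun i => I (lift ord0 i)).
  apply/seteqP; split=> -[s y] /=.
    move=> h; split=> /= [|i]; first by have := h ord0; rewrite mxE unlift_none.
    by have := h (lift ord0 i); rewrite mxE liftK.
  by move=> [/= Is Iy] i; rewrite mxE; case: unliftP => [k|] ->.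
rewrite product_measure2E//; last exact: measurable_rbox.
by rewrite [X in (X * _)%E]aI IH// exprS EFinM.
Qed.

(* A copy of [lebesgue_rV] that can carry a sigma-finite instance. *)
Definition lebm n : set 'rV[R]_n -> \bar R := lebesgue_rV R n.

HB.instance Definition _ n := Measure.on (@lebm n).

Lemma lebm_sigma_finite n : sigma_finite setT (@lebm n).
Proof.
exists (fun k => rbox (fun=> `]- k%:R, k%:R[%classic)).
  rewrite predeqE => x; split=> // _.
  have [k xk] : exists k : nat, `|x| < k%:R.
    exists (Num.truncn `|x|).+1; exact: truncnS_gt.
  exists k => // i /=; rewrite in_itv/= -ltr_norml.
  apply: le_lt_trans xk; rewrite /Num.Def.normr/= mx_normrE.
  exact: (le_bigmax_cond _ (fun ij => `|x ij.1 ij.2|) (j := (ord0, i))).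
move=> k; split; first exact: measurable_rbox.
rewrite /lebm (@lebesgue_rV_cube _ _ (k%:R + k%:R)) ?ltry// => i.
rewrite lebesgue_measure_itv/= lte_fin; case: ifPn.
  by rewrite opprK.
rewrite -leNgt lerNr.
case: k => [|k]; rewrite ?addr0//.
by rewrite leNgt (@lt_trans _ _ 0)// ?oppr_lt0 ltr0n.
Qed.

HB.instance Definition _ n := Measure_isSigmaFinite.Build _ _ _ (@lebm n) (@lebm_sigma_finite n).

(** [lebesgue_rV] is built with [\x^], while the Tonelli theorems speak of [\x]. Both measures take
    the same values on rectangles, so they agree by uniqueness of the product of sigma-finite
    measures. *)
Lemma integral_lebesgue_rVS n (f : 'rV[R]_n.+1 -> \bar R) :
  measurable_fun setT f -> (forall x, 0 <= f x)%E ->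
  (\int[lebesgue_rV R n.+1]_x f x =
   \int[lebesgue_measure \x @lebm n]_p f (cons_rV p))%E.
Proof.
move=> mf f0; rewrite /= ge0_integral_pushforward//; last exact: measurable_cons_rV.
rewrite preimage_setT; apply: eq_measure_integral => A mA _.
apply/esym/product_measure_unique => // B C mB mC.
exact: (product_measure2E lebesgue_measure (lebesgue_rV R n)).
Qed.

Lemma integral_lebesgue_rVS1 n (f : 'rV[R]_n.+1 -> \bar R) :
  measurable_fun setT f -> (forall x, 0 <= f x)%E ->
  (\int[lebesgue_rV R n.+1]_x f x =
   \int[lebesgue_measure]_s \int[lebesgue_rV R n]_y f (cons_rV (s, y)))%E.
Proof.
move=> mf f0; rewrite integral_lebesgue_rVS// (fubini_tonelli1 (f \o @cons_rV R n))//=.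
by apply: measurableT_comp => //; exact: measurable_cons_rV.
Qed.

Lemma integral_lebesgue_rVS2 n (f : 'rV[R]_n.+1 -> \bar R) :
  measurable_fun setT f -> (forall x, 0 <= f x)%E ->
  (\int[lebesgue_rV R n.+1]_x f x =
   \int[lebesgue_rV R n]_y \int[lebesgue_measure]_s f (cons_rV (s, y)))%E.
Proof.
move=> mf f0; rewrite integral_lebesgue_rVS// (fubini_tonelli2 (f \o @cons_rV R n))//=.
by apply: measurableT_comp => //; exact: measurable_cons_rV.
Qed.

End lebesgue_rV_theory.

(** Valid for arbitrary functions, because the integral of a nonnegative function is a supremum over
    the simple functions below it. It is applied to integrands such as the norm of [rep (u t)],
    whose measurability is not established. *)
Lemma le_integral_ge0 d (X : measurableType d) {R : realType}
    (mu : {measure set X -> \bar R}) (D : set X) (f g : X -> \bar R) :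
  (forall x, D x -> (0 <= f x)%E) -> (forall x, D x -> (f x <= g x)%E) ->
  (\int[mu]_(x in D) f x <= \int[mu]_(x in D) g x)%E.
Proof.
move=> f0 fg; rewrite integral_mkcond [leRHS]integral_mkcond.
have F0 x : (0 <= (f \_ D) x)%E by rewrite patchE; case: ifPn => //; rewrite inE; exact: f0.
have FG x : ((f \_ D) x <= (g \_ D) x)%E.
  by rewrite !patchE; case: ifPn => //; rewrite inE; exact: fg.
rewrite !ge0_integralTE//; last by move=> x; exact: le_trans (FG x).
apply: le_ereal_sup => _ [h hf <-]; exists h => // x.
exact: le_trans (hf x) (FG x).
Qed.

Section parametric_integral.
Context d (X : measurableType d) {R : realType}.
Local Open Scope ereal_scope.

Lemma measurable_fun_integral d' (Y : measurableType d')
    (m : {sigma_finite_measure set Y -> \bar R}) (D : set Y) (f : X * Y -> \bar R) :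
  measurable D -> measurable_fun setT f -> (forall p, 0 <= f p) ->
  measurable_fun setT (fun x => \int[m]_(y in D) f (x, y)).
Proof.
move=> mD mf f0.
pose g := f \_ (setT `*` D).
have -> : (fun x => \int[m]_(y in D) f (x, y)) = fubini_F m g.
  apply/funext => x; rewrite /fubini_F [LHS]integral_mkcond; congr (integral _ _ _).
  by apply/funext => y; rewrite /g !patchE in_setX in_setT.
apply: measurable_fun_fubini_tonelli_F => [|p].
  by apply/(measurable_restrictT _ _).1 => //; [exact: measurableX|exact: measurable_funTS].
by rewrite /g patchE; case: ifP.
Qed.

Lemma measurable_fun_integral_rV n (D : set 'rV[R]_n) (f : X * 'rV[R]_n -> \bar R) :
  measurable D -> measurable_fun setT f -> (forall p, 0 <= f p) ->
  measurable_fun setT (fun x => \int[lebesgue_rV R n]_(y in D) f (x, y)).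
Proof. exact: (measurable_fun_integral (@lebm R n)). Qed.

End parametric_integral.

Section boxes.
Context {R : realType}.
Local Open Scope ereal_scope.

Lemma rbox_cons n (I : 'I_n.+1 -> set R) s y :
  rbox I (cons_rV (s, y)) <-> I ord0 s /\ rbox (fun i => I (lift ord0 i)) y.
Proof.
split=> [h|[Is Iy] i].
  split=> /= [|i]; first by have := h ord0; rewrite mxE unlift_none.
  by have := h (lift ord0 i); rewrite mxE liftK.
by rewrite mxE; case: unliftP => [k|] ->//; exact: Iy.
Qed.

Lemma in_rbox_cons n (I : 'I_n.+1 -> set R) s y :
  (cons_rV (s, y) \in rbox I) = (s \in I ord0) && (y \in rbox (fun i => I (lift ord0 i))).
Proof.
apply/idP/idP; rewrite !inE.
  by move/rbox_cons => [? ?]; apply/andP; split; rewrite inE.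
by move/andP; rewrite !inE => ?; apply/rbox_cons.
Qed.

Variables (n : nat) (I : 'I_n.+1 -> set R) (f : 'rV[R]_n.+1 -> \bar R).
Hypothesis mI : forall i, measurable (I i : set (measurableTypeR R)).
Hypothesis mf : measurable_fun setT f.
Hypothesis f0 : forall x, 0 <= f x.

Let mfI : measurable_fun setT (f \_ (rbox I)).
Proof.
apply/(measurable_restrictT _ _).1 => //; first exact: measurable_rbox.
exact: measurable_funTS.
Qed.

Let fI0 x : 0 <= (f \_ (rbox I)) x. Proof. by rewrite patchE; case: ifP. Qed.

Lemma integral_rbox1 :
  \int[lebesgue_rV R n.+1]_(x in rbox I) f x =
  \int[lebesgue_measure]_(s in I ord0)
    \int[lebesgue_rV R n]_(y in rbox (fun i => I (lift ord0 i))) f (cons_rV (s, y)).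
Proof.
rewrite integral_mkcond [LHS](integral_lebesgue_rVS1 mfI fI0) [RHS]integral_mkcond.
apply: eq_integral => s _; rewrite patchE; case: ifPn => sI.
  rewrite [RHS]integral_mkcond; apply: eq_integral => y _.
  by rewrite !patchE in_rbox_cons sI.
by rewrite integral0_eq// => y _; rewrite patchE in_rbox_cons (negbTE sI).
Qed.

Lemma integral_rbox2 :
  \int[lebesgue_rV R n.+1]_(x in rbox I) f x =
  \int[lebesgue_rV R n]_(y in rbox (fun i => I (lift ord0 i)))
    \int[lebesgue_measure]_(s in I ord0) f (cons_rV (s, y)).
Proof.
rewrite integral_mkcond [LHS](integral_lebesgue_rVS2 mfI fI0) [RHS]integral_mkcond.
apply: eq_integral => y _; rewrite patchE; case: ifPn => yI.
  rewrite [RHS]integral_mkcond; apply: eq_integral => s _.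
  by rewrite !patchE in_rbox_cons yI andbT.
by rewrite integral0_eq// => s _; rewrite patchE in_rbox_cons (negbTE yI) andbF.
Qed.

End boxes.

Section slices.
Context {R : realType}.

Definition C1 n (f : 'rV[R]_n -> R) := continuous f /\
  forall i, (forall x, derivable f x (delta_mx ord0 i)) /\ continuous (pderiv i f).

Lemma continuous_cons_rVr n (s : R) : continuous (fun y : 'rV[R]_n => cons_rV (s, y)).
Proof.
move=> y A /nbhs_ballP[e /= e0 eA]; apply/nbhs_ballP; exists e => // z yz.
apply: eA; apply/rV_ballP => // i; rewrite !mxE; case: unlift => [k|] /=.
  exact: (rV_ballP y z e0).1.
by rewrite subrr normr0.
Qed.

Lemma continuous_cons_rVl n (y : 'rV[R]_n) : continuous (fun s : R => cons_rV (s, y)).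
Proof.
move=> s; apply/cvgrPdist_lt => /= e e0.
near=> t; have ts : `|s - t| < e by near: t; exact: cvgr_dist_lt.
have : ball (cons_rV (s, y)) e (cons_rV (t, y)).
  apply/rV_ballP => // i; rewrite !mxE; case: unlift => [k|] //=.
  by rewrite subrr normr0.
by rewrite -ball_normE.
Unshelve. all: by end_near. Qed.

Lemma cons_rV_shift0 n (h s : R) (y : 'rV[R]_n) :
  h *: delta_mx ord0 ord0 + cons_rV (s, y) = cons_rV (h + s, y).
Proof.
apply/rowP => i; rewrite !mxE /=; case: unliftP => [k|] -> /=.
  by rewrite mulr0 add0r.
by rewrite mulr1.
Qed.

Lemma cons_rV_shift n (h s : R) (y : 'rV[R]_n) (i : 'I_n) :
  h *: delta_mx ord0 (lift ord0 i) + cons_rV (s, y) = cons_rV (s, h *: delta_mx ord0 i + y).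
Proof.
apply/rowP => k; rewrite !mxE /=; case: unliftP => [l|] -> /=.
  by rewrite !mxE (inj_eq lift_inj).
by rewrite mulr0 add0r.
Qed.

Lemma derive_slice0 n (f : 'rV[R]_n.+1 -> R) (y : 'rV[R]_n) (s : R) :
  (fun h : R => h^-1 *: ((fun r => f (cons_rV (r, y))) (h *: (1:R) + s) - f (cons_rV (s, y)))) =
  (fun h : R => h^-1 *: (f (h *: delta_mx ord0 ord0 + cons_rV (s, y)) - f (cons_rV (s, y)))).
Proof.
by apply/funext => h; rewrite cons_rV_shift0 /GRing.scale /= mulr1.
Qed.

Lemma derivable_slice0 n (f : 'rV[R]_n.+1 -> R) (y : 'rV[R]_n) (s : R) :
  derivable f (cons_rV (s, y)) (delta_mx ord0 ord0) ->
  derivable (fun r => f (cons_rV (r, y))) s 1.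
Proof. by rewrite /derivable derive_slice0. Qed.

Lemma pderiv_slice0 n (f : 'rV[R]_n.+1 -> R) (y : 'rV[R]_n) (s : R) :
  derive1 (fun r => f (cons_rV (r, y))) s = pderiv ord0 f (cons_rV (s, y)).
Proof. by rewrite derive1E /pderiv /derive derive_slice0. Qed.

Lemma derive_slice n (f : 'rV[R]_n.+1 -> R) (y : 'rV[R]_n) (s : R) (i : 'I_n) :
  (fun h : R => h^-1 *: ((fun z => f (cons_rV (s, z))) (h *: delta_mx ord0 i + y) - f (cons_rV (s, y)))) =
  (fun h : R => h^-1 *: (f (h *: delta_mx ord0 (lift ord0 i) + cons_rV (s, y)) - f (cons_rV (s, y)))).
Proof. by apply/funext => h; rewrite cons_rV_shift. Qed.

Lemma derivable_slice n (f : 'rV[R]_n.+1 -> R) (y : 'rV[R]_n) (s : R) (i : 'I_n) :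
  derivable f (cons_rV (s, y)) (delta_mx ord0 (lift ord0 i)) ->
  derivable (fun z => f (cons_rV (s, z))) y (delta_mx ord0 i).
Proof. by rewrite /derivable derive_slice. Qed.

Lemma pderiv_slice n (f : 'rV[R]_n.+1 -> R) (s : R) (i : 'I_n) :
  pderiv i (fun z => f (cons_rV (s, z))) = fun y => pderiv (lift ord0 i) f (cons_rV (s, y)).
Proof. by apply/funext => y; rewrite /pderiv /derive derive_slice. Qed.

Lemma C1_slice n (f : 'rV[R]_n.+1 -> R) (s : R) :
  C1 f -> C1 (fun z => f (cons_rV (s, z))).
Proof.
move=> [cf df]; split=> [y|i]; first by
  apply: (continuous_comp (f := fun y => cons_rV (s, y))); [exact: continuous_cons_rVr|exact: cf].
have [di ci] := df (lift ord0 i); split=> [y|y]; first exact: derivable_slice.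
rewrite pderiv_slice.
by apply: (continuous_comp (f := fun y => cons_rV (s, y))); [exact: continuous_cons_rVr|exact: ci].
Qed.

Lemma slice0_C1 n (f : 'rV[R]_n.+1 -> R) (y : 'rV[R]_n) : C1 f ->
  (forall s, derivable (fun r => f (cons_rV (r, y))) s 1) /\
  continuous (derive1 (fun r => f (cons_rV (r, y)))).
Proof.
move=> [cf df]; have [d0 c0] := df ord0; split=> s; first exact: derivable_slice0.
rewrite (_ : derive1 _ = fun s => pderiv ord0 f (cons_rV (s, y))); last first.
  by apply/funext => r; rewrite pderiv_slice0.
by apply: (continuous_comp (f := fun s => cons_rV (s, y))); [exact: continuous_cons_rVl|exact: c0].
Qed.

End slices.

(** * Poincare's inequality on cubes, in double-integral form *)

Section poincare.
Context {R : realType}.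
Local Notation leb := (@lebesgue_measure R).

Lemma integral_itv_cst (a l : R) (c : \bar R) : 0 < l ->
  (\int[leb]_(s in `[a, (a + l)%R[) c = c * l%:E)%E.
Proof.
move=> l0; rewrite integral_cst//= lebesgue_measure_itv/= lte_fin ltrDl l0.
by rewrite -EFinB addrAC subrr add0r.
Qed.

(** [g s - g t] is an integral of the derivative. Cauchy-Schwarz is obtained by integrating
    [|y| <= c/2 + y^2/(2c)] over the interval and choosing the parameter [c] afterwards. *)
Lemma sobolev_1d (g : R -> R) (a l s t : R) : 0 < l ->
  (forall x, derivable g x 1) -> continuous (derive1 g) ->
  s \in `[a, a + l[ -> t \in `[a, a + l[ ->
  (((g s - g t) ^+ 2)%:E <=
   l%:E * \int[leb]_(r in `[a, (a + l)%R[) ((derive1 g r) ^+ 2)%:E)%E.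
Proof.
move=> l0 dg cdg.
have mdg : measurable_fun setT (derive1 g) by exact: continuous_measurable_fun.
have J0 : (0 <= \int[leb]_(r in `[a, (a + l)%R[) ((derive1 g r) ^+ 2)%:E)%E.
  by apply: integral_ge0 => r _; rewrite lee_fin sqr_ge0.
wlog st : s t / s < t => [H sI tI|sI tI].
  have [st|ts|->] := ltgtP s t; first exact: H.
    by rewrite -sqrrN opprB; exact: H.
  by rewrite subrr expr0n /= mule_ge0// lee_fin ltW.
have xc (c : R) : 0 < c -> (`|g s - g t|%:E <= (c / 2 * l)%:E +
    ((2 * c)^-1)%:E * \int[leb]_(r in `[a, (a + l)%R[) ((derive1 g r) ^+ 2)%:E)%E.
  move=> c0.
  have -> : g s - g t = - (g t - g s) by rewrite opprB.
  rewrite normrN -[(_%:E)%E]/(`|(g t - g s)%:E|)%E EFinB.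
  have cdgst : {within `[s, t], continuous (derive1 g)} by apply: continuous_subspaceT.
  have dst : derivable_oo_LRcontinuous g s t.
    have cg : continuous g.
      by move=> x; apply/differentiable_continuous; apply/derivable1_diffP; exact: dg.
    by split=> //; [apply: cvg_at_right_filter; exact: cg|apply: cvg_at_left_filter; exact: cg].
  rewrite -(continuous_FTC2 st cdgst dst (fun _ _ => erefl)).
  have mst : measurable (`[s, t]%classic : set (measurableTypeR R)) by [].
  have sub : `[s, t] `<=` `[a, a + l[.
    move=> x /=; rewrite !in_itv/=; move: sI tI; rewrite !in_itv/= => /andP[as_ _] /andP[_ tl] /andP[sx xt].
    by rewrite (le_trans as_)//= (le_lt_trans xt).
  apply: (le_trans (le_abse_integral leb mst _)).
    by apply/measurable_EFinP; exact: measurable_funTS.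
  apply: (@le_trans _ _ (\int[leb]_(x in `[a, (a + l)%R[) `|(derive1 g x)%:E|)%E).
    apply: ge0_subset_integral => //.
    by apply/measurable_EFinP; apply: measurableT_comp => //; exact: measurable_funTS.
  apply: (@le_trans _ _ (\int[leb]_(x in `[a, (a + l)%R[)
     ((c / 2)%:E + ((2 * c)^-1)%:E * ((derive1 g x) ^+ 2)%:E))%E).
    apply: le_integral_ge0 => // x _; rewrite -EFinM -EFinD lee_fin.
    have h := sqr_ge0 (`|derive1 g x| - c); rewrite sqrrB real_normK ?num_real// in h.
    rewrite -subr_ge0.
    have -> : c / 2 + (2 * c)^-1 * derive1 g x ^+ 2 - `|derive1 g x| =
      (2 * c)^-1 * (derive1 g x ^+ 2 - `|derive1 g x| * c *+ 2 + c ^+ 2).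
      by field; rewrite gt_eqF.
    by rewrite mulr_ge0// invr_ge0 mulr_ge0// ltW.
  have m2 : measurable_fun `[a, a + l[ (fun x => ((derive1 g x) ^+ 2)%:E).
    by apply/measurable_EFinP/measurable_funTS/measurable_funX.
  rewrite ge0_integralD//=; last 3 first.
  - by move=> x _; rewrite lee_fin divr_ge0// ltW.
  - by move=> x _; rewrite -EFinM lee_fin mulr_ge0 ?sqr_ge0// invr_ge0 mulr_ge0// ltW.
  - by apply: emeasurable_funM => //.
  rewrite integral_itv_cst// ge0_integralZl_EFin//.
  - by move=> x _; rewrite lee_fin sqr_ge0.
  - by rewrite invr_ge0 mulr_ge0// ltW.
move: xc J0.
set J := integral _ _ _; case: J => [j|_ _|] //; last by rewrite gt0_muley ?lte_fin// leey.
move=> xc j0.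
have [->|x0] := eqVneq (g s - g t) 0.
  by rewrite expr0n/= -EFinM lee_fin mulr_ge0// ltW.
have {}x0 : 0 < `|g s - g t| by rewrite normr_gt0.
(* With [x = |g s - g t|], the choice [c = x / l] turns the bound into [x <= x/2 + l j / (2 x)],
   that is [x^2 <= l j]. *)
have := xc (`|g s - g t| / l) (divr_gt0 x0 l0).
rewrite -EFinM -EFinD !lee_fin -[(g s - g t) ^+ 2]real_normK ?num_real//.
set x := `|g s - g t|.
have -> : x / l / 2 * l = x / 2 by field; rewrite gt_eqF.
have -> : (2 * (x / l))^-1 * j = l * j / (2 * x) by field; rewrite !gt_eqF.
rewrite -lerBlDl ler_pdivlMr ?mulr_gt0//.
have -> : (x - x / 2) * (2 * x) = x ^+ 2 by field.
by [].
Qed.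

(** Half-open, so that the translates by multiples of [l] tile the space without overlap. *)
Definition cell n (a : 'I_n -> R) (l : R) : set 'rV[R]_n :=
  rbox (fun i => `[a i, a i + l[%classic).

Lemma measurable_cell n (a : 'I_n -> R) l : measurable (cell a l).
Proof. by apply: measurable_rbox. Qed.

Lemma lebesgue_rV_cell n (a : 'I_n -> R) l : 0 < l ->
  lebesgue_rV R n (cell a l) = (l ^+ n)%:E.
Proof.
move=> l0; apply: lebesgue_rV_cube => // i.
by rewrite lebesgue_measure_itv/= lte_fin ltrDl l0 -EFinB addrAC subrr add0r.
Qed.

Lemma integral_cell_cst n (a : 'I_n -> R) l (c : \bar R) : 0 < l ->
  (\int[lebesgue_rV R n]_(x in cell a l) c = c * (l ^+ n)%:E)%E.
Proof.
move=> l0; rewrite integral_cst//; last exact: measurable_cell.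
by congr (_ * _)%E; exact: lebesgue_rV_cell.
Qed.

Lemma cell_lift n (a : 'I_n.+1 -> R) l :
  rbox (fun i => `[a (lift ord0 i), a (lift ord0 i) + l[%classic) = cell (a \o lift ord0) l.
Proof. by []. Qed.

Lemma sqr_measurable d (X : measurableType d) (D : set X) (g h : X -> R) :
  measurable_fun D g -> measurable_fun D h ->
  measurable_fun D (fun x => ((g x - h x) ^+ 2)%:E).
Proof.
by move=> mg mh; apply/measurable_EFinP/measurable_funX/measurable_funB.
Qed.

Lemma measurable_fun_cons d (X : measurableType d) n (g : X -> measurableTypeR R)
    (h : X -> 'rV[R]_n) : measurable_fun setT g -> measurable_fun setT h ->
  measurable_fun setT (fun x => cons_rV (g x, h x)).
Proof.
move=> mg mh.
exact: (measurableT_comp (@measurable_cons_rV R n) (measurable_fun_pair mg mh)).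
Qed.

(** Induction on the dimension: from [(s, x)] to [(t, y)] one goes through [(t, x)]. The first
    difference is one-dimensional, the second lies in the slice at [t], where the induction
    hypothesis applies. The inequality [(u + v)^2 <= 2 u^2 + 2 v^2], used once per dimension, is the
    origin of the factor [2 ^+ n]. *)
Lemma poincare_cell n (f : 'rV[R]_n -> R) (a : 'I_n -> R) l : 0 < l -> C1 f ->
  (\int[lebesgue_rV R n]_(x in cell a l) \int[lebesgue_rV R n]_(y in cell a l)
     ((f x - f y) ^+ 2)%:E <=
   (2 ^+ n * l ^+ n.+2)%:E *
   \sum_(i < n) \int[lebesgue_rV R n]_(x in cell a l) ((pderiv i f x) ^+ 2)%:E)%E.
Proof.
move=> l0; elim: n f a => [f a _|n IH f a cf].
  rewrite big_ord0 mule0 integral0_eq// => x _; rewrite integral0_eq// => y _.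
  by rewrite (_ : x = y) ?subrr ?expr0n//; apply/rowP => -[].
pose F s x := f (cons_rV (s, x)).
have mf : measurable_fun setT (f : 'rV[R]_n.+1 -> measurableTypeR R).
  by apply: continuous_measurable_rV; exact: cf.1.
have mF (s : R) : measurable_fun setT (F s : 'rV[R]_n -> measurableTypeR R).
  apply: continuous_measurable_rV; exact: (C1_slice _ cf).1.
pose I0 := `[a ord0, a ord0 + l[%classic : set (measurableTypeR R).
pose Q' := cell (a \o lift ord0) l.
have mQ' : measurable Q' by exact: measurable_cell.
have mI (i : 'I_n.+1) : measurable (`[a i, a i + l[%classic : set (measurableTypeR R)) by [].
have mI0 : measurable I0 by exact: mI.
have mpd (i : 'I_n.+1) : measurable_fun setT (fun x => ((pderiv i f x) ^+ 2)%:E).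
  apply/measurable_EFinP/measurable_funX; apply: continuous_measurable_rV.
  exact: (cf.2 i).2.
pose J x := (\int[leb]_(r in I0) ((pderiv ord0 f (cons_rV (r, x))) ^+ 2)%:E)%E.
pose W x := (\int[leb]_(t in I0) \int[lebesgue_rV R n]_(y in Q') ((F t x - F t y) ^+ 2)%:E)%E.
(* The inner integral of [W] as a function on the whole space, the slice being read off the first
   coordinate of the point. Its joint measurability serves all the iterated integrals below. *)
pose H X := (\int[lebesgue_rV R n]_(y in Q') ((f X - f (cons_rV (X ord0 ord0, y))) ^+ 2)%:E)%E.
have consE (t : R) (x : 'rV[R]_n) : cons_rV (t, x) ord0 ord0 = t by rewrite mxE unlift_none.
have HE t x : H (cons_rV (t, x)) =
    (\int[lebesgue_rV R n]_(y in Q') ((F t x - F t y) ^+ 2)%:E)%E.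
  by rewrite /H consE.
have mH : measurable_fun setT H.
  apply: (measurable_fun_integral_rV (f := fun p : 'rV[R]_n.+1 * 'rV[R]_n =>
    ((f p.1 - f (cons_rV (p.1 ord0 ord0, p.2))) ^+ 2)%:E)) => // [|p].
    apply: sqr_measurable; first exact: measurableT_comp.
    apply: (measurableT_comp mf); apply: measurable_fun_cons => //.
    exact: (measurableT_comp (measurable_rV_coord _)).
  by rewrite lee_fin sqr_ge0.
have H0 X : (0 <= H X)%E by apply: integral_ge0 => y _; rewrite lee_fin sqr_ge0.
have mFF : measurable_fun setT (fun p : 'rV[R]_n.+1 * 'rV[R]_n.+1 => ((f p.1 - f p.2) ^+ 2)%:E).
  by apply: sqr_measurable; exact: measurableT_comp.
have mJ : measurable_fun setT J.
  apply: (measurable_fun_integral leb (f := fun p : 'rV[R]_n * measurableTypeR R =>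
    ((pderiv ord0 f (cons_rV (p.2, p.1))) ^+ 2)%:E)) => // [|p]; last by rewrite lee_fin sqr_ge0.
  by apply: (measurableT_comp (mpd ord0)); apply: measurable_fun_cons.
have mW : measurable_fun setT W.
  have -> : W = (fun x => \int[leb]_(t in I0) (fun p => H (cons_rV (p.2, p.1))) (x, t))%E.
    by apply/funext => x; apply: eq_integral => t _; rewrite HE.
  apply: (measurable_fun_integral leb (f := fun p : 'rV[R]_n * measurableTypeR R => H (cons_rV (p.2, p.1)))) => //.
  by apply: (measurableT_comp mH); apply: measurable_fun_cons.
have J0 x : (0 <= J x)%E by apply: integral_ge0 => y _; rewrite lee_fin sqr_ge0.
have W0 x : (0 <= W x)%E.
  by apply: integral_ge0 => t _; apply: integral_ge0 => y _; rewrite lee_fin sqr_ge0.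
(* The split through [(t, x)], integrated over the far point [(t, y)] with [(s, x)] fixed. The term
   [J x] depends neither on [t] nor on [y], so it only picks up the volume [l ^+ n.+1] of the
   cell. *)
have in1 s x : s \in I0 -> x \in Q' ->
    (\int[lebesgue_rV R n.+1]_(y in cell a l) ((F s x - f y) ^+ 2)%:E <=
     (2 * l ^+ n.+2)%:E * J x + 2%:E * W x)%E.
  move=> sI xQ.
  rewrite /cell integral_rbox1//; last 2 first.
  - by apply: sqr_measurable.
  - by move=> y; rewrite lee_fin sqr_ge0.
  rewrite cell_lift -/Q'.
  have cJ : (0 <= (2 * l)%:E * J x)%E by rewrite mule_ge0// lee_fin mulr_ge0// ltW.
  have e0 t y : (0 <= 2%:E * ((F t x - F t y) ^+ 2)%:E)%E.
    by rewrite -EFinM lee_fin mulr_ge0// sqr_ge0.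
  apply: (@le_trans _ _ (\int[leb]_(t in I0) \int[lebesgue_rV R n]_(y in Q')
      ((2 * l)%:E * J x + 2%:E * ((F t x - F t y) ^+ 2)%:E))%E).
    apply: le_integral_ge0 => t tI.
      by apply: integral_ge0 => y _; rewrite lee_fin sqr_ge0.
    apply: le_integral_ge0 => y yQ; first by rewrite lee_fin sqr_ge0.
    have [d0 c0] := slice0_C1 x cf.
    have := @sobolev_1d (fun r => F r x) (a ord0) l s t l0 d0 c0.
    rewrite inE in sI; move=> /(_ sI tI).
    under eq_integral do rewrite pderiv_slice0.
    rewrite -/I0 -/(J x) => st.
    apply: (@le_trans _ _ (2%:E * ((F s x - F t x) ^+ 2)%:E + 2%:E * ((F t x - F t y) ^+ 2)%:E)%E).
      rewrite -!EFinM -EFinD lee_fin -/(F t y).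
      have -> : F s x - F t y = (F s x - F t x) + (F t x - F t y) by ring.
      set u := (F s x - F t x); set v := (F t x - F t y).
      have := sqr_ge0 (u - v); nra.
    by rewrite leeD2r// [(2 * l)%:E]EFinM -muleA lee_pmul2l.
  under eq_integral => t _.
    rewrite ge0_integralD//; last first.
      apply/measurable_funTS; apply: emeasurable_funM => //.
      by apply: sqr_measurable; [exact: measurable_cst|exact: mF].
    rewrite integral_cell_cst// ge0_integralZl_EFin//; last 2 first.
    - by move=> y _; rewrite lee_fin sqr_ge0.
    - by apply/measurable_funTS; apply: sqr_measurable; [exact: measurable_cst|exact: mF].
    over.
  have mt : measurable_fun setT (fun t : measurableTypeR R =>
      \int[lebesgue_rV R n]_(y in Q') ((F t x - F t y) ^+ 2)%:E)%E.
    under eq_fun do rewrite -HE.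
    by apply: (measurableT_comp mH); apply: measurable_fun_cons.
  have it0 t : (0 <= \int[lebesgue_rV R n]_(y in Q') ((F t x - F t y) ^+ 2)%:E)%E.
    by apply: integral_ge0 => y _; rewrite lee_fin sqr_ge0.
  rewrite ge0_integralD//=; last 3 first.
  - by move=> t _; rewrite mule_ge0// lee_fin exprn_ge0// ltW.
  - by move=> t _; rewrite mule_ge0.
  - by apply: measurable_funTS; apply: emeasurable_funM.
  rewrite integral_itv_cst// ge0_integralZl_EFin//; last first.
    by apply: measurable_funTS.
  rewrite leeD2r//.
  rewrite muleC muleA muleC !muleA -!EFinM.
  by rewrite !exprS (_ : l ^+ n * l * (2 * l) = 2 * (l * (l * l ^+ n)))//; ring.
rewrite {1}/cell integral_rbox1//; last 2 first.
- apply: (measurable_fun_integral_rV (f := fun p : 'rV[R]_n.+1 * 'rV[R]_n.+1 =>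
    ((f p.1 - f p.2) ^+ 2)%:E)) => //; first exact: measurable_cell.
  by move=> p; rewrite lee_fin sqr_ge0.
- by move=> x; apply: integral_ge0 => y _; rewrite lee_fin sqr_ge0.
rewrite cell_lift -/Q'.
apply: (@le_trans _ _ (\int[leb]_(s in I0) \int[lebesgue_rV R n]_(x in Q')
     ((2 * l ^+ n.+2)%:E * J x + 2%:E * W x))%E).
  apply: le_integral_ge0 => s sI.
    by apply: integral_ge0 => x _; apply: integral_ge0 => y _; rewrite lee_fin sqr_ge0.
  apply: le_integral_ge0 => x xQ.
    by apply: integral_ge0 => y _; rewrite lee_fin sqr_ge0.
  by apply: in1; rewrite inE.
have l2 : 0 <= 2 * l ^+ n.+2 by rewrite mulr_ge0// exprn_ge0// ltW.
rewrite integral_itv_cst// ge0_integralD//; last 4 first.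
- by move=> x _; rewrite mule_ge0.
- by apply: measurable_funTS; apply: emeasurable_funM.
- by move=> x _; rewrite mule_ge0.
- by apply: measurable_funTS; apply: emeasurable_funM.
rewrite !ge0_integralZl_EFin//; last 2 first.
- exact: measurable_funTS.
- exact: measurable_funTS.
have -> : (\int[lebesgue_rV R n]_(x in Q') J x =
    \int[lebesgue_rV R n.+1]_(x in cell a l) ((pderiv ord0 f x) ^+ 2)%:E)%E.
  by rewrite [RHS]integral_rbox2// => x; rewrite lee_fin sqr_ge0.
(* Exchanging the integrals in [x] and [t] brings out, for each [t], the double integral over one
   slice, which is what the induction hypothesis bounds. *)
have -> : (\int[lebesgue_rV R n]_(x in Q') W x =
    \int[leb]_(t in I0) \int[lebesgue_rV R n]_(x in Q') \int[lebesgue_rV R n]_(y in Q')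
      ((F t x - F t y) ^+ 2)%:E)%E.
  transitivity (\int[lebesgue_rV R n.+1]_(x in cell a l) H x)%E.
    rewrite /cell (integral_rbox2 mI mH H0); apply: eq_integral => x _.
    by rewrite /W; apply: eq_integral => t _; rewrite HE.
  rewrite /cell (integral_rbox1 mI mH H0); apply: eq_integral => t _.
  by apply: eq_integral => x _; rewrite HE.
rewrite big_ord_recl.
set A0 := (\int[lebesgue_rV R n.+1]_(x in cell a l) _)%E.
set S := (\sum_(i < n) _)%R; set WW := (\int[leb]_(t in I0) _)%E.
have A00 : (0 <= A0)%E by apply: integral_ge0 => y _; rewrite lee_fin sqr_ge0.
have S0 : (0 <= S)%E.
  by apply: sume_ge0 => i _; apply: integral_ge0 => y _; rewrite lee_fin sqr_ge0.
have WW0 : (0 <= WW)%E.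
  apply: integral_ge0 => t _; apply: integral_ge0 => x _.
  by apply: integral_ge0 => y _; rewrite lee_fin sqr_ge0.
have c0 : 0 <= 2 ^+ n * l ^+ n.+2 by rewrite mulr_ge0// exprn_ge0// ltW.
have mtt (i : 'I_n) : measurable_fun setT (fun t : measurableTypeR R =>
   (\int[lebesgue_rV R n]_(x in Q') ((pderiv (lift ord0 i) f (cons_rV (t, x))) ^+ 2)%:E)%E).
  apply: (measurable_fun_integral_rV (f := fun p : measurableTypeR R * 'rV[R]_n =>
    ((pderiv (lift ord0 i) f (cons_rV (p.1, p.2))) ^+ 2)%:E)) => //; last first.
    by move=> p; rewrite lee_fin sqr_ge0.
  by apply: (measurableT_comp (mpd (lift ord0 i))); apply: measurable_fun_cons.
have WS : (WW <= (2 ^+ n * l ^+ n.+2)%:E * S)%E.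
  apply: (@le_trans _ _ (\int[leb]_(t in I0) ((2 ^+ n * l ^+ n.+2)%:E *
  \sum_(i < n) \int[lebesgue_rV R n]_(x in Q') ((pderiv (lift ord0 i) f (cons_rV (t, x))) ^+ 2)%:E))%E).
    apply: le_integral_ge0 => t _.
      by apply: integral_ge0 => x _; apply: integral_ge0 => y _; rewrite lee_fin sqr_ge0.
    apply: (le_trans (IH (F t) (a \o lift ord0) (C1_slice t cf))).
    apply: lee_wpmul2l; first by rewrite lee_fin.
    by apply: lee_sum => i _; rewrite pderiv_slice.
  rewrite ge0_integralZl_EFin//; last 2 first.
  - by move=> t _; apply: sume_ge0 => i _; apply: integral_ge0 => y _; rewrite lee_fin sqr_ge0.
  - by apply: measurable_funTS; apply: emeasurable_sum.
  rewrite ge0_integral_sum//; last 2 first.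
  - by move=> i; apply: measurable_funTS; exact: mtt.
  - by move=> i t _; apply: integral_ge0 => y _; rewrite lee_fin sqr_ge0.
  apply: lee_wpmul2l; first by rewrite lee_fin.
  apply: lee_sum => i _.
  rewrite [leRHS](integral_rbox1 mI (mpd (lift ord0 i)))// => x.
  by rewrite lee_fin sqr_ge0.
apply: (@le_trans _ _ (((2 * l ^+ n.+2)%:E * A0 +
    2%:E * ((2 ^+ n * l ^+ n.+2)%:E * S)) * l%:E)%E).
  apply: lee_wpmul2r; first by rewrite lee_fin ltW.
  by apply: leeD2l; apply: lee_wpmul2l.
rewrite muleA -EFinM.
have aux (x y : R) (z : \bar R) : (x%:E * z * y%:E = (x * y)%:E * z)%E.
  by rewrite muleAC -EFinM.
have h1 : (0 <= (2 * l ^+ n.+2)%:E)%E by rewrite lee_fin.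
have h2 : (0 <= (2 * (2 ^+ n * l ^+ n.+2))%:E)%E by rewrite lee_fin mulr_ge0.
rewrite (ge0_muleDl l%:E (mule_ge0 h1 A00) (mule_ge0 h2 S0)).
rewrite (ge0_muleDr _ A00 S0) !aux.
apply: leeD; apply: lee_wpmul2r => //; rewrite lee_fin.
  have -> : 2 * l ^+ n.+2 * l = 1 * (2 * (l * l ^+ n.+2)) by ring.
  have -> : 2 ^+ n.+1 * l ^+ n.+3 = 2 ^+ n * (2 * (l * l ^+ n.+2)) :> R by rewrite !exprS; ring.
  by rewrite ler_wpM2r ?exprn_ege1 ?ler1n// mulr_ge0// mulr_ge0 ?exprn_ge0// ltW.
by rewrite !exprS [leRHS](_ : _ = 2 * (2 ^+ n * (l * (l * l ^+ n))) * l)//; ring.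
Qed.

End poincare.

(** * Integrals of derivatives of compactly supported functions *)

Section integration_by_parts.
Context {R : realType}.
Local Notation leb := (@lebesgue_measure R).

Lemma integrable_bounded_support n (f : 'rV[R]_n -> R) (C M : R) :
  measurable_fun setT (f : 'rV[R]_n -> measurableTypeR R) ->
  (forall x, `|f x| <= C) ->
  (forall x, f x != 0 -> forall i, `|x ord0 i| <= M) ->
  (lebesgue_rV R n).-integrable setT (EFin \o f).
Proof.
move=> mf fC fM.
have mf' : measurable_fun setT (EFin \o f : 'rV[R]_n -> \bar R) by exact/measurable_EFinP.
apply/integrableP; split => //.
pose B := @rbox R n (fun=> `[- M, M]%classic).
have mB : measurable B by apply: measurable_rbox.
apply: (@le_lt_trans _ _ (\int[lebesgue_rV R n]_(x in B) C%:E)%E).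
  rewrite [leRHS]integral_mkcond; apply: le_integral_ge0 => // x _.
  rewrite /= patchE; case: ifPn => [_|]; first by rewrite lee_fin.
  move=> xB; have [->|fx0] := eqVneq (f x) 0; first by rewrite normr0.
  exfalso; move/negP : xB; apply; rewrite inE => i /=.
  by rewrite in_itv/= -ler_norml; exact: fM.
rewrite integral_cst// lte_mul_pinfty ?lee_fin ?(le_trans _ (fC 0))//.
rewrite (@lebesgue_rV_cube _ _ _ (Num.max (M + M) 0)) ?ltry// => i.
rewrite lebesgue_measure_itv/= lte_fin; case: ltP => h.
  by rewrite -EFinB opprK max_l//; lra.
by rewrite max_r//; lra.
Qed.

Lemma integrable_slices n (f : 'rV[R]_n.+1 -> R) :
  (lebesgue_rV R n.+1).-integrable setT (EFin \o f) ->
  (\int[lebesgue_rV R n.+1]_x (f x)%:E =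
     \int[leb]_s \int[lebesgue_rV R n]_y (f (cons_rV (s, y)))%:E)%E /\
  (\int[lebesgue_rV R n.+1]_x (f x)%:E =
     \int[lebesgue_rV R n]_y \int[leb]_s (f (cons_rV (s, y)))%:E)%E.
Proof.
move=> intf.
have mf : measurable_fun setT (EFin \o f : 'rV[R]_n.+1 -> \bar R) by case/integrableP : intf.
have mfc : measurable_fun setT (fun p => (f (cons_rV p))%:E : \bar R).
  exact: (measurableT_comp mf (@measurable_cons_rV R n)).
have ip : (leb \x @lebm R n)%E.-integrable setT (fun p => (f (cons_rV p))%:E).
  case/integrableP : intf => _ intf; apply/integrableP; split => //.
  move: intf; rewrite integral_lebesgue_rVS//.
  exact: measurableT_comp.
have e : (\int[lebesgue_rV R n.+1]_x (f x)%:E = \int[leb \x @lebm R n]_p (f (cons_rV p))%:E)%E.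
  rewrite [LHS]integralE [RHS]integralE; congr (_ - _)%E.
    apply: (etrans (@integral_lebesgue_rVS R n ((EFin \o f)^\+)%E _ _)) => //.
      exact: measurable_funepos.
    by apply: eq_integral => p _; rewrite !funeposE.
  apply: (etrans (@integral_lebesgue_rVS R n ((EFin \o f)^\-)%E _ _)) => //.
    exact: measurable_funeneg.
  by apply: eq_integral => p _; rewrite !funenegE.
split.
  by rewrite e -[LHS]fubini1.
by rewrite e -[LHS]fubini2.
Qed.

Lemma integral_derive1_eq0 (g : R -> R) (M : R) :
  (forall x, derivable g x 1) -> continuous (derive1 g) ->
  (forall x, M < `|x| -> g x = 0) ->
  (\int[leb]_x (derive1 g x)%:E = 0)%E.
Proof.
move=> dg cdg gM.
pose N : R := `|M| + 1.
have N0 : 0 < N by rewrite ltr_wpDl.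
have MN : M < N by rewrite (le_lt_trans (ler_norm _))// ltrDl.
have g0 x : N <= `|x| -> g x = 0 by move=> Nx; apply: gM; exact: lt_le_trans Nx.
have dg0 x : N < `|x| -> derive1 g x = 0.
  move=> Nx; rewrite derive1E.
  have : \forall y \near x, g y = cst 0 y.
    have /cvgrPdist_lt/(_ (`|x| - N)) : y @[y --> x] --> x by exact: cvg_id.
    rewrite subr_gt0 => /(_ Nx); apply: filterS => y xy; rewrite g0//.
    have := lerB_dist x y; lra.
  by move/near_eq_derive => ->; rewrite ?oner_neq0// derive_cst.
have cg : continuous g.
  by move=> x; apply/differentiable_continuous; apply/derivable1_diffP; exact: dg.
transitivity (\int[leb]_(x in `[(- N)%R, N]) (derive1 g x)%:E)%E.
  rewrite [RHS]integral_mkcond; apply: eq_integral => x _.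
  rewrite patchE; case: ifPn => // xN; rewrite dg0//.
  rewrite ltNge; apply/negP => Nx; move/negP : xN; apply; rewrite inE/= in_itv/=.
  by rewrite -ler_norml.
rewrite (@continuous_FTC2 _ _ g).
- by rewrite !g0 ?subee// ?normrN ger0_norm// ltW.
- by rewrite gtrN.
- exact: continuous_subspaceT.
- by split=> //; [apply: cvg_at_right_filter; exact: cg|apply: cvg_at_left_filter; exact: cg].
- by [].
Qed.

Lemma pderiv_support n (f : 'rV[R]_n -> R) (i : 'I_n) :
  [set x | pderiv i f x != 0] `<=` closure [set x | f x != 0].
Proof.
move=> x /= dx; apply: contrapT => xf; move/negP : dx; apply; apply/eqP.
move: xf => /existsNP[B /not_implyP[xB /set0P/negP/negPn/eqP fB]].
rewrite /pderiv (@near_eq_derive _ _ _ f (cst 0)) ?derive_cst//.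
apply: filterS xB => y By; apply/eqP/negPn/negP => fy.
by have : ([set x | f x != 0] `&` B) y by []; rewrite fB.
Qed.

Lemma closure_box n (A : set 'rV[R]_n) (M : R) :
  (forall x, A x -> forall i, `|x ord0 i| <= M) ->
  forall x, closure A x -> forall i, `|x ord0 i| <= M.
Proof.
move=> AM x Ax i; apply/ler_addgt0Pl => e e0.
have [y [Ay]] := Ax _ (nbhsx_ballx x e e0).
move=> /(rV_ballP _ _ e0)/(_ i) xy; have := AM y Ay i.
have := ler_normD (x ord0 i - y ord0 i) (y ord0 i); rewrite subrK; lra.
Qed.

(** For the first direction, integrate in that variable first and use the fundamental theorem of
    calculus. Any other direction lives on the slices with fixed first coordinate, where the
    induction hypothesis applies. *)
Lemma integral_pderiv_eq0 n (f : 'rV[R]_n -> R) (C M : R) (i : 'I_n) :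
  C1 f -> (forall i x, `|pderiv i f x| <= C) ->
  (forall x, f x != 0 -> forall i, `|x ord0 i| <= M) ->
  (\int[lebesgue_rV R n]_x (pderiv i f x)%:E = 0)%E.
Proof.
elim: n f i => [|n IH] f; first by case.
move=> i cf dC fM.
have M0 (k : 'I_n.+1) (x : 'rV[R]_n.+1) : M < `|x ord0 k| -> f x = 0.
  move=> Mx; apply/eqP/negPn/negP => /fM/(_ k); by rewrite leNgt Mx.
have dM x : pderiv i f x != 0 -> forall k, `|x ord0 k| <= M.
  by move/pderiv_support; exact: closure_box.
have intd : (lebesgue_rV R n.+1).-integrable setT (EFin \o pderiv i f).
  apply: (@integrable_bounded_support _ _ C M) => //.
  apply: continuous_measurable_rV; exact: (cf.2 i).2.
have [e1 e2] := integrable_slices intd.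
case: (unliftP ord0 i) => [k ik|i0].
  rewrite e1 integral0_eq// => s _.
  have := IH (fun y => f (cons_rV (s, y))) k (C1_slice s cf).
  under eq_integral do rewrite pderiv_slice.
  rewrite ik; apply => [l x|x fx l]; first by rewrite pderiv_slice.
  by have := fM _ fx (lift ord0 l); rewrite mxE liftK.
rewrite e2 integral0_eq// => y _; rewrite i0.
have [d0 c0] := slice0_C1 y cf.
have sM x : M < `|x| -> f (cons_rV (x, y)) = 0.
  by move=> Mx; apply: (M0 ord0); rewrite mxE unlift_none.
apply: (etrans _ (integral_derive1_eq0 d0 c0 sM)).
by apply: eq_integral => s _; rewrite pderiv_slice0.
Qed.

End integration_by_parts.

Section friedrichs.
Context {R : realType}.

Lemma rV_normP n (x : 'rV[R]_n) (M : R) : 0 <= M ->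
  (`|x| <= M) = [forall i, `|x ord0 i| <= M].
Proof.
move=> M0; rewrite {1}/Num.Def.normr/= mx_normrE.
apply/idP/forallP => [xM i|xM].
  by apply: le_trans xM; exact: (le_bigmax_cond _ (fun ij => `|x ij.1 ij.2|) (j := (ord0, i))).
by apply/bigmax_leP; split => // -[k i] _; rewrite (ord1 k); exact: xM.
Qed.

Lemma rV_coord_le_norm n (x : 'rV[R]_n) i : `|x ord0 i| <= `|x|.
Proof. by have := rV_normP x (normr_ge0 x); rewrite lexx => /esym/forallP; exact. Qed.

Lemma bounded_integrable d (X : measurableType d) (mu : {measure set X -> \bar R})
    (D : set X) (f : X -> R) (C : R) : measurable D -> (mu D < +oo)%E ->
  measurable_fun D f -> (forall x, `|f x| <= C) -> mu.-integrable D (EFin \o f).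
Proof.
move=> mD fD mf fC; apply/integrableP; split; first exact/measurable_EFinP.
apply: (@le_lt_trans _ _ (\int[mu]_(x in D) `|C|%:E)%E).
  by apply: le_integral_ge0 => // x _; rewrite lee_fin (le_trans (fC x))// ler_norm.
by rewrite integral_cst// lte_mul_pinfty// lee_fin.
Qed.

Lemma integrableRD d (X : measurableType d) (mu : {measure set X -> \bar R})
    (D : set X) (f g : X -> R) : measurable D ->
  mu.-integrable D (EFin \o f) -> mu.-integrable D (EFin \o g) ->
  mu.-integrable D (EFin \o (fun x => f x + g x)).
Proof.
move=> mD f1 g1; apply: (eq_integrable mD _ _ _ (integrableD mD f1 g1)) => x _.
by rewrite /= EFinD.
Qed.

Lemma integrableRZ d (X : measurableType d) (mu : {measure set X -> \bar R})
    (D : set X) (f : X -> R) (c : R) : measurable D ->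
  mu.-integrable D (EFin \o f) -> mu.-integrable D (EFin \o (fun x => c * f x)).
Proof.
move=> mD f1; apply: (eq_integrable mD _ _ _ (integrableZl mD c f1)) => x _.
by rewrite /= EFinM.
Qed.

(** The variance identity. It converts the double-integral form of Poincare's inequality into the
    form with a mean value. *)
Lemma double_integral_sqrB d (X : measurableType d) (mu : {measure set X -> \bar R})
    (D : set X) (f : X -> R) (C v : R) : measurable D -> mu D = v%:E ->
  measurable_fun D f -> (forall x, `|f x| <= C) ->
  (\int[mu]_(x in D) \int[mu]_(y in D) ((f x - f y) ^+ 2)%:E =
   2%:E * (v%:E * \int[mu]_(x in D) ((f x) ^+ 2)%:E - ((\int[mu]_(x in D) f x)%R ^+ 2)%:E))%E.
Proof.
move=> mD muD mf fC.
have fin : (mu D < +oo)%E by rewrite muD ltry.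
have if1 : mu.-integrable D (EFin \o f) by exact: bounded_integrable fC.
have if2 : mu.-integrable D (EFin \o (fun x => f x ^+ 2)).
  apply: (@bounded_integrable _ _ _ _ _ (C ^+ 2)) => //; first exact: measurable_funX.
  by move=> x; rewrite normrX lerXn2r// nnegrE// (le_trans _ (fC x)).
have ic (c : R) : mu.-integrable D (EFin \o cst c).
  by apply: (@bounded_integrable _ _ _ _ _ `|c|) => //; exact: measurable_cst.
set m := (\int[mu]_(x in D) f x)%R.
set A := (\int[mu]_(x in D) (f x ^+ 2))%R.
have fin2 : (\int[mu]_(x in D) ((f x) ^+ 2)%:E)%E = A%:E.
  by rewrite fineK//; exact: integrable_fin_num.
have i3 (a b c : R) : mu.-integrable D (EFin \o (fun x => a + b * f x + c * f x ^+ 2)).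
  apply: integrableRD => //; last exact: integrableRZ.
  by apply: integrableRD => //; [exact: ic|exact: integrableRZ].
have int3 (a b c : R) : (\int[mu]_(x in D) (a + b * f x + c * f x ^+ 2))%R = a * v + b * m + c * A.
  rewrite RintegralD//; last 2 first.
  - by apply: integrableRD => //; [exact: ic|exact: integrableRZ].
  - exact: integrableRZ.
  rewrite RintegralD//; last 2 first.
  - exact: ic.
  - exact: integrableRZ.
  by rewrite !RintegralZl// Rintegral_cst// muD.
have inner x : (\int[mu]_(y in D) ((f x - f y) ^+ 2)%:E =
    (A + (- (2 * m)) * f x + v * f x ^+ 2)%:E)%E.
  transitivity (\int[mu]_(y in D) (f x ^+ 2 + (- (2 * f x)) * f y + 1 * f y ^+ 2)%:E)%E.
    by apply: eq_integral => y _; congr (_%:E); ring.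
  rewrite -[LHS]fineK; last by apply: integrable_fin_num => //; exact: i3.
  by congr (_%:E); rewrite [LHS]int3; ring.
under eq_integral do rewrite inner.
rewrite fin2 -[LHS]fineK; last by apply: integrable_fin_num => //; exact: i3.
have -> : (2 * (v%:E * A%:E - (m ^+ 2)%:E) = (2 * (v * A - m ^+ 2))%:E)%E by [].
by congr (_%:E); rewrite [LHS]int3; ring.
Qed.

(** Divide the variance identity by [2 l^n]. The factor 1/2 which this gains in front of the
    gradient term is given away. *)
Lemma poincare_cell_mean n (f : 'rV[R]_n -> R) (a : 'I_n -> R) (l C : R) : 0 < l -> C1 f ->
  (forall x, `|f x| <= C) ->
  (\int[lebesgue_rV R n]_(x in cell a l) ((f x) ^+ 2)%:E <=
   (l ^- n * (\int[lebesgue_rV R n]_(x in cell a l) f x)%R ^+ 2)%:E +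
   (2 ^+ n * l ^+ 2)%:E *
   \sum_(i < n) \int[lebesgue_rV R n]_(x in cell a l) ((pderiv i f x) ^+ 2)%:E)%E.
Proof.
move=> l0 cf fC.
have := poincare_cell a l0 cf.
have mf : measurable_fun (cell a l) (f : 'rV[R]_n -> measurableTypeR R).
  by apply: measurable_funTS; apply: continuous_measurable_rV; exact: cf.1.
rewrite (double_integral_sqrB (measurable_cell a l) (lebesgue_rV_cell a l0) mf fC).
set m := (\int[lebesgue_rV R n]_(x in cell a l) f x)%R.
set I2 := (\int[lebesgue_rV R n]_(x in cell a l) ((f x) ^+ 2)%:E)%E.
have I20 : (0 <= I2)%E by apply: integral_ge0 => x _; rewrite lee_fin sqr_ge0.
set S := (\sum_(i < n) _)%R.
have S0 : (0 <= S)%E by apply: sume_ge0 => i _; apply: integral_ge0 => x _; rewrite lee_fin sqr_ge0.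
have I2f : (I2 < +oo)%E.
  rewrite /I2; apply: (@le_lt_trans _ _ (\int[lebesgue_rV R n]_(x in cell a l) (C ^+ 2)%:E)%E).
    apply: le_integral_ge0 => x _; rewrite lee_fin ?sqr_ge0//.
    by rewrite -real_normK ?num_real// lerXn2r// nnegrE// (le_trans _ (fC x)).
  by rewrite integral_cell_cst// ltry.
move: I20 I2f S0.
case: I2 => [A| |] // A0 _; case: S => [s| |] // s0; last first.
  move=> _; rewrite gt0_muley ?lte_fin; last by rewrite mulr_gt0// exprn_gt0.
  by rewrite addey ?leey.
have ln : 0 < l ^+ n by rewrite exprn_gt0.
have -> : (2 * ((l ^+ n)%:E * A%:E - (m ^+ 2)%:E) = (2 * (l ^+ n * A - m ^+ 2))%:E)%E by [].
rewrite -!EFinM -EFinD !lee_fin.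
rewrite !exprS => h; rewrite lee_fin in A0; rewrite lee_fin in s0.
rewrite -(ler_pM2l ln).
have -> : l ^+ n * ((l ^+ n)^-1 * (m * (m * m ^+ 0)) + 2 ^+ n * (l * (l * l ^+ 0)) * s) =
  m * (m * m ^+ 0) + 2 ^+ n * (l * (l * l ^+ n)) * s.
  by field; rewrite gt_eqF.
have : 0 <= 2 ^+ n * (l * (l * l ^+ n)) * s by rewrite !mulr_ge0 ?exprn_ge0// ltW.
by lra.
Qed.

(** Cut a cube containing [A] into cells so small that the constant of Poincare's inequality is
    below [e]. The gradient terms add up because the cells are disjoint. What remains are finitely
    many means, taken over cells which are the same for all [f]; this finiteness is the source of
    compactness later. *)
Lemma friedrichs n (M e : R) : 0 < e ->
  exists (J : finType) (Q : J -> set 'rV[R]_n) (c : R),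
  [/\ 0 <= c,
      forall z, measurable (Q z) /\ (lebesgue_rV R n (Q z) < +oo)%E &
      forall (A : set 'rV[R]_n) f C, (forall x, A x -> forall i, `|x ord0 i| <= M) ->
        C1 f -> (forall x, `|f x| <= C) ->
  (\int[lebesgue_rV R n]_(x in A) ((f x) ^+ 2)%:E <=
   (c * \sum_z (\int[lebesgue_rV R n]_(x in Q z) f x)%R ^+ 2)%:E +
   e%:E * \sum_(i < n) \int[lebesgue_rV R n]_x ((pderiv i f x) ^+ 2)%:E)%E].
Proof.
move=> e0.
have [k ke] := exists_natSinv_lt (divr_gt0 e0 (exprn_gt0 n (ltr0Sn R 1))).
(* As [l <= 1] and [l < e / 2^n], the constant [2^n l^2] is at most [e]. *)
pose l : R := k.+1%:R^-1.
have l0 : 0 < l by rewrite invr_gt0.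
have l1 : l <= 1 by rewrite invf_le1// ler1n.
have le : 2 ^+ n * l ^+ 2 <= e.
  rewrite -ler_pdivlMl ?exprn_gt0// mulrC.
  by apply: le_trans (ltW ke); rewrite exprS expr1 -[leRHS]mulr1 ler_pM2l.
(* [N] cells on each side of the origin cover [[-|M|, |M|]] in every direction, which gives [N + N]
   indices per coordinate. *)
pose N := (Num.truncn (`|M| / l)).+1.
have NM : `|M| < N%:R * l by rewrite -ltr_pdivrMr// truncnS_gt.
pose a (z : {ffun 'I_n -> 'I_(N + N)}) (i : 'I_n) : R := l * ((z i)%:R - N%:R).
exists {ffun 'I_n -> 'I_(N + N)}, (fun z => cell (a z) l), (l ^- n); split.
- by rewrite invr_ge0 exprn_ge0// ltW.
- by move=> z; split; [exact: measurable_cell|rewrite lebesgue_rV_cell// ltry].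
move=> A f C AM cf fC.
have mQ z : measurable (cell (a z) l) by exact: measurable_cell.
have cover x : A x -> exists z, cell (a z) l x.
  move=> Ax.
  have /choice[z zP] i : exists z : 'I_(N + N), l * (z%:R - N%:R) <= x ord0 i < l * (z%:R - N%:R) + l.
    have xM : `|x ord0 i| < N%:R * l.
      by apply: le_lt_trans NM; apply: le_trans (AM _ Ax i) (ler_norm _).
    have y0 : 0 <= x ord0 i / l + N%:R.
      by rewrite -lerBlDr sub0r ler_pdivlMr// mulNr; move: xM; rewrite ltr_norml => /andP[/ltW].
    have zN : (Num.truncn (x ord0 i / l + N%:R)%R < N + N)%N.
      rewrite truncn_lt_nat// natrD ltrD2r ltr_pdivrMr//.
      by move: xM; rewrite ltr_norml => /andP[].
    exists (Ordinal zN) => /=; have /andP[h1 h2] := truncn_itv y0.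
    move: h1 h2; set t := Num.truncn _ => h1 h2.
    rewrite -lerBlDr ler_pdivlMr// in h1.
    rewrite -ltrBrDr ltr_pdivrMr// in h2.
    apply/andP; split; first by rewrite mulrC.
    apply: (lt_le_trans h2); rewrite -addn1 natrD; lra.
  by exists [ffun i => z i] => i /=; rewrite in_itv/= /a ffunE; exact: zP.
have disj x z z' : cell (a z) l x -> cell (a z') l x -> z = z'.
  move=> xz xz'; apply/ffunP => i; apply/val_inj/eqP => /=.
  have := xz i; have := xz' i; rewrite /= !in_itv/= /a => /andP[h1 h2] /andP[h3 h4].
  have b1 : (z i)%:R < ((z' i).+1)%:R :> R.
    rewrite -natr1 -(ltr_pM2l l0); lra.
  have b2 : (z' i)%:R < ((z i).+1)%:R :> R.
    rewrite -natr1 -(ltr_pM2l l0); lra.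
  by rewrite eqn_leq -ltnS -(ltr_nat R) b1 -ltnS -(ltr_nat R).
have m2 (h : 'rV[R]_n -> R) z : continuous h ->
    measurable_fun setT ((fun x => ((h x) ^+ 2)%:E) \_ (cell (a z) l)).
  move=> ch; apply/(measurable_restrictT _ _).1 => //; apply: measurable_funTS.
  apply/measurable_EFinP; apply: measurable_funX; exact: continuous_measurable_rV.
have p0 (h : 'rV[R]_n -> R) z x : (0 <= ((fun x => ((h x) ^+ 2)%:E) \_ (cell (a z) l)) x)%E.
  by rewrite patchE; case: ifP => //; rewrite lee_fin sqr_ge0.
apply: (@le_trans _ _ (\sum_z \int[lebesgue_rV R n]_(x in cell (a z) l) ((f x) ^+ 2)%:E)%E).
  under eq_bigr do rewrite integral_mkcond.
  rewrite -ge0_integral_sum//; last by move=> z; apply: m2; exact: cf.1.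
  rewrite [leLHS]integral_mkcond; apply: le_integral_ge0 => x _.
    by rewrite patchE; case: ifP => //; rewrite lee_fin sqr_ge0.
  rewrite [leLHS]patchE; case: ifPn => [|_]; last by apply: sume_ge0.
  rewrite inE => /cover[z xz]; rewrite (bigD1 z)//= patchE mem_set//.
  by rewrite leeDl// sume_ge0.
apply: (le_trans (lee_sum _ (fun z _ => poincare_cell_mean (a z) l0 cf fC))).
rewrite big_split/=; apply: leeD.
  by rewrite sumEFin -mulr_sumr.
rewrite -ge0_sume_distrr; last first.
  by move=> z _; apply: sume_ge0 => i _; apply: integral_ge0 => x _; rewrite lee_fin sqr_ge0.
apply: lee_pmul => //.
- by rewrite lee_fin mulr_ge0 ?exprn_ge0// ltW.
- apply: sume_ge0 => z _.
  by apply: sume_ge0 => i _; apply: integral_ge0 => x _; rewrite lee_fin sqr_ge0.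
- rewrite exchange_big/=; apply: lee_sum => i _.
  under eq_bigr do rewrite integral_mkcond.
  rewrite -ge0_integral_sum//; last by move=> z; apply: m2; exact: (cf.2 i).2.
  apply: le_integral_ge0 => x _; first by apply: sume_ge0.
  have [[z xz]|nz] := pselect (exists z, cell (a z) l x).
    rewrite (bigD1 z)//= patchE mem_set// big1 ?adde0// => z' zz'.
    rewrite patchE; case: ifPn => //; rewrite inE => xz'.
    by move/eqP : zz'; rewrite (disj _ _ _ xz xz').
  rewrite big1 ?lee_fin ?sqr_ge0// => z _; rewrite patchE; case: ifPn => //; rewrite inE => xz.
  by case: nz; exists z.
Qed.

End friedrichs.

(** * Finiteness of Slobodeckij integrals, needed for test fields to lie in V_m when [m] is not an
    integer *)

Section slobodeckij_kernel.
Context {R : realType}.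
Variable n : nat.
Local Open Scope ereal_scope.
Local Notation lam := (lebesgue_rV R n).

Definition near_set (r : R) : set ('rV[R]_n * 'rV[R]_n) :=
  [set p | forall i : 'I_n, (`|(p.1 : 'rV[R]_n) ord0 i - (p.2 : 'rV[R]_n) ord0 i| <= r)%R].

Lemma measurable_near_set r : measurable (near_set r).
Proof.
have -> : near_set r = \bigcap_(i in [set: 'I_n])
    ((fun p : 'rV[R]_n * 'rV[R]_n => `|p.1 ord0 i - p.2 ord0 i|)%R @^-1` `]-oo, r]%classic).
  apply/seteqP; split=> [p pr i _|p pr i] /=; first by rewrite in_itv/=; exact: pr.
  by have := pr i I; rewrite /= in_itv/=.
apply: fin_bigcap_measurable => [|i _]; first exact: finite_finset.
rewrite -[X in measurable X]setTI.
have m1 : measurable_fun setT (fun p : 'rV[R]_n * 'rV[R]_n => p.1 ord0 i : measurableTypeR R).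
  exact: (measurableT_comp (@measurable_rV_coord R n i) measurable_fst).
have m2 : measurable_fun setT (fun p : 'rV[R]_n * 'rV[R]_n => p.2 ord0 i : measurableTypeR R).
  exact: (measurableT_comp (@measurable_rV_coord R n i) measurable_snd).
suff : measurable_fun setT (fun p : 'rV[R]_n * 'rV[R]_n => `|p.1 ord0 i - p.2 ord0 i|%R : measurableTypeR R).
  by apply => //; exact: measurable_itv.
by apply: measurableT_comp => //; exact: measurable_funB.
Qed.

Lemma lebesgue_near_set (r : R) x : (0 <= r)%R ->
  lam [set y | near_set r (x, y)] = ((2 * r) ^+ n)%:E.
Proof.
move=> r0.
have -> : [set y | near_set r (x, y)] = rbox (fun i => `[(x ord0 i - r)%R, (x ord0 i + r)%R]%classic).
  by apply/seteqP; split=> y xy i; have := xy i; rewrite /= in_itv/= distrC ler_distl.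
apply: lebesgue_rV_cube => // i; rewrite lebesgue_measure_itv/= lte_fin.
case: ltP => h; first by rewrite -EFinB; congr (_%:E); ring.
congr (_%:E); lra.
Qed.

(** A majorant for singular kernels: weight [c k] on the scale [|x - y| <= rho k], with one of the
    points in a box. Integrating [y] out turns each scale into [c k (2 rho k)^n], whence the
    summability condition. The swapped integral serves the pairs of which only the second point lies
    in the box. *)
Lemma double_integral_kernel (c rho : nat -> R) (be : R) :
  (forall k, 0 <= c k)%R -> (forall k, 0 <= rho k)%R ->
  \sum_(k <oo) (c k * rho k ^+ n)%:E < +oo ->
  let B := [set x : 'rV[R]_n | forall i, (`|x ord0 i| <= be)%R] in
  let K p := (\1_B p.1)%:E * \sum_(k <oo) ((c k)%:E * (\1_(near_set (rho k)) p)%:E) in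
  [/\ measurable_fun setT K, forall p, 0 <= K p,
      \int[lam]_x \int[lam]_y K (x, y) < +oo &
      \int[lam]_x \int[lam]_y K (y, x) < +oo].
Proof.
move=> c0 rho0 sfin B K.
have mB : measurable B.
  rewrite (_ : B = rbox (fun=> `[(- be)%R, be]%classic)); first exact: measurable_rbox.
  by apply/seteqP; split=> y yB i; have := yB i; rewrite /= in_itv/= ler_norml.
have Bfin : lam B < +oo.
  rewrite (_ : B = rbox (fun=> `[(- be)%R, be]%classic)); last first.
    by apply/seteqP; split=> y yB i; have := yB i; rewrite /= in_itv/= ler_norml.
  rewrite (@lebesgue_rV_cube _ _ _ (Num.max (be + be) 0)%R) ?ltry// => i.
  rewrite lebesgue_measure_itv/= lte_fin; case: ltP => h.
    by rewrite -EFinB opprK max_l//; lra.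
  by rewrite max_r//; lra.
have t0 k p : 0 <= (c k)%:E * (\1_(near_set (rho k)) p)%:E by rewrite -EFinM lee_fin mulr_ge0.
have mt k : measurable_fun setT (fun p => (c k)%:E * (\1_(near_set (rho k)) p)%:E).
  apply: emeasurable_funM => //; apply/measurable_EFinP.
  by apply: measurable_indic; exact: measurable_near_set.
have mK : measurable_fun setT K.
  apply: emeasurable_funM.
    have mB1 : measurable_fun setT (\1_B : 'rV[R]_n -> R) by exact: measurable_indic.
    by apply/measurable_EFinP; exact: (measurableT_comp mB1 measurable_fst).
  by apply: ge0_emeasurable_sum.
have K0 p : 0 <= K p by rewrite mule_ge0// ?lee_fin//; exact: nneseries_ge0.
have e1 : \int[lam]_x \int[lam]_y K (x, y) < +oo.
  have inner x : \int[lam]_y K (x, y) = (\1_B x)%:E * \sum_(k <oo) (c k * (2 * rho k) ^+ n)%:E.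
    have mtx k : measurable_fun setT (fun y => (c k)%:E * (\1_(near_set (rho k)) (x, y))%:E).
      exact: (measurable_fun_pair2 x (mt k)).
    rewrite /K /= ge0_integralZl//; last 2 first.
    - by apply: ge0_emeasurable_sum.
    - by move=> y _; exact: nneseries_ge0.
    congr (_ * _); rewrite integral_nneseries//.
    apply: eq_eseriesr => k _; rewrite ge0_integralZl//; last 2 first.
    - apply/measurable_EFinP.
      have mS : measurable_fun setT (\1_(near_set (rho k)) : 'rV[R]_n * 'rV[R]_n -> R).
        by apply: measurable_indic; exact: measurable_near_set.
      exact: (measurable_fun_pair2 x mS).
    - by rewrite lee_fin.
    rewrite EFinM; congr (_ * _); rewrite -(lebesgue_near_set x (rho0 k)).
    transitivity (\int[lam]_y (\1_[set y | near_set (rho k) (x, y)] y)%:E).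
      by apply: eq_integral => y _; rewrite !indicE; congr (_%:R%:E); apply/idP/idP; rewrite !inE.
    rewrite integral_indic ?setIT//.
    rewrite (_ : mkset _ = xsection (near_set (rho k)) x); first by apply: measurable_xsection; exact: measurable_near_set.
    by apply/seteqP; split=> y; rewrite /xsection /= inE.
  under eq_integral do rewrite inner.
  have s2 : \sum_(k <oo) (c k * (2 * rho k) ^+ n)%:E < +oo.
    have -> : \sum_(k <oo) (c k * (2 * rho k) ^+ n)%:E = (2 ^+ n)%:E * \sum_(k <oo) (c k * rho k ^+ n)%:E.
      rewrite -nneseriesZl//; last by move=> k _; rewrite lee_fin mulr_ge0// exprn_ge0.
      by apply: eq_eseriesr => k _; rewrite -EFinM exprMn; congr (_%:E); ring.
    by rewrite lte_mul_pinfty// lee_fin exprn_ge0.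
  rewrite ge0_integralZr//; last 2 first.
  - by apply/measurable_EFinP; exact: measurable_indic.
  - by apply: nneseries_ge0 => k _ _; rewrite lee_fin mulr_ge0// exprn_ge0// mulr_ge0.
  rewrite integral_indic// setIT; apply: lte_mul_pinfty => //.
  by rewrite ge0_fin_numE.
split; [exact: mK|exact: K0|exact: e1|].
suff esw : \int[lam]_x \int[lam]_y K (y, x) = \int[lam]_x \int[lam]_y K (x, y) by rewrite esw.
have mKs : measurable_fun setT (fun p => K (p.2, p.1)).
  by apply: (measurableT_comp mK); exact: measurable_fun_pair.
exact: (@fubini_tonelli _ _ _ _ R (@lebm R n) (@lebm R n) (fun p => K (p.2, p.1)) mKs (fun p => K0 _)).
Qed.

Lemma dyadic_near (N : R) : (0 < N)%R -> (N <= 1)%R ->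
  exists k : nat, (2^-1 ^+ k.+1 < N <= 2^-1 ^+ k)%R.
Proof.
move=> N0 N1.
have ex : exists k : nat, (2^-1 ^+ k.+1 < N)%R.
  have [k kN] := exists_natSinv_lt N0; exists k.
  apply: le_lt_trans kN; rewrite exprVn lef_pV2 ?posrE ?exprn_gt0// -natrX ler_nat.
  by apply: ltnW; exact: ltn_expl.
case: (ex_minnP ex) => -[|k] kN min; first by exists 0%N; rewrite kN expr0.
exists k.+1; rewrite kN/= leNgt; apply/negP => /min; by rewrite ltnn.
Qed.

Lemma dyadic_far (N : R) : (1 < N)%R -> exists k : nat, (2 ^+ k < N <= 2 ^+ k.+1)%R.
Proof.
move=> N1.
have ex : exists k : nat, (N <= 2 ^+ k.+1)%R.
  exists (Num.truncn N); apply: ltW; apply: lt_le_trans (truncnS_gt N) _.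
  by rewrite -natrX ler_nat; apply: ltnW; exact: ltn_expl.
case: (ex_minnP ex) => -[|k] kN min; first by exists 0%N; rewrite kN expr0 N1.
exists k.+1; rewrite kN andbT ltNge; apply/negP => /min; by rewrite ltnn.
Qed.

Lemma geometric_nneseries_lty (z A : R) : (0 < z < 1)%R -> \sum_(k <oo) (A * z ^+ k)%:E < +oo.
Proof.
move=> /andP[z0 z1].
have cv : ((fun k => \sum_(0 <= i < k) (A * z ^+ i)%:E) @ \oo --> (A / (1 - z))%:E).
  under eq_fun do rewrite sumEFin.
  apply: cvg_EFin; first by near=> k.
  by have := @cvg_geometric_series R A z; rewrite ger0_norm ?ltW// => /(_ z1).
by rewrite (cvg_lim _ cv)// ltry.
Unshelve. all: by end_near. Qed.

Lemma nneseries_ge_term (u : nat -> \bar R) k : (forall k, 0 <= u k) -> u k <= \sum_(k <oo) u k.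
Proof.
move=> u0; apply: le_trans (nneseries_lim_ge k.+1 _); last by [].
by rewrite big_nat_recr//= leeDr// sume_ge0.
Qed.

Lemma double_integralD (f g : 'rV[R]_n * 'rV[R]_n -> \bar R) :
  measurable_fun setT f -> (forall p, 0 <= f p) ->
  measurable_fun setT g -> (forall p, 0 <= g p) ->
  \int[lam]_x \int[lam]_y (f (x, y) + g (x, y)) =
  \int[lam]_x \int[lam]_y f (x, y) + \int[lam]_x \int[lam]_y g (x, y).
Proof.
move=> mf f0 mg g0; rewrite -ge0_integralD//; last 4 first.
- by move=> x _; exact: integral_ge0.
- exact: measurable_fun_integral_rV.
- by move=> x _; exact: integral_ge0.
- exact: measurable_fun_integral_rV.
apply: eq_integral => x _; rewrite ge0_integralD//.
- exact: (measurable_fun_pair2 x mf).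
- exact: (measurable_fun_pair2 x mg).
Qed.

(** Dyadic shells in [|x - y|]. Near the diagonal [psi <= C |x - y|^2] beats the singularity because
    [s < 1]; far from it [psi <= C] suffices because [s > 0]. Integrability in the remaining
    variable comes from the bounded support. *)
Lemma slobodeckij_kernel_lty (psi : 'rV[R]_n -> 'rV[R]_n -> R) (D : set 'rV[R]_n)
    (s C be : R) : (0 < s)%R -> (s < 1)%R -> (0 <= C)%R ->
  (forall x y, 0 <= psi x y)%R -> (forall x y, psi x y <= C)%R ->
  (forall x y : 'rV[R]_n, `|x - y| <= 1 -> psi x y <= C * `|x - y| ^+ 2)%R ->
  (forall x y, psi x y != 0%R ->
     (forall i, `|x ord0 i| <= be)%R \/ (forall i, `|y ord0 i| <= be)%R) ->
  \int[lam]_(x in D) \int[lam]_(y in D)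
    (psi x y / Num.sqrt (dot (x - y) (x - y)) `^ (n%:R + 2 * s))%:E < +oo.
Proof.
move=> s0 s1 C0 psi0 psiC psi1 psiB.
set p : R := (n%:R + 2 * s)%R.
have p0 : (0 < p)%R by rewrite ltr_wpDl// mulr_gt0.
pose tk k : R := (2^-1 ^+ k)%R.
have tk0 k : (0 < tk k)%R by rewrite exprn_gt0.
(* [ak k] bounds the integrand on the shell [2^-(k+1) < |x - y| <= 2^-k], and [bk k] on the shell
   [2^k < |x - y| <= 2^(k+1)], whose outer radius is [Rk k]. *)
pose ak k : R := (C * (tk k ^+ 2 / (tk k / 2) `^ p))%R.
pose bk k : R := (C * ((tk k) `^ p))%R.
pose Rk k : R := (2 / tk k)%R.
have ak0 k : (0 <= ak k)%R by rewrite mulr_ge0// divr_ge0// ?exprn_ge0 ?powR_ge0// ltW.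
have bk0 k : (0 <= bk k)%R by rewrite mulr_ge0// powR_ge0.
have Rk0 k : (0 <= Rk k)%R by rewrite divr_ge0// ltW.
have h20 (r : R) : (0 < (2^-1 : R) `^ r)%R by rewrite powR_gt0.
have h21 (r : R) : (0 < r)%R -> ((2^-1 : R) `^ r < 1)%R.
  move=> r0; have := @gt0_ltr_powR R r r0 2^-1%R 1%R.
  by rewrite !nnegrE powR1 => ->//; rewrite invf_lt1// ltr1n.
have tkn k : (tk k `^ p = tk k ^+ n * ((2^-1 : R) `^ (2 * s)) ^+ k)%R.
  rewrite /p powRD; last by apply/implyP => _; rewrite gt_eqF.
  rewrite powR_mulrn ?ltW//; congr (_ * _)%R.
  have := powRrM (2^-1 : R) (2 * s)%R k%:R; rewrite powR_mulrn ?powR_ge0// => <-.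
  by rewrite [(2 * s * _)%R]mulrC [X in _ = X]powRrM powR_mulrn.
have sa : \sum_(k <oo) (ak k * tk k ^+ n)%:E < +oo.
  (* The ratio is [2^-(2 - 2s)], below 1 since [s < 1]. *)
  pose z : R := (2^-1 ^+ 2 / (2^-1 : R) `^ (2 * s))%R.
  have z2 : (0 < z < 1)%R.
    rewrite divr_gt0//= /z -powR_mulrn// -powRB; last first.
      by apply/implyP => _; rewrite gt_eqF.
    apply: h21; lra.
  apply: le_lt_trans (geometric_nneseries_lty (C / ((2^-1 : R) `^ p))%R z2).
  apply: lee_nneseries => [k _ _|k _]; first by rewrite lee_fin mulr_ge0// exprn_ge0// ltW.
  rewrite lee_fin /ak (powRM _ (ltW (tk0 k)))// tkn /z expr_div_n.
  rewrite -[((2^-1 ^+ 2) ^+ k)%R]exprM mulnC exprM -/(tk k).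
  rewrite le_eqVlt; apply/orP; left; apply/eqP; field.
  by rewrite !expf_neq0// gt_eqF.
have sb : \sum_(k <oo) (bk k * Rk k ^+ n)%:E < +oo.
  have z2 : (0 < (2^-1 : R) `^ (2 * s) < 1)%R by rewrite h20 h21// mulr_gt0.
  apply: le_lt_trans (geometric_nneseries_lty (C * 2 ^+ n)%R z2).
  apply: lee_nneseries => [k _ _|k _]; first by rewrite lee_fin mulr_ge0// exprn_ge0.
  rewrite lee_fin /bk tkn /Rk expr_div_n.
  by rewrite le_eqVlt; apply/orP; left; apply/eqP; field; rewrite expf_neq0// gt_eqF.
pose B := [set x : 'rV[R]_n | forall i, (`|x ord0 i| <= be)%R].
pose K (q : 'rV[R]_n * 'rV[R]_n) :=
  (\1_B q.1)%:E * \sum_(k <oo) ((ak k)%:E * (\1_(near_set (tk k)) q)%:E).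
pose L (q : 'rV[R]_n * 'rV[R]_n) :=
  (\1_B q.1)%:E * \sum_(k <oo) ((bk k)%:E * (\1_(near_set (Rk k)) q)%:E).
have [mK K0 KA KA'] : [/\ measurable_fun setT K, forall p, 0 <= K p,
      \int[lam]_x \int[lam]_y K (x, y) < +oo &
      \int[lam]_x \int[lam]_y K (y, x) < +oo].
  exact: (double_integral_kernel be ak0 (fun k => ltW (tk0 k)) sa).
have [mL L0 LA LA'] : [/\ measurable_fun setT L, forall p, 0 <= L p,
      \int[lam]_x \int[lam]_y L (x, y) < +oo &
      \int[lam]_x \int[lam]_y L (y, x) < +oo].
  exact: (double_integral_kernel be bk0 Rk0 sb).
have KK0 x y : 0 <= K (x, y) + K (y, x) by exact: adde_ge0.
have LL0 x y : 0 <= L (x, y) + L (y, x) by exact: adde_ge0.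
have msw (h : 'rV[R]_n * 'rV[R]_n -> \bar R) : measurable_fun setT h ->
    measurable_fun setT (fun p => h (p.2, p.1)).
  by move=> mh; apply: (measurableT_comp mh); exact: measurable_fun_pair.
pose G (q : 'rV[R]_n * 'rV[R]_n) := (K q + K (q.2, q.1)) + (L q + L (q.2, q.1)).
have G0 q : 0 <= G q by case: q => x y; exact: adde_ge0.
have Glt : \int[lam]_x \int[lam]_y G (x, y) < +oo.
  rewrite (double_integralD (f := fun q => K q + K (q.2, q.1)) (g := fun q => L q + L (q.2, q.1)))//.
  - rewrite (double_integralD mK K0 (msw _ mK) (fun q => K0 _)).
    rewrite (double_integralD mL L0 (msw _ mL) (fun q => L0 _)).
    by apply: lte_add_pinfty; apply: lte_add_pinfty; [exact: KA|exact: KA'|exact: LA|exact: LA'].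
  - by apply: emeasurable_funD => //; exact: msw.
  - by case=> x y; exact: adde_ge0.
  - by apply: emeasurable_funD => //; exact: msw.
  - by case=> x y; exact: adde_ge0.
have F0 x y : (0 <= psi x y / Num.sqrt (dot (x - y) (x - y)) `^ p)%R.
  by rewrite divr_ge0// powR_ge0.
have FG x y : (psi x y / Num.sqrt (dot (x - y) (x - y)) `^ p)%:E <= G (x, y).
  have [->|pxy] := eqVneq (psi x y) 0%R; first by rewrite mul0r.
  have nxy : (0 < `|x - y|)%R.
    rewrite lt_neqAle normr_ge0 andbT eq_sym; apply/eqP => xy0.
    have := psi1 x y; rewrite xy0 ler01 expr0n mulr0 => /(_ isT) h.
    by move/eqP : pxy; apply; apply/eqP; rewrite eq_le h psi0.
  (* The shells are measured in the sup norm and the kernel in the Euclidean norm. The latter is the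
     larger one, so replacing it by the former only increases the kernel. *)
  have nd : (`|x - y| <= Num.sqrt (dot (x - y) (x - y)))%R.
    rewrite rV_normP ?sqrtr_ge0//; apply/forallP => i.
    rewrite -sqrtr_sqr; apply: ler_wsqrtr; rewrite /dot (bigD1 i)//= expr2 lerDl.
    by apply: sumr_ge0 => k _; rewrite -expr2 sqr_ge0.
  have F1 (M N : R) : (0 < N)%R -> (N <= `|x - y|)%R -> (psi x y <= M)%R ->
      (psi x y / Num.sqrt (dot (x - y) (x - y)) `^ p <= M / N `^ p)%R.
    move=> N0 NM pM; apply: ler_pM => //.
    rewrite lef_pV2 ?posrE ?powR_gt0// ?(lt_le_trans nxy)//.
    apply: ge0_ler_powR; [exact: ltW|by rewrite nnegrE ltW|by rewrite nnegrE sqrtr_ge0|].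
    exact: le_trans NM nd.
  pose QQ (c rho : nat -> R) (q : 'rV[R]_n * 'rV[R]_n) :=
    (\1_B q.1)%:E * \sum_(k <oo) ((c k)%:E * (\1_(near_set (rho k)) q)%:E).
  have kern (c rho : nat -> R) k : (forall k, 0 <= c k)%R -> (`|x - y| <= rho k)%R ->
      (c k)%:E <= QQ c rho (x, y) + QQ c rho (y, x).
    move=> c0 xyk.
    have t0 q k' : 0 <= (c k')%:E * (\1_(near_set (rho k')) q)%:E by rewrite -EFinM lee_fin mulr_ge0.
    have Q0 q : 0 <= QQ c rho q by rewrite mule_ge0// ?lee_fin//; exact: nneseries_ge0.
    have step q : near_set (rho k) q -> B q.1 -> (c k)%:E <= QQ c rho q.
      move=> qk Bq; rewrite /QQ indicE mem_set// mul1e.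
      apply: le_trans (nneseries_ge_term k (t0 q)).
      by rewrite indicE mem_set// mule1.
    have nxyk : near_set (rho k) (x, y).
      move=> i /=; apply: le_trans xyk; have := rV_coord_le_norm (x - y) i.
      by rewrite !mxE.
    case: (psiB x y pxy) => B1.
      by apply: le_trans (step (x, y) nxyk B1) _; rewrite leeDl.
    apply: (@le_trans _ _ (QQ c rho (y, x))); last by rewrite leeDr.
    by apply: step => // i /=; rewrite distrC; exact: nxyk.
  have [n1|n1] := leP `|x - y|%R 1%R.
    have [k /andP[k1 k2]] := dyadic_near nxy n1.
    apply: (@le_trans _ _ (ak k)%:E); last first.
      by apply: le_trans (kern ak tk k ak0 k2) _; rewrite leeDl.
    rewrite lee_fin /ak mulrA; apply: F1; first by rewrite divr_gt0.
      by rewrite -exprSr ltW.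
    by apply: le_trans (psi1 _ _ n1) _; apply: ler_wpM2l => //; rewrite lerXn2r// nnegrE ltW.
  have [k /andP[k1 k2]] := dyadic_far n1.
  have tkE : (2 ^+ k = (tk k)^-1 :> R)%R by rewrite /tk exprVn invrK.
  apply: (@le_trans _ _ (bk k)%:E); last first.
    apply: le_trans (kern bk Rk k bk0 _) _; last by rewrite leeDr.
    by rewrite /Rk -tkE -exprS.
  rewrite lee_fin /bk.
  have -> : (tk k `^ p = ((2 ^+ k) `^ p)^-1)%R.
    apply: (@mulfI _ ((2 ^+ k) `^ p)%R); first by rewrite gt_eqF// powR_gt0// exprn_gt0.
    rewrite mulfV; last by rewrite gt_eqF// powR_gt0// exprn_gt0.
    by rewrite -powRM ?exprn_ge0 ?ltW// tkE mulVf ?gt_eqF// powR1.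
  by apply: F1; rewrite ?exprn_gt0// ltW.
apply: le_lt_trans Glt.
rewrite [leLHS]integral_mkcond; apply: le_integral_ge0 => x _.
  by rewrite patchE; case: ifP => // _; apply: integral_ge0 => y _; rewrite lee_fin.
rewrite patchE; case: ifP => _; last by apply: integral_ge0.
rewrite [leLHS]integral_mkcond; apply: le_integral_ge0 => y _.
  by rewrite patchE; case: ifP => // _; rewrite lee_fin.
by rewrite patchE; case: ifP.
Qed.

End slobodeckij_kernel.

(** * Convexity and quadratic functionals *)

Section mazur.
Context {R : realType} {X : lmodType R}.
Variable x : nat -> X.

(** Convex combinations with dyadic weights of the tail [x n], [x n.+1], ... Midpoints suffice for
    Mazur's argument, and a property has only two cases to check. *)
Inductive hull (n : nat) : X -> Prop :=
| hull_gen k : (n <= k)%N -> hull n (x k)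
| hull_mid a b : hull n a -> hull n b -> hull n (2^-1 *: (a + b)).

Lemma hullS n m a : (n <= m)%N -> hull m a -> hull n a.
Proof.
move=> nm; elim=> [k mk|b c _ hb _ hc]; first by apply: hull_gen; exact: leq_trans mk.
exact: hull_mid.
Qed.

Lemma hull_ind_pred n (P : X -> Prop) :
  (forall k, (n <= k)%N -> P (x k)) -> (forall a b, P a -> P b -> P (2^-1 *: (a + b))) ->
  forall a, hull n a -> P a.
Proof. by move=> P1 P2 a; elim=> [k /P1|b c _ Pb _ Pc] //; exact: P2. Qed.

(** The infima of [G] over the tails increase to a limit [Ds]. Near-minimisers [y n] have [G] close
    to [Ds], and so do their midpoints, which again lie in a tail; uniform convexity then makes [G]
    small on half their differences. The error [dl * e] in the convexity hypothesis lets [G] be the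
    [q]-th power of a norm, for which [dl] depends on [e]. *)
Lemma mazur (G : X -> R) (C : R) :
  (forall a, hull 0 a -> 0 <= G a <= C) ->
  (forall e, 0 < e -> exists2 dl, 0 < dl & forall a b, hull 0 a -> hull 0 b ->
     dl * G (2^-1 *: (a - b)) + G (2^-1 *: (a + b)) <= (1 + dl * e) * ((G a + G b) / 2)) ->
  exists2 y : nat -> X, forall n, hull n (y n) &
    forall e, 0 < e -> exists N : nat, forall n m, (N <= n)%N -> (N <= m)%N ->
      G (2^-1 *: (y n - y m)) <= e.
Proof.
move=> GC conv.
have C0 : 0 <= C by have /andP[+ +] := GC _ (hull_gen (leqnn 0)); exact: le_trans.
pose S n := [set G a | a in hull n].
have Sx n : S n (G (x n)) by exists (x n) => //; exact: hull_gen.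
have lbS n : lbound (S n) 0.
  by move=> _ [a /(hullS (leq0n n))/GC/andP[+ _] <-].
have hiS n : has_inf (S n) by split; [exists (G (x n))|exists 0].
pose D n := inf (S n).
have DC n : D n <= C.
  apply: le_trans (ge_inf (proj2 (hiS n)) (Sx n)) _.
  by have /andP[_] := GC _ (hull_gen (leq0n n)).
have hsD : has_sup (range D) by split; [exists (D 0%N), 0%N|exists C => _ [n _ <-]].
pose Ds := sup (range D).
have DDs n : D n <= Ds by apply: ub_le_sup; [exact: (proj2 hsD)|exists n].
have DsC : Ds <= C by apply: ge_sup; [exact: (proj1 hsD)|move=> _ [n _ <-]].
have Dmono n m : (n <= m)%N -> D n <= D m.
  move=> nm; apply: lb_le_inf; first by exists (G (x m)).
  by move=> _ [a ha <-]; apply: ge_inf; [exact: (proj2 (hiS n))|exists a => //; exact: hullS ha].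
have /choice[y yP] n : exists a, hull n a /\ G a < D n + n.+1%:R^-1.
  have n0 : (0 : R) < n.+1%:R^-1 by rewrite invr_gt0.
  by have [_ [a ha <-] Ga] := inf_adherent n0 (hiS n); exists a.
exists y => [n|e e0]; first by have [] := yP n.
(* Budget: [dl * gd <= 2 eta + dl * e1 * (C + 1)], where the last term equals [dl * e / 4] and
   [eta <= dl * e / 4], so that the total stays below [dl * e]. *)
pose e1 := e / (4 * (C + 1)).
have C1 : 0 < C + 1 by rewrite ltr_wpDl.
have e10 : 0 < e1 by rewrite divr_gt0// mulr_gt0.
have [dl dl0 dlP] := conv _ e10.
pose eta := Num.min 1 (dl * e / 4).
have eta0 : 0 < eta by rewrite lt_min ltr01 divr_gt0// mulr_gt0.
have [N1 N1P] := exists_natSinv_lt eta0.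
have [_ [N2 _ <-] N2P] := sup_adherent eta0 hsD.
exists (maxn N1 N2) => n m; rewrite !geq_max => /andP[n1 n2] /andP[m1 m2].
have GyP k : (N1 <= k)%N -> G (y k) <= Ds + eta.
  move=> kN; have [_ /ltW Gk] := yP k; apply: le_trans Gk _; apply: lerD => //.
  apply: le_trans (ltW N1P); rewrite lef_pV2 ?posrE// ler_nat; exact: kN.
have hy k : (N2 <= k)%N -> hull N2 (y k) by move=> kN; apply: hullS kN (yP k).1.
have mid : Ds - eta <= G (2^-1 *: (y n + y m)).
  apply: le_trans (ltW N2P) _; apply: ge_inf; first exact: (proj2 (hiS N2)).
  by exists (2^-1 *: (y n + y m)) => //; apply: hull_mid; exact: hy.
have := dlP _ _ (hullS (leq0n _) (hy _ n2)) (hullS (leq0n _) (hy _ m2)).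
have Gn := GyP _ n1; have Gm := GyP _ m1.
have eta1 : eta <= 1 by rewrite ge_min lexx.
have eta2 : eta <= dl * e / 4 by rewrite ge_min lexx orbT.
set gd := G (2^-1 *: (y n - y m)) => h.
have : dl * gd <= dl * e.
  have h1 : (1 + dl * e1) * ((G (y n) + G (y m)) / 2) <= (1 + dl * e1) * (Ds + eta).
    by apply: ler_wpM2l; [rewrite addr_ge0// mulr_ge0// ltW|lra].
  have h2 : dl * e1 * (Ds + eta) <= dl * e1 * (C + 1).
    by apply: ler_wpM2l; [rewrite mulr_ge0// ltW|lra].
  have h3 : dl * e1 * (C + 1) = dl * e / 4 by rewrite /e1; field; rewrite gt_eqF.
  lra.
by rewrite ler_pM2l.
Qed.

End mazur.

Section ereal_approx.
Context {R : realType}.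
Implicit Types x y : \bar R.
Local Open Scope ereal_scope.

Lemma lee_by_lb x y : (forall r : R, r%:E < x -> r%:E <= y) -> x <= y.
Proof.
case: x => [x| |] h; last exact: leNye.
  apply/lee_addgt0Pr => e e0; rewrite -leeBlDr//.
  by rewrite (_ : x%:E - e%:E = (x - e)%:E)//; apply: h; rewrite lte_fin ltrBlDr ltrDl.
suff -> : y = +oo by [].
by apply/eqyP => A _; apply: h; rewrite ltry.
Qed.

Lemma lee_by_ub x y : (forall r : R, y < r%:E -> x <= r%:E) -> x <= y.
Proof.
move=> h; rewrite -leeN2; apply: lee_by_lb => r; rewrite lteNr -EFinN => /h.
by rewrite leeNr.
Qed.

Lemma fin_le (x : \bar R) (c : R) : 0 <= x -> x <= c%:E -> exists2 r : R, x = r%:E & (0 <= r <= c)%R.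
Proof.
case: x => [x| |]//; rewrite !lee_fin => x0 xc; by exists x => //; rewrite x0.
Qed.

Lemma fin_lt (x : \bar R) : 0 <= x -> x < +oo -> exists2 r : R, x = r%:E & (0 <= r)%R.
Proof. by case: x => [x| |]// x0 _; exists x. Qed.

Lemma lee_fin_mul (c a : R) x : (0 <= c)%R -> x <= a%:E -> c%:E * x <= (c * a)%:E.
Proof.
by move=> c0 xa; rewrite (_ : (c * a)%:E = c%:E * a%:E)//; exact: lee_wpmul2l.
Qed.

Lemma lee_fin_comb (c a e b : R) x y : (0 <= c)%R -> (0 <= e)%R -> x <= a%:E -> y <= b%:E ->
  c%:E * x + e%:E * y <= (c * a + e * b)%:E.
Proof.
by move=> c0 e0 xa yb; rewrite (_ : (_ + _)%:E = (c * a)%:E + (e * b)%:E)//; apply: leeD; exact: lee_fin_mul.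
Qed.

End ereal_approx.

Section fatou_le.
Context d (X : measurableType d) {R : realType} (mu : {measure set X -> \bar R}).
Local Open Scope ereal_scope.

(** Fatou's lemma where [F] is only bounded by the lower limit of the [f k], as a norm is along a
    weakly convergent sequence. *)
Lemma fatou_le (D : set X) (f : nat -> X -> \bar R) (F : X -> \bar R) (c : \bar R) N :
  measurable D -> (forall k, measurable_fun D (f k)) -> measurable_fun D F ->
  (forall k x, D x -> 0 <= f k x) -> (forall x, D x -> 0 <= F x) ->
  {ae mu, forall x, D x -> forall r : R, r%:E < F x ->
     exists M, forall k, (M <= k)%N -> r%:E <= f k x} ->
  (forall k, (N <= k)%N -> \int[mu]_(x in D) f k x <= c) ->
  \int[mu]_(x in D) F x <= c.
Proof.
move=> mD mf mF f0 F0 Ff fc.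
have mlim : measurable_fun D (fun x => limn_einf (f ^~ x)).
  apply: (emeasurable_fun_cvg (fun n x => einfs (f ^~ x) n)).
    by move=> n; exact: measurable_fun_einfs.
  by move=> x Dx; rewrite limn_einf_lim; exact: is_cvg_einfs.
have Fl x : (forall r : R, r%:E < F x -> exists M, forall k, (M <= k)%N -> r%:E <= f k x) ->
    F x <= limn_einf (f ^~ x).
  move=> h; apply: lee_by_lb => r /h[M hM]; rewrite limn_einf_lim.
  apply: lime_ge; first exact: is_cvg_einfs.
  exists M => // n /= Mn; apply: le_ereal_inf_tmp => _ [k /= nk <-].
  by apply: hM; exact: leq_trans nk.
apply: (@le_trans _ _ (\int[mu]_(x in D) limn_einf (f ^~ x))).
  apply: ae_ge0_le_integral => //.
    move=> x Dx; rewrite limn_einf_lim; apply: lime_ge; first exact: is_cvg_einfs.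
    by apply: nearW => n; apply: le_ereal_inf_tmp => _ [k /= _ <-]; exact: f0.
  by apply: filterS Ff => x h Dx; apply: Fl; exact: h.
apply: (le_trans (fatou mu mD mf f0)).
rewrite limn_einf_lim; apply: lime_le; first exact: is_cvg_einfs.
exists N => // k /= Nk; apply: le_trans (fc k Nk).
by apply: ereal_inf_lbound; exists k => /=.
Qed.

End fatou_le.

Section quadratic.
Context {R : realType} {X : lmodType R}.
Implicit Types (S : set X) (Q : X -> \bar R).

Definition subspace S := S 0 /\ forall (a : R) u v, S u -> S v -> S (a *: u + v).

Lemma subspaceZ S a u : subspace S -> S u -> S (a *: u).
Proof. by move=> [S0 SD] Su; rewrite -[_ *: _]addr0; exact: SD. Qed.

Lemma subspaceD S u v : subspace S -> S u -> S v -> S (u + v).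
Proof. by move=> [S0 SD] Su Sv; rewrite -[u]scale1r; exact: SD. Qed.

Lemma subspaceB S u v : subspace S -> S u -> S v -> S (u - v).
Proof. by move=> [S0 SD] Su Sv; rewrite addrC -scaleN1r; exact: SD. Qed.

(* Squared Hilbert seminorms with values in [0, +oo], without the uniqueness of the weak
   derivatives that a scalar product for [H1sq] would require. *)
Record quadratic S Q : Prop := Quadratic {
  quad_ge0 : forall u, (0 <= Q u)%E;
  quad0 : Q 0 = 0%E;
  quadZ : forall (a : R) u, a != 0 -> S u -> (Q (a *: u) <= (a ^+ 2)%:E * Q u)%E;
  quad_par : forall u v, S u -> S v -> (Q (u + v)%R + Q (u - v)%R <= 2%:E * Q u + 2%:E * Q v)%E;
  quad_young : forall (t : R) u v, 0 < t -> S u -> S v ->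
    (Q (u + v)%R <= (1 + t)%:E * Q u + (1 + t^-1)%:E * Q v)%E }.

(** The rate [8^-n] leaves room for the weights [4^n] that produce convergence almost everywhere in
    L^2. Cauchy sequences are brought to this rate by passing to a subsequence. *)
Definition quad_complete S Q := forall z : nat -> X, (forall n, S (z n)) ->
  (forall n, (Q (z n) < +oo)%E) -> (forall n, (Q (z n.+1 - z n)%R <= (8^-1 ^+ n)%:E)%E) ->
  exists2 y, S y & forall e, 0 < e -> exists N : nat, forall n, (N <= n)%N ->
    (Q (z n - y)%R <= e%:E)%E.

Section theory.
Variables (S : set X) (Q : X -> \bar R).
Hypotheses (sS : subspace S) (qQ : quadratic S Q).

Lemma quadZ_le a u (c : R) : S u -> (Q u <= c%:E)%E -> (Q (a *: u) <= (a ^+ 2 * c)%:E)%E.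
Proof.
move=> Su Qu; have [->|a0] := eqVneq a 0.
  by rewrite scale0r (quad0 qQ) expr0n/= mul0r.
apply: le_trans (quadZ qQ a0 Su) _.
by apply: lee_fin_mul => //; exact: sqr_ge0.
Qed.

Lemma quadN u : S u -> Q (- u) = Q u.
Proof.
have h v : S v -> (Q (- v)%R <= Q v)%E.
  have N1 : (-1 : R) != 0 by rewrite oppr_eq0 oner_eq0.
  by move=> Sv; have := quadZ qQ N1 Sv; rewrite scaleN1r sqrrN expr1n mul1e.
move=> Su; apply/eqP; rewrite eq_le h//= -{1}[u]opprK h// -scaleN1r.
exact: subspaceZ.
Qed.

Lemma quadBC u v : S u -> S v -> Q (u - v) = Q (v - u).
Proof. by move=> Su Sv; rewrite -opprB quadN//; exact: subspaceB. Qed.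

Lemma quad_young_le t u v (a b : R) : 0 < t -> S u -> S v ->
  (Q u <= a%:E)%E -> (Q v <= b%:E)%E -> (Q (u + v)%R <= ((1 + t) * a + (1 + t^-1) * b)%:E)%E.
Proof.
move=> t0 Su Sv Qu Qv; apply: le_trans (quad_young qQ t0 Su Sv) _.
by apply: lee_fin_comb => //; rewrite addr_ge0// ltW// invr_gt0.
Qed.

Lemma quad_par_le u v (a b : R) : S u -> S v ->
  (Q u <= a%:E)%E -> (Q v <= b%:E)%E ->
  (Q (u + v)%R + Q (u - v)%R <= (2 * a + 2 * b)%:E)%E.
Proof.
move=> Su Sv Qu Qv; apply: le_trans (quad_par qQ Su Sv) _.
exact: lee_fin_comb.
Qed.

Lemma quadD_le u v (a b : R) : S u -> S v ->
  (Q u <= a%:E)%E -> (Q v <= b%:E)%E -> (Q (u + v)%R <= (2 * a + 2 * b)%:E)%E.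
Proof.
move=> Su Sv Qu Qv; have := quad_young_le ltr01 Su Sv Qu Qv.
by rewrite invr1 (_ : 1 + 1 = 2 :> R).
Qed.

Lemma quadB_le u v (a b : R) : S u -> S v ->
  (Q u <= a%:E)%E -> (Q v <= b%:E)%E -> (Q (u - v)%R <= (2 * a + 2 * b)%:E)%E.
Proof.
move=> Su Sv Qu Qv; apply: quadD_le => //; last by rewrite quadN.
by rewrite -scaleN1r; exact: subspaceZ.
Qed.

Lemma quad_mid_le u v (a b : R) : S u -> S v ->
  (Q u <= a%:E)%E -> (Q v <= b%:E)%E ->
  (Q (2^-1 *: (u - v))%R + Q (2^-1 *: (u + v))%R <= ((a + b) / 2)%:E)%E.
Proof.
move=> Su Sv Qu Qv.
have hZ w : S w -> (Q (2^-1 *: w)%R <= (4^-1)%:E * Q w)%E.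
  move=> Sw; have n0 : (2^-1 : R) != 0 by rewrite invr_eq0 pnatr_eq0.
  apply: le_trans (quadZ qQ n0 Sw) _.
  by rewrite (_ : _ ^+ 2 = 4^-1)//; field.
apply: le_trans (leeD (hZ _ (subspaceB sS Su Sv)) (hZ _ (subspaceD sS Su Sv))) _.
have := quad_par_le Su Sv Qu Qv; rewrite addeC => h.
rewrite -ge0_muleDr ?(quad_ge0 qQ)//.
apply: le_trans (lee_fin_mul (_ : 0 <= 4^-1) h) _; rewrite ?invr_ge0// lee_fin.
by rewrite (_ : 4^-1 * _ = (a + b) / 2)//; field.
Qed.

Lemma quad_midpoint u v (c : R) : S u -> S v ->
  (Q u <= c%:E)%E -> (Q v <= c%:E)%E -> (Q (2^-1 *: (u + v))%R <= c%:E)%E.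
Proof.
move=> Su Sv Qu Qv; have := quad_mid_le Su Sv Qu Qv.
rewrite (_ : (c + c) / 2 = c); last by field.
apply: le_trans; apply: leeDr; exact: (quad_ge0 qQ).
Qed.

Lemma quad_finite_subspace : subspace (S `&` [set u | (Q u < +oo)%E]).
Proof.
split; first by split; [exact: sS.1|rewrite /= (quad0 qQ)].
move=> a u v [Su /= Qu] [Sv Qv]; split; first exact: sS.2.
have [r /= Er r0] := fin_lt (quad_ge0 qQ u) Qu.
have [s Es s0] := fin_lt (quad_ge0 qQ v) Qv.
have h1 : (Q u <= r%:E)%E by rewrite Er.
have h2 : (Q v <= s%:E)%E by rewrite Es.
have := quadD_le (subspaceZ a sS Su) Sv (quadZ_le a Su h1) h2.
by move=> h; apply: le_lt_trans h _; rewrite ltry.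
Qed.

Lemma quad_triangle u v : S u -> S v ->
  (Q (u + v)%R `^ 2^-1 <= Q u `^ 2^-1 + Q v `^ 2^-1)%E.
Proof.
move=> Su Sv.
have [Qu|] := boolP (Q u < +oo)%E; last first.
  rewrite -leNgt leye_eq => /eqP ->; rewrite poweRyr ?invr_eq0 ?pnatr_eq0//.
  by rewrite addye ?leey// gt_eqF// (lt_le_trans _ (poweR_ge0 _ _))// ltNy0.
have [Qv|] := boolP (Q v < +oo)%E; last first.
  rewrite -leNgt leye_eq => /eqP ->; rewrite poweRyr ?invr_eq0 ?pnatr_eq0//.
  by rewrite addey ?leey// gt_eqF// (lt_le_trans _ (poweR_ge0 _ _))// ltNy0.
have [r Er r0] := fin_lt (quad_ge0 qQ u) Qu.
have [s Es s0] := fin_lt (quad_ge0 qQ v) Qv.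
have h1 : (Q u <= r%:E)%E by rewrite Er.
have h2 : (Q v <= s%:E)%E by rewrite Es.
have [w Ew w0] : exists2 w : R, Q (u + v) = w%:E & 0 <= w.
  by apply: fin_lt; [exact: (quad_ge0 qQ)|exact: le_lt_trans (quadD_le Su Sv h1 h2) (ltry _)].
rewrite Er Es Ew !poweR_EFin -EFinD lee_fin.
rewrite !powR12_sqrt//.
apply/ler_addgt0Pr => e e0.
(* Enlarging the roots keeps the quotient [t = b / a] defined and positive when a seminorm vanishes.
   For this [t], Young's bound is exactly [(a + b)^2]. *)
pose a := Num.sqrt r + e / 2; pose b := Num.sqrt s + e / 2.
have a0 : 0 < a by rewrite ltr_wpDl ?sqrtr_ge0// divr_gt0.
have b0 : 0 < b by rewrite ltr_wpDl ?sqrtr_ge0// divr_gt0.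
have ra : r <= a ^+ 2.
  by rewrite -{1}(sqr_sqrtr r0) ler_sqr ?nnegrE ?sqrtr_ge0 ?(ltW a0)// lerDl divr_ge0// ltW.
have sb : s <= b ^+ 2.
  by rewrite -{1}(sqr_sqrtr s0) ler_sqr ?nnegrE ?sqrtr_ge0 ?(ltW b0)// lerDl divr_ge0// ltW.
have ba0 : 0 < b / a by rewrite divr_gt0.
have := quad_young_le ba0 Su Sv (le_trans h1 (_ : (r%:E <= (a ^+ 2)%:E)%E)) (le_trans h2 (_ : (s%:E <= (b ^+ 2)%:E)%E)).
rewrite !lee_fin => /(_ ra sb); rewrite Ew lee_fin => h.
have {}h : w <= (a + b) ^+ 2.
  apply: le_trans h _; rewrite le_eqVlt; apply/orP; left; apply/eqP.
  by field; rewrite !gt_eqF.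
have ab0 : 0 <= a + b by rewrite addr_ge0// ltW.
have := h; rewrite -(ler_sqrt _ (sqr_ge0 _)) sqrtr_sqr ger0_norm// => h'.
apply: le_trans h' _; rewrite /a /b; lra.
Qed.

(** Plays the role of weak compactness of balls in a Hilbert space. By the parallelogram law [mazur]
    applies to [Q] itself with [dl = 1], and completeness gives a strong limit of convex
    combinations of tails. The bounds [r + 1/(n+1)] on the tails leave [r] in the limit. *)
Lemma quad_weak_limit (z : nat -> X) (r : R) : quad_complete S Q ->
  (forall n, S (z n)) -> (forall n, (Q (z n) <= (r + n.+1%:R^-1)%:E)%E) ->
  exists y w, [/\ S y, (Q y <= r%:E)%E, forall k, hull z k (w k) &
    forall e, 0 < e -> exists N : nat, forall n, (N <= n)%N -> (Q (w n - y)%R <= e%:E)%E].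
Proof.
move=> cQ Sz Qz.
have hS n a : hull z n a -> S a /\ (Q a <= (r + n.+1%:R^-1)%:E)%E.
  move=> ha; apply: (hull_ind_pred (x := z) (n := n) (P := fun a => S a /\ (Q a <= (r + n.+1%:R^-1)%:E)%E)) ha => [k nk|a' b [Sa Qa] [Sb Qb]].
    split=> //; apply: le_trans (Qz k) _; rewrite lee_fin lerD2l lef_pV2 ?posrE// ler_nat.
    exact: nk.
  split; last exact: quad_midpoint.
  by apply: subspaceZ => //; exact: subspaceD.
pose G a := fine (Q a).
have QG n a : hull z n a -> Q a = (G a)%:E /\ 0 <= G a <= r + n.+1%:R^-1.
  move=> /hS[_ Qa]; have [s Es s0] := fin_le (quad_ge0 qQ a) Qa.
  by rewrite /G Es.
have [||y hy yC] := mazur (x := z) (G := G) (C := r + 1).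
- by move=> a /QG[_]; rewrite invr1.
- move=> e e0; exists 1 => // a b ha hb.
  have [[Sa _] [Qa Ga]] := (hS _ _ ha, QG _ _ ha).
  have [[Sb _] [Qb Gb]] := (hS _ _ hb, QG _ _ hb).
  have := quad_mid_le Sa Sb (_ : (Q a <= (G a)%:E)%E) (_ : (Q b <= (G b)%:E)%E).
  rewrite Qa Qb !lexx => /(_ isT isT) h.
  have fin w : S w -> (Q w <= ((G a + G b) / 2)%:E)%E -> Q w = (G w)%:E.
    by move=> Sw Qw; have [s Es s0] := fin_le (quad_ge0 qQ w) Qw; rewrite /G Es.
  have Qab : (Q (2^-1 *: (a - b))%R <= ((G a + G b) / 2)%:E)%E.
    by apply: le_trans h; rewrite leeDl//; exact: (quad_ge0 qQ).
  move: h; rewrite (fin (2^-1 *: (a - b)))//; last first.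
    by apply: subspaceZ => //; exact: subspaceB.
  have [Qm _] := QG _ _ (hull_mid ha hb); rewrite Qm -EFinD lee_fin mul1r => h.
  apply: le_trans h _; rewrite ler_peMl//; last by rewrite mul1r lerDl ltW.
  by rewrite divr_ge0// addr_ge0//; [case/andP: Ga|case/andP: Gb].
have Sy n : S (y n) by have [] := hS _ _ (hy n).
have Qy n : (Q (y n) <= (r + n.+1%:R^-1)%:E)%E by have [] := hS _ _ (hy n).
have yC' e : 0 < e -> exists N : nat, forall n m, (N <= n)%N -> (N <= m)%N ->
    (Q (y n - y m)%R <= e%:E)%E.
  move=> e0; have e4 : 0 < e / 4 by rewrite divr_gt0.
  have [N NP] := yC _ e4; exists N => n m Nn Nm.
  have := NP _ _ Nn Nm.
  have [s Es s0] : exists2 s : R, Q (2^-1 *: (y n - y m)) = s%:E & 0 <= s.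
    apply: fin_lt; first exact: (quad_ge0 qQ).
    exact: le_lt_trans (quadZ_le _ (subspaceB sS (Sy n) (Sy m)) (quadB_le (Sy n) (Sy m) (Qy n) (Qy m))) (ltry _).
  rewrite /G Es /= => se.
  have -> : y n - y m = 2 *: (2^-1 *: (y n - y m)) by rewrite scalerA divff ?scale1r ?pnatr_eq0.
  have hs : (Q (2^-1 *: (y n - y m))%R <= (e / 4)%:E)%E by rewrite Es lee_fin.
  have := quadZ_le 2 (subspaceZ 2^-1 sS (subspaceB sS (Sy n) (Sy m))) hs.
  by rewrite (_ : 2 ^+ 2 * (e / 4) = e)//; field.
have /choice[f fP] k : exists N : nat, forall n m, (N <= n)%N -> (N <= m)%N ->
    (Q (y n - y m)%R <= (8^-1 ^+ k)%:E)%E by apply: yC'; rewrite exprn_gt0.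
(* Strictly increasing and beyond [f k], so that consecutive terms of [y (s k)] differ by at most
   [8^-k]. *)
pose s := fix s k := if k is k'.+1 then (maxn (s k').+1 (f k)) else f 0%N.
have sS' k : (s k < s k.+1)%N by rewrite /= leq_maxl.
have sk k : (k <= s k)%N by elim: k => // k IH; exact: leq_trans (sS' k).
have fs k : (f k <= s k)%N by case: k => //= k; rewrite leq_maxr.
have [|||l Sl lP] := cQ (fun k => y (s k)).
- by move=> k; exact: Sy.
- by move=> k; exact: le_lt_trans (Qy _) (ltry _).
- by move=> k; apply: fP => //; apply: leq_trans (fs k) (ltnW (sS' k)).
exists l, (fun k => y (s k)); split => //; last first.
  by move=> k; apply: hullS (hy (s k)).
have [r0|r0] := ltP r 0.
  have nr0 : 0 < - r by rewrite oppr_gt0.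
  have [n nr] := exists_natSinv_lt nr0.
  have := le_trans (quad_ge0 qQ _) (Qz n); by rewrite lee_fin -lerBlDl sub0r leNgt nr.
apply: lee_by_ub => c; rewrite lte_fin => rc.
pose t := (c - r) / (2 * (c + 1)).
have c1 : 0 < c + 1 by lra.
have t0 : 0 < t by rewrite divr_gt0 ?mulr_gt0 ?subr_gt0.
pose e := (c - r) / 8 .
have e0 : 0 < e by rewrite divr_gt0 ?subr_gt0.
have [e1 e10 e1P] : exists2 e1, 0 < e1 & (1 + t^-1) * e1 <= e.
  have p : 0 < 1 + t^-1 by rewrite addr_gt0// invr_gt0.
  exists (e / (1 + t^-1)); first by rewrite divr_gt0.
  by rewrite mulrCA divff ?mulr1// gt_eqF.
have [N NP] := lP _ e10.
have [M MP] := exists_natSinv_lt e0.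
pose k := maxn N M.
have kN : (N <= k)%N by rewrite leq_maxl.
have kM : (M <= k)%N by rewrite leq_maxr.
have h1 : (Q (y (s k)) <= (r + e)%:E)%E.
  apply: le_trans (Qy _) _; rewrite lee_fin lerD2l; apply: le_trans (ltW MP).
  rewrite lef_pV2 ?posrE// ler_nat ltnS; exact: leq_trans (sk k).
have h2 : (Q (l - y (s k))%R <= e1%:E)%E by rewrite quadBC//; exact: NP.
have -> : l = y (s k) + (l - y (s k)) by rewrite addrCA subrr addr0.
apply: le_trans (quad_young_le t0 (Sy _) (subspaceB sS Sl (Sy _)) h1 h2) _.
rewrite lee_fin; have : t * (r + e) <= (c - r) / 2.
  rewrite /t mulrAC ler_pdivrMr ?mulr_gt0//.
  have : (c - r) * (r + e) <= (c - r) * (c + 1).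
    by apply: ler_wpM2l; [rewrite subr_ge0 ltW|rewrite /e; lra].
  lra.
move: e1P; rewrite /e; lra.
Qed.

End theory.

Lemma quadratic_sub S S' Q : S' `<=` S -> quadratic S Q -> quadratic S' Q.
Proof.
move=> SS [h1 h2 h3 h4 h5]; split => //; [move=> a u a0 /SS|move=> u v /SS Su /SS Sv|
  move=> t u v t0 /SS Su /SS Sv]; [exact: h3|exact: h4|exact: h5].
Qed.

Lemma quadraticD S Q1 Q2 : quadratic S Q1 -> quadratic S Q2 ->
  quadratic S (fun u => Q1 u + Q2 u)%E.
Proof.
move=> q1 q2; have p1 := quad_ge0 q1; have p2 := quad_ge0 q2; split.
- by move=> u; rewrite adde_ge0.
- by rewrite (quad0 q1) (quad0 q2) adde0.
- move=> a u a0 Su; rewrite ge0_muleDr//; apply: leeD; [exact: (quadZ q1)|exact: (quadZ q2)].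
- move=> u v Su Sv; rewrite addeACA !ge0_muleDr// [leRHS]addeACA.
  by apply: leeD; [exact: (quad_par q1)|exact: (quad_par q2)].
- move=> t u v t0 Su Sv; rewrite !ge0_muleDr// [leRHS]addeACA.
  by apply: leeD; [exact: (quad_young q1)|exact: (quad_young q2)].
Qed.

Lemma quadratic_zero S : quadratic S (fun=> 0%E).
Proof.
by split => // [a u _ _|u v _ _|t u v _ _]; rewrite !mule0// adde0.
Qed.

Lemma quadratic_sum S (I : Type) (r : seq I) (P : pred I) (Q : I -> X -> \bar R) :
  (forall i, quadratic S (Q i)) -> quadratic S (fun u => \sum_(i <- r | P i) Q i u)%E.
Proof.
move=> qQ; elim: r => [|i r IH].
  rewrite (_ : (fun u => _) = fun=> 0%E); first exact: quadratic_zero.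
  by apply/funext => u; rewrite big_nil.
case: (boolP (P i)) => Pi.
  rewrite (_ : (fun u => _) = fun u => (Q i u + \sum_(i <- r | P i) Q i u)%E).
    exact: quadraticD.
  by apply/funext => u; rewrite big_cons Pi.
rewrite (_ : (fun u => _) = fun u => (\sum_(i <- r | P i) Q i u)%E)//.
by apply/funext => u; rewrite big_cons (negbTE Pi).
Qed.

End quadratic.

Section quadratic_inf.
Context {R : realType} {X Y : lmodType R}.
Variables (S : set X) (S' : set Y) (Q : X -> \bar R) (L : X -> Y -> Prop).

(** The seminorm induced through a linear relation. It has two uses: [L g u] meaning that [g] is a
    weak derivative of [u], and [L h l] meaning that [h] represents the functional [l]. *)
Definition quad_inf (y : Y) : \bar R := ereal_inf [set Q x | x in [set x | S x /\ L x y]].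

Lemma quad_inf_lt y (r : \bar R) : (quad_inf y < r)%E -> exists x, [/\ S x, L x y & (Q x < r)%E].
Proof. by move=> /ereal_inf_lt[_ [x [Sx Lxy] <-]]; exists x. Qed.

Lemma quad_inf_le x y : S x -> L x y -> (quad_inf y <= Q x)%E.
Proof. by move=> Sx Lxy; apply: ereal_inf_lbound; exists x. Qed.

Hypotheses (sS : subspace S) (qQ : quadratic S Q).
Hypothesis L0 : L 0 0.
Hypothesis LD : forall (a : R) x x' y y', S x -> S x' -> S' y -> S' y' -> L x y -> L x' y' ->
  L (a *: x + x') (a *: y + y').
Hypothesis sS' : subspace S'.

Lemma quad_inf_approx y : S' y -> (quad_inf y < +oo)%E -> forall e : R, 0 < e ->
  exists x, [/\ S x, L x y & (Q x <= quad_inf y + e%:E)%E].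
Proof.
move=> S'y yf e e0.
have y0 : (0 <= quad_inf y)%E by apply: le_ereal_inf_tmp => _ [x _ <-]; exact: (quad_ge0 qQ).
have [r Er r0] := fin_lt y0 yf.
have /quad_inf_lt[x [Sx Lx /ltW Qx]] : (quad_inf y < quad_inf y + e%:E)%E.
  by rewrite Er -EFinD lte_fin ltrDl.
by exists x.
Qed.

(** Each inequality required of a [quadratic] bounds something by a positive combination of two
    values, and near-minimisers carry such a bound over to the infima. Positive coefficients keep
    the bound true when an infimum is +oo. *)
Lemma quad_inf_comb (A : \bar R) c1 c2 u v : S' u -> S' v -> 0 < c1 -> 0 < c2 ->
  (forall x y, S x -> S y -> L x u -> L y v -> (A <= c1%:E * Q x + c2%:E * Q y)%E) ->
  (A <= c1%:E * quad_inf u + c2%:E * quad_inf v)%E.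
Proof.
move=> S'u S'v c10 c20 h.
have i0 y : (0 <= quad_inf y)%E by apply: le_ereal_inf_tmp => _ [x _ <-]; exact: (quad_ge0 qQ).
have [uf|] := boolP (quad_inf u < +oo)%E; last first.
  rewrite -leNgt leye_eq => /eqP ->; rewrite gt0_muley ?lte_fin// addye ?leey//.
  by rewrite gt_eqF// (lt_le_trans (ltNyr 0))// mule_ge0// lee_fin ltW.
have [vf|] := boolP (quad_inf v < +oo)%E; last first.
  rewrite -leNgt leye_eq => /eqP ->; rewrite (gt0_muley (x := c2%:E)) ?lte_fin// addey ?leey//.
  by rewrite gt_eqF// (lt_le_trans (ltNyr 0))// mule_ge0// lee_fin ltW.
have [r Er r0] := fin_lt (i0 u) uf.
have [s Es s0] := fin_lt (i0 v) vf.
apply/lee_addgt0Pr => e e0.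
have c0 : 0 < c1 + c2 by rewrite addr_gt0.
have e'0 : 0 < e / (c1 + c2) by rewrite divr_gt0.
have [x [Sx Lx]] := quad_inf_approx S'u uf e'0; rewrite Er => Qx.
have [y [Sy Ly]] := quad_inf_approx S'v vf e'0; rewrite Es => Qy.
apply: le_trans (h _ _ Sx Sy Lx Ly) _.
apply: le_trans (lee_fin_comb (ltW c10) (ltW c20) Qx Qy) _.
rewrite -!EFinM -!EFinD lee_fin le_eqVlt; apply/orP; left; apply/eqP.
by field; rewrite gt_eqF.
Qed.

Lemma quadratic_inf : quadratic S' quad_inf.
Proof.
have i0 y : (0 <= quad_inf y)%E by apply: le_ereal_inf_tmp => _ [x _ <-]; exact: (quad_ge0 qQ).
have S'0 := sS'.1; have S0 := sS.1.
have LZ a x y : S x -> S' y -> L x y -> L (a *: x) (a *: y).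
  by move=> Sx Sy Lx; rewrite -[a *: x]addr0 -[a *: y]addr0; exact: LD.
have LDD x x' y y' : S x -> S x' -> S' y -> S' y' -> L x y -> L x' y' -> L (x + x') (y + y').
  by move=> ? ? ? ? ? ?; rewrite -[x]scale1r -[y]scale1r; exact: LD.
have LB x x' y y' : S x -> S x' -> S' y -> S' y' -> L x y -> L x' y' -> L (x - x') (y - y').
  move=> ? ? ? ? ? ?; rewrite addrC -scaleN1r [y - y']addrC -(scaleN1r y'); exact: LD.
split => //.
- apply/eqP; rewrite eq_le i0 andbT -(quad0 qQ); exact: quad_inf_le.
- move=> a u a0 Su.
  have a2 : 0 < a ^+ 2 by rewrite exprn_even_gt0//= a0.
  (* The homogeneity bound has a single term; it is cast in the two-term form with the second vector
     0, whose seminorm vanishes. *)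
  suff : (quad_inf (a *: u) <= (a ^+ 2)%:E * quad_inf u + 1%:E * quad_inf 0%R)%E.
    suff -> : quad_inf 0%R = 0%E by rewrite mule0 adde0.
    by apply/eqP; rewrite eq_le i0 andbT -(quad0 qQ); exact: quad_inf_le.
  apply: quad_inf_comb => // x y Sx Sy Lx Ly.
  apply: (@le_trans _ _ (Q (a *: x))); first by apply: quad_inf_le; [exact: subspaceZ|exact: LZ].
  apply: le_trans (quadZ qQ a0 Sx) _; rewrite leeDl// mul1e; exact: (quad_ge0 qQ).
- move=> u v Su Sv; apply: quad_inf_comb => // x y Sx Sy Lx Ly.
  apply: le_trans (quad_par qQ Sx Sy); apply: leeD; apply: quad_inf_le.
  + exact: subspaceD.
  + exact: LDD.
  + exact: subspaceB.
  + exact: LB.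
- move=> t u v t0 Su Sv; apply: quad_inf_comb => //.
  + by rewrite addr_gt0.
  + by rewrite addr_gt0// invr_gt0.
  move=> x y Sx Sy Lx Ly; apply: le_trans (quad_young qQ t0 Sx Sy).
  by apply: quad_inf_le; [exact: subspaceD|exact: LDD].
Qed.

End quadratic_inf.

Section dot_lemmas.
Context {R : realType} {d : nat}.
Implicit Types x y z : 'rV[R]_d.

Lemma dotC x y : dot x y = dot y x.
Proof. by apply: eq_bigr => i _; rewrite mulrC. Qed.

Lemma dotDl x y z : dot (x + y) z = dot x z + dot y z.
Proof. by rewrite -big_split/=; apply: eq_bigr => i _; rewrite mxE mulrDl. Qed.

Lemma dotZl (a : R) x y : dot (a *: x) y = a * dot x y.
Proof. by rewrite mulr_sumr; apply: eq_bigr => i _; rewrite mxE mulrA. Qed.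

Lemma dotDr x y z : dot z (x + y) = dot z x + dot z y.
Proof. by rewrite dotC dotDl ![dot _ z]dotC. Qed.

Lemma dotZr (a : R) x y : dot y (a *: x) = a * dot y x.
Proof. by rewrite dotC dotZl dotC. Qed.

Lemma dot_ge0 x : 0 <= dot x x.
Proof. by apply: sumr_ge0 => i _; rewrite -expr2 sqr_ge0. Qed.

Lemma coord_le_dot x i : x ord0 i ^+ 2 <= dot x x.
Proof.
rewrite /dot (bigD1 i)//= expr2 lerDl.
by apply: sumr_ge0 => k _; rewrite -expr2 sqr_ge0.
Qed.

Lemma dot_young (t : R) x y : 0 < t ->
  dot (x + y) (x + y) <= (1 + t) * dot x x + (1 + t^-1) * dot y y.
Proof.
move=> t0; have := dot_ge0 (t *: x - y).
rewrite -scaleN1r !(dotDl, dotDr, dotZl, dotZr) (dotC y x) => h.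
have t10 : 0 < t^-1 by rewrite invr_gt0.
have : 0 <= t * dot x x - 2 * dot x y + t^-1 * dot y y.
  rewrite (_ : _ + _ = t^-1 * (t * (t * dot x x + -1 * dot x y) +
    (t * (-1 * dot x y) + -1 * (-1 * dot y y)))); first by rewrite mulr_ge0// ltW.
  by field; rewrite gt_eqF.
lra.
Qed.

Lemma dot_parallelogram x y :
  dot (x + y) (x + y) + dot (x - y) (x - y) = 2 * dot x x + 2 * dot y y.
Proof. by rewrite -scaleN1r !(dotDl, dotDr, dotZl, dotZr); ring. Qed.

Lemma dot_amgm x y : `|dot x y| <= dot x x + dot y y.
Proof.
rewrite ler_norml; apply/andP; split.
  have := dot_ge0 (x + y); rewrite !(dotDl, dotDr, dotC y x).
  have := dot_ge0 x; have := dot_ge0 y; lra.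
have := dot_ge0 (x - y); rewrite -scaleN1r !(dotDl, dotDr, dotZl, dotZr, dotC y x).
have := dot_ge0 x; have := dot_ge0 y; lra.
Qed.

End dot_lemmas.

Lemma cvgn_fast {R : realType} (u : nat -> R) (C : R) :
  (forall n, `|u n.+1 - u n| <= C * 2^-1 ^+ n) -> cvgn u.
Proof.
move=> h.
have hc : cvgn [normed series (telescope u)].
  apply: (@series_le_cvg _ _ (geometric C 2^-1)) => //.
  - by move=> n; exact: normr_ge0.
  - by move=> n; apply: le_trans (h n); exact: normr_ge0.
  - by apply: is_cvg_geometric_series; rewrite ger0_norm ?invr_ge0// invf_lt1// ltr1n.
have /cvg_ex[l hl] := normed_cvg hc.
apply/cvg_ex; exists (u 0%N + l).
have e : (fun n => u 0%N + series (telescope u) n) = u.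
  by apply/funext => n; rewrite -eq_sum_telescope.
have : (fun n => u 0%N + series (telescope u) n) @ \oo --> u 0%N + l.
  by apply: cvgD => //; exact: cvg_cst.
by rewrite e.
Qed.

Lemma cvg_dot {R : realType} {d : nat} (u v : nat -> 'rV[R]_d) (x y : 'rV[R]_d) :
  (forall i, (u n ord0 i : R) @[n --> \oo] --> (x ord0 i : R)) ->
  (forall i, (v n ord0 i : R) @[n --> \oo] --> (y ord0 i : R)) ->
  dot (u n) (v n) @[n --> \oo] --> dot x y.
Proof.
move=> hu hv; rewrite /dot.
elim: (index_enum _) => [|i s IH].
  rewrite big_nil (_ : (fun n => _) = cst 0); first exact: cvg_cst.
  by apply/funext => n; rewrite big_nil.
rewrite big_cons (_ : (fun n => _) = fun n => u n ord0 i * v n ord0 i + \sum_(k <- s) u n ord0 k * v n ord0 k).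
  by apply: cvgD => //; exact: cvgM.
by apply/funext => n; rewrite big_cons.
Qed.

(** * L^2 and H^1 fields *)

Section L2_theory.
Context {R : realType} {d : nat} {Om : set 'rV[R]_d}.
Hypothesis oOm : open Om.
Local Notation mu := (lebesgue_rV R d).
Local Notation mf := (measurable_field Om).
Implicit Types (u v w : vfield R d) (A : set 'rV[R]_d).

Lemma measurable_Om : measurable Om. Proof. exact: open_measurable_rV. Qed.
Hint Resolve measurable_Om : core.

Lemma subspace_mf : subspace mf.
Proof.
split=> [i|a u v mu' mv i].
  rewrite (_ : (fun x => _) = cst 0); first exact: measurable_cst.
  by apply/funext => x; rewrite /= mxE.
apply: (eq_measurable_fun (fun x => a * u x ord0 i + v x ord0 i)).
  by move=> x _; rewrite /= !mxE.
apply: measurable_funD; last exact: mv.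
by apply: measurable_funM; [exact: measurable_cst|exact: mu'].
Qed.

Lemma measurable_dot u v : mf u -> mf v -> measurable_fun Om (fun x => dot (u x) (v x)).
Proof.
by move=> mu' mv; apply: measurable_sum => i; apply: measurable_funM; [exact: mu'|exact: mv].
Qed.

Lemma measurable_dotE u v A : A `<=` Om -> measurable A -> mf u -> mf v ->
  measurable_fun A (fun x => (dot (u x) (v x))%:E).
Proof.
move=> AO mA mu' mv; apply/measurable_EFinP.
by apply: measurable_funS (measurable_dot mu' mv).
Qed.

Lemma quadratic_L2sq A : A `<=` Om -> measurable A -> quadratic mf (L2sq A).
Proof.
move=> AO mA.
have I0 u : (0 <= L2sq A u)%E by apply: integral_ge0 => x _; rewrite lee_fin dot_ge0.
have d0 u x : (0 <= (dot (u x) (u x))%:E)%E by rewrite lee_fin dot_ge0.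
have S := subspace_mf.
have Z (a : R) u : 0 <= a -> mf u -> (\int[mu]_(x in A) (a%:E * (dot (u x) (u x))%:E) = a%:E * L2sq A u)%E.
  by move=> a0 mu'; rewrite ge0_integralZl//; exact: measurable_dotE.
have C (a b : R) u v : 0 <= a -> 0 <= b -> mf u -> mf v ->
    (\int[mu]_(x in A) (a%:E * (dot (u x) (u x))%:E + b%:E * (dot (v x) (v x))%:E) =
     a%:E * L2sq A u + b%:E * L2sq A v)%E.
  move=> a0 b0 mu' mv; rewrite ge0_integralD//; first by rewrite !Z.
  - by move=> x _; apply: mule_ge0; rewrite ?lee_fin// dot_ge0.
  - by apply: emeasurable_funM; [exact: measurable_cst|exact: measurable_dotE].
  - by move=> x _; apply: mule_ge0; rewrite ?lee_fin// dot_ge0.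
  - by apply: emeasurable_funM; [exact: measurable_cst|exact: measurable_dotE].
split=> //.
- by rewrite /L2sq integral0_eq// => x _; rewrite /dot big1// => i _; rewrite mxE mul0r.
- move=> a u a0 mu'; rewrite -Z ?sqr_ge0//; apply: le_integral_ge0 => // x _.
  by rewrite -EFinM lee_fin /= dotZl dotZr mulrA -expr2.
- move=> u v mu' mv.
  rewrite -(C 2 2)// /L2sq -ge0_integralD//.
  + apply: le_integral_ge0 => x _; first by rewrite adde_ge0.
    by rewrite -!EFinM -!EFinD lee_fin dot_parallelogram.
  + by have h := subspaceD S mu' mv; exact: (measurable_dotE AO mA h h).
  + by have h := subspaceB S mu' mv; exact: (measurable_dotE AO mA h h).
- move=> t u v t0 mu' mv.
  have t10 : 0 <= t^-1 by rewrite invr_ge0 ltW.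
  rewrite -C ?addr_ge0// ?(ltW t0)//.
  apply: le_integral_ge0 => // x _.
  by rewrite -!EFinM -!EFinD lee_fin; exact: dot_young.
Qed.

Let qOm := @quadratic_L2sq Om (@subset_refl _ Om) measurable_Om.

Lemma subspace_L2 : subspace (L2 Om).
Proof. exact: quad_finite_subspace subspace_mf qOm. Qed.

Lemma quadratic_L2 A : A `<=` Om -> measurable A -> quadratic (L2 Om) (L2sq A).
Proof. by move=> AO mA; apply: quadratic_sub (quadratic_L2sq AO mA) => u []. Qed.

Lemma L2sqS A B u : A `<=` B -> measurable A -> measurable B -> B `<=` Om -> mf u ->
  (L2sq A u <= L2sq B u)%E.
Proof.
move=> AB mA mB BO mu'; apply: ge0_subset_integral => //.
  exact: measurable_dotE.
by move=> x _; rewrite lee_fin dot_ge0.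
Qed.

Lemma integrable_dot u v : L2 Om u -> L2 Om v ->
  mu.-integrable Om (EFin \o (fun x => dot (u x) (v x))).
Proof.
move=> [mu' fu] [mv fv]; apply/integrableP; split; first exact: measurable_dotE.
have : (L2sq Om u + L2sq Om v < +oo)%E by rewrite lte_add_pinfty.
apply: le_lt_trans; rewrite /L2sq -ge0_integralD//.
- apply: le_integral_ge0 => // x _; rewrite /= lee_fin; exact: dot_amgm.
- by move=> x _; rewrite lee_fin dot_ge0.
- exact: measurable_dotE.
- by move=> x _; rewrite lee_fin dot_ge0.
- exact: measurable_dotE.
Qed.

Lemma L2ipC u v : L2ip Om u v = L2ip Om v u.
Proof. by congr (fine _); apply: eq_integral => x _; rewrite dotC. Qed.

Lemma L2ipDZl (a : R) u v w : L2 Om u -> L2 Om v -> L2 Om w ->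
  L2ip Om (a *: u + v) w = a * L2ip Om u w + L2ip Om v w.
Proof.
move=> Lu Lv Lw.
have i1 := integrable_dot Lu Lw; have i2 := integrable_dot Lv Lw.
have i3 := integrableRZ a measurable_Om i1.
rewrite /L2ip -RintegralZl// -RintegralD//.
by apply: eq_Rintegral => x _; rewrite /= dotDl dotZl.
Qed.

Lemma L2ipZl a u w : L2 Om u -> L2 Om w -> L2ip Om (a *: u) w = a * L2ip Om u w.
Proof.
move=> Lu Lw; have L0 := subspace_L2.1.
have := L2ipDZl a Lu L0 Lw; rewrite addr0 => ->.
have -> : L2ip Om 0 w = 0; last by rewrite addr0.
rewrite /L2ip /Rintegral integral0_eq// => x _.
by rewrite /dot big1// => i _; rewrite mxE mul0r.
Qed.

Lemma L2ipDl u v w : L2 Om u -> L2 Om v -> L2 Om w ->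
  L2ip Om (u + v) w = L2ip Om u w + L2ip Om v w.
Proof. by move=> *; rewrite -[u in LHS]scale1r L2ipDZl// mul1r. Qed.

Lemma L2ipBl u v w : L2 Om u -> L2 Om v -> L2 Om w ->
  L2ip Om (u - v) w = L2ip Om u w - L2ip Om v w.
Proof. by move=> *; rewrite addrC -scaleN1r L2ipDZl// mulN1r addrC. Qed.

Lemma L2ipDr u v w : L2 Om u -> L2 Om v -> L2 Om w ->
  L2ip Om w (u + v) = L2ip Om w u + L2ip Om w v.
Proof. by move=> *; rewrite L2ipC L2ipDl// !(L2ipC w). Qed.

Lemma L2ipBr u v w : L2 Om u -> L2 Om v -> L2 Om w ->
  L2ip Om w (u - v) = L2ip Om w u - L2ip Om w v.
Proof. by move=> *; rewrite L2ipC L2ipBl// !(L2ipC w). Qed.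

Lemma L2ipZr a u w : L2 Om u -> L2 Om w -> L2ip Om w (a *: u) = a * L2ip Om w u.
Proof. by move=> *; rewrite L2ipC L2ipZl// L2ipC. Qed.

Lemma L2sq_ge0 A u : (0 <= L2sq A u)%E.
Proof. by apply: integral_ge0 => x _; rewrite lee_fin dot_ge0. Qed.

Lemma L2sq_ip u : L2 Om u -> L2sq Om u = (L2ip Om u u)%:E.
Proof.
move=> [_ fu]; rewrite /L2ip /Rintegral fineK// ge0_fin_numE//; exact: L2sq_ge0.
Qed.

Lemma L2ip_ge0 u : 0 <= L2ip Om u u.
Proof. by apply: fine_ge0; exact: L2sq_ge0. Qed.

Lemma L2_cauchy_schwarz u v : L2 Om u -> L2 Om v ->
  L2ip Om u v ^+ 2 <= L2ip Om u u * L2ip Om v v.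
Proof.
move=> Lu Lv.
set a := L2ip Om u u; set b := L2ip Om v v; set c := L2ip Om u v.
have key s t : 0 <= s ^+ 2 * a - 2 * s * t * c + t ^+ 2 * b.
  have := L2ip_ge0 (s *: u - t *: v).
  have Ls : L2 Om (s *: u) by apply: subspaceZ => //; exact: subspace_L2.
  have Lt : L2 Om (t *: v) by apply: subspaceZ => //; exact: subspace_L2.
  have Lst : L2 Om (s *: u - t *: v) by apply: subspaceB => //; exact: subspace_L2.
  rewrite L2ipBl// !L2ipBr// !L2ipZl// !L2ipZr// (L2ipC v u) -/a -/b -/c; lra.
have a0 : 0 <= a := L2ip_ge0 u.
have b0 : 0 <= b := L2ip_ge0 v.
have [b_0|bn0] := eqVneq b 0.
  have [->|cn0] := eqVneq c 0; first by rewrite expr0n/= mulr_ge0.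
  (* With [b = 0] the form [a - 2 t c] is affine in [t]; this [t] would make it equal to -1. *)
  have := key 1 ((a + 1) / (2 * c)); rewrite b_0 mulr0 addr0 expr1n mul1r mulr1.
  rewrite (_ : 2 * ((a + 1) / (2 * c)) * c = a + 1); last by field.
  by lra.
have bp : 0 < b by rewrite lt_neqAle eq_sym bn0.
have := key b c.
rewrite (_ : _ + _ = b * (a * b - c ^+ 2)); last by ring.
by rewrite pmulr_rge0// subr_ge0.
Qed.

Lemma L2ip_le u v : L2 Om u -> L2 Om v ->
  `|L2ip Om u v| <= Num.sqrt (L2ip Om u u) * Num.sqrt (L2ip Om v v).
Proof.
move=> Lu Lv; rewrite -sqrtrM ?L2ip_ge0// -sqrtr_sqr ler_wsqrtr//.
exact: L2_cauchy_schwarz.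
Qed.

Lemma L2ip_bound u v (a b : R) : L2 Om u -> L2 Om v ->
  (L2sq Om u <= a%:E)%E -> (L2sq Om v <= b%:E)%E -> `|L2ip Om u v| <= Num.sqrt (a * b).
Proof.
move=> Lu Lv; rewrite !L2sq_ip// !lee_fin => ua vb.
apply: le_trans (L2ip_le Lu Lv) _; rewrite -sqrtrM ?L2ip_ge0// ler_wsqrtr//.
by apply: ler_pM => //; exact: L2ip_ge0.
Qed.

Lemma L2sq_eq0 u : mf u -> L2sq Om u = 0%E -> ae_eq_on Om u (fun=> 0).
Proof.
move=> mu' u0.
have : (\int[mu]_(x in Om) `|(dot (u x) (u x))%:E|)%E = 0%E.
  rewrite -[RHS]u0; apply: eq_integral => x _.
  by rewrite gee0_abs// lee_fin dot_ge0.
move/(ae_eq_integral_abs mu measurable_Om (measurable_dotE (@subset_refl _ Om) measurable_Om mu' mu')).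
apply: filterS => x h Ox; apply/rowP => i; rewrite mxE.
have := h Ox; rewrite /= => -[] dd.
have := coord_le_dot (u x) i; rewrite dd => h1.
by apply/eqP; rewrite -sqrf_eq0 eq_le h1 sqr_ge0.
Qed.

Lemma ae_eq_L2sq A u v : A `<=` Om -> measurable A -> mf u -> mf v -> ae_eq_on Om u v ->
  L2sq A u = L2sq A v.
Proof.
move=> AO mA mu' mv uv; apply: ae_eq_integral => //.
- exact: measurable_dotE.
- exact: measurable_dotE.
- by apply: filterS uv => x h Ax; rewrite h//; exact: AO.
Qed.

Lemma ae_eq_L2ip u v w : L2 Om u -> L2 Om v -> L2 Om w -> ae_eq_on Om u v ->
  L2ip Om u w = L2ip Om v w.
Proof.
move=> [mu' _] [mv _] [mw _] uv; congr (fine _); apply: ae_eq_integral => //.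
- exact: measurable_dotE.
- exact: measurable_dotE.
- by apply: filterS uv => x h Ax; rewrite h.
Qed.

(** The Riesz-Fischer argument. The additional term on [A] is carried along because the seminorm
    [QHA], which serves to measure local norms, is built from the sum; [A := Om] gives back plain
    completeness. *)
Lemma L2_complete A : A `<=` Om -> measurable A ->
  quad_complete (L2 Om) (fun u => L2sq Om u + L2sq A u)%E.
Proof.
move=> AO mA z Lz _ zC.
have S2 := subspace_L2; have q2 := quadratic_L2 (@subset_refl _ Om) measurable_Om.
have mz n : mf (z n) by case: (Lz n).
pose w k := z k.+1 - z k.
have Lw k : L2 Om (w k) by exact: subspaceB.
have mw k : mf (w k) by case: (Lw k).
have wC k : (L2sq Om (w k) <= (8^-1 ^+ k)%:E)%E.
  by apply: le_trans (zC k); rewrite leeDl//; exact: L2sq_ge0.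
have zC' m : forall n, (L2sq Om (z (n + m)%N - z n)%R <= (3 * 8^-1 ^+ n)%:E)%E.
  elim: m => [|m IH] n.
    by rewrite addn0 subrr (quad0 q2) lee_fin mulr_ge0// exprn_ge0.
  rewrite (_ : z (n + m.+1)%N - z n = (z (n.+1 + m)%N - z n.+1) + w n); last first.
    by rewrite addSnnS addrA subrK.
  have Lzz : L2 Om (z (n.+1 + m)%N - z n.+1) by exact: subspaceB.
  have h0 := IH n.+1.
  have := quadD_le q2 Lzz (Lw n) h0 (wC n).
  move=> h; apply: le_trans h _; rewrite lee_fin exprS.
  have : 0 <= (8^-1 : R) ^+ n by rewrite exprn_ge0.
  lra.
(* With the weights [4^k] the integrals still decrease like [2^-k]. Where the series converges, to
   [c] say, each coordinate of [w k x] is at most [sqrt c * 2^-k], hence [z n x] converges. *)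
pose t k x : \bar R := ((4 ^+ k)%:E * (dot (w k x) (w k x))%:E)%E.
have t0 k x : (0 <= t k x)%E by rewrite /t -EFinM lee_fin mulr_ge0 ?dot_ge0// exprn_ge0.
have mt k : measurable_fun Om (t k).
  by apply: emeasurable_funM; [exact: measurable_cst|exact: measurable_dotE].
pose g x : \bar R := (\sum_(k <oo) t k x)%E.
have mg : measurable_fun Om g by apply: ge0_emeasurable_sum.
have g0 x : (0 <= g x)%E by apply: nneseries_ge0.
have ig : (\int[mu]_(x in Om) g x < +oo)%E.
  rewrite integral_nneseries//.
  apply: (@le_lt_trans _ _ (\sum_(k <oo) (1 * 2^-1 ^+ k)%:E)%E); last first.
    by apply: geometric_nneseries_lty; rewrite invr_gt0 ltr0n/= invf_lt1// ltr1n.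
  apply: lee_nneseries => [k _ _|k _]; first exact: integral_ge0.
  rewrite /t ge0_integralZl//; last 2 first.
  - exact: measurable_dotE.
  - by move=> x _; rewrite lee_fin dot_ge0.
  apply: le_trans (lee_fin_mul _ (wC k)) _; first by rewrite exprn_ge0.
  by rewrite lee_fin -exprMn (_ : 4 * 8^-1 = 2^-1) ?mul1r//; field.
pose G := Om `&` [set x | (g x < +oo)%E].
have mG : measurable G by exact: emeasurable_fun_infty_o.
have aeG : {ae mu, forall x, Om x -> G x}.
  have gI : mu.-integrable Om g.
    apply/integrableP; split => //; apply: le_lt_trans ig.
    by apply: le_integral_ge0 => // x _; rewrite gee0_abs.
  apply: filterS (integrable_ae measurable_Om gI) => x h Ox; split => //=.
  by have := h Ox; rewrite fin_numE => /andP[_]; rewrite ltey.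
(* Set to 0 off the set [G] of convergence, so that the limit exists at every point and is
   measurable. *)
pose zt n i x := z n x ord0 i * \1_G x.
have mzt n i : measurable_fun Om (zt n i).
  apply: measurable_funM; first exact: mz.
  exact: measurable_funTS.
have zt_cvg i x : cvgn (fun n => zt n i x).
  have [Gx|nGx] := boolP (x \in G); last first.
    rewrite (_ : (fun n => _) = cst 0); first exact: is_cvg_cst.
    by apply/funext => n; rewrite /zt indicE (negbTE nGx) mulr0.
  move: (Gx); rewrite inE => -[Ox /= gx].
  have [c Ec c0] := fin_lt (g0 x) gx.
  apply: (@cvgn_fast _ _ (Num.sqrt c)) => n.
  rewrite /zt indicE Gx !mulr1 (_ : _ - _ = w n x ord0 i); last by rewrite !mxE.
  rewrite -(@ler_pXn2r _ 2) ?nnegrE ?mulr_ge0 ?sqrtr_ge0 ?exprn_ge0//.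
  rewrite real_normK ?num_real// exprMn sqr_sqrtr// -exprM mulnC exprM.
  rewrite (_ : 2^-1 ^+ 2 = 4^-1); last by field.
  have : (t n x <= c%:E)%E by rewrite -Ec; apply: nneseries_ge_term.
  rewrite /t -EFinM lee_fin => h.
  have p4 : 0 < (4 : R) ^+ n by rewrite exprn_gt0.
  rewrite exprVn ler_pdivlMr// mulrC; apply: le_trans h.
  by rewrite ler_pM2l// coord_le_dot.
pose y x : 'rV[R]_d := \row_i limn (fun n => zt n i x).
have my : mf y.
  move=> i; rewrite (_ : (fun x => _) = fun x => limn (fun n => zt n i x)); last first.
    by apply/funext => x; rewrite mxE.
  by apply: (measurable_fun_cvg (h := fun n x => zt n i x)) => // x _; exact: zt_cvg.
have zy x i : G x -> (z n x ord0 i : R) @[n --> \oo] --> (y x ord0 i : R).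
  move=> Gx; rewrite mxE.
  rewrite (_ : (fun n => z n x ord0 i) = fun n => zt n i x); first exact: zt_cvg.
  by apply/funext => n; rewrite /zt indicE mem_set// mulr1.
(* Fatou's lemma in the second index [m], with [z n] held fixed. *)
have lim n : (L2sq Om (z n - y)%R <= (3 * 8^-1 ^+ n)%:E)%E.
  apply: (@fatou_le _ _ _ mu Om (fun m x => (dot ((z n - z m) x) ((z n - z m) x))%:E) _ _ n) => //.
  - by move=> k; have h := subspaceB subspace_mf (mz n) (mz k); exact: (measurable_dotE _ _ h h).
  - by have h := subspaceB subspace_mf (mz n) my; exact: (measurable_dotE _ _ h h).
  - by move=> k x _; rewrite lee_fin dot_ge0.
  - by move=> x _; rewrite lee_fin dot_ge0.
  - apply: filterS aeG => x h Ox r; rewrite lte_fin => hr.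
    have cv : dot ((z n - z m) x) ((z n - z m) x) @[m --> \oo] --> dot ((z n - y) x) ((z n - y) x).
      have ci i : ((z n - z m) x ord0 i : R) @[m --> \oo] --> ((z n - y) x ord0 i : R).
        rewrite (_ : (fun m => _) = (fun m => z n x ord0 i - z m x ord0 i)); last first.
          by apply/funext => m; rewrite !mxE.
        rewrite (_ : (z n - y) x ord0 i = z n x ord0 i - y x ord0 i); last by rewrite !mxE.
        by apply: cvgB; [exact: cvg_cst|apply: zy; exact: h].
      exact: cvg_dot.
    have [M _ hM] := cvgr_gt _ cv _ hr.
    by exists M => k Mk; rewrite lee_fin ltW//; exact: hM.
  - move=> k nk; rewrite -/(L2sq Om (z n - z k)) (quadBC S2 q2)//.
    by rewrite -(subnKC nk); exact: zC'.
have Ly : L2 Om y.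
  split => //; rewrite (_ : y = z 0%N - (z 0%N - y)); last by rewrite opprB addrC subrK.
  have h1 : L2 Om (z 0%N - y).
    split; first exact: (subspaceB subspace_mf).
    exact: le_lt_trans (lim 0%N) (ltry _).
  by case: (subspaceB S2 (Lz 0%N) h1).
exists y => // e e0.
have e6 : 0 < e / 6 by rewrite divr_gt0.
have [N hN] := exists_natSinv_lt e6.
exists N => n Nn.
have h8 : 8^-1 ^+ n <= e / 6.
  apply: le_trans (ltW hN); rewrite exprVn lef_pV2 ?posrE ?exprn_gt0//.
  rewrite -natrX ler_nat; apply: (@leq_trans n.+1); first by rewrite ltnS.
  exact: ltn_expl.
have l1 : (L2sq Om (z n - y)%R <= (e / 2)%:E)%E.
  by apply: le_trans (lim n) _; rewrite lee_fin; lra.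
have l2 : (L2sq A (z n - y)%R <= (e / 2)%:E)%E.
  apply: le_trans l1; apply: L2sqS => //.
  exact: (subspaceB subspace_mf).
by have := leeD l1 l2; rewrite -EFinD -splitr.
Qed.

End L2_theory.

Lemma continuous_addR {R : realType} {X : topologicalType} (f g : X -> R) :
  continuous f -> continuous g -> continuous (fun x => f x + g x).
Proof. by move=> cf cg x; exact: (cvgD (cf x) (cg x)). Qed.

Lemma continuous_mulR {R : realType} {X : topologicalType} (f g : X -> R) :
  continuous f -> continuous g -> continuous (fun x => f x * g x).
Proof. by move=> cf cg x; exact: (cvgM (cf x) (cg x)). Qed.

(** * Calculus of test functions *)

Section test_functions.
Context {R : realType} {d : nat} {Om : set 'rV[R]_d}.
Implicit Types (f g : 'rV[R]_d -> R) (w : seq 'I_d).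

Lemma smooth_C1 f w : smooth f -> C1 (pderivs w f).
Proof.
move=> sf; have [c1 d1] := sf w; split => // i; split => [x|]; first exact: d1.
by have [] := sf (i :: w).
Qed.

Lemma pderivs_cat w1 w2 f : pderivs w1 (pderivs w2 f) = pderivs (w1 ++ w2) f.
Proof. by rewrite /pderivs foldr_cat. Qed.

Lemma smooth_pderivs w f : smooth f -> smooth (pderivs w f).
Proof. by move=> sf w'; rewrite pderivs_cat; exact: sf. Qed.

Lemma pderivs_lin w f g (a : R) : smooth f -> smooth g ->
  pderivs w (fun x => a * f x + g x) = fun x => a * pderivs w f x + pderivs w g x.
Proof.
move=> sf sg; elim: w => //= i w IH; rewrite [LHS]/pderiv IH; apply/funext => x.
have df := (sf w).2 i x; have dg := (sg w).2 i x.
rewrite (_ : (fun x => _) = (a \*: pderivs w f) + pderivs w g); last by [].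
by rewrite (deriveD (derivableZ (k := a) df) dg) (deriveZ a df).
Qed.

Lemma smooth_lin f g (a : R) : smooth f -> smooth g -> smooth (fun x => a * f x + g x).
Proof.
move=> sf sg w; rewrite pderivs_lin//.
have [cf df] := sf w; have [cg dg] := sg w; split=> [|i x].
  by apply: continuous_addR => //; apply: continuous_mulR => //; exact: cst_continuous.
rewrite (_ : (fun x => _) = (a \*: pderivs w f) + pderivs w g); last by [].
by apply: derivableD; [apply: derivableZ; exact: df|exact: dg].
Qed.

Lemma pderivs_support w f :
  closure [set x | pderivs w f x != 0] `<=` closure [set x | f x != 0].
Proof.
elim: w => //= i w IH; apply: subset_trans IH.
move=> x /(closureS (@pderiv_support _ _ _ i)).
by rewrite -(closure_id _).1//; exact: closed_closure.
Qed.

Lemma test_pderivs w f : test_function Om f -> test_function Om (pderivs w f).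
Proof.
move=> [sf cf fO]; split; first exact: smooth_pderivs.
  by apply: subclosed_compact cf _; [exact: closed_closure|exact: pderivs_support].
by apply: subset_trans fO; exact: pderivs_support.
Qed.

Lemma test_lin f g (a : R) : test_function Om f -> test_function Om g ->
  test_function Om (fun x => a * f x + g x).
Proof.
move=> [sf cf fO] [sg cg gO].
have S : closure [set x | a * f x + g x != 0] `<=`
    closure [set x | f x != 0] `|` closure [set x | g x != 0].
  rewrite -closureU; apply: closureS => x /= h.
  have [f0|fn0] := eqVneq (f x) 0; last by left.
  by right; move: h; rewrite f0 mulr0 add0r.
split; first exact: smooth_lin.
  by apply: subclosed_compact S; [exact: closed_closure|exact: compactU].
by apply: subset_trans S _ => x [/fO|/gO].
Qed.

Lemma test_cst0 : test_function Om (fun=> 0).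
Proof.
have p0 w : pderivs w (fun=> 0 : R) = (fun=> 0 : R) :> ('rV[R]_d -> R).
  by elim: w => //= i w ->; apply/funext => x; rewrite /pderiv derive_cst.
have s0 : [set x : 'rV[R]_d | (0 : R) != 0] = set0.
  by apply/seteqP; split => // x /=; rewrite eqxx.
split; last 2 first.
- by rewrite s0 closure0; exact: compact0.
- by rewrite s0 closure0.
move=> w; rewrite p0; split; first exact: cst_continuous.
by move=> i x; exact: derivable_cst.
Qed.

Lemma test_Om f x : test_function Om f -> f x != 0 -> Om x.
Proof. by move=> [_ _ fO] fx; apply: fO; exact: subset_closure. Qed.

Lemma compact_box (A : set 'rV[R]_d) : compact A ->
  exists M : R, forall x, A x -> forall i, `|x ord0 i| <= M.
Proof.
move=> /compact_bounded[M [_ hM]]; exists (M + 1) => x Ax i.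
by apply: le_trans (rV_coord_le_norm x i) _; apply: (hM (M + 1)) => //; rewrite ltrDl.
Qed.

Lemma test_bounded f : test_function Om f -> exists C M : R,
  (forall x, `|f x| <= C) /\ (forall x, f x != 0 -> forall i, `|x ord0 i| <= M).
Proof.
move=> [sf cf fO]; have [M hM] := compact_box cf.
have /compact_bounded[C [_ hC]] : compact (f @` closure [set x | f x != 0]).
  apply: continuous_compact => //; apply: continuous_subspaceT.
  by have [] := sf [::].
exists (Num.max 0 (C + 1)), M; split=> [x|x fx]; last first.
  by apply: hM; exact: subset_closure.
have [->|fx] := eqVneq (f x) 0; first by rewrite normr0 le_max lexx.
rewrite le_max; apply/orP; right; apply: (hC (C + 1)); first by rewrite ltrDl.
by exists x => //; exact: subset_closure.
Qed.

Lemma measurable_test f : test_function Om f ->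
  measurable_fun setT (f : 'rV[R]_d -> measurableTypeR R).
Proof. by move=> [sf _ _]; apply: continuous_measurable_rV; have [] := sf [::]. Qed.

Lemma integral_test_Om f g : test_function Om f ->
  (\int[lebesgue_rV R d]_(x in Om) (g x * f x)%:E = \int[lebesgue_rV R d]_x (g x * f x)%:E)%E.
Proof.
move=> tf; rewrite integral_mkcond; apply: eq_integral => x _; rewrite patchE.
case: ifPn => // nOx; have [->|fx] := eqVneq (f x) 0; first by rewrite mulr0.
by move/negP: nOx; case; rewrite inE; exact: (test_Om tf).
Qed.

Lemma integrable_test f g : test_function Om f -> test_function Om g ->
  (lebesgue_rV R d).-integrable setT (EFin \o (fun x => f x * g x)).
Proof.
move=> tf tg; have [C1 [M [hC1 hM]]] := test_bounded tf.
have [C2 [_ [hC2 _]]] := test_bounded tg.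
apply: (@integrable_bounded_support _ _ _ (C1 * C2) M).
- by apply: measurable_funM; exact: measurable_test.
- by move=> x; rewrite normrM; exact: ler_pM.
- by move=> x; rewrite mulf_eq0 negb_or => /andP[fx _]; exact: hM.
Qed.

Lemma test_ibp1 f g i : test_function Om f -> test_function Om g ->
  \int[lebesgue_rV R d]_(x in Om) (f x * pderiv i g x) =
  - \int[lebesgue_rV R d]_(x in Om) (pderiv i f x * g x).
Proof.
move=> tf tg.
have tdg : test_function Om (pderiv i g) := test_pderivs [:: i] tg.
have tdf : test_function Om (pderiv i f) := test_pderivs [:: i] tf.
rewrite /Rintegral !integral_test_Om//.
have [C1' [M [_ hM]]] := test_bounded tf.
have [sf _ _] := tf; have [sg _ _] := tg.
have c1f := smooth_C1 [::] sf; have c1g := smooth_C1 [::] sg.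
have dfg k x : derivable (f * g) x (delta_mx ord0 k).
  by apply: derivableM; [exact: (c1f.2 k).1|exact: (c1g.2 k).1].
have pfg k : pderiv k (f * g) = fun x => f x * pderiv k g x + pderiv k f x * g x.
  apply/funext => x; rewrite /pderiv deriveM; last 2 first.
  - exact: (c1f.2 k).1.
  - exact: (c1g.2 k).1.
  by rewrite /GRing.scale/= (mulrC (g x)).
have c1fg : C1 (f * g).
  split=> [|k]; first by apply: continuous_mulR; [exact: c1f.1|exact: c1g.1].
  split=> // ; rewrite pfg; apply: continuous_addR; apply: continuous_mulR.
  - exact: c1f.1.
  - exact: (c1g.2 k).2.
  - exact: (c1f.2 k).2.
  - exact: c1g.1.
have [C hC] : exists C, forall k x, `|pderiv k (f * g) x| <= C.
  have h k : exists C, forall x, `|pderiv k (f * g) x| <= C.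
    have [A1 [_ [hA1 _]]] := test_bounded tf.
    have [A2 [_ [hA2 _]]] := test_bounded tg.
    have [B1 [_ [hB1 _]]] := test_bounded (test_pderivs [:: k] tf).
    have [B2 [_ [hB2 _]]] := test_bounded (test_pderivs [:: k] tg).
    exists (A1 * B2 + B1 * A2) => x; rewrite pfg; apply: le_trans (ler_normD _ _) _.
    by rewrite !normrM; apply: lerD; apply: ler_pM => //; [exact: hB2|exact: hB1].
  have /choice[C hC] := h; exists (\sum_k `|C k|) => k x.
  apply: le_trans (hC k x) _; apply: le_trans (ler_norm _) _.
  by rewrite (bigD1 k)//= lerDl sumr_ge0.
have hM' x : (f * g) x != 0 -> forall i, `|x ord0 i| <= M.
  by rewrite mulf_eq0 negb_or => /andP[fx _]; exact: hM.
have h0 := integral_pderiv_eq0 i c1fg hC hM'.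
have i1 := integrable_test tf tdg; have i2 := integrable_test tdf tg.
have : \int[lebesgue_rV R d]_x (f x * pderiv i g x + pderiv i f x * g x) = 0.
  by rewrite /Rintegral -[RHS]/(fine 0%E) -h0 pfg.
by rewrite RintegralD// => /eqP; rewrite addr_eq0 => /eqP.
Qed.

(** The derivatives move one at a time, the outermost first, which reverses their order. *)
Lemma test_ibp w f g : test_function Om f -> test_function Om g ->
  \int[lebesgue_rV R d]_(x in Om) (f x * pderivs w g x) =
  (-1) ^+ size w * \int[lebesgue_rV R d]_(x in Om) (pderivs (rev w) f x * g x).
Proof.
elim: w f => [|i w IH] f tf tg; first by rewrite expr0 mul1r.
rewrite /= test_ibp1//; last exact: test_pderivs.
rewrite IH//; last exact: (test_pderivs [:: i]).
by rewrite rev_cons -cats1 exprS mulN1r mulNr -pderivs_cat.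
Qed.

(** Change one coordinate at a time and use the mean value theorem in each; the [n] coordinates
    account for the factor [n]. *)
Lemma C1_lipschitz n (f : 'rV[R]_n -> R) (C : R) : C1 f ->
  (forall i x, `|pderiv i f x| <= C) -> forall x y, `|f x - f y| <= n%:R * C * `|x - y|.
Proof.
elim: n f => [|n IH] f cf fC x y.
  by rewrite (_ : x = y) ?subrr ?normr0 ?mulr0//; apply/rowP => -[].
have C0 : 0 <= C by apply: le_trans (fC ord0 x).
have E (z : 'rV[R]_n.+1) : z = cons_rV (z ord0 ord0, \row_i z ord0 (lift ord0 i)).
  by apply/rowP => i; rewrite mxE; case: unliftP => [k|] ->; rewrite ?mxE.
set s := x ord0 ord0; set t := y ord0 ord0.
set x' := \row_i x ord0 (lift ord0 i); set y' := \row_i y ord0 (lift ord0 i).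
have h1 : `|f (cons_rV (s, x')) - f (cons_rV (t, x'))| <= C * `|x - y|.
  have [dr cr] := slice0_C1 x' cf.
  have key a b : a <= b -> `|f (cons_rV (b, x')) - f (cons_rV (a, x'))| <= C * `|b - a|.
    move=> ab; have [||c _ ->] := MVT_segment (f := fun r => f (cons_rV (r, x')))
      (df := derive1 (fun r => f (cons_rV (r, x')))) ab.
    - by move=> z _; rewrite derive1E; exact: derivableP.
    - apply: continuous_subspaceT => z.
      by apply/differentiable_continuous/derivable1_diffP.
    by rewrite normrM ler_wpM2r// pderiv_slice0.
  have xy : `|s - t| <= `|x - y|.
    by rewrite (_ : s - t = (x - y) ord0 ord0) ?rV_coord_le_norm// !mxE.
  apply: (@le_trans _ _ (C * `|s - t|)); last exact: ler_wpM2l.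
  have [ts|st] := leP t s; first exact: key.
  by rewrite distrC [X in _ <= C * X]distrC; apply: key; exact: ltW.
have h2 : `|f (cons_rV (t, x')) - f (cons_rV (t, y'))| <= n%:R * C * `|x - y|.
  have := IH _ (C1_slice t cf) _ x' y'.
  move=> h; apply: le_trans (h _) _; first by move=> i z; rewrite pderiv_slice.
  apply: ler_wpM2l; first by rewrite mulr_ge0.
  rewrite rV_normP//; apply/forallP => i; apply: le_trans (rV_coord_le_norm (x - y) (lift ord0 i)).
  by rewrite !mxE.
rewrite [X in f X - _]E [X in _ - f X]E -/s -/t -/x' -/y'.
rewrite (_ : f _ - f _ = (f (cons_rV (s, x')) - f (cons_rV (t, x'))) +
  (f (cons_rV (t, x')) - f (cons_rV (t, y')))); last by rewrite addrA subrK.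
apply: le_trans (ler_normD _ _) _; apply: le_trans (lerD h1 h2) _.
by rewrite -mulrDl -[C in C + _]mul1r -mulrDl nat1r.
Qed.

End test_functions.

(** * Weak derivatives, completeness of H^1, and Friedrichs' inequality in V *)

Section weak_derivatives.
Context {R : realType} {d : nat} {Om : set 'rV[R]_d}.
Hypothesis oOm : open Om.
Local Notation mu := (lebesgue_rV R d).
Implicit Types (f : 'rV[R]_d -> R) (w : seq 'I_d) (u v g h : vfield R d).
Let mOm : measurable Om := measurable_Om oOm.
Let S2 := subspace_L2 oOm.
Let q2 := quadratic_L2 oOm (@subset_refl _ Om) mOm.

(** Turns the scalar integrals of [weak_deriv] into scalar products of fields, for which bilinearity
    and Cauchy-Schwarz are available. *)
Definition coord_field f (i : 'I_d) : vfield R d := fun x => f x *: delta_mx ord0 i.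

Lemma dot_coord_field u f i x : dot (u x) (coord_field f i x) = u x ord0 i * f x.
Proof.
rewrite /dot (bigD1 i)//= big1 ?addr0 => [|k ki]; first by rewrite !mxE !eqxx mulr1.
by rewrite !mxE eqxx (negbTE ki) !mulr0.
Qed.

Lemma L2ip_coord u f i : L2ip Om u (coord_field f i) = \int[mu]_(x in Om) (u x ord0 i * f x).
Proof. by apply: eq_Rintegral => x _; rewrite dot_coord_field. Qed.

Lemma L2_test u : (forall i, test_function Om (fun x => u x ord0 i)) -> L2 Om u.
Proof.
move=> tu; split=> [i|].
  apply: measurable_funTS; exact: (measurable_test (tu i)).
rewrite /L2sq (_ : (fun x => _) = fun x => (\sum_i (u x ord0 i * u x ord0 i)%:E)%E); last first.
  by apply/funext => x; rewrite /dot sumEFin.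
rewrite ge0_integral_sum//.
- apply: lte_sum_pinfty => i _; rewrite integral_test_Om//.
  have /integrableP[_] := integrable_test (tu i) (tu i).
  by under eq_integral do rewrite /= ger0_norm -?expr2 ?sqr_ge0//.
- move=> i; apply/measurable_EFinP; apply: measurable_funM;
  by apply: measurable_funTS; exact: (measurable_test (tu i)).
- by move=> i x _; rewrite lee_fin -expr2 sqr_ge0.
Qed.

Lemma L2_coord_field f i : test_function Om f -> L2 Om (coord_field f i).
Proof.
move=> tf; apply: L2_test => k; have [<-|ik] := eqVneq i k.
  by rewrite (_ : (fun x => _) = f)//; apply/funext => x; rewrite !mxE !eqxx mulr1.
rewrite (_ : (fun x => _) = fun=> 0); first exact: test_cst0.
by apply/funext => x; rewrite !mxE eq_sym (negbTE ik) andbF mulr0.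
Qed.

Lemma weak_derivP w u g : weak_deriv Om w u g <-> forall f, test_function Om f -> forall i,
  L2ip Om u (coord_field (pderivs w f) i) = (-1) ^+ size w * L2ip Om g (coord_field f i).
Proof. by split=> H f tf i; have := H f tf i; rewrite !L2ip_coord. Qed.

Lemma weak_deriv_lin w (a : R) u v g h : L2 Om u -> L2 Om v -> L2 Om g -> L2 Om h ->
  weak_deriv Om w u g -> weak_deriv Om w v h -> weak_deriv Om w (a *: u + v) (a *: g + h).
Proof.
move=> Lu Lv Lg Lh /weak_derivP wu /weak_derivP wv; apply/weak_derivP => f tf i.
have Lf := L2_coord_field i tf.
have Ldf := L2_coord_field i (test_pderivs w tf).
by rewrite !L2ipDZl// wu// wv//; ring.
Qed.

Lemma weak_deriv0 w : weak_deriv Om w 0 0.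
Proof.
apply/weak_derivP => f tf i.
have z u : L2ip Om 0 u = 0.
  rewrite /L2ip /Rintegral integral0_eq// => x _.
  by rewrite /dot big1// => k _; rewrite mxE mul0r.
by rewrite !z mulr0.
Qed.

Lemma quadratic_weak_deriv_sq w : quadratic (L2 Om) (weak_deriv_sq Om w).
Proof.
apply: (quadratic_inf (L := fun g u => weak_deriv Om w u g) S2 q2) => //.
  exact: weak_deriv0.
by move=> *; exact: weak_deriv_lin.
Qed.

Lemma quadratic_H1sq : quadratic (L2 Om) (H1sq Om).
Proof.
by apply: quadraticD => //; apply: quadratic_sum => i; exact: quadratic_weak_deriv_sq.
Qed.

Lemma L2sq_H1sq u : (L2sq Om u <= H1sq Om u)%E.
Proof.
by rewrite leeDl// sume_ge0// => i _; apply: (quad_ge0 (quadratic_weak_deriv_sq _)).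
Qed.

Lemma weak_deriv_cvg w (z g : nat -> vfield R d) y h :
  (forall n, L2 Om (z n)) -> (forall n, L2 Om (g n)) -> L2 Om y -> L2 Om h ->
  (forall n, weak_deriv Om w (z n) (g n)) ->
  (forall e, 0 < e -> exists N : nat, forall n, (N <= n)%N -> (L2sq Om (z n - y)%R <= e%:E)%E) ->
  (forall e, 0 < e -> exists N : nat, forall n, (N <= n)%N -> (L2sq Om (g n - h)%R <= e%:E)%E) ->
  weak_deriv Om w y h.
Proof.
move=> Lz Lg Ly Lh wz zy gh; apply/weak_derivP => f tf i.
have Lf := L2_coord_field i tf.
have Ldf := L2_coord_field i (test_pderivs w tf).
set F := coord_field f i; set F' := coord_field (pderivs w f) i.
set A := L2ip Om y F'; set B := (-1) ^+ size w * L2ip Om h F.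
apply/eqP; rewrite -subr_eq0 -normr_le0; apply/ler_addgt0Pr => e e0; rewrite add0r.
pose c := L2ip Om F F + L2ip Om F' F' + 1.
have c0 : 0 < c by rewrite ltr_wpDl// addr_ge0// L2ip_ge0.
pose e1 := (e / 2) ^+ 2 / c.
have e10 : 0 < e1 by rewrite divr_gt0// exprn_gt0// divr_gt0.
have [N1 H1] := zy _ e10; have [N2 H2] := gh _ e10.
pose n := maxn N1 N2.
have bd a G : L2 Om a -> L2 Om G -> L2ip Om G G <= c -> (L2sq Om a <= e1%:E)%E ->
    `|L2ip Om a G| <= e / 2.
  move=> La LG Gc ae.
  have Gc' : (L2sq Om G <= c%:E)%E by rewrite L2sq_ip// lee_fin.
  apply: le_trans (L2ip_bound oOm La LG ae Gc') _.
  rewrite /e1 divfK ?gt_eqF// sqrtr_sqr ger0_norm// divr_ge0// ltW//.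
have b1 := bd (z n - y) F' (subspaceB S2 (Lz n) Ly) Ldf _ (H1 n (leq_maxl _ _)).
have b2 := bd (g n - h) F (subspaceB S2 (Lg n) Lh) Lf _ (H2 n (leq_maxr _ _)).
have /weak_derivP/(_ f tf i) E := wz n.
rewrite L2ipBl// -/A in b1; rewrite L2ipBl// in b2.
have {}b1 : `|L2ip Om (z n) F' - A| <= e / 2.
  by apply: b1; rewrite /c; have := L2ip_ge0 (Om := Om) F; have := L2ip_ge0 (Om := Om) F'; lra.
have {}b2 : `|L2ip Om (g n) F - L2ip Om h F| <= e / 2.
  by apply: b2; rewrite /c; have := L2ip_ge0 (Om := Om) F; have := L2ip_ge0 (Om := Om) F'; lra.
have {}b2 : `|(-1) ^+ size w * L2ip Om (g n) F - B| <= e / 2.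
  by rewrite /B -mulrBr normrM normrX normrN1 expr1n mul1r.
rewrite -E -/F' in b2.
rewrite (_ : A - B = (L2ip Om (z n) F' - B) - (L2ip Om (z n) F' - A)); last by ring.
apply: le_trans (ler_normB _ _) _; lra.
Qed.

Lemma weak_deriv_sq_lt w u (r : \bar R) : (weak_deriv_sq Om w u < r)%E ->
  exists g, [/\ L2 Om g, weak_deriv Om w u g & (L2sq Om g < r)%E].
Proof. by move=> /ereal_inf_lt[_ [g [Lg wg] <-]]; exists g. Qed.

Lemma weak_deriv_sq_le w u g : L2 Om g -> weak_deriv Om w u g ->
  (weak_deriv_sq Om w u <= L2sq Om g)%E.
Proof. by move=> Lg wg; apply: ereal_inf_lbound; exists g. Qed.

(** As [weak_deriv_sq] is an infimum, derivatives of the [z n] must be chosen coherently: start from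
    any derivative of [z 0] and add near-minimal derivatives [k n] of the increments. The resulting
    [g n] inherit the rate of the increments, and their limit is a weak derivative of [y]. *)
Lemma weak_deriv_sq_cvg w (z : nat -> vfield R d) y :
  (forall n, L2 Om (z n)) -> L2 Om y -> (weak_deriv_sq Om w (z 0%N) < +oo)%E ->
  (forall n, (weak_deriv_sq Om w (z n.+1 - z n)%R <= (8^-1 ^+ n)%:E)%E) ->
  (forall e, 0 < e -> exists N : nat, forall n, (N <= n)%N -> (L2sq Om (z n - y)%R <= e%:E)%E) ->
  (forall e, 0 < e -> exists N : nat, forall n, (N <= n)%N ->
     (weak_deriv_sq Om w (z n - y)%R <= e%:E)%E).
Proof.
move=> Lz Ly z0 zC zy.
have [g0 [Lg0 wg0 _]] := weak_deriv_sq_lt z0.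
have /choice[k kP] n : exists k, [/\ L2 Om k, weak_deriv Om w (z n.+1 - z n) k &
    (L2sq Om k < (2 * 8^-1 ^+ n)%:E)%E].
  apply: weak_deriv_sq_lt; apply: le_lt_trans (zC n) _.
  by rewrite lte_fin -[ltLHS]mul1r ltr_pM2r ?exprn_gt0// ltr1n.
pose g := fix g n := if n is n'.+1 then g n' + k n' else g0.
have Lg n : L2 Om (g n).
  by elim: n => //= n IH; apply: subspaceD => //; case: (kP n).
have wg n : weak_deriv Om w (z n) (g n).
  elim: n => //= n IH; have [Lk wk _] := kP n.
  rewrite (_ : z n.+1 = 1 *: z n + (z n.+1 - z n)); last by rewrite scale1r addrC subrK.
  by rewrite -[g n]scale1r; apply: weak_deriv_lin => //; exact: subspaceB.
(* Taking [A := Om] counts the norm twice, and near-minimality costs another factor 2. The shift of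
   the index by one gains 8 and absorbs both. *)
have [|||h Lh gh] := L2_complete oOm (@subset_refl _ Om) mOm (z := fun n => g n.+1).
- by move=> n; exact: Lg.
- by move=> n; apply: lte_add_pinfty; have [] := Lg n.+1.
- move=> n; have -> : g n.+2 - g n.+1 = k n.+1.
    by change (g n.+1 + k n.+1 - g n.+1 = k n.+1); rewrite addrAC subrr add0r.
  have [Lk wk /ltW Hk] := kP n.+1.
  apply: le_trans (leeD Hk Hk) _; rewrite -EFinD lee_fin exprS.
  have : 0 <= (8^-1 : R) ^+ n by rewrite exprn_ge0.
  lra.
have gh' e : 0 < e -> exists N : nat, forall n, (N <= n)%N -> (L2sq Om (g n - h)%R <= e%:E)%E.
  move=> /gh[N HN]; exists N.+1 => -[//|n] Nn.
  by apply: le_trans (HN n Nn); rewrite leeDl//; exact: L2sq_ge0.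
have wy := weak_deriv_cvg Lz Lg Ly Lh wg zy gh'.
move=> e /gh'[N HN]; exists N => n Nn; apply: le_trans (HN n Nn).
apply: weak_deriv_sq_le; first exact: subspaceB.
have E (a b : vfield R d) : a - b = -1 *: b + a by rewrite scaleN1r addrC.
by rewrite !E; exact: weak_deriv_lin.
Qed.

Lemma H1_complete : quad_complete (L2 Om) (H1sq Om).
Proof.
move=> z Lz zf zC.
have wd0 i u : (0 <= weak_deriv_sq Om [:: i] u)%E.
  exact: (quad_ge0 (quadratic_weak_deriv_sq _)).
have wdH i u : (weak_deriv_sq Om [:: i] u <= H1sq Om u)%E.
  rewrite /H1sq (bigD1 i)//= addeCA leeDl//; apply: adde_ge0; first exact: L2sq_ge0.
  by apply: sume_ge0 => k _; exact: wd0.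
have [|||y Ly zy] := L2_complete oOm (@subset_refl _ Om) mOm (z := fun n => z n.+1).
- by move=> n; exact: Lz.
- by move=> n; have [_ h] := Lz n.+1; exact: lte_add_pinfty.
- move=> n; have h := le_trans (L2sq_H1sq _) (zC n.+1).
  apply: le_trans (leeD h h) _; rewrite -EFinD lee_fin exprS.
  have : 0 <= (8^-1 : R) ^+ n by rewrite exprn_ge0.
  lra.
have zy' e : 0 < e -> exists N : nat, forall n, (N <= n)%N -> (L2sq Om (z n - y)%R <= e%:E)%E.
  move=> /zy[N HN]; exists N.+1 => -[//|n] Nn.
  by apply: le_trans (HN n Nn); rewrite leeDl//; exact: L2sq_ge0.
exists y => // e e0.
pose e1 := e / (d.+1%:R).
have e10 : 0 < e1 by rewrite divr_gt0.
have hN (i : 'I_d) : exists N : nat, forall n, (N <= n)%N ->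
     (weak_deriv_sq Om [:: i] (z n - y)%R <= e1%:E)%E.
  apply: weak_deriv_sq_cvg => //; first exact: le_lt_trans (wdH _ _) (zf 0%N).
  by move=> n; exact: le_trans (wdH _ _) (zC n).
have /choice[N HN] := hN.
have [N0 HN0] := zy' _ e10.
exists (maxn N0 (\max_i N i)) => n; rewrite geq_max => /andP[n0 nN].
rewrite (_ : e = e1 + \sum_(i < d) e1); last first.
  by rewrite sumr_const card_ord -mulrS -mulr_natr /e1 divfK.
rewrite EFinD -sumEFin; apply: leeD; first exact: HN0.
apply: lee_sum => i _; apply: HN; apply: leq_trans nN; exact: leq_bigmax.
Qed.

Lemma weak_deriv_sq_ge0 w u : (0 <= weak_deriv_sq Om w u)%E.
Proof. exact: (quad_ge0 (quadratic_weak_deriv_sq _)). Qed.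

Definition test_vfield u := forall i, test_function Om (fun x => u x ord0 i).

Definition class_deriv w u : vfield R d := fun x => \row_i pderivs w (fun y => u y ord0 i) x.

Lemma test_class_deriv w u : test_vfield u -> test_vfield (class_deriv w u).
Proof.
move=> tu i; rewrite (_ : (fun x => _) = pderivs w (fun y => u y ord0 i)).
  exact: test_pderivs.
by apply/funext => x; rewrite mxE.
Qed.

Lemma weak_class_deriv w u : test_vfield u -> weak_deriv Om w u (class_deriv (rev w) u).
Proof.
move=> tu f tf i; rewrite test_ibp//; congr (_ * _).
by apply: eq_Rintegral => x _; rewrite mxE.
Qed.

Lemma test_weak_deriv_sq_lty w u : test_vfield u -> (weak_deriv_sq Om w u < +oo)%E.
Proof.
move=> tu; apply: le_lt_trans (weak_deriv_sq_le _ (weak_class_deriv w tu)) _.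
  exact/L2_test/test_class_deriv.
by have [] := L2_test (test_class_deriv (rev w) tu).
Qed.

Lemma test_H1sq_lty u : test_vfield u -> (H1sq Om u < +oo)%E.
Proof.
move=> tu; apply: lte_add_pinfty; first by have [] := L2_test tu.
by apply: lte_sum_pinfty => i _; exact: test_weak_deriv_sq_lty.
Qed.

Lemma field_sum_coord u : u = \sum_i coord_field (fun x => u x ord0 i) i.
Proof.
apply/funext => x; rewrite fct_sumE; apply/rowP => k.
rewrite summxE (bigD1 k)//= big1 ?addr0 => [|i ik]; first by rewrite !mxE !eqxx mulr1.
by rewrite !mxE eqxx eq_sym (negbTE ik) mulr0.
Qed.

(** The classical derivative [D] is itself made of test functions, so testing with it gives
    [<g, D> = <D, D>] for every weak derivative [g], and Cauchy-Schwarz shows that [D] has the least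
    norm. *)
Lemma class_deriv_le i u : test_vfield u ->
  (L2sq Om (class_deriv [:: i] u) <= weak_deriv_sq Om [:: i] u)%E.
Proof.
move=> tu; apply: le_ereal_inf_tmp => _ [g [Lg wg] <-].
set D := class_deriv [:: i] u; have tD : test_vfield D := test_class_deriv [:: i] tu.
have LD : L2 Om D := L2_test tD.
have wD : weak_deriv Om [:: i] u D := weak_class_deriv [:: i] tu.
have E k : L2ip Om g (coord_field (fun x => D x ord0 k) k) =
           L2ip Om D (coord_field (fun x => D x ord0 k) k).
  have /weak_derivP/(_ _ (tD k) k) := wg; have /weak_derivP/(_ _ (tD k) k) := wD.
  by move=> -> /eqP; rewrite expr1 !mulN1r eqr_opp => /eqP.
have Es v : L2 Om v -> forall s : seq 'I_d, L2ip Om v (\sum_(k <- s) coord_field (fun x => D x ord0 k) k)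
    = \sum_(k <- s) L2ip Om v (coord_field (fun x => D x ord0 k) k)
    /\ L2 Om (\sum_(k <- s) coord_field (fun x => D x ord0 k) k).
  move=> Lv; elim=> [|k s [IH1 IH2]].
    rewrite !big_nil; split; last exact: S2.1.
    rewrite L2ipC /L2ip /Rintegral integral0_eq// => x _.
    by rewrite /dot big1// => k _; rewrite mxE mul0r.
  have Lk : L2 Om (coord_field (fun x => D x ord0 k) k) := L2_coord_field k (tD k).
  by rewrite !big_cons L2ipDr// IH1; split => //; exact: subspaceD.
have gD : L2ip Om g D = L2ip Om D D.
  rewrite {1 3}(field_sum_coord D) (Es _ Lg _).1 (Es _ LD _).1.
  by apply: eq_bigr => k _; exact: E.
rewrite !L2sq_ip// lee_fin.
have := L2_cauchy_schwarz oOm Lg LD; rewrite gD expr2.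
have := L2ip_ge0 (Om := Om) D; rewrite le_eqVlt => /orP[/eqP <- _|D0].
  exact: L2ip_ge0.
by rewrite ler_pM2r.
Qed.

Lemma test_field_vfield u : test_field Om u -> test_vfield u.
Proof. by case. Qed.

Lemma subspace_test_field : subspace (test_field Om).
Proof.
have E (a : R) u v i : (fun x => (a *: u + v) x ord0 i) = fun x => a * u x ord0 i + v x ord0 i.
  by apply/funext => x; rewrite !mxE.
have E0 i : (fun x => (0 : vfield R d) x ord0 i) = fun=> 0.
  by apply/funext => x; rewrite mxE.
split.
  split=> [i|x]; first by rewrite E0; exact: test_cst0.
  by rewrite big1// => i _; rewrite E0 /pderiv derive_cst.
move=> a u v [tu du] [tv dv]; split=> [i|x]; first by rewrite E; exact: test_lin.
transitivity (a * (\sum_i pderiv i (fun y => u y ord0 i) x) + \sum_i pderiv i (fun y => v y ord0 i) x);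
  last by rewrite du dv mulr0 addr0.
rewrite mulr_sumr -big_split; apply: eq_bigr => i _; rewrite E /=.
have [su _ _] := tu i; have [sv _ _] := tv i.
by have := pderivs_lin [:: i] a su sv; move=> /(congr1 (fun f => f x)).
Qed.

Section closure_test.
Variable N : vfield R d -> \bar R.
Hypothesis qN : quadratic (L2 Om) N.
Hypothesis testN : forall u, test_vfield u -> (N u < +oo)%E.

Lemma test_closure u : test_field Om u -> closure_test Om N u.
Proof.
move=> tu; have tv := test_field_vfield tu.
split; [exact: L2_test|exact: testN|move=> e e0; exists u => //].
by rewrite (_ : _ \- _ = u - u)// subrr (quad0 qN) lte_fin.
Qed.

Lemma closure_test_adherent u : L2 Om u ->
  (forall e : R, 0 < e -> exists2 v, closure_test Om N v & (N (u - v)%R < e%:E)%E) ->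
  closure_test Om N u.
Proof.
move=> Lu h; have [v [Lv Nv _] Nuv] := h 1 ltr01.
split=> //.
  have [r Er r0] := fin_lt (quad_ge0 qN _) Nv.
  have h1 : (N v <= r%:E)%E by rewrite Er.
  have := quadD_le qN (subspaceB S2 Lu Lv) Lv (ltW Nuv) h1.
  by rewrite subrK => h2; exact: le_lt_trans h2 (ltry _).
move=> e e0; have e8 : 0 < e / 8 by rewrite divr_gt0.
have [w [Lw Nw hw] /ltW Nuw] := h _ e8; have [t tt /ltW Nwt] := hw _ e8.
exists t => //; have Lt : L2 Om t by apply/L2_test/test_field_vfield.
rewrite (_ : _ \- _ = (u - w) + (w - t)); last by rewrite addrA subrK.
apply: le_lt_trans (quadD_le qN (subspaceB S2 Lu Lw) (subspaceB S2 Lw Lt) Nuw Nwt) _.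
rewrite lte_fin; lra.
Qed.

Lemma subspace_closure_test : subspace (closure_test Om N).
Proof.
split; first by apply: test_closure; exact: subspace_test_field.1.
move=> a u v [Lu Nu hu] [Lv Nv hv].
have Lauv : L2 Om (a *: u + v) by exact: S2.2.
apply: closure_test_adherent => // e e0.
pose c := 4 * (a ^+ 2 + 1).
have c0 : 0 < c by rewrite mulr_gt0// ltr_wpDl// sqr_ge0.
have ec : 0 < e / c by rewrite divr_gt0.
have [t tt /ltW ht] := hu _ ec; have [s ts /ltW hs] := hv _ ec.
have Lt : L2 Om t by apply/L2_test/test_field_vfield.
have Ls : L2 Om s by apply/L2_test/test_field_vfield.
exists (a *: t + s); first by apply: test_closure; exact: subspace_test_field.2.
rewrite (_ : _ - _ = a *: (u - t) + (v - s)); last by rewrite scalerBr opprD addrACA.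
have Lut := subspaceB S2 Lu Lt; have Lvs := subspaceB S2 Lv Ls.
apply: le_lt_trans (quadD_le qN (subspaceZ a S2 Lut) Lvs (quadZ_le qN a Lut ht) hs) _.
rewrite lte_fin -mulrDr -{2}[e / c]mul1r -mulrDl mulrA.
rewrite -[ltRHS](divfK (lt0r_neq0 c0)) mulrC ltr_pM2l// /c ltr_pM2r ?ltr_nat//.
by rewrite ltr_wpDl// sqr_ge0.
Qed.

(** A closed subspace of a complete space. [Q] may be stronger than the norm [N] of the closure, as
    for H with the additional term on [A]. *)
Lemma complete_closure_test (Q : vfield R d -> \bar R) :
  (forall u, L2 Om u -> (N u <= Q u)%E) -> quad_complete (L2 Om) Q ->
  quad_complete (closure_test Om N) Q.
Proof.
move=> NQ cQ z Sz Qz zC.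
have Lz n : L2 Om (z n) by case: (Sz n).
have [y Ly zy] := cQ z Lz Qz zC.
exists y => //; apply: closure_test_adherent => // e e0.
have e2 : 0 < e / 2 by rewrite divr_gt0.
have [n hn] := zy _ e2; exists (z n); first exact: Sz.
rewrite (quadBC S2 qN)//.
apply: le_lt_trans (NQ _ (subspaceB S2 (Lz n) Ly)) _.
apply: le_lt_trans (hn n (leqnn n)) _; rewrite lte_fin; lra.
Qed.

End closure_test.

Lemma slobodeckij_sq_ge0 (s : R) u : (0 <= slobodeckij_sq Om s u)%E.
Proof.
apply: integral_ge0 => x _; apply: integral_ge0 => y _.
by rewrite lee_fin divr_ge0 ?dot_ge0// powR_ge0.
Qed.

Lemma weak_deriv_slobodeckij_sq_ge0 (s : R) w u :
  (0 <= weak_deriv_slobodeckij_sq Om s w u)%E.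
Proof. by apply: le_ereal_inf_tmp => _ [g _ <-]; exact: slobodeckij_sq_ge0. Qed.

Lemma truncn_ge1 (m : R) : 1 < m -> (0 < Num.truncn m)%N.
Proof. by move=> m1; rewrite truncn_ge_nat ?ltW// (lt_trans _ m1). Qed.

(** As [m > 1], the term [j = 1] of the sum is present and consists of the first derivatives; all
    other terms are nonnegative. *)
Lemma H1sq_Hmsq (m : R) u : 1 < m -> (H1sq Om u <= Hmsq Om m u)%E.
Proof.
move=> m1; rewrite /Hmsq /H1sq; set k := Num.truncn m.
have k0 : (0 < k)%N := truncn_ge1 m1.
rewrite big_ltn//; move: (L2sq Om u) => a; rewrite -!addeA; apply: leeD => //.
have -> : (\sum_(w : 1.-tuple 'I_d) weak_deriv_sq Om w u = \sum_(i < d) weak_deriv_sq Om [:: i] u)%E.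
  rewrite (reindex (fun i : 'I_d => [tuple i])) //.
  exists (fun t : 1.-tuple 'I_d => thead t) => [i _|t _]; first by [].
  by case/tupleP: t => b t; rewrite (tuple0 t); apply: val_inj.
rewrite leeDl// adde_ge0//.
  by apply: sume_ge0 => j _; apply: sume_ge0 => w _; exact: weak_deriv_sq_ge0.
case: ifP => // _; apply: sume_ge0 => w _; exact: weak_deriv_slobodeckij_sq_ge0.
Qed.

(** A test field is bounded, Lipschitz and boundedly supported. In the constant handed to the kernel
    estimate, [(C i + C i)^2] bounds the squared difference everywhere and [(d D i)^2] near the
    diagonal; the difference is nonzero only if one of the two points lies in the support. *)
Lemma test_slobodeckij_lty (s : R) u : 0 < s -> s < 1 -> test_vfield u ->
  (slobodeckij_sq Om s u < +oo)%E.
Proof.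
move=> s0 s1 tu.
have h0 i : exists C : R, forall x, `|u x ord0 i| <= C.
  by have [C [_ [hC _]]] := test_bounded (tu i); exists C.
have /choice[C hC] := h0.
have hM i : exists M : R, forall x, u x ord0 i != 0 -> forall k, `|x ord0 k| <= M.
  by have [_ [M [_ hM]]] := test_bounded (tu i); exists M.
have /choice[M HM] := hM.
have hD i : exists D : R, forall k x, `|pderiv k (fun x => u x ord0 i) x| <= D.
  have h k : exists D : R, forall x, `|pderiv k (fun x => u x ord0 i) x| <= D.
    by have [D [_ [hD _]]] := test_bounded (test_pderivs [:: k] (tu i)); exists D.
  have /choice[D HD] := h; exists (\sum_k `|D k|) => k x.
  apply: le_trans (HD k x) _; apply: le_trans (ler_norm _) _.
  by rewrite (bigD1 k)//= lerDl sumr_ge0.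
have /choice[D HD] := hD.
have uL i x y : `|u x ord0 i - u y ord0 i| <= d%:R * D i * `|x - y|.
  have [su _ _] := tu i.
  exact: (C1_lipschitz (smooth_C1 [::] su) (HD i)).
have dE x y : dot (u x - u y) (u x - u y) = \sum_i `|u x ord0 i - u y ord0 i| ^+ 2.
  by apply: eq_bigr => i _; rewrite real_normK ?num_real// !mxE expr2.
apply: (@slobodeckij_kernel_lty _ _ (fun x y => dot (u x - u y) (u x - u y)) Om s
  (\sum_i ((C i + C i) ^+ 2 + (d%:R * D i) ^+ 2)) (\sum_i `|M i|)) => //.
- by apply: sumr_ge0 => i _; rewrite addr_ge0// sqr_ge0.
- by move=> x y; exact: dot_ge0.
- move=> x y; rewrite dE; apply: ler_sum => i _.
  apply: (@le_trans _ _ ((C i + C i) ^+ 2)); last by rewrite lerDl sqr_ge0.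
  have h : `|u x ord0 i - u y ord0 i| <= C i + C i.
    by apply: le_trans (ler_normB _ _) _; exact: lerD.
  by rewrite ler_sqr ?nnegrE// (le_trans _ h).
- move=> x y _; rewrite dE mulr_suml; apply: ler_sum => i _; rewrite mulrDl.
  apply: (@le_trans _ _ ((d%:R * D i) ^+ 2 * `|x - y| ^+ 2)); last first.
    by rewrite lerDr mulr_ge0 ?sqr_ge0.
  have h := uL i x y.
  by rewrite -exprMn ler_sqr ?nnegrE// (le_trans _ h).
- move=> x y; rewrite dE => n0.
  have [i hi] : exists i, u x ord0 i - u y ord0 i != 0.
    apply: contrapT => /forallNP H; move/eqP: n0; apply.
    by rewrite big1// => i _; move/negP: (H i) => /negPn/eqP ->; rewrite normr0 expr0n.
  have Mi : M i <= \sum_i `|M i|.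
    by rewrite (bigD1 i)//=; apply: le_trans (ler_norm _) _; rewrite lerDl sumr_ge0.
  have [ux|ux] := eqVneq (u x ord0 i) 0.
    right=> k; apply: le_trans Mi; apply: HM.
    by move: hi; rewrite ux sub0r oppr_eq0.
  by left=> k; apply: le_trans Mi; exact: HM.
Qed.

Lemma test_Hmsq_lty (m : R) u : 1 < m -> test_vfield u -> (Hmsq Om m u < +oo)%E.
Proof.
move=> m1 tu; rewrite /Hmsq; set k := Num.truncn m.
apply: lte_add_pinfty.
  apply: lte_add_pinfty; first by have [] := L2_test tu.
  by apply: lte_sum_pinfty => j _; apply: lte_sum_pinfty => w _; exact: test_weak_deriv_sq_lty.
case: ifPn => // mk; apply: lte_sum_pinfty => w _.
have m0 : 0 <= m by rewrite ltW// (lt_trans _ m1).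
have /andP[km mk1] : k%:R <= m < k.+1%:R by exact: truncn_itv.
have L : L2 Om (class_deriv (rev w) u) := L2_test (test_class_deriv (rev w) tu).
apply: (@le_lt_trans _ _ (slobodeckij_sq Om (m - k%:R) (class_deriv (rev w) u))).
  apply: ereal_inf_lbound; exists (class_deriv (rev w) u) => //; split=> //.
  exact: weak_class_deriv.
apply: test_slobodeckij_lty; last exact: test_class_deriv.
  by rewrite subr_gt0 lt_neqAle eq_sym mk.
by rewrite ltrBlDl -natr1 in mk1 *.
Qed.

(** Friedrichs' inequality for each component, the mean over a cell being the scalar product with
    the indicator of the cell times a basis vector. Cells may leave [Om], since test fields and
    their derivatives vanish there. [class_deriv_le] compares the classical gradient with the
    infimum in [H1sq]. *)
Lemma friedrichs_test (A : set 'rV[R]_d) (M e : R) : measurable A -> A `<=` Om ->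
  (forall x, A x -> forall i, `|x ord0 i| <= M) -> 0 < e ->
  exists (J : finType) (F : J -> vfield R d) (c : R), [/\ 0 <= c, forall z, L2 Om (F z) &
    forall v, test_vfield v ->
    (L2sq A v <= (c * \sum_z L2ip Om v (F z) ^+ 2)%:E + e%:E * H1sq Om v)%E].
Proof.
move=> mA AO AM e0; have [J [Q [c [c0 mQ HF]]]] := friedrichs d M e0.
exists (J * 'I_d)%type, (fun z => coord_field (\1_(Q z.1)) z.2), c; split => //.
  move=> [z k] /=; have [mz fz] := mQ z.
  have E i x : coord_field (\1_(Q z)) k x ord0 i = (k == i)%:R * \1_(Q z) x.
    by rewrite !mxE eq_sym /= mulrC.
  split=> [i|].
    rewrite (_ : (fun x => _) = fun x => (k == i)%:R * \1_(Q z) x); last first.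
      by apply/funext => x; exact: E.
    apply: measurable_funM; first exact: measurable_cst.
    exact: measurable_funTS.
  apply: (@le_lt_trans _ _ (\int[mu]_(x in Om) (\1_(Q z) x)%:E)%E).
    apply: le_integral_ge0 => x _; first by rewrite lee_fin dot_ge0.
    rewrite lee_fin dot_coord_field E eqxx mul1r indicE.
    by case: (x \in Q z); rewrite ?mulr1// mulr0.
  rewrite integral_indic//; apply: le_lt_trans fz; apply: le_measure; rewrite ?inE//.
  exact: measurableI.
move=> v tv.
have m1 k : measurable_fun setT (fun x => v x ord0 k : measurableTypeR R) := measurable_test (tv k).
have m2 i k : measurable_fun setT (fun x => pderiv i (fun y => v y ord0 k) x : measurableTypeR R).
  exact: (measurable_test (test_pderivs [:: i] (tv k))).
have -> : L2sq A v = (\sum_k \int[mu]_(x in A) (v x ord0 k ^+ 2)%:E)%E.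
  rewrite -ge0_integral_sum//.
  - by apply: eq_integral => x _; rewrite /dot -sumEFin; apply: eq_bigr => k _; rewrite expr2.
  - move=> k; apply/measurable_EFinP; under eq_fun do rewrite expr2.
    by apply: measurable_funM; apply: measurable_funTS; exact: m1.
  - by move=> k x _; rewrite lee_fin sqr_ge0.
have h k : (\int[mu]_(x in A) (v x ord0 k ^+ 2)%:E <=
   (c * \sum_z L2ip Om v (coord_field (\1_(Q z)) k) ^+ 2)%:E +
   e%:E * \sum_i \int[mu]_x (pderiv i (fun y => v y ord0 k) x ^+ 2)%:E)%E.
  have [C [_ [hC _]]] := test_bounded (tv k).
  have [sv _ _] := tv k.
  have := HF A _ C AM (smooth_C1 [::] sv) hC; rewrite /=.
  suff -> : \sum_z (\int[mu]_(x in Q z) v x ord0 k)%R ^+ 2 =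
     \sum_z L2ip Om v (coord_field (\1_(Q z)) k) ^+ 2 by [].
  apply: eq_bigr => z _; congr (_ ^+ 2); rewrite L2ip_coord /Rintegral; congr fine.
  rewrite integral_mkcond [RHS]integral_mkcond; apply: eq_integral => x _.
  rewrite !patchE indicE; case: (x \in Q z); rewrite ?mulr1 ?mulr0.
    case: ifPn => // nO; have [->//|vx] := eqVneq (v x ord0 k) 0.
    by move/negP : nO; case; rewrite inE; apply: (test_Om (tv k)).
  by case: ifP.
apply: le_trans (lee_sum _ (fun k _ => h k)) _.
rewrite big_split/=; apply: leeD.
  rewrite sumEFin lee_fin -mulr_sumr exchange_big/= pair_bigA/= .
  by rewrite le_eqVlt; apply/orP; left; apply/eqP.
rewrite -ge0_sume_distrr; last first.
  by move=> k _; apply: sume_ge0 => i _; apply: integral_ge0 => x _; rewrite lee_fin sqr_ge0.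
apply: lee_wpmul2l; first by rewrite lee_fin ltW.
rewrite exchange_big/=.
apply: (@le_trans _ _ (\sum_i weak_deriv_sq Om [:: i] v)%E); last by rewrite leeDr// L2sq_ge0.
apply: lee_sum => i _; apply: le_trans (class_deriv_le i tv).
rewrite /L2sq -ge0_integral_sum//; last 2 first.
- move=> k; apply/measurable_EFinP; under eq_fun do rewrite expr2.
  by apply: measurable_funM; exact: m2.
- by move=> k x _; rewrite lee_fin sqr_ge0.
rewrite [leRHS]integral_mkcond le_eqVlt; apply/orP; left; apply/eqP.
apply: eq_integral => x _; rewrite patchE sumEFin; case: ifPn => [_|nO].
  by congr EFin; apply: eq_bigr => k _; rewrite !mxE expr2.
rewrite big1// => k _; have [->|vx] := eqVneq (pderiv i (fun y => v y ord0 k) x) 0.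
  by rewrite expr0n.
by move/negP : nO; case; rewrite inE; apply: (test_Om (test_pderivs [:: i] (tv k))).
Qed.

Lemma friedrichs_closure (A : set 'rV[R]_d) (M e : R) : measurable A -> A `<=` Om ->
  (forall x, A x -> forall i, `|x ord0 i| <= M) -> 0 < e ->
  exists (J : finType) (F : J -> vfield R d) (c : R), [/\ 0 <= c, forall z, L2 Om (F z) &
    forall v, Vsp Om v ->
    (L2sq A v <= (c * \sum_z L2ip Om v (F z) ^+ 2)%:E + e%:E * H1sq Om v)%E].
Proof.
move=> mA AO AM e0; have e4 : 0 < e / 4 by rewrite divr_gt0.
have [J [F [c [c0 LF HF]]]] := friedrichs_test mA AO AM e4.
(* The factor 4, and the choice of [e / 4] above, pay for two uses of
   [|a + b|^2 <= 2 |a|^2 + 2 |b|^2]: from [h] to the test field [v], and back. *)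
exists J, F, (4 * c); split => //; first by rewrite mulr_ge0.
move=> h [Lh Hh hh].
have [r Er r0] := fin_lt (quad_ge0 quadratic_H1sq _) Hh.
have qA := quadratic_L2 oOm AO mA.
rewrite Er -EFinM -EFinD; apply/lee_addgt0Pr => eta' eta'0.
set SF := \sum_z L2ip Om (F z) (F z).
have SF0 : 0 <= SF by apply: sumr_ge0 => z _; exact: L2ip_ge0.
(* The total coefficient of the approximation error [eta] in the final bound. *)
pose K := 2 + 4 * c * SF + e.
have K0 : 0 < K by rewrite /K; have := mulr_ge0 c0 SF0; lra.
pose eta := eta' / K.
have eta0 : 0 < eta by rewrite divr_gt0.
have [v /test_field_vfield tv /ltW hv] := hh _ eta0.
have Lv : L2 Om v := L2_test tv.
have Lhv := subspaceB S2 Lh Lv; have Lvh := subspaceB S2 Lv Lh.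
have hv' : (H1sq Om (v - h)%R <= eta%:E)%E by rewrite (quadBC S2 quadratic_H1sq).
have l1 : (L2sq Om (v - h)%R <= eta%:E)%E by apply: le_trans hv'; exact: L2sq_H1sq.
have l2 : (L2sq A (h - v)%R <= eta%:E)%E.
  rewrite (quadBC S2 qA)//; apply: le_trans l1.
  exact: (L2sqS oOm AO mA mOm (@subset_refl _ Om) Lvh.1).
have Hr : (H1sq Om h <= r%:E)%E by rewrite Er.
have l3 : (H1sq Om v <= (2 * eta + 2 * r)%:E)%E.
  by rewrite -[v](subrK h); exact: (quadD_le quadratic_H1sq).
have l4 : c * \sum_z L2ip Om v (F z) ^+ 2 <= c * (2 * \sum_z L2ip Om h (F z) ^+ 2 + 2 * eta * SF).
  apply: ler_wpM2l => //; rewrite !mulr_sumr -big_split/=; apply: ler_sum => z _.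
  have E : L2ip Om v (F z) = L2ip Om h (F z) + L2ip Om (v - h) (F z).
    by rewrite L2ipBl//; ring.
  have b : L2ip Om (v - h) (F z) ^+ 2 <= eta * L2ip Om (F z) (F z).
    apply: le_trans (L2_cauchy_schwarz oOm Lvh (LF z)) _; apply: ler_wpM2r; first exact: L2ip_ge0.
    by move: l1; rewrite L2sq_ip.
  rewrite E; have := sqr_ge0 (L2ip Om h (F z) - L2ip Om (v - h) (F z)); lra.
have l5 : (L2sq A v <= (c * (2 * \sum_z L2ip Om h (F z) ^+ 2 + 2 * eta * SF) + e / 4 * (2 * eta + 2 * r))%:E)%E.
  apply: le_trans (HF v tv) _.
  rewrite EFinD; apply: leeD; first by rewrite lee_fin.
  by apply: lee_fin_mul => //; exact: ltW.
have := quadD_le qA Lhv Lv l2 l5; rewrite subrK => l6; apply: le_trans l6 _.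
rewrite -EFinD lee_fin.
have etaK : eta * K = eta' by rewrite /eta divfK// gt_eqF.
rewrite -etaK /K; lra.
Qed.

End weak_derivatives.

Lemma cvg_ereal0P {R : realType} {T : Type} (F : set_system T) {FF : Filter F} (f : T -> \bar R) :
  (forall x, (0 <= f x)%E) ->
  f @ F --> 0%E <-> forall e : R, 0 < e -> \forall x \near F, (f x < e%:E)%E.
Proof.
move=> f0; split=> [cf e e0|h].
  have : nbhs (0%E : \bar R) [set y | (y < e%:E)%E].
    apply: open_nbhs_nbhs; split; [exact: open_ereal_lt_ereal|by rewrite /= lte_fin].
  by move/cf.
move=> A; rewrite -[0%E]/(0%:E) /nbhs/= => -[e /= e0 eA].
apply: filterS (h e e0) => x fx /=.
have [r Er r0] := fin_lt (f0 x) (lt_trans fx (ltry _)).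
rewrite Er; apply: eA; rewrite /ball_/= sub0r normrN ger0_norm//.
by rewrite -lte_fin -Er.
Qed.

Lemma L2_triangle {R : realType} {d : nat} {Om : set 'rV[R]_d} (u v : vfield R d) : open Om ->
  L2 Om u -> L2 Om v -> Num.sqrt (L2ip Om (u - v) (u - v)) <=
    Num.sqrt (L2ip Om u u) + Num.sqrt (L2ip Om v v).
Proof.
move=> oOm Lu Lv; have Luv := subspaceB (subspace_L2 oOm) Lu Lv.
rewrite -ler_sqr ?nnegrE ?addr_ge0 ?sqrtr_ge0// sqrrD !sqr_sqrtr ?L2ip_ge0//.
rewrite L2ipBl// !L2ipBr// (L2ipC v u).
have := L2ip_le oOm Lu Lv; rewrite ler_norml => /andP[t _]; lra.
Qed.

(** * Functionals on U *)

Section ae_invariance.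
Context {R : realType} {d : nat} {Om : set 'rV[R]_d}.
Hypothesis oOm : open Om.
Implicit Types (u v : vfield R d).
Let mOm : measurable Om := measurable_Om oOm.
Let S2 := subspace_L2 oOm.

Lemma ae_eq_onC u v : ae_eq_on Om u v -> ae_eq_on Om v u.
Proof. by apply: filterS => x h Ox; rewrite h. Qed.

Lemma ae_eq_onB u v u' v' : ae_eq_on Om u u' -> ae_eq_on Om v v' ->
  ae_eq_on Om (u - v) (u' - v').
Proof.
move=> h1 h2; apply: (filterS2 _ _ h1 h2) => x e1 e2 Ox.
by rewrite -[LHS]/(u x - v x) -[RHS]/(u' x - v' x) e1// e2.
Qed.

Lemma ae_eq_on_refl u : ae_eq_on Om u u.
Proof. by apply: nearW. Qed.

Lemma ae_eq_weak_deriv_sq w u v : L2 Om u -> L2 Om v -> ae_eq_on Om u v ->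
  weak_deriv_sq Om w u = weak_deriv_sq Om w v.
Proof.
move=> Lu Lv uv; rewrite /weak_deriv_sq; congr ereal_inf; apply/seteqP.
have h u' v' g : L2 Om u' -> L2 Om v' -> ae_eq_on Om u' v' -> weak_deriv Om w u' g ->
    weak_deriv Om w v' g.
  move=> Lu' Lv' uv' /weak_derivP wu; apply/weak_derivP => f tf i.
  rewrite -(wu f tf i); apply: ae_eq_L2ip => //; last exact: ae_eq_onC.
  by apply: L2_coord_field => //; exact: test_pderivs.
split=> _ [g [Lg wg] <-]; exists g => //; split => //.
  exact: h wg.
by apply: h wg => //; exact: ae_eq_onC.
Qed.

Lemma ae_eq_H1sq u v : L2 Om u -> L2 Om v -> ae_eq_on Om u v -> H1sq Om u = H1sq Om v.
Proof.
move=> Lu Lv uv; rewrite /H1sq; congr (_ + _)%E.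
  exact: (ae_eq_L2sq oOm (@subset_refl _ Om) mOm Lu.1 Lv.1 uv).
by apply: eq_bigr => i _; exact: ae_eq_weak_deriv_sq.
Qed.

Lemma ae_eq_closure_test (N : vfield R d -> \bar R) u v :
  (forall u v, L2 Om u -> L2 Om v -> ae_eq_on Om u v -> N u = N v) ->
  L2 Om v -> ae_eq_on Om u v -> closure_test Om N u -> closure_test Om N v.
Proof.
move=> aeN Lv uv [Lu Nu hu]; split => //; first by rewrite -(aeN u v).
move=> e /hu[t tt ht]; exists t => //.
have Lt : L2 Om t by apply/(L2_test oOm)/test_field_vfield.
have E (a b : vfield R d) : a \- b = a - b by [].
rewrite E (aeN (v - t) (u - t))//; try exact: (subspaceB S2).
by apply: ae_eq_onB; [exact: ae_eq_onC|exact: ae_eq_on_refl].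
Qed.

End ae_invariance.

Section U_layer.
Context {R : realType} {d : nat} {Om : set 'rV[R]_d} {m : R} {U : normedModType R}.
Variable j : U -> vfield R d.
Hypotheses (oOm : open Om) (m1 : 1 < m) (dce : dense_compact_embedding Om m j).
Implicit Types (h : vfield R d) (x y : U) (l : U -> R) (A : set 'rV[R]_d).
Let mOm : measurable Om := measurable_Om oOm.
Let S2 := subspace_L2 oOm.
Let q2 := quadratic_L2 oOm (@subset_refl _ Om) mOm.
Let qH1 := quadratic_H1sq oOm.

Lemma test_L2sq_lty u : test_vfield (Om := Om) u -> (L2sq Om u < +oo)%E.
Proof. by move=> /(L2_test oOm)[]. Qed.

Lemma subspace_Hsp : subspace (Hsp Om).
Proof. exact: (subspace_closure_test oOm q2 test_L2sq_lty). Qed.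

Lemma subspace_Vsp : subspace (Vsp Om).
Proof. by apply: (subspace_closure_test oOm qH1) => u tu; exact: test_H1sq_lty. Qed.

Lemma Hsp_L2 h : Hsp Om h -> L2 Om h. Proof. by case. Qed.

Lemma Vsp_L2 h : Vsp Om h -> L2 Om h. Proof. by case. Qed.

Lemma Vsp_Hsp h : Vsp Om h -> Hsp Om h.
Proof.
move=> [Lh Nh hh]; split=> //; first exact: le_lt_trans (L2sq_H1sq oOm _) Nh.
by move=> e /hh[v tv hv]; exists v => //; exact: le_lt_trans (L2sq_H1sq oOm _) hv.
Qed.

Lemma Vmsp_Vsp h : Vmsp Om m h -> Vsp Om h.
Proof.
move=> [Lh Nh hh]; split=> //; first exact: le_lt_trans (H1sq_Hmsq oOm _ m1) Nh.
by move=> e /hh[v tv hv]; exists v => //; exact: le_lt_trans (H1sq_Hmsq oOm _ m1) hv.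
Qed.

Lemma j_Vsp x : Vsp Om (j x).
Proof. by have [jV _ _ _] := dce; exact: Vmsp_Vsp. Qed.

Lemma j_L2 x : L2 Om (j x). Proof. exact: Vsp_L2 (j_Vsp x). Qed.

Lemma j_Hsp x : Hsp Om (j x). Proof. exact: Vsp_Hsp (j_Vsp x). Qed.

Lemma j_lin (a : R) x y : ae_eq_on Om (j (a *: x + y)) (a *: j x + j y).
Proof. by have [_ [jl _] _ _] := dce; exact: jl. Qed.

Lemma test_Vmsp v : test_field Om v -> Vmsp Om m v.
Proof.
move=> tv; have tvf := test_field_vfield tv.
split; [exact: L2_test|exact: test_Hmsq_lty|move=> e e0; exists v => //].
rewrite (_ : v \- v = 0); last by apply/funext => x; rewrite /= subrr.
have [-> ] : Hmsq Om m (0 : vfield R d) = 0%E /\ True; last by rewrite lte_fin.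
split=> //; rewrite /Hmsq (quad0 q2) add0e big1 ?add0e; last first.
  by move=> i _; apply: big1 => w _; rewrite (quad0 (quadratic_weak_deriv_sq oOm w)).
case: ifP => // _; apply: big1 => w _; apply/eqP; rewrite eq_le.
rewrite weak_deriv_slobodeckij_sq_ge0 andbT; apply: ereal_inf_lbound.
exists 0; first by split; [exact: S2.1|exact: weak_deriv0].
rewrite /slobodeckij_sq integral0_eq// => x _; rewrite integral0_eq// => y _.
by rewrite /dot big1 ?mul0r// => i _; rewrite !mxE subrr mul0r.
Qed.

(** The density of [U] in V_m passes to V through the test fields, which belong to both and are
    dense in V. *)
Lemma j_dense_V h (e : R) : Vsp Om h -> 0 < e -> exists x, (H1sq Om (h - j x)%R < e%:E)%E.
Proof.
move=> [Lh _ hh] e0; have e4 : 0 < e / 8 by rewrite divr_gt0.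
have [v tv /ltW hv] := hh _ e4.
have [_ _ dj _] := dce; have [x /ltW hx] := dj _ (test_Vmsp tv) _ e4.
have Lv : L2 Om v by apply/(L2_test oOm)/test_field_vfield.
exists x; rewrite (_ : h - j x = (h - v) + (v - j x)); last by rewrite addrA subrK.
have hx' := le_trans (H1sq_Hmsq oOm _ m1) hx.
apply: le_lt_trans (quadD_le qH1 (subspaceB S2 Lh Lv) (subspaceB S2 Lv (j_L2 x)) hv hx') _.
rewrite lte_fin; lra.
Qed.

Lemma j_dense_H h (e : R) : Hsp Om h -> 0 < e -> exists x, (L2sq Om (h - j x)%R < e%:E)%E.
Proof.
move=> [Lh _ hh] e0; have e4 : 0 < e / 8 by rewrite divr_gt0.
have [v tv /ltW hv] := hh _ e4.
have [_ _ dj _] := dce; have [x /ltW hx] := dj _ (test_Vmsp tv) _ e4.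
have Lv : L2 Om v by apply/(L2_test oOm)/test_field_vfield.
exists x; rewrite (_ : h - j x = (h - v) + (v - j x)); last by rewrite addrA subrK.
have hx' := le_trans (L2sq_H1sq oOm _) (le_trans (H1sq_Hmsq oOm _ m1) hx).
apply: le_lt_trans (quadD_le q2 (subspaceB S2 Lh Lv) (subspaceB S2 Lv (j_L2 x)) hv hx') _.
rewrite lte_fin; lra.
Qed.

(** Otherwise a greedy choice, each point avoiding the list [G n] of its predecessors, gives a
    bounded sequence whose pairwise squared distances are at least [e], against compactness of the
    embedding. *)
Lemma j_totally_bounded (M e : R) : 0 < e -> exists s : seq U, forall x, `|x| <= M ->
  exists2 y, y \in s & (H1sq Om (j x - j y)%R < e%:E)%E.
Proof.
move=> e0; apply: contrapT => /forallNP H.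
have /choice[f fP] : forall s : seq U, exists x, `|x| <= M /\ forall y, y \in s -> (e%:E <= H1sq Om (j x - j y)%R)%E.
  move=> s; have /existsNP[x /not_implyP[xM hx]] := H s; exists x; split => // y ys.
  by rewrite leNgt; apply/negP => hy; apply: hx; exists y.
pose G := fix G n := if n is n'.+1 then f (G n') :: G n' else [::].
pose x n := f (G n).
have xG (k n : nat) : (k < n)%N -> x k \in G n.
  elim: n => // n IH; rewrite ltnS leq_eqVlt => /orP[/eqP ->|/IH kn].
    by rewrite /= inE eqxx.
  by rewrite /= inE kn orbT.
have xM n : `|x n| <= M by have [] := fP (G n).
have [_ _ _ comp] := dce.
have [|s [u [sS Vu cvg]]] := comp x; first by exists M.
have Lu : L2 Om u by case: Vu.
have e8 : 0 < e / 8 by rewrite divr_gt0.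
have Hm0 n : (0 <= Hmsq Om m (j (x (s n)) \- u)%R)%E.
  exact: le_trans (quad_ge0 qH1 _) (H1sq_Hmsq oOm _ m1).
have [N _ HN] := (cvg_ereal0P Hm0).1 cvg _ e8.
have h1 n : (N <= n)%N -> (H1sq Om (j (x (s n)) - u)%R <= (e / 8)%:E)%E.
  by move=> Nn; apply: le_trans (H1sq_Hmsq oOm _ m1) (ltW (HN n Nn)).
have := quadB_le S2 qH1 (subspaceB S2 (j_L2 _) Lu) (subspaceB S2 (j_L2 _) Lu)
  (h1 N.+1 (leqnSn N)) (h1 N (leqnn N)).
rewrite opprB addrA subrK => h2.
have [_ /(_ (x (s N)) (xG _ _ (sS N)))] := fP (G (s N.+1)).
rewrite -/(x (s N.+1)) => h3; have := le_trans h3 h2; rewrite lee_fin; lra.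
Qed.

(** Moves the centres of the net into the ball, by replacing each useful one with a point of the
    ball near it. *)
Lemma j_net_bound (M e : R) : 0 < e -> exists s : seq U, (forall y, y \in s -> `|y| <= M) /\
  forall x, `|x| <= M -> exists2 y, y \in s & (H1sq Om (j x - j y)%R < e%:E)%E.
Proof.
move=> e0; have e8 : 0 < e / 8 by rewrite divr_gt0.
have [s hs] := j_totally_bounded M e8.
have /choice[f fP] : forall y : U, exists z, (`|z| <= M /\ (H1sq Om (j z - j y)%R < (e / 8)%:E)%E) \/
    forall z, `|z| <= M -> ~ (H1sq Om (j z - j y)%R < (e / 8)%:E)%E.
  move=> y; have [[z zP]|/forallNP H] := pselect (exists z, `|z| <= M /\ (H1sq Om (j z - j y)%R < (e / 8)%:E)%E).
    by exists z; left.
  by exists 0; right => z zM hz; exact: (H z).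
have fM y x : y \in s -> `|x| <= M -> (H1sq Om (j x - j y)%R < (e / 8)%:E)%E ->
    `|f y| <= M /\ (H1sq Om (j (f y) - j y)%R < (e / 8)%:E)%E.
  by move=> ys xM hx; have [//|H] := fP y; case: (H x).
exists [seq f y | y <- s & `|f y| <= M]; split=> [_ /mapP[y + ->]|x xM].
  by rewrite mem_filter => /andP[].
have [y ys hy] := hs x xM; have [fyM hf] := fM y x ys xM hy.
exists (f y); first by apply/mapP; exists y => //; rewrite mem_filter fyM.
have := quadB_le S2 qH1 (subspaceB S2 (j_L2 _) (j_L2 _)) (subspaceB S2 (j_L2 _) (j_L2 _))
  (ltW hy) (ltW hf).
rewrite opprB addrA subrK => h; apply: le_lt_trans h _; rewrite lte_fin; lra.
Qed.

(** A totally bounded image is bounded. This is how the continuity of [j] is obtained from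
    [dense_compact_embedding], which speaks of sequences only. *)
Lemma j_bounded : exists2 B : R, 0 <= B & forall x, `|x| <= 1 -> (L2sq Om (j x) <= B%:E)%E.
Proof.
have [s hs] := j_totally_bounded 1 (@ltr01 R).
pose B := \sum_(y <- s) 2 * (1 + L2ip Om (j y) (j y)).
have p y : 0 <= 2 * (1 + L2ip Om (j y) (j y)) by rewrite mulr_ge0// addr_ge0// L2ip_ge0.
exists B; first by apply: sumr_ge0 => y _.
move=> x x1; have [y ys hy] := hs x x1.
have h1 : (L2sq Om (j x - j y)%R <= 1%:E)%E by apply: le_trans (L2sq_H1sq oOm _) (ltW hy).
have h2 : (L2sq Om (j y) <= (L2ip Om (j y) (j y))%:E)%E by rewrite L2sq_ip//; exact: j_L2.
have := quadD_le q2 (subspaceB S2 (j_L2 x) (j_L2 y)) (j_L2 y) h1 h2.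
rewrite subrK => h; apply: le_trans h _; rewrite lee_fin -mulrDr /B.
by rewrite (big_rem y)//= lerDl sumr_ge0.
Qed.

Lemma emb_lin (a : R) h k : L2 Om h -> L2 Om k -> emb Om j (a *: h + k) = a *: emb Om j h + emb Om j k.
Proof.
by move=> Lh Lk; apply/funext => x; rewrite /emb L2ipDZl//; exact: j_L2.
Qed.

Lemma emb_sub h k : L2 Om h -> L2 Om k -> emb Om j (h - k) = emb Om j h - emb Om j k.
Proof. by move=> Lh Lk; rewrite addrC -scaleN1r emb_lin// scaleN1r addrC. Qed.

Lemma emb0 : emb Om j 0 = 0.
Proof. by have := emb_sub S2.1 S2.1; rewrite !subrr. Qed.

Lemma emb_linear h (a : R) x y : L2 Om h ->
  emb Om j h (a *: x + y) = a * emb Om j h x + emb Om j h y.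
Proof.
move=> Lh; have Lx := j_L2 x; have Ly := j_L2 y.
have La : L2 Om (a *: j x + j y) by exact: S2.2.
rewrite /emb L2ipC (ae_eq_L2ip oOm (j_L2 _) La Lh (j_lin a x y)) L2ipDZl//.
by rewrite !(L2ipC h).
Qed.

(** [h - k] is orthogonal to the range of [j], which is dense in H. *)
Lemma emb_inj h k : Hsp Om h -> Hsp Om k -> emb Om j h = emb Om j k -> ae_eq_on Om h k.
Proof.
move=> Hh Hk hk; have Lh := Hsp_L2 Hh; have Lk := Hsp_L2 Hk.
have Hhk := subspaceB subspace_Hsp Hh Hk; have Lhk := Hsp_L2 Hhk.
have o x : L2ip Om (h - k) (j x) = 0.
  by have := congr1 (fun f => f x) (emb_sub Lh Lk); rewrite hk subrr.
suff z : L2ip Om (h - k) (h - k) = 0.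
  have := L2sq_eq0 oOm Lhk.1 (_ : L2sq Om (h - k) = 0%E); rewrite L2sq_ip// z => /(_ erefl).
  apply: filterS => x hx Ox; apply/eqP; rewrite -subr_eq0; apply/eqP; exact: hx.
apply/eqP; rewrite eq_le L2ip_ge0 andbT; apply/ler_addgt0Pr => e e0; rewrite add0r.
set a := L2ip Om (h - k) (h - k).
have a0 : 0 <= a := L2ip_ge0 _.
have c0 : 0 < e ^+ 2 / (a + 1) by rewrite divr_gt0 ?exprn_gt0// ltr_wpDl.
have [x hx] := j_dense_H Hhk c0.
have Lx := j_L2 x.
have E : a = L2ip Om (h - k) (h - k - j x) by rewrite L2ipBr// o subr0.
have Lr := subspaceB S2 Lhk Lx.
have := L2_cauchy_schwarz oOm Lhk Lr; rewrite -E -/a.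
move: hx; rewrite L2sq_ip// lte_fin.
set b := L2ip Om _ _ => bc h1.
have : a ^+ 2 <= e ^+ 2.
  apply: le_trans h1 _; apply: (@le_trans _ _ (a * (e ^+ 2 / (a + 1)))).
    by apply: ler_wpM2l => //; exact: ltW.
  rewrite mulrA ler_pdivrMr ?ltr_wpDl// mulrC ler_wpM2l ?sqr_ge0//; lra.
by rewrite ler_sqr// nnegrE ltW.
Qed.

Lemma rep_emb h : Hsp Om h -> ae_eq_on Om (rep Om j (emb Om j h)) h.
Proof.
move=> Hh; rewrite /rep; case: xgetP => [k _ [Hk hk]|/(_ h)[]//].
exact: emb_inj.
Qed.

Lemma repP l : in_H Om j l -> Hsp Om (rep Om j l) /\ emb Om j (rep Om j l) = l.
Proof.
by move=> [h Hh ->]; rewrite /rep; case: xgetP => [k _ [Hk ->]|/(_ h)[]].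
Qed.

Lemma dual_norm_le (l : U -> R) (c : R) : (forall x, `|x| <= 1 -> `|l x| <= c) -> (dual_norm l <= c%:E)%E.
Proof. by move=> h; apply: ge_ereal_sup => _ [x /= x1 <-]; rewrite lee_fin; exact: h. Qed.

Lemma dual_norm_ge (l : U -> R) x : `|x| <= 1 -> (`|l x|%:E <= dual_norm l)%E.
Proof. by move=> x1; apply: ereal_sup_ubound; exists x. Qed.

Lemma dual_norm_ge0 (l : U -> R) : (0 <= dual_norm l)%E.
Proof. by apply: le_trans (dual_norm_ge l (_ : `|0| <= 1)); rewrite ?lee_fin// normr0. Qed.

Lemma dual_norm_bound (l : U -> R) (c : R) x : (forall (a : R) x y, l (a *: x + y) = a * l x + l y) ->
  (dual_norm l <= c%:E)%E -> `|l x| <= c * `|x|.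
Proof.
move=> ll lc; have l0 : l 0 = 0 by have := ll 1 0 0; rewrite scale1r addr0 mul1r => /eqP; rewrite -subr_eq0 opprD addNKr oppr_eq0 => /eqP.
have [->|x0] := eqVneq x 0; first by rewrite l0 !normr0 mulr0.
have nx : 0 < `|x| by rewrite normr_gt0.
have h1 : `|(`|x|^-1 *: x)| <= 1 by rewrite normrZ normfV normr_id mulVf// gt_eqF.
have := le_trans (dual_norm_ge l h1) lc; rewrite lee_fin.
have := ll `|x|^-1 x 0; rewrite !addr0 l0 addr0 => ->.
by rewrite normrM normfV normr_id mulrC ler_pdivrMr.
Qed.

Lemma emb_dual h : L2 Om h -> dual (emb Om j h).
Proof.
move=> Lh; split; first by move=> a x y; exact: emb_linear.
have [B B0 HB] := j_bounded.
apply: (@le_lt_trans _ _ (Num.sqrt (L2ip Om h h * B))%:E); last exact: ltry.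
apply: dual_norm_le => x x1; apply: (L2ip_bound oOm Lh (j_L2 x) _ (HB _ x1)).
by rewrite L2sq_ip.
Qed.

Lemma dual_norm_finite (C e : R) : 0 < e -> exists s : seq U, (forall y, y \in s -> `|y| <= 1) /\
  forall h, L2 Om h -> (L2sq Om h <= C%:E)%E -> forall b : R,
  (forall y, y \in s -> `|emb Om j h y| <= b) -> (dual_norm (emb Om j h) <= (b + e)%:E)%E.
Proof.
move=> e0; pose C' := `|C| + 1.
have C'0 : 0 < C' by rewrite ltr_wpDl.
(* Replacing [x] by its net point costs at most [sqrt (C' * (e^2 / C')) = e] by Cauchy-Schwarz. *)
have e1 : 0 < e ^+ 2 / C' by rewrite divr_gt0// exprn_gt0.
have [s [s1 hs]] := j_net_bound 1 e1; exists s; split=> // h Lh hC b hb.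
apply: dual_norm_le => x x1; have [y ys hy] := hs x x1.
have Lxy := subspaceB S2 (j_L2 x) (j_L2 y).
have -> : emb Om j h x = L2ip Om h (j x - j y) + emb Om j h y.
  by rewrite L2ipBr//; [rewrite subrK|exact: j_L2|exact: j_L2].
apply: le_trans (ler_normD _ _) _; rewrite addrC; apply: lerD; first exact: hb.
have hC' : (L2sq Om h <= C'%:E)%E.
  by apply: le_trans hC _; rewrite lee_fin /C'; have := ler_norm C; lra.
have := L2ip_bound oOm Lh Lxy hC' (le_trans (L2sq_H1sq oOm _) (ltW hy)).
rewrite [C' * _]mulrC divfK; last by rewrite gt_eqF.
by rewrite sqrtr_sqr (ger0_norm (ltW e0)).
Qed.

(** * Norms transported to functionals on [U] *)

Section fiber.
Variables (S : set (vfield R d)) (N : vfield R d -> \bar R).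

Definition fiber_sq : (U -> R) -> \bar R := quad_inf S N (fun h l => emb Om j h = l).

Hypotheses (sS : subspace S) (SH : S `<=` Hsp Om) (qN : quadratic S N).
Hypothesis aeN : forall u v, S u -> S v -> ae_eq_on Om u v -> N u = N v.

Lemma quadratic_fiber : quadratic setT fiber_sq.
Proof.
apply: (quadratic_inf sS qN) => //; first exact: emb0.
move=> a h h' l l' /SH/Hsp_L2 Lh /SH/Hsp_L2 Lh' _ _ <- <-; exact: emb_lin.
Qed.

Lemma fiber_emb h : S h -> fiber_sq (emb Om j h) = N h.
Proof.
move=> Sh; apply/eqP; rewrite eq_le; apply/andP; split.
  by apply: ereal_inf_lbound; exists h.
apply: le_ereal_inf_tmp => _ [k [Sk kh] <-]; rewrite (aeN Sh Sk)//.
by apply: emb_inj; [exact: SH|exact: SH|].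
Qed.

Lemma fiber_lty l : (fiber_sq l < +oo)%E -> exists2 h, S h & l = emb Om j h.
Proof. by move=> /quad_inf_lt[h [Sh hl _]]; exists h. Qed.

Hypothesis cN : quad_complete S N.
Hypothesis LN : forall u, S u -> (L2sq Om u <= N u)%E.

(** Near-minimal representatives of the [l k] have convex combinations [w n] converging to some [y]
    by [quad_weak_limit]. The functionals of the [w n] still tend to [l0] pointwise, since [w n]
    combines only indices at least [n]; hence [y] represents [l0]. *)
Lemma fiber_closed (l : nat -> U -> R) (l0 : U -> R) (r : R) :
  (forall k, (fiber_sq (l k) <= r%:E)%E) ->
  (forall x e, 0 < e -> exists K : nat, forall k, (K <= k)%N -> `|l k x - l0 x| <= e) ->
  (fiber_sq l0 <= r%:E)%E.
Proof.
move=> lr ll0.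
have /choice[z zP] : forall k, exists h, [/\ S h, emb Om j h = l k & (N h < (r + k.+1%:R^-1)%:E)%E].
  move=> k; apply: (quad_inf_lt (L := fun h l => emb Om j h = l)).
  apply: le_lt_trans (lr k) _.
  by rewrite lte_fin ltrDl invr_gt0.
have Sz k : S (z k) by have [] := zP k.
have Nz k : (N (z k) <= (r + k.+1%:R^-1)%:E)%E by have [_ _ /ltW] := zP k.
have [y [w [Sy Ny hw wy]]] := quad_weak_limit sS qN cN Sz Nz.
have Ly := Hsp_L2 (SH Sy).
have Sw k : S (w k).
  apply: (hull_ind_pred (P := S) _ _ (hw k)) => // a b Sa Sb.
  by apply: subspaceZ => //; exact: subspaceD.
have <- : emb Om j y = l0; last by apply: le_trans Ny; apply: ereal_inf_lbound; exists y.
apply/funext => x; apply/eqP; rewrite -subr_eq0 -normr_le0; apply/ler_addgt0Pr => e e0; rewrite add0r.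
have e2 : 0 < e / 2 by rewrite divr_gt0.
have [K HK] := ll0 x _ e2.
pose c := L2ip Om (j x) (j x) + 1.
have c0 : 0 < c by rewrite ltr_wpDl// L2ip_ge0.
have e1 : 0 < (e / 2) ^+ 2 / c by rewrite divr_gt0// exprn_gt0.
have [M HM] := wy _ e1.
pose n := maxn K M.
have Lw := Hsp_L2 (SH (Sw n)).
have h1 : `|emb Om j (w n) x - l0 x| <= e / 2.
  (* The set of fields whose functional is within [e / 2] of [l0] at [x] is convex, so it contains
     [w n] along with the tail. *)
  have P0 : S (w n) /\ `|emb Om j (w n) x - l0 x| <= e / 2; last by case: P0.
  apply: (hull_ind_pred (P := fun a => S a /\ `|emb Om j a x - l0 x| <= e / 2) _ _ (hw n)).
    move=> k nk; split => //; have [_ -> _] := zP k.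
    by apply: HK; exact: leq_trans (leq_maxl _ _) nk.
  move=> a b [Sa ha] [Sb hb]; have La := Hsp_L2 (SH Sa); have Lb := Hsp_L2 (SH Sb).
  split; first by apply: subspaceZ => //; exact: subspaceD.
  have -> : emb Om j (2^-1 *: (a + b)) x = 2^-1 * (emb Om j a x + emb Om j b x).
    by rewrite /emb L2ipZl ?L2ipDl//; [exact: j_L2|exact: subspaceD|exact: j_L2].
  rewrite (_ : _ - _ = 2^-1 * ((emb Om j a x - l0 x) + (emb Om j b x - l0 x))); last by field.
  rewrite normrM ger0_norm ?invr_ge0//; have := ler_normD (emb Om j a x - l0 x) (emb Om j b x - l0 x).
  lra.
have Lwy := subspaceB S2 Lw Ly.
have h2 : `|emb Om j (w n) x - emb Om j y x| <= e / 2.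
  rewrite /emb -L2ipBl//; last exact: j_L2.
  have b1 : (L2sq Om (w n - y)%R <= ((e / 2) ^+ 2 / c)%:E)%E.
    apply: le_trans (LN (subspaceB sS (Sw n) Sy)) _; apply: HM; exact: leq_maxr.
  have b2 : (L2sq Om (j x) <= c%:E)%E.
    by rewrite L2sq_ip ?lee_fin ?lerDl//; exact: j_L2.
  apply: le_trans (L2ip_bound oOm Lwy (j_L2 x) b1 b2) _.
  rewrite divfK; last by rewrite gt_eqF.
  by rewrite sqrtr_sqr (ger0_norm (ltW e2)).
rewrite (_ : _ - _ = (emb Om j (w n) x - l0 x) - (emb Om j (w n) x - emb Om j y x)); last by ring.
by apply: le_trans (ler_normB _ _) _; rewrite (splitr e); exact: lerD.
Qed.

End fiber.

(* Squared norms of H, V and L^2(A) as functions on U', equal to +oo off the image of [emb]. [QA A]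
   need not have closed sublevels for the pointwise convergence; [QHA A] has. *)
Definition QH := fiber_sq (Hsp Om) (L2sq Om).
Definition QV := fiber_sq (Vsp Om) (H1sq Om).
Definition QA A := fiber_sq (Hsp Om) (L2sq A).
Definition QHA A := fiber_sq (Hsp Om) (fun u => L2sq Om u + L2sq A u)%E.

Let qL2 A : A `<=` Om -> measurable A -> quadratic (Hsp Om) (L2sq A).
Proof. by move=> AO mA; apply: quadratic_sub (quadratic_L2 oOm AO mA) => u /Hsp_L2. Qed.

Let aeL2 A : A `<=` Om -> measurable A ->
  forall u v, Hsp Om u -> Hsp Om v -> ae_eq_on Om u v -> L2sq A u = L2sq A v.
Proof. by move=> AO mA u v /Hsp_L2[mu _] /Hsp_L2[mv _]; exact: ae_eq_L2sq. Qed.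

Let aeH1 u v : Vsp Om u -> Vsp Om v -> ae_eq_on Om u v -> H1sq Om u = H1sq Om v.
Proof. by move=> /Vsp_L2 Lu /Vsp_L2 Lv; exact: ae_eq_H1sq. Qed.

Let OmOm := @subset_refl _ Om.

Lemma quadratic_QH : quadratic setT QH.
Proof. exact: (quadratic_fiber subspace_Hsp (@subset_refl _ _) (qL2 OmOm mOm)). Qed.

Lemma quadratic_QA A : A `<=` Om -> measurable A -> quadratic setT (QA A).
Proof. by move=> AO mA; exact: (quadratic_fiber subspace_Hsp (@subset_refl _ _) (qL2 AO mA)). Qed.

Lemma quadratic_QHA A : A `<=` Om -> measurable A -> quadratic setT (QHA A).
Proof.
move=> AO mA; apply: (quadratic_fiber subspace_Hsp (@subset_refl _ _)).
by apply: quadraticD; exact: qL2.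
Qed.

Lemma quadratic_QV : quadratic setT QV.
Proof.
apply: (quadratic_fiber subspace_Vsp) => [u /Vsp_Hsp//|].
by apply: quadratic_sub qH1 => u /Vsp_L2.
Qed.

Lemma QH_emb h : Hsp Om h -> QH (emb Om j h) = L2sq Om h.
Proof. by apply: (fiber_emb (@subset_refl _ _)) => *; exact: (aeL2 OmOm mOm). Qed.

Lemma QA_emb A h : A `<=` Om -> measurable A -> Hsp Om h -> QA A (emb Om j h) = L2sq A h.
Proof. by move=> AO mA; apply: (fiber_emb (@subset_refl _ _)) => *; exact: aeL2. Qed.

Lemma QHA_emb A h : A `<=` Om -> measurable A -> Hsp Om h ->
  QHA A (emb Om j h) = (L2sq Om h + L2sq A h)%E.
Proof.
move=> AO mA; apply: (fiber_emb (@subset_refl _ _)) => u v Hu Hv uv.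
by rewrite (aeL2 OmOm mOm Hu Hv uv) (aeL2 AO mA Hu Hv uv).
Qed.

Lemma QV_emb h : Vsp Om h -> QV (emb Om j h) = H1sq Om h.
Proof. by apply: fiber_emb => [u /Vsp_Hsp|*]//; exact: aeH1. Qed.

Lemma QH_in_H l : (QH l < +oo)%E <-> in_H Om j l.
Proof.
split; first exact: fiber_lty.
by move=> [h Hh ->]; rewrite QH_emb//; case: Hh.
Qed.

Lemma QV_in_V l : (QV l < +oo)%E -> exists2 h, Vsp Om h & l = emb Om j h.
Proof. exact: fiber_lty. Qed.

Lemma QH_closed (l : nat -> U -> R) (l0 : U -> R) (r : R) :
  (forall k, (QH (l k) <= r%:E)%E) ->
  (forall x e, 0 < e -> exists K : nat, forall k, (K <= k)%N -> `|l k x - l0 x| <= e) ->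
  (QH l0 <= r%:E)%E.
Proof.
apply: (fiber_closed subspace_Hsp (@subset_refl _ _) (qL2 OmOm mOm)) => //.
apply: (complete_closure_test oOm q2) => // z Lz Qz zC.
have [|||y Ly zy] := L2_complete oOm OmOm mOm (z := fun n => z n.+1).
- by move=> n; exact: Lz.
- by move=> n; have [_ h] := Lz n.+1; exact: lte_add_pinfty.
- move=> n; have h := zC n.+1.
  apply: le_trans (leeD h h) _; rewrite -EFinD lee_fin exprS.
  have : 0 <= (8^-1 : R) ^+ n by rewrite exprn_ge0.
  lra.
exists y => // e /zy[N HN]; exists N.+1 => -[//|n] Nn.
by apply: le_trans (HN n Nn); rewrite leeDl//; exact: L2sq_ge0.
Qed.

Lemma QHA_closed A (l : nat -> U -> R) (l0 : U -> R) (r : R) : A `<=` Om -> measurable A ->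
  (forall k, (QHA A (l k) <= r%:E)%E) ->
  (forall x e, 0 < e -> exists K : nat, forall k, (K <= k)%N -> `|l k x - l0 x| <= e) ->
  (QHA A l0 <= r%:E)%E.
Proof.
move=> AO mA.
have le u : (L2sq Om u <= L2sq Om u + L2sq A u)%E by rewrite leeDl//; exact: L2sq_ge0.
apply: (fiber_closed subspace_Hsp (@subset_refl _ _)) => [| |u _].
- by apply: quadraticD; exact: qL2.
- exact: (complete_closure_test oOm q2 (fun u _ => le u) (L2_complete oOm AO mA)).
- exact: le.
Qed.

Lemma QV_closed (l : nat -> U -> R) (l0 : U -> R) (r : R) :
  (forall k, (QV (l k) <= r%:E)%E) ->
  (forall x e, 0 < e -> exists K : nat, forall k, (K <= k)%N -> `|l k x - l0 x| <= e) ->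
  (QV l0 <= r%:E)%E.
Proof.
apply: (fiber_closed subspace_Vsp) => [u /Vsp_Hsp//| | |u _]; last exact: L2sq_H1sq.
  by apply: quadratic_sub qH1 => u /Vsp_L2.
exact: (complete_closure_test oOm qH1 (fun u _ => lexx _) (H1_complete oOm)).
Qed.

(** [rep] picks a representative in H only. It agrees almost everywhere with the one in V, and both
    membership in V and [H1sq] are invariant under such changes. *)
Lemma rep_Vsp l : (QV l < +oo)%E -> Vsp Om (rep Om j l) /\ H1sq Om (rep Om j l) = QV l.
Proof.
move=> /QV_in_V[h Vh ->]; have Hh := Vsp_Hsp Vh.
have [Hr _] := repP (ex_intro2 _ _ h Hh erefl : in_H Om j (emb Om j h)).
have ae := ae_eq_onC (rep_emb Hh); have Lr := Hsp_L2 Hr.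
have Vr : Vsp Om (rep Om j (emb Om j h)).
  by apply: (ae_eq_closure_test oOm _ Lr ae Vh) => *; exact: ae_eq_H1sq.
split => //; rewrite QV_emb//; apply: ae_eq_H1sq => //; first exact: Vsp_L2.
exact: ae_eq_onC.
Qed.

Lemma Vnorm_rep_le l : (Vnorm Om (rep Om j l) <= QV l `^ 2^-1)%E.
Proof.
have [/rep_Vsp[_ E]|] := boolP (QV l < +oo)%E; first by rewrite /Vnorm E.
by rewrite -leNgt leye_eq => /eqP ->; rewrite poweRyr ?leey// invr_eq0 pnatr_eq0.
Qed.

Lemma L2norm_rep A l : A `<=` Om -> measurable A -> in_H Om j l ->
  L2norm A (rep Om j l) = (QA A l `^ 2^-1)%E.
Proof.
move=> AO mA Hl; have [Hr E] := repP Hl.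
by rewrite /L2norm -{2}E QA_emb.
Qed.

Lemma Hnorm_rep l : in_H Om j l -> Hnorm Om (rep Om j l) = (QH l `^ 2^-1)%E.
Proof. by move=> Hl; have [Hr E] := repP Hl; rewrite /Hnorm /L2norm -{2}E QH_emb. Qed.

(* A near-minimiser of |F - j x| is almost the projection of F on the closure of the range of j. *)
Lemma near_projection F (kap : R) : L2 Om F -> 0 < kap -> exists x0, forall h, Hsp Om h ->
  L2ip Om h F ^+ 2 <= 2 * kap * L2ip Om h h + 2 * emb Om j h x0 ^+ 2.
Proof.
move=> LF kap0.
pose E x := L2ip Om (F - j x) (F - j x).
have hE : has_inf (range E).
  by split; [exists (E 0), 0|exists 0 => _ [x _ <-]; exact: L2ip_ge0].
have [_ [x0 _ <-] hx0] := inf_adherent kap0 hE.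
have min x : E x0 <= E x + kap.
  by apply: le_trans (ltW hx0) _; rewrite lerD2r; apply: ge_inf; [case: hE|exists x].
pose G := F - j x0; have LG : L2 Om G := subspaceB S2 LF (j_L2 x0).
have GE : G = F - j x0 by [].
have EG : E x0 = L2ip Om G G by [].
clearbody G.
have jb x : L2ip Om G (j x) ^+ 2 <= kap * L2ip Om (j x) (j x).
  have Lx := j_L2 x.
  (* Comparing [x0] with the competitor [s *: x + x0] gives a quadratic inequality in [s], up to the
     defect [kap] of minimality. The choice [s = <G, j x> / |j x|^2] yields the bound. *)
  have key s : 2 * s * L2ip Om G (j x) <= s ^+ 2 * L2ip Om (j x) (j x) + kap.
    have Lsx : L2 Om (s *: j x) by exact: (subspaceZ s S2).
    have := min (s *: x + x0).
    have ae : ae_eq_on Om (F - j (s *: x + x0)) (G - s *: j x).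
      rewrite (_ : G - s *: j x = F - (s *: j x + j x0)); last by rewrite GE opprD addrA addrAC.
      by apply: ae_eq_onB; [exact: ae_eq_on_refl|exact: j_lin].
    have L1 := subspaceB S2 LF (j_L2 (s *: x + x0)).
    have L2' := subspaceB S2 LG Lsx.
    have -> : E (s *: x + x0) = L2ip Om (G - s *: j x) (G - s *: j x).
      by rewrite /E (ae_eq_L2ip oOm L1 L2' L1 ae) L2ipC (ae_eq_L2ip oOm L1 L2' L2' ae).
    rewrite EG L2ipBl// !L2ipBr// !L2ipZl// !L2ipZr// (L2ipC (j x) G).
    lra.
  have b0 : 0 <= L2ip Om (j x) (j x) := L2ip_ge0 _.
  have [b_0|bn0] := eqVneq (L2ip Om (j x) (j x)) 0.
    have := L2_cauchy_schwarz oOm LG Lx; rewrite b_0 !mulr0; exact.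
  have bp : 0 < L2ip Om (j x) (j x) by rewrite lt_neqAle eq_sym bn0.
  have := key (L2ip Om G (j x) / L2ip Om (j x) (j x)).
  set a := L2ip Om G (j x); set b := L2ip Om (j x) (j x) in bp *.
  rewrite (_ : 2 * (a / b) * a = 2 * a ^+ 2 / b); last by field; rewrite gt_eqF.
  rewrite (_ : (a / b) ^+ 2 * b = a ^+ 2 / b); last by field; rewrite gt_eqF.
  move=> h; have : a ^+ 2 / b <= kap by lra.
  by rewrite ler_pdivrMr.
exists x0 => h Hh; have Lh := Hsp_L2 Hh.
(* Since [F = G + j x0], the inequality [(a + b)^2 <= 2 a^2 + 2 b^2] reduces the claim to [G]. The
   bound on the range of [j] then extends to H by density. *)
suff Gh : L2ip Om h G ^+ 2 <= kap * L2ip Om h h.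
  have -> : L2ip Om h F = L2ip Om h G + emb Om j h x0.
    by rewrite GE L2ipBr//; [rewrite subrK|exact: j_L2].
  have := sqr_ge0 (L2ip Om h G - emb Om j h x0); lra.
rewrite L2ipC; set a := L2ip Om G h; set b := L2ip Om h h.
have b0 : 0 <= b := L2ip_ge0 _.
rewrite -(ger0_norm (sqr_ge0 a)) normrX -(sqr_sqrtr (mulr_ge0 (ltW kap0) b0)).
rewrite ler_sqr ?nnegrE ?sqrtr_ge0//; apply/ler_addgt0Pr => e e0.
pose c := Num.sqrt kap + Num.sqrt (L2ip Om G G) + 1.
have c0 : 0 < c by rewrite ltr_wpDl// addr_ge0// sqrtr_ge0.
have e1 : 0 < (e / c) ^+ 2 by rewrite exprn_gt0// divr_gt0.
have [x hx] := j_dense_H Hh e1.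
have Lx := j_L2 x; have Lr := subspaceB S2 Lh Lx.
have rn : Num.sqrt (L2ip Om (h - j x) (h - j x)) <= e / c.
  move: hx; rewrite L2sq_ip// lte_fin => /ltW h2.
  by rewrite -(ger0_norm (ltW (divr_gt0 e0 c0))) -sqrtr_sqr ler_wsqrtr.
have -> : a = L2ip Om G (j x) + L2ip Om G (h - j x) by rewrite L2ipBr// addrCA subrr addr0.
have t1 : `|L2ip Om G (j x)| <= Num.sqrt kap * Num.sqrt (L2ip Om (j x) (j x)).
  by rewrite -sqrtrM ?(ltW kap0)// -sqrtr_sqr ler_wsqrtr.
have t2 := L2ip_le oOm LG Lr.
have t3 : Num.sqrt (L2ip Om (j x) (j x)) <= Num.sqrt b + Num.sqrt (L2ip Om (h - j x) (h - j x)).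
  have := L2_triangle oOm Lh Lr; rewrite (_ : h - (h - j x) = j x)//.
  by rewrite opprB addrC subrK.
apply: le_trans (ler_normD _ _) _.
set sk := Num.sqrt kap in t1 c c0 e1 rn hx *; set n := Num.sqrt _ in rn t2 t3 *.
rewrite sqrtrM ?(ltW kap0)// -/sk.
have sk0 : 0 <= sk := sqrtr_ge0 _.
have t4 := ler_wpM2l sk0 t3.
have t5 : (sk + Num.sqrt (L2ip Om G G)) * n <= e.
  apply: (@le_trans _ _ (c * (e / c))); last by rewrite mulrC divfK// gt_eqF.
  have p : 0 <= sk + Num.sqrt (L2ip Om G G) := addr_ge0 sk0 (sqrtr_ge0 _).
  have n0 : 0 <= n := sqrtr_ge0 _.
  have q : sk + Num.sqrt (L2ip Om G G) <= c by rewrite /c lerDl ler01.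
  exact: (ler_pM p n0 q rn).
move: t4 t5; rewrite mulrDr mulrDl; lra.
Qed.

(* Lions' (Ehrling's) inequality, with U' as the weak space. *)
Lemma QA_lions A (M e : R) : measurable A -> A `<=` Om ->
  (forall x : 'rV[R]_d, A x -> forall i, `|x ord0 i| <= M) -> 0 < e ->
  exists2 C : R, 0 <= C & forall l (r D : R), (QV l <= r%:E)%E -> (dual_norm l <= D%:E)%E ->
    (QA A l <= (e * r + C * D ^+ 2)%:E)%E.
Proof.
move=> mA AO AM e0; have e2 : 0 < e / 2 by rewrite divr_gt0.
have [J [F [c [c0 LF HF]]]] := friedrichs_closure oOm mA AO AM e2.
(* The test fields [F z] need not come from [U], and replacing each by an element [x0 z] of [U]
   costs [2 (e/2/K) r]. After summation over [J] and multiplication by [c] the cost is at most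
   [e/2 * r]. *)
pose K := 2 * c * #|J|%:R + 1.
have K0 : 0 < K by rewrite ltr_wpDl// mulr_ge0// mulr_ge0.
have kap0 : 0 < e / 2 / K by rewrite divr_gt0.
have /choice[x0 Hx0] : forall z, exists x0, forall h, Hsp Om h ->
  L2ip Om h (F z) ^+ 2 <= 2 * (e / 2 / K) * L2ip Om h h + 2 * emb Om j h x0 ^+ 2.
  by move=> z; exact: near_projection.
pose C := c * \sum_z 2 * `|x0 z| ^+ 2.
exists C; first by rewrite mulr_ge0// sumr_ge0// => z _; rewrite mulr_ge0// sqr_ge0.
move=> l r D Ql Dl.
have [h Vh El] : exists2 h, Vsp Om h & l = emb Om j h by apply: QV_in_V; exact: le_lt_trans Ql (ltry _).
have Hh := Vsp_Hsp Vh; have Lh := Hsp_L2 Hh.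
move: Ql Dl; rewrite El QV_emb// QA_emb// => Ql Dl.
apply: le_trans (HF h Vh) _.
have nr : L2ip Om h h <= r by rewrite -lee_fin -L2sq_ip//; exact: le_trans (L2sq_H1sq oOm _) Ql.
have r0 : 0 <= r by apply: le_trans nr; exact: L2ip_ge0.
have D0 : 0 <= D by rewrite -lee_fin; apply: le_trans Dl; exact: dual_norm_ge0.
have h1 : c * (\sum_z L2ip Om h (F z) ^+ 2) <= c * (\sum_z (2 * (e / 2 / K) * r + 2 * `|x0 z| ^+ 2 * D ^+ 2)).
  apply: ler_wpM2l => //; apply: ler_sum => z _; apply: le_trans (Hx0 z h Hh) _.
  apply: lerD; first by apply: ler_wpM2l => //; rewrite mulr_ge0// ltW.
  have b : `|emb Om j h (x0 z)| <= D * `|x0 z|.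
    by apply: dual_norm_bound => // a x y; exact: emb_linear.
  rewrite -mulrA ler_wpM2l// -exprMn -real_normK ?num_real//.
  by rewrite ler_sqr ?nnegrE ?mulr_ge0// mulrC.
have h2 : c * (\sum_z (2 * (e / 2 / K) * r + 2 * `|x0 z| ^+ 2 * D ^+ 2)) <= e / 2 * r + C * D ^+ 2.
  rewrite big_split/= sumr_const mulrDr; apply: lerD; last by rewrite /C -mulrA mulr_suml.
  rewrite (_ : c * _ = (2 * c * #|J|%:R / K) * (e / 2 * r)); last first.
    by rewrite -mulr_natr; field; rewrite gt_eqF.
  rewrite ler_piMl//; first by rewrite mulr_ge0// ltW.
  by rewrite ler_pdivrMr// mul1r /K lerDl.
rewrite (_ : e * r + C * D ^+ 2 = (e / 2 * r + C * D ^+ 2) + e / 2 * r); last by field.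
rewrite EFinD; apply: leeD; first by rewrite lee_fin; exact: le_trans h2.
by apply: lee_fin_mul => //; exact: ltW.
Qed.

Lemma ipH_approx h (e : R) : Hsp Om h -> 0 < e -> exists x, forall l (C : R), in_H Om j l ->
  (QH l <= C%:E)%E -> `|ipH Om j l h - l x| <= Num.sqrt (C * e).
Proof.
move=> Hh e0; have [x hx] := j_dense_H Hh e0; exists x => l C Hl.
have [Hr E] := repP Hl; rewrite -{1}E QH_emb// => QC.
have Lr := Hsp_L2 Hr; have Lh := Hsp_L2 Hh; have Lx := j_L2 x.
have lx : l x = L2ip Om (rep Om j l) (j x) by rewrite -{1}E.
rewrite /ipH lx -L2ipBr//.
exact: (L2ip_bound oOm Lr (subspaceB S2 Lh Lx) QC (ltW hx)).
Qed.

(** The nets of the balls of integer radius [M] at precision [1/(p+1)] are finite, and all their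
    points are enumerated by decoding triples. One sequence serves V and H, since the H^1 norm
    dominates. *)
Lemma j_separable : exists D : nat -> U,
  (forall h, Vsp Om h -> forall e : R, 0 < e -> exists k, (H1sq Om (h - j (D k))%R < e%:E)%E) /\
  (forall h, Hsp Om h -> forall e : R, 0 < e -> exists k, (L2sq Om (h - j (D k))%R < e%:E)%E).
Proof.
have p0 (p : nat) : (0 : R) < p.+1%:R^-1 by rewrite invr_gt0.
have /choice[N HN] : forall Mp : nat * nat, exists s : seq U, forall x, `|x| <= Mp.1%:R ->
    exists2 y, y \in s & (H1sq Om (j x - j y)%R < (Mp.2.+1%:R^-1)%:E)%E.
  by move=> [M p]; exact: j_totally_bounded.
pose D k : U := if unpickle k is Some (M, p, i) then nth 0 (N (M, p)) i else 0.
exists D.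
have net x e : 0 < e -> exists k, (H1sq Om (j x - j (D k))%R <= e%:E)%E.
  move=> e0; have [p hp] := exists_natSinv_lt e0.
  pose M := (Num.truncn `|x|).+1.
  have xM : `|x| <= M%:R by rewrite ltW// truncnS_gt.
  have [y ys hy] := HN (M, p) x xM.
  exists (pickle ((M, p), index y (N (M, p)))); rewrite /D pickleK nth_index//.
  by apply: le_trans (ltW hy) _; rewrite lee_fin ltW.
split=> h Sh e e0; have e8 : 0 < e / 8 by rewrite divr_gt0.
- have [x /ltW hx] := j_dense_V Sh e8; have [k hk] := net x _ e8; exists k.
  have -> : h - j (D k) = (h - j x) + (j x - j (D k)) by rewrite addrA subrK.
  apply: le_lt_trans (quadD_le qH1 (subspaceB S2 (Vsp_L2 Sh) (j_L2 x))
    (subspaceB S2 (j_L2 x) (j_L2 _)) hx hk) _; rewrite lte_fin; lra.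
- have [x /ltW hx] := j_dense_H Sh e8; have [k hk] := net x _ e8; exists k.
  have -> : h - j (D k) = (h - j x) + (j x - j (D k)) by rewrite addrA subrK.
  apply: le_lt_trans (quadD_le q2 (subspaceB S2 (Hsp_L2 Sh) (j_L2 x))
    (subspaceB S2 (j_L2 x) (j_L2 _)) hx (le_trans (L2sq_H1sq oOm _) hk)) _; rewrite lte_fin; lra.
Qed.

End U_layer.

(** * Cadlag paths and changes of time *)

Section right_open.
Context {R : realType}.

(** Such a set differs from its interior by a countable set. A non-interior point [t] is labelled by
    a rational in []t, t + e[]; two of them [t < t'] cannot share a label, because [t'] would lie in
    []t, t + e[] and so be interior. *)
Lemma right_open_measurable (E : set (measurableTypeR R)) :
  (forall t : R, E t -> exists2 e : R, 0 < e & forall s : R, t <= s < t + e -> E s) ->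
  measurable E.
Proof.
move=> roE; pose Eo : set R := interior (E : set R).
have oEo : open Eo by exact: open_interior.
have mEo : measurable (Eo : set (measurableTypeR R)) by exact: open_measurable.
pose D (q : rat) : set R := [set t | [/\ E t, ~ Eo t & exists2 e : R, t < ratr q < t + e &
  forall s : R, t <= s < t + e -> E s]].
have D1 q (t t' : R) : D q t -> D q t' -> t < t' -> False.
  move=> [_ _ [e /andP[tq qe] he]] [_ nt' [e' /andP[t'q _] _]] tt'; apply: nt'.
  have : nbhs t' `]t, t + e[%classic.
    apply: open_nbhs_nbhs; split; first exact: interval_open.
    by rewrite /= in_itv/= tt' (lt_trans t'q).
  apply: filterS => s; rewrite /= in_itv/= => /andP[ts se]; apply: he.
  by rewrite (ltW ts).
have mD q : measurable (D q : set (measurableTypeR R)).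
  have [[t Dt]|D0] := pselect (D q !=set0); last first.
    rewrite (_ : D q = set0)//; apply/seteqP; split=> // t Dt; exfalso; apply: D0; by exists t.
  rewrite (_ : D q = [set t]); first exact: measurable_set1.
  apply/seteqP; split=> [s Ds|s ->//]; have [ts|st|//] := ltgtP s t.
    by exfalso; exact: (D1 q s t).
  by exfalso; exact: (D1 q t s).
rewrite (_ : E = Eo `|` \bigcup_q D q).
  apply: measurableU => //; apply: countable_bigcupT_measurable => //; exact: countableP.
apply/seteqP; split=> [t Et|t []]; last first.
- by move=> [q _ []].
- exact: interior_subset.
have [?|nt] := pselect (Eo t); [by left|right].
have [e e0 he] := roE t Et.
have [q] : exists q : rat, ratr q \in `]t, t + e[ by apply: rat_in_itvoo; rewrite ltrDl.
by rewrite in_itv/= => tq; exists q => //; split => //; exists e.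
Qed.

Lemma right_continuous_measurable (f : R -> \bar R) :
  (forall (t : R) (r : R), (r%:E < f t)%E -> exists2 e : R, 0 < e &
     forall s, t <= s < t + e -> (r%:E < f s)%E) ->
  (forall t, 0%E <= f t)%E -> measurable_fun setT (f : measurableTypeR R -> \bar R).
Proof.
move=> rof f0; apply: (measurability _ (@ErealGenOInfty.measurableE R)).
move=> _ [_ [r ->] <-]; rewrite setTI; apply: right_open_measurable => t /=.
rewrite in_itv/= andbT => /rof[e e0 he]; exists e => // s /he.
by rewrite /= in_itv/= andbT.
Qed.

End right_open.

Section time_changes.
Context {R : realType} {T : R}.
Hypothesis T0 : 0 < T.

Let zT : 0 <= T := ltW T0.

(** An increasing surjection between intervals is continuous, so continuity is never checked
    separately for a composition or a piecewise construction. *)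
Lemma time_changeP (lam : R -> R) :
  (forall t, 0 <= t <= T -> 0 <= lam t <= T) ->
  (forall y, 0 <= y <= T -> exists2 t, 0 <= t <= T & lam t = y) ->
  (forall s t, 0 <= s <= T -> 0 <= t <= T -> s < t -> lam s < lam t) ->
  time_change T lam.
Proof.
move=> lT lsurj linc.
have linc' : {in `[0, T]%R &, {homo lam : s t / s < t}}.
  by move=> s t; rewrite !in_itv/=; exact: linc.
have mono : {in `[0, T]%R &, increasing_fun lam} by exact: (le_mono_in linc').
have l0 : lam 0 = 0.
  have h0 : 0 <= (0 : R) <= T by rewrite lexx zT.
  have [s /andP[s0 sT] ls] := lsurj 0 h0.
  move: s0; rewrite le_eqVlt => /orP[/eqP s_0|s0]; first by rewrite {1}s_0.
  have := linc 0 s h0 _ s0; rewrite (ltW s0) sT ls => /(_ isT).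
  by have /andP[h _] := lT 0 h0; rewrite ltNge h.
have lTT : lam T = T.
  have hT : 0 <= T <= T by rewrite lexx zT.
  have [s /andP[s0 sT] ls] := lsurj T hT.
  move: sT; rewrite le_eqVlt => /orP[/eqP s_T|sT]; first by rewrite -{1}s_T.
  have := linc s T _ hT sT; rewrite s0 (ltW sT) ls => /(_ isT).
  by have /andP[_ h] := lT T hT; rewrite ltNge h.
have surj : set_surj `[0, T] `[0, T] lam.
  by move=> y /=; rewrite in_itv/= => /lsurj[t tT <-]; exists t => //=; rewrite in_itv.
split => //.
- split; [|by move=> s t; rewrite !inE => sT tT; exact: (inc_inj_in mono)|exact: surj].
  by move=> t /=; rewrite !in_itv/=; exact: lT.
- by apply: segment_inc_surj_continuous => //; rewrite l0 lTT.
Qed.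

Lemma time_change_range (lam : R -> R) t : time_change T lam -> 0 <= t <= T -> 0 <= lam t <= T.
Proof.
by move=> [[lT _ _] _ _] tT; have := lT t; rewrite /= !in_itv/=; exact.
Qed.

Lemma time_change_surj (lam : R -> R) y : time_change T lam -> 0 <= y <= T ->
  exists2 t, 0 <= t <= T & lam t = y.
Proof.
move=> [[_ _ ls] _ _] yT; have [|t /= tT <-] := ls y; first by rewrite /= in_itv.
by exists t => //; rewrite in_itv/= in tT.
Qed.

Lemma time_change_lt (lam : R -> R) s t : time_change T lam -> 0 <= s <= T -> 0 <= t <= T ->
  (lam s < lam t) = (s < t).
Proof.
move=> [_ linc _] sT tT.
have h a b : 0 <= a <= T -> 0 <= b <= T -> a < b -> lam a < lam b.
  by move=> aT bT; apply: linc; rewrite in_itv.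
have [st|ts|->] := ltgtP s t; last by rewrite ltxx.
  by rewrite h.
by apply/negbTE; rewrite -leNgt ltW// h.
Qed.

Lemma time_change_le (lam : R -> R) s t : time_change T lam -> 0 <= s <= T -> 0 <= t <= T ->
  (lam s <= lam t) = (s <= t).
Proof. by move=> tc sT tT; rewrite !leNgt (time_change_lt tc). Qed.

Lemma time_change0 lam : time_change T lam -> lam 0 = 0.
Proof.
move=> tc; have h0 : 0 <= (0 : R) <= T by rewrite lexx zT.
have [s sT ls] := time_change_surj tc h0.
apply/eqP; rewrite eq_le (proj1 (andP (time_change_range tc h0))) andbT -{2}ls.
by rewrite (time_change_le tc)//; case/andP: sT.
Qed.

Lemma time_changeT lam : time_change T lam -> lam T = T.
Proof.
move=> tc; have hT : 0 <= T <= T by rewrite lexx zT.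
have [s sT ls] := time_change_surj tc hT.
apply/eqP; rewrite eq_le (proj2 (andP (time_change_range tc hT))) /= -{1}ls.
by rewrite (time_change_le tc)//; case/andP: sT.
Qed.

Lemma time_change_id : time_change T id.
Proof. by apply: time_changeP => // y yT; exists y. Qed.

Lemma time_change_comp lam mu : time_change T lam -> time_change T mu -> time_change T (mu \o lam).
Proof.
move=> tl tm; apply: time_changeP => [t tT|y yT|s t sT tT st] /=.
- by do 2!apply: time_change_range => //.
- have [s sT <-] := time_change_surj tm yT; have [t tT <-] := time_change_surj tl sT.
  by exists t.
- by rewrite (time_change_lt tm) ?(time_change_lt tl)//; exact: time_change_range.
Qed.

Definition strict_subdivision (n : nat) (a : nat -> R) :=
  [/\ a 0%N = 0, a n = T & forall i, (i < n)%N -> a i < a i.+1].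

Lemma subdivision_strict dl n a : subdivision T dl n a -> strict_subdivision n a.
Proof. by move=> [a0 an h]; split=> // i /h[]. Qed.

Lemma subdivision_le n a (i k : nat) : strict_subdivision n a -> (i <= k <= n)%N -> a i <= a k.
Proof.
move=> [_ _ h] /andP[ik kn]; elim: k ik kn => [|k IH]; first by rewrite leqn0 => /eqP ->.
rewrite leq_eqVlt => /orP[/eqP ->//|ik] kn.
by apply: le_trans (IH ik (ltnW kn)) _; rewrite ltW// h.
Qed.

Lemma subdivision_lt n a (i k : nat) : strict_subdivision n a -> (i < k <= n)%N -> a i < a k.
Proof.
move=> sa /andP[ik kn]; have [_ _ h] := sa; apply: (lt_le_trans (h i (leq_trans ik kn))).
by apply: (subdivision_le sa); rewrite ik kn.
Qed.

Lemma subdivision_range n a i : strict_subdivision n a -> (i <= n)%N -> 0 <= a i <= T.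
Proof.
move=> sa ni; have [a0 an _] := sa; rewrite -{1}a0 -an.
by rewrite !(subdivision_le sa)// ?leqnn ?leq0n ?ni.
Qed.

Lemma subdivision_locate n a t : strict_subdivision n a -> 0 <= t < T ->
  exists2 i, (i < n)%N & a i <= t < a i.+1.
Proof.
move=> [a0 an h] /andP[t0 tT].
have : t < a n by rewrite an.
elim: n {an h} => [|n IH]; first by rewrite a0 ltNge t0.
have [tn _|nt tn] := ltP t (a n).
  by have [i ni hi] := IH tn; exists i => //; exact: ltn_trans ni _.
by exists n => //; rewrite nt.
Qed.

Lemma subdivision_locateT n a t : strict_subdivision n a -> 0 <= t <= T ->
  exists2 i, (i < n)%N & a i <= t <= a i.+1.
Proof.
move=> sa /andP[t0]; rewrite le_eqVlt => /orP[/eqP ->|tT]; last first.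
  have [|i ni /andP[h1 h2]] := subdivision_locate sa (_ : 0 <= t < T); first by rewrite t0.
  by exists i => //; rewrite h1 ltW.
have [a0 an h] := sa; case: n sa an h => [|n] sa an h.
  by move: T0; rewrite -an a0 ltxx.
by exists n => //; rewrite -an lexx andbT ltW// h.
Qed.

(** Affine interpolation from [a] to [b]. On each cell the displacement [lam t - t] is a convex
    combination of the displacements of the two end points. *)
Lemma piecewise_time_change n a b (eta : R) : strict_subdivision n a -> strict_subdivision n b ->
  (forall i, (i <= n)%N -> `|b i - a i| <= eta) ->
  exists lam, [/\ time_change T lam, forall t, 0 <= t <= T -> `|lam t - t| <= eta &
    forall i t, (i < n)%N -> a i <= t < a i.+1 -> b i <= lam t < b i.+1].
Proof.
move=> sa sb ab.
pose c i := (b i.+1 - b i) / (a i.+1 - a i).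
pose f i t := b i + c i * (t - a i).
have da i : (i < n)%N -> 0 < a i.+1 - a i by move=> ni; rewrite subr_gt0; case: sa => _ _; exact.
have db i : (i < n)%N -> 0 < b i.+1 - b i by move=> ni; rewrite subr_gt0; case: sb => _ _; exact.
have c0 i : (i < n)%N -> 0 < c i by move=> ni; rewrite divr_gt0 ?da ?db.
have fa i : f i (a i) = b i by rewrite /f subrr mulr0 addr0.
have fb i : (i < n)%N -> f i (a i.+1) = b i.+1.
  by move=> ni; rewrite /f /c divfK ?gt_eqF ?da// addrC subrK.
have flt i s t : (i < n)%N -> (f i s < f i t) = (s < t).
  by move=> ni; rewrite /f ltrD2l ltr_pM2l ?c0// ltrD2r.
have fle i s t : (i < n)%N -> (f i s <= f i t) = (s <= t).
  by move=> ni; rewrite !leNgt flt.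
have lea i k : (i <= k)%N -> (k <= n)%N -> a i <= a k.
  by move=> ik kn; apply: (subdivision_le sa); rewrite ik.
have leb i k : (i <= k)%N -> (k <= n)%N -> b i <= b k.
  by move=> ik kn; apply: (subdivision_le sb); rewrite ik.
have lta i k : (i < k)%N -> (k <= n)%N -> a i < a k.
  by move=> ik kn; apply: (subdivision_lt sa); rewrite ik.
(* Two affine pieces agree wherever their closed cells meet, so the value of [lam] does not depend
   on the cell chosen for a partition point. *)
have agree i k t : (i < n)%N -> (k < n)%N -> a i <= t <= a i.+1 -> a k <= t <= a k.+1 -> f i t = f k t.
  have wl (p r : nat) : (p < r)%N -> (p < n)%N -> (r < n)%N -> a p <= t <= a p.+1 ->
      a r <= t <= a r.+1 -> f p t = f r t.
    move=> ik ni nk /andP[_ t1] /andP[t2 _].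
    have E : p.+1 = r.
      apply/eqP; rewrite eqn_leq ik leqNgt; apply/negP => ik'.
      by have := lt_le_trans (lta _ _ ik' (ltnW nk)) t2; rewrite ltNge t1.
    have -> : t = a p.+1 by apply/eqP; rewrite eq_le t1 E t2.
    by rewrite fb// E fa.
  by move=> ni nk hi hk; have [ik|ki|->//] := ltngtP i k; [exact: wl|apply/esym; exact: wl].
have /choice[lam lamP] : forall t, exists y, 0 <= t <= T ->
    exists2 i, (i < n)%N & a i <= t <= a i.+1 /\ y = f i t.
  move=> t; have [tT|ntT] := boolP (0 <= t <= T); last by exists 0.
  by have [i ni hi] := subdivision_locateT sa tT; exists (f i t) => _; exists i.
have lamE i t : (i < n)%N -> a i <= t <= a i.+1 -> lam t = f i t.
  move=> ni /andP[h1 h2].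
  have /lamP[k nk [hk ->]] : 0 <= t <= T.
    have /andP[p _] := subdivision_range sa (ltnW ni).
    have /andP[_ q] := subdivision_range sa ni.
    by rewrite (le_trans p)// (le_trans h2).
  by apply: agree => //; rewrite h1.
have [a0 an _] := sa; have [b0 bn _] := sb.
exists lam; split.
- apply: time_changeP => [t /lamP[i ni [/andP[h1 h2] ->]]|y yT|s t].
  + have /andP[p _] := subdivision_range sb (ltnW ni).
    have /andP[_ q] := subdivision_range sb ni.
    rewrite (le_trans p) ?(le_trans _ q)//; first by rewrite -fb// fle.
    by rewrite -(fa i) fle.
  + have [i ni /andP[h1 h2]] := subdivision_locateT sb yT.
    pose t := a i + (y - b i) / c i.
    have ft : f i t = y.
      by rewrite /f /t addrAC subrr add0r mulrC divfK ?gt_eqF ?c0// addrC subrK.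
    have ht : a i <= t <= a i.+1 by apply/andP; split;
      [rewrite -(fle i (a i) t ni) fa ft|rewrite -(fle i t (a i.+1) ni) ft fb].
    exists t; last by rewrite (lamE i).
    have /andP[p _] := subdivision_range sa (ltnW ni).
    have /andP[_ q] := subdivision_range sa ni.
    by case/andP: ht => ht1 ht2; rewrite (le_trans p)// (le_trans ht2).
  + move=> /lamP[i ni [hi ->]] /lamP[k nk [hk ->]] st.
    have [ik|ki|<-] := ltngtP i k; last by rewrite flt.
      case/andP: hi => h1 h2; case/andP: hk => h3 h4.
      have p1 : f i s <= b i.+1 by rewrite -fb// fle.
      have p2 : b k <= f k t by rewrite -(fa k) fle.
      have [ik'|ki'] := ltnP i.+1 k.
        apply: (le_lt_trans p1); apply: lt_le_trans p2.
        by apply: (subdivision_lt sb); rewrite ik' ltnW.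
      have E : i.+1 = k by apply/eqP; rewrite eqn_leq ik ki'.
      have [sa'|sa'] := ltP s (a i.+1).
        apply: (@lt_le_trans _ _ (b i.+1)); first by rewrite -fb// flt.
        by rewrite E.
      apply: (le_lt_trans p1); rewrite E -(fa k) flt//.
      by rewrite -E; exact: le_lt_trans st.
    exfalso; case/andP: hi => h1 h2; case/andP: hk => h3 h4.
    have := lea _ _ ki (ltnW ni).
    by move=> q; have := le_lt_trans (le_trans q h1) st; rewrite ltNge h4.
- move=> t /lamP[i ni [/andP[h1 h2] ->]].
  (* The weight [w] is the relative position of [t] in its cell. *)
  have -> : f i t - t = (1 - (t - a i) / (a i.+1 - a i)) * (b i - a i) +
      (t - a i) / (a i.+1 - a i) * (b i.+1 - a i.+1).
    by rewrite /f /c; field; rewrite gt_eqF ?da.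
  set w := (t - a i) / _.
  have w0 : 0 <= w by apply: divr_ge0; [rewrite subr_ge0|exact: ltW (da i ni)].
  have w1 : w <= 1 by rewrite ler_pdivrMr ?da// mul1r lerD2r.
  clearbody w; apply: le_trans (ler_normD _ _) _; rewrite !normrM (ger0_norm w0) ger0_norm ?subr_ge0//.
  rewrite (_ : eta = (1 - w) * eta + w * eta); last by ring.
  by apply: lerD; apply: ler_wpM2l; rewrite ?subr_ge0//; apply: ab => //; exact: ltnW.
- move=> i t ni /andP[h1 h2]; rewrite (lamE i)//; last by rewrite h1 ltW.
  by rewrite -{1}(fa i) fle// h1 -fb// flt.
Qed.

End time_changes.

Section skorokhod_close.
Context {R : realType} {T : R} {E : zmodType}.
Variable N : E -> \bar R.
Hypothesis T0 : 0 < T.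
Hypothesis N0 : forall x, (0 <= N x)%E.
Hypothesis ND : forall x y, (N (x + y)%R <= N x + N y)%E.
Implicit Types u v w : R -> E.

(** A bound on the Skorokhod distance witnessed by one time change. In this form radii add under
    composition of time changes. *)
Definition skorokhod_within u v (r : R) := exists2 lam, time_change T lam &
  forall t, 0 <= t <= T -> `|lam t - t| <= r /\ (N (u t - v (lam t))%R <= r%:E)%E.

Lemma skorokhod_close u v (r : R) : (skorokhod_dist T N u v < r%:E)%E ->
  exists2 r', r' < r & skorokhod_within u v r'.
Proof.
move=> /ereal_inf_lt[_ [lam tl <-] hs]; set M := ereal_sup _ in hs.
have M0 : (0 <= M)%E.
  apply: (@le_trans _ _ (maxe `|lam 0 - 0|%:E (N (u 0 - v (lam 0))))).
    by rewrite le_max lee_fin normr_ge0.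
  by apply: ereal_sup_ubound; exists 0 => //=; rewrite in_itv/= lexx ltW.
have [s Es s0] := fin_lt M0 (lt_trans hs (ltry r)).
exists s; first by rewrite -lte_fin -Es.
exists lam => // t tT.
have : (maxe `|lam t - t|%:E (N (u t - v (lam t))) <= s%:E)%E.
  by rewrite -Es; apply: ereal_sup_ubound; exists t => //=; rewrite in_itv.
by rewrite ge_max lee_fin => /andP[].
Qed.

Lemma close_skorokhod u v (r : R) : skorokhod_within u v r -> (skorokhod_dist T N u v <= r%:E)%E.
Proof.
move=> [lam tl h]; apply: (@le_trans _ _ (ereal_sup [set maxe `|lam t - t|%:E (N (u t - v (lam t)))
                           | t in `[0, T]])).
  by apply: ereal_inf_lbound; exists lam.
apply: ge_ereal_sup => _ [t /= + <-]; rewrite in_itv/= => /h[h1 h2].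
by rewrite ge_max lee_fin h1.
Qed.

Lemma close_le u v (r r' : R) : r <= r' -> skorokhod_within u v r -> skorokhod_within u v r'.
Proof.
move=> rr [lam tl h]; exists lam => // t /h[h1 h2]; split; first exact: le_trans rr.
by apply: le_trans h2 _; rewrite lee_fin.
Qed.

Lemma close_trans u v w (r s : R) : skorokhod_within u v r -> skorokhod_within v w s -> skorokhod_within u w (r + s).
Proof.
move=> [lam tl hl] [mu tm hm]; exists (mu \o lam); first exact: time_change_comp.
move=> t tT; have [l1 l2] := hl t tT.
have [m1 m2] := hm (lam t) (time_change_range tl tT); split => /=.
  rewrite (_ : _ - _ = (lam t - t) + (mu (lam t) - lam t)); last by ring.
  by apply: le_trans (ler_normD _ _) _; exact: lerD.
rewrite (_ : _ - _ = (u t - v (lam t)) + (v (lam t) - w (mu (lam t)))); last by rewrite addrA subrK.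
by apply: le_trans (ND _ _) _; rewrite EFinD; exact: leeD.
Qed.

(** The sub-base of the Skorokhod topology consists of balls around all centres. By the triangle
    inequality, a ball contains every path close enough to one of its points. *)
Lemma ball_close c u (r : R) : (skorokhod_dist T N c u < r%:E)%E ->
  exists2 e, 0 < e & forall v, skorokhod_within u v e -> (skorokhod_dist T N c v < r%:E)%E.
Proof.
move=> /skorokhod_close[r' r'r cu]; exists ((r - r') / 2); first by rewrite divr_gt0 ?subr_gt0.
move=> v uv; apply: le_lt_trans (close_skorokhod (close_trans cu uv)) _.
rewrite lte_fin; lra.
Qed.

End skorokhod_close.

(** * Uniform convexity of L^q *)

Section uniform_convexity.
Context {R : realType}.
Implicit Types x y q : R.

(** The strict Young inequality for the product of [x] and 1. It comes from [1 + t < exp t] at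
    [t = (q - 1) ln x] and at [t = - ln x]: with weights [1/q] and [1 - 1/q], the terms in [ln x]
    cancel. *)
Lemma powR_bernoulli x q : 0 <= x -> 1 < q -> x != 1 -> x < x `^ q / q + (1 - q^-1).
Proof.
move=> x0 q1 x1; have q0 : 0 < q := lt_trans ltr01 q1.
move: x0; rewrite le_eqVlt => /orP[/eqP <-|x0].
  by rewrite powR0 ?gt_eqF// mul0r add0r subr_gt0 invf_lt1.
have L0 : ln x != 0 by rewrite ln_eq0.
have xE : x `^ q = expR (q * ln x) by rewrite /powR gt_eqF.
have Ex : x = expR (ln x) by rewrite lnK.
set L := ln x in L0 xE Ex *.
have h1 : expR L * (1 + (q - 1) * L) < x `^ q.
  rewrite xE (_ : q * L = L + (q - 1) * L); last by ring.
  by rewrite expRD ltr_pM2l ?expR_gt0// expR_gt1Dx// mulf_neq0// subr_eq0 gt_eqF.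
have h2 : expR L * (1 - L) < 1.
  rewrite -[ltRHS](expRxMexpNx_1 L) ltr_pM2l ?expR_gt0//.
  by have := expR_gt1Dx (_ : - L != 0); rewrite oppr_eq0; exact.
rewrite {1}Ex.
have qi : 0 < q^-1 by rewrite invr_gt0.
have qi1 : q^-1 < 1 by rewrite invf_lt1.
have e : expR L = expR L * (1 + (q - 1) * L) / q + expR L * (1 - L) * (1 - q^-1).
  by field; rewrite gt_eqF.
rewrite {1}e; apply: ltrD; first by rewrite ltr_pM2r.
by rewrite gtr_pMl// subr_gt0.
Qed.

(** Young's inequality at [1 / M] and [x / M], where [M] is the midpoint. These two numbers add up
    to 2, and neither of them is 1. *)
Lemma powR_strict_convex x q : 0 <= x < 1 -> 1 < q -> ((1 + x) / 2) `^ q < (1 + x `^ q) / 2.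
Proof.
move=> /andP[x0 x1] q1; have q0 : 0 < q := lt_trans ltr01 q1.
set M := (1 + x) / 2; have M0 : 0 < M by rewrite /M; lra.
have Mq : 0 < M `^ q by rewrite powR_gt0.
have i0 : 0 <= 1 / M by rewrite divr_ge0// ltW.
have xM0 : 0 <= x / M by rewrite divr_ge0// ltW.
have h1 := powR_bernoulli i0 q1; have h2 := powR_bernoulli xM0 q1.
have {}h1 : 1 / M < (1 / M) `^ q / q + (1 - q^-1).
  by apply: h1; rewrite mul1r invr_eq1 lt_eqF// /M; lra.
have {}h2 : x / M < (x / M) `^ q / q + (1 - q^-1).
  apply: h2; rewrite lt_eqF// ltr_pdivrMr// mul1r /M; lra.
have E1 : (1 / M) `^ q = 1 / M `^ q.
  have n0 : M `^ q != 0 by rewrite gt_eqF.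
  rewrite !mul1r; apply: (mulIf n0); rewrite mulVf// -powRM ?invr_ge0 ?(ltW M0)//.
  by rewrite mulVf ?powR1// gt_eqF.
have E2 : (x / M) `^ q = x `^ q / M `^ q.
  by rewrite powRM ?invr_ge0 ?(ltW M0)//; move: E1; rewrite !mul1r => ->.
have S : 1 / M + x / M = 2 by rewrite /M; field; rewrite gt_eqF//; lra.
have : 2 < (1 + x `^ q) / M `^ q / q + 2 * (1 - q^-1).
  rewrite -{1}S; apply: lt_le_trans (ltrD h1 h2) _; rewrite E1 E2 le_eqVlt; apply/orP; left; apply/eqP.
  by move: (M `^ q) (x `^ q) Mq => P X P0; field; rewrite !gt_eqF.
move=> h; have : 2 / q < (1 + x `^ q) / M `^ q / q by lra.
rewrite ltr_pM2r ?invr_gt0// ltr_pdivlMr//; lra.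
Qed.

Lemma powR_midpoint_le x y q : 0 <= x -> 0 <= y -> 1 < q ->
  ((x + y) / 2) `^ q <= (x `^ q + y `^ q) / 2.
Proof.
wlog yx : x y / y <= x.
  move=> H x0 y0 q1; have [yx|xy] := leP y x; first exact: H.
  by rewrite addrC [x `^ _ + _]addrC; apply: H => //; exact: ltW.
move=> x0 y0 q1; have q0 : 0 < q := lt_trans ltr01 q1.
have [->|xn] := eqVneq x y; first by have h (z : R) : (z + z) / 2 = z; [field|rewrite !h].
have xp : 0 < x by apply: (le_lt_trans y0); rewrite lt_neqAle eq_sym xn.
have yx1 : 0 <= y / x < 1.
  by rewrite divr_ge0 ?(ltW xp)//= ltr_pdivrMr// mul1r lt_neqAle eq_sym xn.
have := powR_strict_convex yx1 q1.
have E : (x + y) / 2 = x * ((1 + y / x) / 2) by field; rewrite gt_eqF.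
rewrite E [(x * _) `^ q]powRM//; last by case/andP: yx1 => p _; rewrite divr_ge0// addr_ge0.
have -> : y `^ q = x `^ q * (y / x) `^ q by rewrite -powRM ?(divr_ge0 y0 x0)// mulrC divfK ?gt_eqF.
move=> /ltW h; have := ler_wpM2l (powR_ge0 x q) h.
by rewrite (_ : _ * ((1 + _) / 2) = (x `^ q + x `^ q * (y / x) `^ q) / 2)//; field.
Qed.

Lemma powR_continuous01 q (b : R) : 0 < q -> 0 < b -> {within `[0, b], continuous (fun x : R => x `^ q)}.
Proof.
move=> q0 b0; apply: segment_inc_surj_continuous.
  apply: le_mono_in => x y; rewrite !in_itv/= => /andP[x0 _] /andP[y0 _].
  by move=> xy; apply: gt0_ltr_powR => //; rewrite nnegrE.
move=> y /=; rewrite in_itv/= powR0 ?gt_eqF// => /andP[y0 yb].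
exists (y `^ q^-1); last by rewrite -powRrM mulVf ?gt_eqF// powRr1.
rewrite in_itv/= powR_ge0/=.
have := ge0_ler_powR (_ : 0 <= q^-1) (_ : y \is Num.nneg) (_ : b `^ q \is Num.nneg) yb.
rewrite !nnegrE powR_ge0 y0 invr_ge0 (ltW q0) => /(_ isT isT isT).
by rewrite -powRrM mulfV ?gt_eqF// powRr1// ltW.
Qed.

(** The convexity defect is continuous and positive on [[0, b0]], so it has a positive minimum
    there. *)
Lemma powR_gap q (b0 : R) : 1 < q -> 0 < b0 < 1 ->
  exists2 c, 0 < c & forall b, 0 <= b <= b0 -> c <= (1 + b `^ q) / 2 - ((1 + b) / 2) `^ q.
Proof.
move=> q1 /andP[b0p b01]; have q0 : 0 < q := lt_trans ltr01 q1.
pose f b := (1 + b `^ q) / 2 - ((1 + b) / 2) `^ q.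
have cf : {within `[0, b0], continuous f}.
  have c1 := powR_continuous01 q0 b0p.
  have c2 : {within `[0, b0], continuous (fun b : R => ((1 + b) / 2) `^ q)}.
    apply: segment_inc_surj_continuous.
      apply: le_mono_in => x y; rewrite !in_itv/= => /andP[x0 _] /andP[y0 _] xy.
      by apply: gt0_ltr_powR; rewrite ?nnegrE//; lra.
    move=> y /=; rewrite in_itv/= addr0 => /andP[y1 y2].
    have y0 : 0 <= y by apply: le_trans y1; exact: powR_ge0.
    have root x : 0 <= x -> (x `^ q) `^ q^-1 = x.
      by move=> x0; rewrite -powRrM mulfV ?gt_eqF// powRr1.
    have qi0 : 0 <= q^-1 by rewrite invr_ge0 ltW.
    exists (2 * y `^ q^-1 - 1); last first.
      rewrite (_ : (1 + _) / 2 = y `^ q^-1); last by field.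
      by rewrite -powRrM mulVf ?gt_eqF// powRr1.
    have h1 : 1 / 2 <= y `^ q^-1.
      by rewrite -(root (1 / 2))//; apply: ge0_ler_powR; rewrite ?nnegrE ?powR_ge0.
    have h2 : y `^ q^-1 <= (1 + b0) / 2.
      rewrite -(root ((1 + b0) / 2)); last by lra.
      by apply: ge0_ler_powR; rewrite ?nnegrE ?powR_ge0.
    rewrite in_itv/=; lra.
  move=> x; exact: (cvgB (cvgM (cvgD (cvg_cst _) (c1 x)) (cvg_cst _)) (c2 x)).
have [c cb hc] := EVT_min (ltW b0p) cf.
exists (f c); last by move=> b hb; apply: hc; rewrite in_itv.
rewrite subr_gt0; apply: powR_strict_convex => //.
by move: cb; rewrite in_itv/= => /andP[-> /le_lt_trans->].
Qed.

(** Here [a] and [b] stand for the norms of two vectors, [s] for that of their midpoint and [d] for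
    that of half their difference; the hypotheses are the parallelogram law and the triangle
    inequality. After scaling to [a = 1] there are three cases: [d] is small and the error term
    absorbs it; [b] is far from 1 and strict convexity leaves a gap; [b] is near 1 and the
    parallelogram law pushes [s] down. *)
Lemma hilbert_uniform_convexity q (e : R) : 1 < q -> 0 < e -> exists2 dl, 0 < dl &
  forall a b s d : R, 0 <= a -> 0 <= b -> 0 <= s -> 0 <= d ->
    s ^+ 2 + d ^+ 2 <= (a ^+ 2 + b ^+ 2) / 2 -> s <= (a + b) / 2 ->
    dl * d `^ q + s `^ q <= (1 + dl * e) * ((a `^ q + b `^ q) / 2).
Proof.
move=> q1 e0; have q0 : 0 < q := lt_trans ltr01 q1.
pose e1 := Num.min e 1; have e10 : 0 < e1 by rewrite lt_min e0 ltr01.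
have e1e : e1 <= e by rewrite ge_min lexx.
have e11 : e1 <= 1 by rewrite ge_min lexx orbT.
pose d0 := (e1 / 2) `^ q^-1.
have d00 : 0 < d0 by rewrite powR_gt0// divr_gt0.
have d0q : d0 `^ q = e1 / 2 by rewrite -powRrM mulVf ?gt_eqF// powRr1// divr_ge0// ltW.
have ltq x y : 0 <= x -> 0 <= y -> (x `^ q < y `^ q) = (x < y).
  move=> x0 y0; have [xy|yx] := ltP x y.
    by apply: gt0_ltr_powR => //; rewrite nnegrE.
  by apply/negbTE; rewrite -leNgt; apply: ge0_ler_powR => //; rewrite ?nnegrE ?(ltW q0).
have d01 : d0 < 1.
  by rewrite -(ltq _ _ (ltW d00) ler01) d0q powR1; lra.
pose th := 1 - d0 ^+ 2.
have th0 : 0 < th by rewrite subr_gt0 expr_lt1// ltW.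
have th1 : th < 1 by rewrite /th ltrBlDr ltrDl exprn_gt0.
(* Chosen so that [d >= d0] and [b <= 1] force [s^2 <= 1 - d0^2 = b0^4], hence [s <= b0^2], while
   the mean of the [q]-th powers is at least that of [b0] once [b > b0]. The difference is [c2]. *)
pose b0 := th `^ 4^-1.
have b00 : 0 < b0 by rewrite powR_gt0.
have b04 : b0 ^+ 4 = th.
  by rewrite -powR_mulrn ?(ltW b00)// -powRrM mulVf ?powRr1// ltW.
have b01 : b0 < 1.
  by rewrite ltNge; apply/negP => h; have := exprn_ege1 4 h; rewrite b04 leNgt th1.
have b0i : 0 < b0 < 1 by rewrite b00.
have [c1 c10 hc1] := powR_gap q1 b0i.
pose c2 := b0 `^ q - (b0 ^+ 2) `^ q.
have c20 : 0 < c2.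
  by rewrite subr_gt0 ltq ?sqr_ge0// ?(ltW b00)// expr2 gtr_pMr.
pose c := Num.min c1 c2; have c0 : 0 < c by rewrite lt_min c10.
exists (c / 2); first by rewrite divr_gt0.
(* by homogeneity the larger of the two norms is 1 *)
have unit b s d : 0 <= b <= 1 -> 0 <= s -> 0 <= d -> s ^+ 2 + d ^+ 2 <= (1 + b ^+ 2) / 2 ->
    s <= (1 + b) / 2 -> c / 2 * d `^ q + s `^ q <= (1 + c / 2 * e) * ((1 + b `^ q) / 2).
  move=> /andP[b0' b1] s0 d0' sd sb; set m := (1 + b `^ q) / 2.
  have bq0 : 0 <= b `^ q := powR_ge0 _ _.
  have m12 : 2^-1 <= m by rewrite /m; lra.
  have leq x y : 0 <= x -> 0 <= y -> x <= y -> x `^ q <= y `^ q.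
    by move=> x0 y0 xy; apply: ge0_ler_powR => //; rewrite ?nnegrE ?(ltW q0).
  have sm : s `^ q <= m.
    apply: le_trans (leq _ _ s0 _ sb) _; first by rewrite divr_ge0// addr_ge0.
    by have := powR_midpoint_le ler01 b0' q1; rewrite powR1.
  have d1 : d `^ q <= 1.
    suff d1 : d <= 1 by have := leq d 1 d0' ler01 d1; rewrite powR1.
    rewrite -(@ler_pXn2r _ 2) ?nnegrE// expr1n.
    have h1 := sqr_ge0 s; have h2 : b ^+ 2 <= 1 by rewrite expr_le1.
    clear -h1 h2 sd; lra.
  (* Small [d]: its [q]-th power is at most [e1 / 2], which the error term covers because the mean
     [m] is at least 1/2. *)
  have [dd|dd] := ltP d d0.
    have : d `^ q <= e1 / 2 by rewrite -d0q; apply: leq => //; exact: ltW.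
    move=> h; have : c / 2 * d `^ q <= c / 2 * (e * m).
      apply: ler_wpM2l; first by rewrite divr_ge0// ltW.
      have h2 : e * 2^-1 <= e * m by rewrite ler_pM2l.
      clear -h2 e1e h; lra.
    rewrite mulrDl mul1r -mulrA => h2; clear -h2 sm; lra.
  suff gap : c <= m - s `^ q.
    have : c / 2 * d `^ q <= c / 2 * 1 by apply: ler_wpM2l => //; rewrite divr_ge0// ltW.
    have m0 : 0 <= m by apply: le_trans m12; rewrite invr_ge0.
    have h1 : 0 <= c / 2 * e * m by apply: mulr_ge0 => //; apply: mulr_ge0; [apply: divr_ge0 => //|]; exact: ltW.
    rewrite mulrDl mul1r => h2; clearbody m; clear -h1 h2 gap c0; lra.
  have [bb|bb] := leP b b0.
    have := hc1 b (introT andP (conj b0' bb)); rewrite -/m => h.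
    have := leq _ _ s0 _ sb; rewrite divr_ge0// ?addr_ge0// => /(_ isT) h2.
    have h3 : c <= c1 by rewrite ge_min lexx.
    clear -h h2 h3; lra.
  have h1 : b0 `^ q <= m.
    have h2 : b0 `^ q <= b `^ q by apply: leq => //; exact: ltW.
    have h3 : b `^ q <= 1 by have := leq b 1 b0' ler01 b1; rewrite powR1.
    clear -h2 h3; rewrite /m; lra.
  have h3 : s `^ q <= (b0 ^+ 2) `^ q.
    apply: leq => //; first exact: sqr_ge0.
    rewrite -(@ler_pXn2r _ 2) ?nnegrE ?sqr_ge0// -exprM b04 /th.
    have h4 : d0 ^+ 2 <= d ^+ 2 by rewrite ler_pXn2r ?nnegrE// ltW.
    have h5 : b ^+ 2 <= 1 by rewrite expr_le1.
    clear -h4 h5 sd; lra.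
  have h4 : c <= c2 by rewrite ge_min lexx orbT.
  rewrite /c2 in h4; clear -h4 h1 h3; lra.
have wl a b s d : 0 <= b <= a -> 0 <= s -> 0 <= d ->
    s ^+ 2 + d ^+ 2 <= (a ^+ 2 + b ^+ 2) / 2 -> s <= (a + b) / 2 ->
    c / 2 * d `^ q + s `^ q <= (1 + c / 2 * e) * ((a `^ q + b `^ q) / 2).
  move=> /andP[b0' ba] s0 d0' sd sab; have a0 := le_trans b0' ba.
  have [a_0|an0] := eqVneq a 0.
    have b_0 : b = 0 by apply/eqP; rewrite eq_le b0' -a_0 ba.
    have s_0 : s = 0 by apply/eqP; rewrite eq_le s0 andbT; move: sab; rewrite a_0 b_0; lra.
    have d_0 : d = 0.
      apply/eqP; rewrite -sqrf_eq0 eq_le sqr_ge0 andbT; move: sd; rewrite a_0 b_0 s_0; lra.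
    by rewrite a_0 b_0 s_0 d_0 powR0 ?gt_eqF// !mulr0 !addr0 mul0r mulr0.
  have ap : 0 < a by rewrite lt_neqAle eq_sym an0.
  have sc x : 0 <= x -> x `^ q = a `^ q * (x / a) `^ q.
    by move=> x0; rewrite -powRM ?divr_ge0// mulrC divfK.
  have := unit (b / a) (s / a) (d / a) _ _ _ _ _.
  have -> : 0 <= b / a <= 1 by rewrite divr_ge0//= ler_pdivrMr// mul1r.
  rewrite !divr_ge0// => /(_ isT isT isT) h.
  rewrite (sc d)// (sc s)// (sc b)//.
  have aq : 0 < a `^ q by rewrite powR_gt0.
  have := ler_wpM2l (ltW aq) (h _ _).
  rewrite !expr_div_n => {}h.
  rewrite (_ : _ + _ = a `^ q * (c / 2 * (d / a) `^ q + (s / a) `^ q)); last by ring.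
  rewrite (_ : _ * (_ / 2) = a `^ q * ((1 + c / 2 * e) * ((1 + (b / a) `^ q) / 2))); last by ring.
  apply: h.
    rewrite -mulrDl ler_pdivrMr ?exprn_gt0//; apply: le_trans sd _.
    by rewrite le_eqVlt; apply/orP; left; apply/eqP; field.
  rewrite ler_pdivrMr//; apply: le_trans sab _.
  by rewrite le_eqVlt; apply/orP; left; apply/eqP; field.
move=> a b s d a0 b0' s0 d0' sd sab; have [ba|ab] := leP b a.
  by apply: wl => //; rewrite b0'.
rewrite [a `^ q + _]addrC; apply: wl => //; first by rewrite a0 ltW.
  by rewrite [b ^+ 2 + _]addrC.
by rewrite [b + _]addrC.
Qed.

End uniform_convexity.

(** * Right-continuous and regulated paths with values in U' *)

Section paths.
Context {R : realType} {U : normedModType R} {T : R}.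
Hypothesis T0 : 0 < T.
Implicit Types (l : U -> R) (w : R -> U -> R) (x : U).
Local Notation leb := (@lebesgue_measure R).

Definition linear_form l := forall (a : R) x y, l (a *: x + y) = a * l x + l y.

Lemma linear_formB l l' : linear_form l -> linear_form l' -> linear_form (l - l').
Proof. by move=> h h' a x y; rewrite !fctE h h'; ring. Qed.

Lemma dual_normN l : dual_norm (- l) = dual_norm l.
Proof.
by congr ereal_sup; apply/seteqP; split=> _ [x x1 <-]; exists x => //; rewrite fctE normrN.
Qed.

Lemma dual_normD l l' : (dual_norm (l + l')%R <= dual_norm l + dual_norm l')%E.
Proof.
apply: ge_ereal_sup => _ [x x1 <-]; rewrite fctE.
apply: (@le_trans _ _ (`|l x|%:E + `|l' x|%:E)%E); first by rewrite -EFinD lee_fin ler_normD.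
by apply: leeD; exact: dual_norm_ge.
Qed.

Lemma dual_normBC l l' : dual_norm (l - l') = dual_norm (l' - l).
Proof. by rewrite -dual_normN opprB. Qed.

Lemma dual_norm_tri l1 l2 l3 (a b : R) : (dual_norm (l1 - l2)%R <= a%:E)%E ->
  (dual_norm (l2 - l3)%R <= b%:E)%E -> (dual_norm (l1 - l3)%R <= (a + b)%:E)%E.
Proof.
move=> h1 h2; rewrite (_ : l1 - l3 = (l1 - l2) + (l2 - l3)); last by rewrite addrA subrK.
by apply: le_trans (dual_normD _ _) _; rewrite EFinD; exact: leeD.
Qed.

Lemma dual_norm_closed (l : nat -> U -> R) (l0 : U -> R) (r : R) :
  (forall k, (dual_norm (l k) <= r%:E)%E) ->
  (forall x e, 0 < e -> exists K : nat, forall k, (K <= k)%N -> `|l k x - l0 x| <= e) ->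
  (dual_norm l0 <= r%:E)%E.
Proof.
move=> lr ll; apply: dual_norm_le => x x1; apply/ler_addgt0Pr => e e0.
have [K HK] := ll x e e0; have := HK K (leqnn K).
have := le_trans (dual_norm_ge (l K) x1) (lr K); rewrite lee_fin => h1 h2.
have := ler_normD (l K x) (l0 x - l K x).
rewrite (_ : l K x + (l0 x - l K x) = l0 x); last by ring.
rewrite distrC in h2; lra.
Qed.

Lemma dual_cvg_pointwise (l : nat -> U -> R) (l0 : U -> R) :
  (forall k, linear_form (l k)) -> linear_form l0 ->
  (forall e, 0 < e -> exists K : nat, forall k, (K <= k)%N -> (dual_norm (l k - l0)%R <= e%:E)%E) ->
  forall x e, 0 < e -> exists K : nat, forall k, (K <= k)%N -> `|l k x - l0 x| <= e.
Proof.
move=> ll ll0 h x e e0; pose e' := e / (`|x| + 1).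
have x1 : 0 < `|x| + 1 by rewrite ltr_wpDl.
have e'0 : 0 < e' by rewrite divr_gt0.
have [K HK] := h _ e'0; exists K => k Kk.
have := dual_norm_bound x (linear_formB (ll k) ll0) (HK k Kk); rewrite fctE => h1.
apply: le_trans h1 _; rewrite /e' -mulrA [X in e * X]mulrC ler_piMr ?(ltW e0)//.
by rewrite ler_pdivrMr// mul1r lerDl.
Qed.

Lemma cvgn_of_cauchy (u : nat -> R) :
  (forall e, 0 < e -> exists K : nat, forall n k, (K <= n)%N -> (K <= k)%N -> `|u n - u k| <= e) ->
  cvgn u.
Proof.
move=> h; apply/cauchy_cvgP; apply: cauchy_exP => e e0.
have e2 : 0 < e / 2 by rewrite divr_gt0.
have [K HK] := h _ e2; exists (u K); exists K => // n /= Kn.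
rewrite /ball/=; apply: le_lt_trans (HK K n (leqnn K) Kn) _.
by rewrite ltr_pdivrMr// ltr_pMr// ltr1n.
Qed.

Lemma dual_complete (l : nat -> U -> R) : (forall k, dual (l k)) ->
  (forall e, 0 < e -> exists K : nat, forall k k', (K <= k)%N -> (K <= k')%N ->
     (dual_norm (l k - l k')%R <= e%:E)%E) ->
  exists l0, dual l0 /\ forall e, 0 < e -> exists K : nat, forall k, (K <= k)%N ->
     (dual_norm (l k - l0)%R <= e%:E)%E.
Proof.
move=> dl cl.
have lin k : linear_form (l k) by case: (dl k).
have cx x : cvgn (fun k => l k x).
  apply: cvgn_of_cauchy => e e0; pose e' := e / (`|x| + 1).
  have x1 : 0 < `|x| + 1 by rewrite ltr_wpDl.
  have e'0 : 0 < e' by rewrite divr_gt0.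
  have [K HK] := cl _ e'0; exists K => n k Kn Kk.
  have := dual_norm_bound x (linear_formB (lin n) (lin k)) (HK n k Kn Kk); rewrite fctE => h1.
  apply: le_trans h1 _; rewrite /e' -mulrA [X in e * X]mulrC ler_piMr ?(ltW e0)//.
  by rewrite ler_pdivrMr// mul1r lerDl.
pose l0 x := limn (fun k => l k x).
have ptw x e : 0 < e -> exists K : nat, forall k, (K <= k)%N -> `|l k x - l0 x| <= e.
  move=> e0; have /cvgrPdist_le/(_ e e0)[K _ HK] := cx x.
  by exists K => k Kk; rewrite distrC; exact: HK.
have lin0 : linear_form l0.
  move=> a x y; rewrite /l0.
  rewrite (_ : (fun k => _) = (fun k => a * l k x + l k y)); last by apply/funext => k; exact: lin.
  by apply: cvg_lim => //; apply: cvgD; [apply: cvgM; [exact: cvg_cst|exact: cx]|exact: cx].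
have l0l e : 0 < e -> exists K : nat, forall k, (K <= k)%N -> (dual_norm (l k - l0)%R <= e%:E)%E.
  move=> e0; have [K HK] := cl e e0; exists K => k Kk.
  apply: (@dual_norm_closed (fun k' => l k - l (maxn K k'))) => [k'|x e' e'0].
    by apply: HK => //; rewrite leq_maxl.
  have [M HM] := ptw x e' e'0; exists M => k' Mk'; rewrite !fctE.
  rewrite (_ : _ - _ = l0 x - l (maxn K k') x); last by ring.
  by rewrite distrC; apply: HM; rewrite (leq_trans Mk')// leq_maxr.
exists l0; split => //; split => //.
have [K HK] := l0l 1 ltr01; have [_ fK] := dl K.
rewrite (_ : l0 = l K - (l K - l0)); last by rewrite opprB addrC subrK.
apply: le_lt_trans (dual_normD _ _) _; rewrite dual_normN.
by apply: lte_add_pinfty => //; exact: le_lt_trans (HK K (leqnn K)) (ltry _).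
Qed.

(** Right continuity of each evaluation at a point of [U]. It is stable under linear combinations
    and suffices for the measurability of lower semicontinuous functions of the path. *)
Definition rc w := forall t, 0 <= t < T -> forall x e, 0 < e -> exists2 eta, 0 < eta &
  forall s, t <= s < t + eta -> s <= T -> `|w s x - w t x| <= e.

Lemma rc_lin (a : R) w w' : rc w -> rc w' -> rc (a *: w + w').
Proof.
move=> rw rw' t tT x e e0; have c0 : 0 < 2 * (`|a| + 1) by rewrite mulr_gt0// ltr_wpDl.
have e1 : 0 < e / (2 * (`|a| + 1)) by rewrite divr_gt0.
have [h1 h10 H1] := rw t tT x _ e1; have [h2 h20 H2] := rw' t tT x _ e1.
exists (Num.min h1 h2); first by rewrite lt_min h10.
move=> s /andP[ts sh] sT.
have sh1 : s < t + h1 by apply: lt_le_trans sh _; rewrite lerD2l ge_min lexx.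
have sh2 : s < t + h2 by apply: lt_le_trans sh _; rewrite lerD2l ge_min lexx orbT.
have := H1 s (introT andP (conj ts sh1)) sT; have := H2 s (introT andP (conj ts sh2)) sT.
rewrite (_ : (a *: w + w') s x = a * w s x + w' s x)// (_ : (a *: w + w') t x = a * w t x + w' t x)//.
move=> b2 b1; rewrite (_ : _ - _ = a * (w s x - w t x) + (w' s x - w' t x)); last by ring.
apply: le_trans (ler_normD _ _) _; rewrite normrM.
apply: (le_trans (lerD (ler_wpM2l (normr_ge0 a) b1) b2)).
rewrite -{2}[e / _]mul1r -mulrDl mulrA ler_pdivrMr//; have := normr_ge0 a.
move=> p; rewrite mulrC ler_pM2l//; lra.
Qed.

Lemma rc_cst l : rc (fun=> l).
Proof. by move=> t tT x e e0; exists 1 => // s _ _; rewrite subrr normr0 ltW. Qed.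

(** The closed sublevels make [phi] lower semicontinuous for pointwise convergence, so the times
    where [phi (w t) > r] form a set open to the right. Clamping the time to [[0, T]] extends the
    path to the whole line. *)
Lemma measurable_path (phi : (U -> R) -> \bar R) w : rc w -> (forall l, (0 <= phi l)%E) ->
  (forall (l : nat -> U -> R) (l0 : U -> R) (r : R), (forall k, (phi (l k) <= r%:E)%E) ->
     (forall x e, 0 < e -> exists K : nat, forall k, (K <= k)%N -> `|l k x - l0 x| <= e) ->
     (phi l0 <= r%:E)%E) ->
  measurable_fun (`[0, T]%classic : set (measurableTypeR R)) (fun t => phi (w t)).
Proof.
move=> rw phi0 cphi; pose clamp t : R := Num.max 0 (Num.min t T).
have cl t : 0 <= t <= T -> clamp t = t.
  by move=> /andP[t0 tT]; rewrite /clamp min_l// max_r.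
have key : measurable_fun setT ((fun t => phi (w (clamp t))) : measurableTypeR R -> \bar R).
  apply: right_continuous_measurable => // t r rt.
  have [t0|t0] := ltP t 0.
    exists (- t); first by rewrite oppr_gt0.
    move=> s; rewrite subrr => /andP[_ s0].
    have E (z : R) : z < 0 -> clamp z = 0.
      move=> z0; rewrite /clamp max_l// ge_min; apply/orP; left; exact: ltW.
    by rewrite E// -(E t).
  have [tT|Tt] := ltP t T; last first.
    exists 1 => // s /andP[ts _].
    have E (z : R) : T <= z -> clamp z = T by move=> Tz; rewrite /clamp min_r// max_r// ltW.
    by rewrite E ?(le_trans Tt)// -(E t).
  rewrite cl ?t0 ?ltW// in rt.
  apply: contrapT => H.
  have /choice[s sP] : forall k : nat, exists s, t <= s < t + k.+1%:R^-1 /\ (phi (w (clamp s)) <= r%:E)%E.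
    move=> k; apply: contrapT => Hk; apply: H; exists k.+1%:R^-1; first by rewrite invr_gt0.
    move=> s hs; rewrite ltNge; apply/negP => hr; apply: Hk; by exists s.
  have := cphi (fun k => w (clamp (s k))) (w t) r (fun k => (sP k).2).
  rewrite leNgt rt => /(_ _)/negP; apply => // x e e0.
  have [eta eta0 He] := rw t (introT andP (conj t0 tT)) x e e0.
  have [K HK] := exists_natSinv_lt eta0; exists K => k Kk.
  have [/andP[ts sk] _] := sP k.
  have tc : t <= clamp (s k) by rewrite /clamp le_max le_min ts (ltW tT) orbT.
  have cs : clamp (s k) <= s k by rewrite /clamp ge_max (le_trans t0 ts) ge_min lexx.
  apply: He; last by rewrite /clamp ge_max (ltW T0) ge_min lexx orbT.
  rewrite tc/=; apply: (le_lt_trans cs); apply: (lt_trans sk); rewrite ltrD2l.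
  apply: le_lt_trans HK; rewrite lef_pV2 ?posrE// ler_nat; exact: Kk.
apply: (eq_measurable_fun (fun t => phi (w (clamp t)))); last exact: measurable_funTS.
by move=> t; rewrite inE/= in_itv/= => /cl ->.
Qed.

Definition osc_le w (e : R) n (a : nat -> R) := forall i, (i < n)%N -> forall s t,
  a i <= s -> s < t -> t < a i.+1 -> (dual_norm (w t - w s)%R <= e%:E)%E.

Definition regulated w := forall e, 0 < e -> exists n a, strict_subdivision (T := T) n a /\ osc_le w e n a.

Lemma osc_le_sym w e n a i s t : 0 <= e -> osc_le w e n a -> (i < n)%N ->
  a i <= s < a i.+1 -> a i <= t < a i.+1 -> (dual_norm (w t - w s)%R <= e%:E)%E.
Proof.
move=> e0 h ni /andP[s1 s2] /andP[t1 t2]; have [st|ts|->] := ltgtP s t.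
- exact: h ni _ _ _ st _.
- by rewrite dual_normBC; exact: h ni _ _ _ ts _.
- rewrite subrr; apply: dual_norm_le => x _; by rewrite normr0.
Qed.

(** Oscillations are controlled on the half-open cells [[a i, a i.+1[]. A point is in the cell to
    its right, which gives right continuity at once; the left limit is built along a sequence by
    completeness of U'. *)
Lemma regulated_cadlag w : (forall t, 0 <= t <= T -> dual (w t)) -> regulated w ->
  cadlag T (@dual _ U) (@dual_norm _ U) w.
Proof.
move=> dw rw; split=> // [t tT|t /andP[t0 tT]].
  apply/cvg_ereal0P => [s|e e0]; first exact: dual_norm_ge0.
  have e2 : 0 < e / 2 by rewrite divr_gt0.
  have [n [a [sa oa]]] := rw _ e2.
  have [i ni /andP[h1 h2]] := subdivision_locate sa tT.
  near=> s; apply: (@le_lt_trans _ _ (e / 2)%:E); last by rewrite lte_fin; lra.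
  apply: (osc_le_sym (ltW e2) oa ni); first by rewrite h1.
  apply/andP; split; last by near: s; exact: nbhs_right_lt.
  by apply: (le_trans h1); near: s; exact: nbhs_right_ge.
pose tk (k : nat) := t - t / k.+2%:R.
have tk1 k : 0 <= tk k <= T.
  rewrite /tk subr_ge0 ler_pdivrMr// ler_peMr ?(ltW t0) ?ler1n//=.
  by apply: le_trans tT; rewrite gerBl divr_ge0// ltW.
have tkt k : tk k < t by rewrite /tk gtrBl divr_gt0.
have loc e : 0 < e -> exists2 b, 0 <= b < t & forall r s, b <= r < t -> b <= s < t ->
    (dual_norm (w s - w r)%R <= e%:E)%E.
  move=> e0; have [n [a [sa oa]]] := rw e e0.
  have [i ni /andP[h1 h2]] : exists2 i, (i < n)%N & a i < t <= a i.+1.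
    have [i ni /andP[]] := subdivision_locateT T0 sa (introT andP (conj (ltW t0) tT)).
    rewrite le_eqVlt => /orP[/eqP E|h1] h2; last by exists i => //; rewrite h1.
    case: i ni E h2 => [|i] ni E h2.
      by have [a0 _ _] := sa; move: t0; rewrite -E a0 ltxx.
    exists i; first exact: ltnW.
    by rewrite -E lexx andbT; have [_ _] := sa; apply; exact: ltnW.
  have /andP[p _] := subdivision_range sa (ltnW ni).
  exists (a i); first by rewrite p.
  move=> r s /andP[r1 r2] /andP[s1 s2]; apply: (osc_le_sym (ltW e0) oa ni).
    by rewrite r1 (lt_le_trans r2).
  by rewrite s1 (lt_le_trans s2).
have tkb b : 0 <= b < t -> exists K : nat, forall k, (K <= k)%N -> b <= tk k.
  move=> /andP[b0 bt]; have g : 0 < (t - b) / t by rewrite divr_gt0// subr_gt0.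
  have [K HK] := exists_natSinv_lt g; exists K => k Kk; rewrite /tk lerBrDr addrC -lerBrDr.
  rewrite mulrC -ler_pdivlMr//; apply: le_trans (ltW HK).
  by rewrite lef_pV2 ?posrE// ler_nat; apply: leq_trans (leqnSn _).
have [|l0 [dl0 hl0]] := @dual_complete (fun k => w (tk k)) (fun k => dw _ (tk1 k)).
  move=> e e0; have [b b0 hb] := loc e e0; have [K HK] := tkb b b0; exists K => k k' Kk Kk'.
  by apply: hb; rewrite HK// tkt.
exists l0 => //; apply/cvg_ereal0P => [s|e e0]; first exact: dual_norm_ge0.
have e4 : 0 < e / 4 by rewrite divr_gt0.
have [b b0 hb] := loc _ e4; have [K HK] := tkb b b0; have [K' HK'] := hl0 _ e4.
pose k := maxn K K'; have hk : b <= tk k < t by rewrite HK ?leq_maxl// tkt.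
near=> s; apply: (@le_lt_trans _ _ (e / 4 + e / 4)%:E); last by rewrite lte_fin; lra.
apply: (dual_norm_tri (l2 := w (tk k))); last by apply: HK'; rewrite leq_maxr.
apply: hb => //; apply/andP; split; last by near: s; exact: nbhs_left_lt.
by near: s; apply: nbhs_left_ge; case/andP: b0.
Unshelve. all: by end_near. Qed.

Lemma cadlag_rc w : cadlag T (@dual _ U) (@dual_norm _ U) w -> rc w.
Proof.
move=> [dw rw _] t tT x e e0.
have x1 : 0 < `|x| + 1 by rewrite ltr_wpDl.
have e1 : 0 < e / (`|x| + 1) by rewrite divr_gt0.
have /(cvg_ereal0P (fun s => dual_norm_ge0 _))/(_ _ e1) := rw t tT.
move=> [eta /= eta0 He]; exists eta => // s /andP[ts st] sT.
have /andP[t0 tT'] := tT.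
move: ts; rewrite le_eqVlt => /orP[/eqP <-|ts]; first by rewrite subrr normr0 ltW.
have nst : `|t - s| < eta by rewrite distrC ger0_norm ?subr_ge0 ?(ltW ts)// ltrBlDl.
have h := He s nst ts.
have ls : linear_form (w s) := (dw s (introT andP (conj (le_trans t0 (ltW ts)) sT))).1.
have lt : linear_form (w t) := (dw t (introT andP (conj t0 (ltW tT')))).1.
have := dual_norm_bound x (linear_formB ls lt) (ltW h); rewrite fctE => h1.
apply: le_trans h1 _; rewrite -mulrA [X in e * X]mulrC ler_piMr ?(ltW e0)//.
by rewrite ler_pdivrMr// mul1r lerDl.
Qed.

(** The exceptional set consists of the partition points of [u] for all levels [1/(p+1)]. At any
    other [t], the point moved to [t] by the time change lies in the same open cell as soon as [k]
    is large. *)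
Lemma ae_close (u : R -> U -> R) (v : nat -> R -> U -> R) : regulated u ->
  (forall k, skorokhod_within (T := T) (@dual_norm _ U) u (v k) k.+1%:R^-1) ->
  {ae leb, forall t, 0 <= t <= T -> forall e, 0 < e -> exists K : nat, forall k, (K <= k)%N ->
     (dual_norm (v k t - u t)%R <= e%:E)%E}.
Proof.
move=> ru cuv.
have p0 (p : nat) : (0 : R) < p.+1%:R^-1 by rewrite invr_gt0.
have /choice[A AP] : forall p : nat, exists A : (nat * (nat -> R)),
    strict_subdivision (T := T) A.1 A.2 /\ osc_le u p.+1%:R^-1 A.1 A.2.
  by move=> p; have [n [a h]] := ru _ (p0 p); exists (n, a).
pose B : set R := range (fun pi : nat * nat => (A pi.1).2 pi.2).
have cB : countable B by apply: card_le_trans (card_image_le _ _) _; exact: countableP.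
apply: (@negligibleS _ _ _ leb B); last first.
  exists B; split => //; last exact: countable_lebesgue_measure0.
  by apply: countable_measurable => // t; exact: measurable_set1.
move=> t /= H; apply: contrapT => nB; apply: H => tT e e0.
have e2 : 0 < e / 2 by rewrite divr_gt0.
have [p hp] := exists_natSinv_lt e2.
have [sa oa] := AP p.
have [i ni /andP[h1 h2]] := subdivision_locateT T0 sa tT.
have inB k : (A p).2 k != t by apply/eqP => E; apply: nB; exists (p, k).
have {}h1 : (A p).2 i < t by rewrite lt_neqAle inB.
have {}h2 : t < (A p).2 i.+1 by rewrite lt_neqAle eq_sym inB.
have g0 : 0 < Num.min (e / 2) (Num.min (t - (A p).2 i) ((A p).2 i.+1 - t)).
  by rewrite !lt_min e2 !subr_gt0 h1.
have [K HK] := exists_natSinv_lt g0; exists K => k Kk.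
have : k.+1%:R^-1 < Num.min (e / 2) (Num.min (t - (A p).2 i) ((A p).2 i.+1 - t)).
  by apply: le_lt_trans HK; rewrite lef_pV2 ?posrE// ler_nat.
rewrite !lt_min => /and3P[g1 g2 g3].
have [lam tc hl] := cuv k; have [s sT ls] := time_change_surj tc tT.
have [l1 l2] := hl s sT; rewrite ls in l1 l2.
have e2e : e = e / 2 + e / 2 by rewrite -splitr.
rewrite e2e; apply: (dual_norm_tri (l2 := u s)).
  by rewrite dual_normBC; apply: le_trans l2 _; rewrite lee_fin ltW.
have : (dual_norm (u s - u t)%R <= (p.+1%:R^-1)%:E)%E.
  apply: (osc_le_sym _ oa ni); first by rewrite invr_ge0.
    by rewrite (ltW h1).
  move: (k.+1%:R^-1) l1 g2 g3 => z l1 g2 g3.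
    by move: l1; rewrite ler_norml => /andP[l1 l1']; apply/andP; split; clear -l1 l1' g2 g3; lra.
by move=> h; apply: le_trans h _; rewrite lee_fin ltW.
Qed.

End paths.

Definition pointwise_cvg {R : realType} {U : Type} (l : nat -> U -> R) (l0 : U -> R) :=
  forall x e, 0 < e -> exists K : nat, forall k, (K <= k)%N -> `|l k x - l0 x| <= e.

Lemma le_poweR {R : realType} (r : R) (x y : \bar R) : 0 <= r -> (0 <= x)%E -> (x <= y)%E ->
  (x `^ r <= y `^ r)%E.
Proof.
move=> r0 x0 xy; apply: gt0_ler_poweR => //; rewrite in_itv/= leey ?x0//.
by rewrite (le_trans x0 xy).
Qed.

Lemma ae_leb_imp {R : realType} (P Q : R -> Prop) :
  {ae (@lebesgue_measure R), forall t : R, P t} -> (forall t, P t -> Q t) ->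
  {ae (@lebesgue_measure R), forall t : R, Q t}.
Proof. by move=> [N [mN N0 hN]] PQ; exists N; split=> // t /= nQ; apply: hN => /PQ. Qed.

(** * The L^q energy of a path *)

Section energy.
Context {R : realType} {U : normedModType R} {T q : R} (Q : (U -> R) -> \bar R).
Hypotheses (T0 : 0 < T) (q1 : 1 < q) (qQ : quadratic setT Q).
Hypothesis closedQ : forall (l : nat -> U -> R) l0 (r : R), (forall k, (Q (l k) <= r%:E)%E) ->
  pointwise_cvg l l0 -> (Q l0 <= r%:E)%E.
Implicit Types (l : U -> R) (w u : R -> U -> R).
Local Notation leb := (@lebesgue_measure R).
Local Notation rc := (rc (T := T)).
Let J : set (measurableTypeR R) := `[0, T]%classic.
Let mJ : measurable J. Proof. exact: measurable_itv. Qed.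
Let q0 : 0 < q := lt_trans ltr01 q1.
Let ST : subspace [set: U -> R]. Proof. by []. Qed.

(** The two successive powers reproduce the form of the integrand in the L^q norms, a norm raised to
    the power [q]. *)
Definition density l : \bar R := ((Q l `^ 2^-1) `^ q)%E.
Definition energy w : \bar R := (\int[leb]_(t in J) density (w t))%E.

Lemma density_ge0 l : (0 <= density l)%E. Proof. exact: poweR_ge0. Qed.

Lemma density_fin l (r : R) : 0 <= r -> Q l = r%:E -> density l = (Num.sqrt r `^ q)%:E.
Proof. by move=> r0 E; rewrite /density E !poweR_EFin powR12_sqrt. Qed.

Lemma density_le l (r : R) : 0 <= r -> (density l <= r%:E)%E = (Q l <= (r `^ (2 / q))%:E)%E.
Proof.
move=> r0; have Q0 := quad_ge0 qQ l; apply/idP/idP => h.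
  have : (density l `^ (2 / q) <= r%:E `^ (2 / q))%E.
    by apply: le_poweR => //; [rewrite divr_ge0// ltW|exact: density_ge0].
  rewrite poweR_EFin /density -!poweRrM (_ : 2^-1 * _ = 1) ?poweRe1//.
  by field; rewrite gt_eqF.
have : ((Q l `^ 2^-1) `^ q <= ((r `^ (2 / q))%:E `^ 2^-1) `^ q)%E.
  apply: le_poweR; [exact: ltW|exact: poweR_ge0|].
  by apply: le_poweR => //; rewrite invr_ge0.
rewrite !poweR_EFin -!powRrM (_ : 2 / q * _ = 1) ?powRr1//.
by field; rewrite gt_eqF.
Qed.

Lemma density_closed (l : nat -> U -> R) l0 (r : R) :
  (forall k, (density (l k) <= r%:E)%E) -> pointwise_cvg l l0 -> (density l0 <= r%:E)%E.
Proof.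
move=> lr ll.
have r0 : 0 <= r by rewrite -lee_fin; apply: le_trans (lr 0%N); exact: density_ge0.
rewrite density_le//; apply: closedQ ll => k; rewrite -density_le//.
Qed.

Lemma density_measurable w : rc w -> measurable_fun J (fun t => density (w t)).
Proof. by move=> rw; apply: measurable_path => //; [exact: density_ge0|exact: density_closed]. Qed.

Lemma density0 : density 0 = 0%E.
Proof.
by rewrite /density (quad0 qQ) !poweR_EFin !powR0 ?invr_eq0 ?pnatr_eq0// gt_eqF.
Qed.

Lemma densityZ (a : R) l : (density (a *: l) <= (`|a| `^ q)%:E * density l)%E.
Proof.
have [->|a0] := eqVneq a 0.
  by rewrite scale0r density0 normr0 powR0 ?mul0e// gt_eqF.
apply: (@le_trans _ _ ((((a ^+ 2)%:E * Q l) `^ 2^-1) `^ q)%E).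
  apply: le_poweR; [exact: ltW|exact: poweR_ge0|].
  apply: le_poweR; [by rewrite invr_ge0|exact: (quad_ge0 qQ)|exact: (quadZ qQ)].
rewrite poweRM ?lee_fin ?sqr_ge0 ?(quad_ge0 qQ)// poweRM ?poweR_ge0//.
by rewrite !poweR_EFin powR12_sqrt ?sqr_ge0// sqrtr_sqr.
Qed.

Lemma densityD l l' : (density (l + l')%R <= (2 `^ q)%:E * (density l + density l'))%E.
Proof.
have p2 : (0 : R) < 2 `^ q by rewrite powR_gt0.
have [fl|] := boolP (Q l < +oo)%E; last first.
  rewrite -leNgt leye_eq => /eqP El; rewrite {2}/density El poweRyr ?invr_eq0 ?pnatr_eq0//.
  rewrite poweRyr ?gt_eqF// addye ?gt0_muley ?lte_fin ?leey//.
  by rewrite gt_eqF// (lt_le_trans (ltNyr 0)) ?density_ge0.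
have [fl'|] := boolP (Q l' < +oo)%E; last first.
  rewrite -leNgt leye_eq => /eqP El; rewrite {3}/density El poweRyr ?invr_eq0 ?pnatr_eq0//.
  rewrite poweRyr ?gt_eqF// addey ?gt0_muley ?lte_fin ?leey//.
  by rewrite gt_eqF// (lt_le_trans (ltNyr 0)) ?density_ge0.
have [r Er r0] := fin_lt (quad_ge0 qQ l) fl.
have [s Es s0] := fin_lt (quad_ge0 qQ l') fl'.
rewrite (density_fin r0 Er) (density_fin s0 Es) -EFinD -EFinM.
set a := Num.sqrt r; set b := Num.sqrt s.
have a0 : 0 <= a := sqrtr_ge0 _; have b0 : 0 <= b := sqrtr_ge0 _.
rewrite density_le ?mulr_ge0 ?addr_ge0 ?powR_ge0//.
have h1 : (Q l <= r%:E)%E by rewrite Er.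
have h2 : (Q l' <= s%:E)%E by rewrite Es.
apply: le_trans (quadD_le qQ (I : setT l) (I : setT l') h1 h2) _; rewrite lee_fin.
pose M := Num.max a b.
have M0 : 0 <= M by rewrite le_max a0.
have rM : r <= M ^+ 2 by rewrite -(sqr_sqrtr r0) ler_sqr ?nnegrE// le_max lexx.
have sM : s <= M ^+ 2 by rewrite -(sqr_sqrtr s0) ler_sqr ?nnegrE// le_max lexx orbT.
apply: (@le_trans _ _ ((2 * M) ^+ 2)); first by rewrite exprMn; lra.
have -> : (2 * M) ^+ 2 = ((2 * M) `^ q) `^ (2 / q).
  rewrite -powRrM (_ : q * (2 / q) = 2%:R); last by field; rewrite gt_eqF.
  by rewrite powR_mulrn// mulr_ge0.
apply: ge0_ler_powR; rewrite ?nnegrE ?powR_ge0 ?mulr_ge0 ?addr_ge0 ?powR_ge0 ?invr_ge0 ?(ltW q0)//.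
rewrite powRM// ler_pM2l// /M; case: (leP a b) => _.
  by rewrite lerDr powR_ge0.
by rewrite lerDl powR_ge0.
Qed.

(** [hilbert_uniform_convexity] for the norms of [l], [l'], their midpoint and half their
    difference. If one of the two norms is infinite, the right-hand sides are infinite. *)
Lemma density_convex (e : R) : 0 < e -> exists2 dl, 0 < dl & forall l l',
  (dl%:E * density (2^-1 *: (l - l')) + density (2^-1 *: (l + l')) <=
   (1 + dl * e)%:E * (2^-1%:E * density l + 2^-1%:E * density l'))%E /\
  (density (2^-1 *: (l + l')) <= 2^-1%:E * density l + 2^-1%:E * density l')%E.
Proof.
move=> e0; have [dl dl0 H] := hilbert_uniform_convexity q1 e0.
exists dl => // l l'.
have c0 : 0 < 1 + dl * e by rewrite addr_gt0// mulr_gt0.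
have i2 : (0 : R) < 2^-1 by rewrite invr_gt0.
have inf (l1 : U -> R) : ~~ (Q l1 < +oo)%E -> (2^-1%:E * density l1 = +oo)%E.
  rewrite -leNgt leye_eq => /eqP El; rewrite /density El poweRyr ?invr_eq0 ?pnatr_eq0//.
  by rewrite poweRyr ?gt_eqF// gt0_muley// lte_fin.
have fin (l1 : U -> R) : (2^-1%:E * density l1 != -oo)%E.
  by rewrite gt_eqF// (lt_le_trans (ltNyr 0)) ?mule_ge0 ?density_ge0// lee_fin ltW.
have [fl|/inf El] := boolP (Q l < +oo)%E; last first.
  by rewrite El addye// gt0_muley ?lte_fin// !leey.
have [fl'|/inf El] := boolP (Q l' < +oo)%E; last first.
  by rewrite El addey// gt0_muley ?lte_fin// !leey.
have [r Er r0] := fin_lt (quad_ge0 qQ l) fl.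
have [s Es s0] := fin_lt (quad_ge0 qQ l') fl'.
have h1 : (Q l <= r%:E)%E by rewrite Er.
have h2 : (Q l' <= s%:E)%E by rewrite Es.
have mid := quad_mid_le ST qQ (I : setT l) (I : setT l') h1 h2.
have Qd0 := quad_ge0 qQ (2^-1 *: (l - l')); have Qs0 := quad_ge0 qQ (2^-1 *: (l + l')).
have [x Ex x0] := fin_lt Qd0 (le_lt_trans (le_trans (leeDl _ Qs0) mid) (ltry _)).
have [y Ey y0] := fin_lt Qs0 (le_lt_trans (le_trans (leeDr _ Qd0) mid) (ltry _)).
rewrite (density_fin r0 Er) (density_fin s0 Es) (density_fin x0 Ex) (density_fin y0 Ey).
have xy : y + x <= (r + s) / 2 by move: mid; rewrite Ex Ey -EFinD lee_fin addrC.
suff tri : Num.sqrt y <= (Num.sqrt r + Num.sqrt s) / 2.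
  split.
    change ((dl * (Num.sqrt x `^ q) + Num.sqrt y `^ q)%:E <=
      ((1 + dl * e) * (2^-1 * (Num.sqrt r `^ q) + 2^-1 * (Num.sqrt s `^ q)))%:E)%E.
    rewrite lee_fin -mulrDr [2^-1 * _]mulrC.
    by apply: H; rewrite ?sqrtr_ge0// ?sqr_sqrtr.
  change ((Num.sqrt y `^ q)%:E <= (2^-1 * (Num.sqrt r `^ q) + 2^-1 * (Num.sqrt s `^ q))%:E)%E.
  rewrite lee_fin -mulrDr [2^-1 * _]mulrC.
  apply: le_trans (powR_midpoint_le (sqrtr_ge0 r) (sqrtr_ge0 s) q1).
  by apply: ge0_ler_powR; rewrite ?nnegrE ?sqrtr_ge0 ?divr_ge0 ?addr_ge0 ?sqrtr_ge0 ?(ltW q0).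
have t := quad_triangle qQ (I : setT l) (I : setT l').
have z : (Q (2^-1 *: (l + l')) `^ 2^-1 <= 2^-1%:E * Q (l + l')%R `^ 2^-1)%E.
  have n2 : (2^-1 : R) != 0 by rewrite gt_eqF.
  apply: (@le_trans _ _ (((2^-1 ^+ 2)%:E * Q (l + l')%R) `^ 2^-1)%E).
    by apply: le_poweR; [exact: ltW|exact: (quad_ge0 qQ)|exact: (quadZ qQ n2)].
  rewrite poweRM ?lee_fin ?sqr_ge0 ?(quad_ge0 qQ)// poweR_EFin powR12_sqrt ?sqr_ge0// sqrtr_sqr.
  by rewrite ger0_norm// ltW.
have := le_trans z (lee_wpmul2l (_ : (0 <= 2^-1%:E)%E) t).
rewrite lee_fin (ltW i2) => /(_ isT).
rewrite Er Es Ey !poweR_EFin !powR12_sqrt// -EFinD -EFinM lee_fin mulrC; exact.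
Qed.

Lemma energy_ge0 w : (0 <= energy w)%E.
Proof. by apply: integral_ge0 => t _; exact: density_ge0. Qed.

Let intZ (f : R -> \bar R) (c : R) : measurable_fun J f -> (forall t, (0 <= f t)%E) -> 0 <= c ->
  (\int[leb]_(t in J) (c%:E * f t) = c%:E * \int[leb]_(t in J) f t)%E.
Proof. by move=> mf f0 c0; rewrite ge0_integralZl// lee_fin. Qed.

Let intD (f g : R -> \bar R) : measurable_fun J f -> measurable_fun J g ->
  (forall t, (0 <= f t)%E) -> (forall t, (0 <= g t)%E) ->
  (\int[leb]_(t in J) (f t + g t) = \int[leb]_(t in J) f t + \int[leb]_(t in J) g t)%E.
Proof. by move=> mf mg f0 g0; rewrite ge0_integralD. Qed.

Let mZ (f : R -> \bar R) (c : R) : measurable_fun J f -> measurable_fun J (fun t => c%:E * f t)%E.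
Proof. by move=> mf; apply: emeasurable_funM => //; exact: measurable_cst. Qed.

Let mD (f g : R -> \bar R) : measurable_fun J f -> measurable_fun J g ->
  measurable_fun J (fun t => f t + g t)%E.
Proof. by move=> mf mg; exact: emeasurable_funD. Qed.

Lemma energyZ (a : R) w : rc w -> (energy (a *: w) <= (`|a| `^ q)%:E * energy w)%E.
Proof.
move=> rw; rewrite -(intZ (density_measurable rw) (fun t => density_ge0 (w t)) (powR_ge0 _ _)).
by apply: le_integral_ge0 => t _; [exact: density_ge0|exact: densityZ].
Qed.

Lemma energyD w w' : rc w -> rc w' -> (energy (w + w')%R <= (2 `^ q)%:E * (energy w + energy w'))%E.
Proof.
move=> rw rw'; have mw := density_measurable rw; have mw' := density_measurable rw'.
have D0 (v : R -> U -> R) t : (0 <= density (v t))%E := density_ge0 _.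
rewrite -(intD mw mw' (D0 w) (D0 w')) -(intZ (mD mw mw') _ (powR_ge0 2 q)); last first.
  by move=> t; exact: adde_ge0.
by apply: le_integral_ge0 => t _; [exact: density_ge0|exact: densityD].
Qed.

Lemma rcZ (a : R) w : rc w -> rc (a *: w).
Proof. by move=> rw; rewrite -[a *: w]addr0; apply: rc_lin => //; exact: rc_cst. Qed.

Lemma rcD w w' : rc w -> rc w' -> rc (w + w').
Proof. by move=> rw rw'; rewrite -[w]scale1r; exact: rc_lin. Qed.

Lemma rcB w w' : rc w -> rc w' -> rc (w - w').
Proof. by move=> rw rw'; rewrite addrC -scaleN1r; exact: rc_lin. Qed.

Lemma energy_mid w w' : rc w -> rc w' ->
  (energy (2^-1 *: (w + w')) <= 2^-1%:E * energy w + 2^-1%:E * energy w')%E.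
Proof.
move=> rw rw'; have mw := density_measurable rw; have mw' := density_measurable rw'.
have D0 (v : R -> U -> R) t : (0 <= density (v t))%E := density_ge0 _.
have h0 : 0 <= (2^-1 : R) by rewrite invr_ge0.
have z0 (v : R -> U -> R) t : (0 <= 2^-1%:E * density (v t))%E by rewrite mule_ge0// density_ge0.
rewrite /energy -(intZ mw (D0 w) h0) -(intZ mw' (D0 w') h0).
rewrite -(intD (mZ 2^-1 mw) (mZ 2^-1 mw') (z0 w) (z0 w')).
apply: le_integral_ge0 => t _; first exact: density_ge0.
by have [dl _ H] := density_convex ltr01; have [] := H (w t) (w' t).
Qed.

Lemma energy_convex (e : R) : 0 < e -> exists2 dl, 0 < dl & forall w w', rc w -> rc w' ->
  (dl%:E * energy (2^-1 *: (w - w')) + energy (2^-1 *: (w + w')) <=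
   (1 + dl * e)%:E * (2^-1%:E * energy w + 2^-1%:E * energy w'))%E.
Proof.
move=> e0; have [dl dl0 H] := density_convex e0; exists dl => // w w' rw rw'.
have m1 := density_measurable (rcZ 2^-1 (rcB rw rw')).
have m2 := density_measurable (rcZ 2^-1 (rcD rw rw')).
have mw := density_measurable rw; have mw' := density_measurable rw'.
have i2 : (0 <= (2^-1 : R)%:E)%E by rewrite lee_fin invr_ge0.
have D0 (v : R -> U -> R) t : (0 <= density (v t))%E := density_ge0 _.
have h0 : 0 <= (2^-1 : R) by rewrite invr_ge0.
have c0 : 0 <= 1 + dl * e by rewrite addr_ge0// mulr_ge0// ltW.
have z0 (c : R) (v : R -> U -> R) : 0 <= c -> forall t, (0 <= c%:E * density (v t))%E.
  by move=> c0' t; rewrite mule_ge0// density_ge0.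
rewrite /energy -(intZ m1 (D0 _) (ltW dl0)) -(intZ mw (D0 w) h0) -(intZ mw' (D0 w') h0).
rewrite -(intD (mZ dl m1) m2 (z0 dl _ (ltW dl0)) (D0 _)).
rewrite -(intD (mZ 2^-1 mw) (mZ 2^-1 mw') (z0 2^-1 w h0) (z0 2^-1 w' h0)).
rewrite -(intZ (mD (mZ 2^-1 mw) (mZ 2^-1 mw')) _ c0); last first.
  by move=> t; apply: adde_ge0; exact: z0.
apply: le_integral_ge0 => t _; last exact: (H (w t) (w' t)).1.
by apply: adde_ge0; [apply: z0; exact: ltW|exact: density_ge0].
Qed.

Lemma energy_fatou (v : nat -> R -> U -> R) u (C : \bar R) N : (forall k, rc (v k)) -> rc u ->
  {ae leb, forall t, 0 <= t <= T -> pointwise_cvg (v ^~ t) (u t)} ->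
  (forall k, (N <= k)%N -> (energy (v k) <= C)%E) -> (energy u <= C)%E.
Proof.
move=> rv ru vu vC.
apply: (@fatou_le _ _ _ leb J (fun k t => density (v k t)) (fun t => density (u t)) C N) => //.
- by move=> k; exact: density_measurable.
- exact: density_measurable.
- by move=> k t _; exact: density_ge0.
- by move=> t _; exact: density_ge0.
apply: (ae_leb_imp vu) => t h It r rt; have {}h : pointwise_cvg (v ^~ t) (u t).
  by apply: h; move: It; rewrite /J/= in_itv.
apply: contrapT => /forallNP H.
have /choice[k kP] : forall M : nat, exists k, (M <= k)%N /\ (density (v k t) <= r%:E)%E.
  move=> M; apply: contrapT => H'; apply: (H M) => k Mk; rewrite leNgt; apply/negP => /ltW hk.
  by apply: H'; exists k.
have := @density_closed (fun M => v (k M) t) (u t) r (fun M => (kP M).2).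
rewrite leNgt rt => /(_ _)/negP; apply => // x e e0.
have [K HK] := h x e e0; exists K => M KM; apply: HK.
exact: leq_trans (kP M).1.
Qed.

(** [mazur] gives convex combinations [y n] of tails that are Cauchy in energy. They inherit the
    pointwise convergence to [u], so Fatou's lemma in the second index bounds the energy of
    [y N - u]. *)
Lemma energy_mazur (v : nat -> R -> U -> R) u (C : R) : (forall k, rc (v k)) -> rc u ->
  {ae leb, forall t, 0 <= t <= T -> pointwise_cvg (v ^~ t) (u t)} ->
  (forall k, (energy (v k) <= C%:E)%E) ->
  forall e, 0 < e -> exists y, [/\ hull v 0 y, rc y & (energy (y - u)%R <= e%:E)%E].
Proof.
move=> rv ru vu vC e e0.
have C0 : 0 <= C by rewrite -lee_fin; apply: le_trans (vC 0%N); exact: energy_ge0.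
have hP a : hull v 0 a -> rc a /\ (energy a <= C%:E)%E.
  move=> ha; apply: (hull_ind_pred (P := fun a => rc a /\ (energy a <= C%:E)%E) _ _ ha).
    by move=> k _; split.
  move=> {ha}a b [ra Ea] [rb Eb]; split; first by apply: rcZ; exact: rcD.
  apply: le_trans (energy_mid ra rb) _; rewrite (_ : C%:E = (2^-1 * C + 2^-1 * C)%:E).
    by apply: lee_fin_comb; rewrite ?invr_ge0.
  by congr EFin; field.
have hE a : hull v 0 a -> energy a = (fine (energy a))%:E /\ 0 <= fine (energy a) <= C.
  by move=> /hP[_ Ea]; have [r Er r0] := fin_le (energy_ge0 a) Ea; rewrite Er.
have [|e1 e10|y hy yC] := mazur (x := v) (G := fun a => fine (energy a)) (C := C).
- by move=> a /hE[].
- have [dl dl0 H] := energy_convex e10; exists dl => // a b ha hb.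
  have [[ra Ea] [rb Eb]] := (hP a ha, hP b hb).
  have [[Fa _] [Fb _]] := (hE a ha, hE b hb).
  have [Fm _] := hE _ (hull_mid ha hb).
  have := H a b ra rb; rewrite Fa Fb Fm.
  have [r Er r0] : exists2 r : R, energy (2^-1 *: (a - b)) = r%:E & 0 <= r.
    apply: fin_lt; first exact: energy_ge0.
    apply: le_lt_trans (energyZ _ (rcB ra rb)) _.
    apply: lte_mul_pinfty; [by rewrite lee_fin powR_ge0|by []|].
    rewrite -scaleN1r addrC; apply: le_lt_trans (energyD (rcZ _ rb) ra) _.
    apply: lte_mul_pinfty; [by rewrite lee_fin powR_ge0|by []|].
    rewrite lte_add_pinfty//; last exact: le_lt_trans Ea (ltry _).
    apply: le_lt_trans (energyZ _ rb) _; rewrite normrN normr1 powR1 mul1e.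
    exact: le_lt_trans Eb (ltry _).
  rewrite Er /= => h.
  have {}h : ((dl * r + fine (energy (2^-1 *: (a + b))))%:E <=
    ((1 + dl * e1) * (2^-1 * fine (energy a) + 2^-1 * fine (energy b)))%:E)%E := h.
  by rewrite lee_fin -mulrDr [2^-1 * _]mulrC in h.
(* [mazur] controls half the differences; doubling costs the factor [2^q]. *)
pose c := 2 `^ q; have c0 : 0 < c by rewrite powR_gt0.
have e1 : 0 < e / c by rewrite divr_gt0.
have [N HN] := yC _ e1.
have hy0 n : hull v 0 (y n) := hullS (leq0n n) (hy n).
have ry n : rc (y n) by have [] := hP _ (hy0 n).
exists (y N); split => //.
have half : (energy (2^-1 *: (y N - u)) <= (e / c)%:E)%E.
  apply: (@energy_fatou (fun k => 2^-1 *: (y N - y k)) _ _ N).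
  - by move=> k; apply: rcZ; exact: rcB.
  - by apply: rcZ; exact: rcB.
  - apply: (ae_leb_imp vu) => t h tT x e2 e20; have [K HK] := h tT x _ e20.
    exists K => k Kk.
    have hk : `|y k t x - u t x| <= e2.
      apply: (hull_ind_pred (P := fun a => `|a t x - u t x| <= e2) _ _ (hy k)).
        by move=> i ki; apply: HK; exact: leq_trans ki.
      move=> a b ha hb; rewrite !fctE /GRing.scale/=.
      rewrite (_ : _ - _ = 2^-1 * ((a t x - u t x) + (b t x - u t x))); last by field.
      rewrite normrM ger0_norm ?invr_ge0//; have := ler_normD (a t x - u t x) (b t x - u t x); lra.
    rewrite !fctE /GRing.scale/=.
    rewrite (_ : _ - _ = 2^-1 * - (y k t x - u t x)); last by ring.
    rewrite normrM ger0_norm ?invr_ge0// normrN; have := normr_ge0 (y k t x - u t x); lra.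
  - move=> k Nk; have := HN N k (leqnn N) Nk.
    have [r Er r0] : exists2 r : R, energy (2^-1 *: (y N - y k)) = r%:E & 0 <= r.
      apply: fin_lt; first exact: energy_ge0.
      have [_ Ea] := hP _ (hy0 N); have [_ Eb] := hP _ (hy0 k).
      apply: le_lt_trans (energyZ _ (rcB (ry N) (ry k))) _.
      apply: lte_mul_pinfty; [by rewrite lee_fin powR_ge0|by []|].
      rewrite -scaleN1r addrC; apply: le_lt_trans (energyD (rcZ _ (ry k)) (ry N)) _.
      apply: lte_mul_pinfty; [by rewrite lee_fin powR_ge0|by []|].
      rewrite lte_add_pinfty//; last exact: le_lt_trans Ea (ltry _).
      apply: le_lt_trans (energyZ _ (ry k)) _; rewrite normrN normr1 powR1 mul1e.
      exact: le_lt_trans Eb (ltry _).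
    by rewrite Er /= lee_fin.
rewrite (_ : y N - u = 2 *: (2^-1 *: (y N - u))); last by rewrite scalerA divff ?scale1r ?pnatr_eq0.
apply: le_trans (energyZ _ (rcZ _ (rcB (ry N) ru))) _.
apply: le_trans (lee_fin_mul (powR_ge0 _ _) half) _.
by rewrite ger0_norm// lee_fin mulrC divfK// gt_eqF.
Qed.

End energy.

(** * Limits of paths along ultrafilters *)

Section ultrafilters.
Context {X : Type} {F : set_system X}.

Lemma filter_all_mem {I : eqType} (s : seq I) (P : I -> set X) : Filter F ->
  (forall y, y \in s -> F (P y)) -> F [set v | forall y, y \in s -> P y v].
Proof.
move=> FF; elim: s => [|y s IH] h; first by apply: filterS filterT => v _ y; rewrite in_nil.
have h1 := h y (mem_head y s).
have h2 : F [set v | forall z, z \in s -> P z v].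
  by apply: IH => z zs; apply: h; rewrite in_cons zs orbT.
apply: filterS (filterI h1 h2) => v [p1 p2] z; rewrite in_cons => /orP[/eqP ->//|]; exact: p2.
Qed.

Lemma filter_all_leq n (P : nat -> set X) : Filter F ->
  (forall i, (i <= n)%N -> F (P i)) -> F [set v | forall i, (i <= n)%N -> P i v].
Proof.
move=> FF h; have := @filter_all_mem _ (iota 0 n.+1) P FF.
move=> H; apply: filterS (H _) => [v hv i ni|i]; first by apply: hv; rewrite mem_iota.
by rewrite mem_iota => /andP[_]; exact: h.
Qed.

Lemma ultra_bounded_lim {R : realType} (f : X -> R) (M : R) : UltraFilter F ->
  F [set v | `|f v| <= M] -> exists l, forall e, 0 < e -> F [set v | `|f v - l| <= e].
Proof.
move=> UF FM.
have [|l [_ cl]] := @segment_compact R (- M) M (f @ F) _.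
- change (F [set v | `[- M, M]%classic (f v)]); apply: filterS FM.
  by move=> v h; rewrite /= in_itv/= -ler_norml.
- exists l => e e0; have [//|nF] := in_ultra_setVsetC [set v | `|f v - l| <= e] UF.
  have /cl/(_ (nbhsx_ballx l e e0)) : (f @ F) (~` [set y | `|y - l| <= e]) by [].
  by move=> [y [/= h1]]; rewrite /ball/= distrC => h2; exfalso; apply: h1; exact: ltW.
Qed.

End ultrafilters.

Section good_paths.
Context {R : realType} {d : nat} {Om : set 'rV[R]_d} {m : R} {U : normedModType R} {T q : R}.
Variable j : U -> vfield R d.
Hypotheses (oOm : open Om) (m1 : 1 < m) (dce : dense_compact_embedding Om m j).
Hypotheses (T0 : 0 < T) (q1 : 1 < q).
Implicit Types (l : U -> R) (w u : R -> U -> R) (x : U) (v : nat -> R -> U -> R).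
Local Notation leb := (@lebesgue_measure R).
Local Notation QH := (@QH R d Om U j).
Local Notation QV := (@QV R d Om U j).
Local Notation dn := (@dual_norm R U).
Local Notation energy := (@energy R U T q QV).
Local Notation close := (skorokhod_within (T := T) dn).
Local Notation regulated := (regulated (T := T)).
Local Notation rc := (rc (T := T)).
Let qQV : quadratic setT QV := quadratic_QV oOm m1 dce.
Let cQV := QV_closed oOm m1 dce.

Lemma QH_dual l (C : R) : (QH l <= C%:E)%E -> dual l.
Proof.
move=> h; have /(QH_in_H (Om := Om) (j := j) oOm m1 dce)[h' Hh ->] := le_lt_trans h (ltry C).
by apply: (emb_dual oOm m1 dce); exact: Hsp_L2.
Qed.

(* The sequence [D] fixes a gap for each oscillation level 1/(p+1); such uniform gaps are what makes
   the partitions converge along an ultrafilter. *)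
Record good (C1 C2 : R) (D : nat -> R) w : Prop := Good {
  good_QH : forall t, 0 <= t <= T -> (QH (w t) <= C1%:E)%E;
  good_osc : forall p : nat, exists n a, subdivision T (D p) n a /\ osc_le w p.+1%:R^-1 n a;
  good_energy : (energy w <= C2%:E)%E;
  good_off : forall t, ~~ (0 <= t <= T) -> w t = 0 }.

Lemma osc_regulated D w :
  (forall p : nat, exists n a, subdivision T (D p) n a /\ osc_le w p.+1%:R^-1 n a) -> regulated w.
Proof.
move=> h e e0; have [p hp] := exists_natSinv_lt e0.
have [n [a [sa oa]]] := h p; exists n, a; split; first exact: subdivision_strict sa.
move=> i ni s t h1 h2 h3; apply: le_trans (oa i ni s t h1 h2 h3) _.
by rewrite lee_fin ltW.
Qed.

Lemma good_regulated C1 C2 D w : good C1 C2 D w -> regulated w.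
Proof. by move=> [_ h _ _]; exact: osc_regulated h. Qed.

Lemma good_dual C1 C2 D w t : good C1 C2 D w -> 0 <= t <= T -> dual (w t).
Proof. by move=> [h _ _ _] tT; exact: QH_dual (h t tT). Qed.

Lemma good_cadlag C1 C2 D w : good C1 C2 D w -> cadlag T (@dual _ U) dn w.
Proof.
move=> g; apply: regulated_cadlag => //; last exact: good_regulated g.
by move=> t; exact: good_dual g.
Qed.

Lemma good_rc C1 C2 D w : good C1 C2 D w -> rc w.
Proof. by move=> g; apply: cadlag_rc; exact: good_cadlag g. Qed.

Lemma good_in_H C1 C2 D w t : good C1 C2 D w -> 0 <= t <= T -> in_H Om j (w t).
Proof. by move=> [h _ _ _] tT; apply/(QH_in_H oOm m1 dce); exact: le_lt_trans (h t tT) (ltry _). Qed.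

Lemma close_pointwise u v t : (forall s, 0 <= s <= T -> linear_form (u s)) ->
  (forall k s, 0 <= s <= T -> linear_form (v k s)) -> 0 <= t <= T ->
  (forall k, close u (v k) k.+1%:R^-1) -> exists2 s : nat -> R, (forall k, 0 <= s k <= T) &
  pointwise_cvg (fun k => v k (s k)) (u t).
Proof.
move=> lu lv tT cuv.
have /choice[s sP] : forall k, exists s, 0 <= s <= T /\ (dn (v k s - u t)%R <= (k.+1%:R^-1)%:E)%E.
  move=> k; have [lam tl hl] := cuv k; exists (lam t); split; first exact: time_change_range.
  by rewrite dual_normBC; have [] := hl t tT.
exists s; first by move=> k; have [] := sP k.
apply: dual_cvg_pointwise; first by move=> k; apply: lv; have [] := sP k.
  exact: lu.
move=> e e0; have [K HK] := exists_natSinv_lt e0; exists K => k Kk.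
have [_ h] := sP k; apply: le_trans h _; rewrite lee_fin; apply: ltW; apply: le_lt_trans HK.
by rewrite lef_pV2 ?posrE// ler_nat.
Qed.

(** Pull the partition back by [lam], so that [lam (b i) = a i]. Two values of [u] are each within
    [r] of values of [w], and each [b i] is within [r] of [a i]; this explains both terms
    [2 * r]. *)
Lemma osc_transfer u w lam (r e : R) n a : time_change T lam -> 0 <= r ->
  (forall t, 0 <= t <= T -> `|lam t - t| <= r /\ (dn (u t - w (lam t))%R <= r%:E)%E) ->
  strict_subdivision (T := T) n a -> osc_le w e n a ->
  exists b, [/\ strict_subdivision (T := T) n b, osc_le u (e + 2 * r) n b &
    forall i, (i < n)%N -> a i.+1 - a i - 2 * r <= b i.+1 - b i].
Proof.
move=> tl r0 hl sa oa; have [a0 an ha] := sa.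
have /choice[b bP] : forall i, exists y, (i <= n)%N -> 0 <= y <= T /\ lam y = a i.
  move=> i; have [ni|ni] := leqP i n; last by exists 0.
  by have [y yT ly] := time_change_surj tl (subdivision_range sa ni); exists y.
have sb : strict_subdivision (T := T) n b.
  split.
  - have [h1 h2] := bP 0%N (leq0n n); apply/eqP; rewrite eq_le.
    have hT : 0 <= (0:R) <= T by rewrite lexx ltW.
    by rewrite -(time_change_le tl) // h2 a0 (time_change0 T0 tl) lexx; case/andP: h1.
  - have [h1 h2] := bP n (leqnn n); apply/eqP; rewrite eq_le.
    have hT : 0 <= T <= T by rewrite lexx ltW.
    by rewrite -[T <= _](time_change_le tl) // h2 an (time_changeT T0 tl) lexx; case/andP: h1 => _ ->.
  - move=> i ni; have [h1 h2] := bP i (ltnW ni); have [h3 h4] := bP i.+1 ni.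
    by rewrite -(time_change_lt tl)// h2 h4; exact: ha.
exists b; split => // i ni.
- move=> s t bs st tb.
  have [h1 h2] := bP i (ltnW ni); have [h3 h4] := bP i.+1 ni.
  case/andP: (h1) => p1 p2; case/andP: (h3) => p3 p4.
  have sT : 0 <= s <= T by rewrite (le_trans p1)//= (le_trans (ltW st))// (le_trans (ltW tb)).
  have tT : 0 <= t <= T by rewrite (le_trans p1 (le_trans bs (ltW st)))//= (le_trans (ltW tb)).
  have [_ hs] := hl s sT; have [_ ht] := hl t tT.
  rewrite (_ : e + 2 * r = r + (e + r)); last by ring.
  apply: (dual_norm_tri (l2 := w (lam t))) => //.
  apply: (dual_norm_tri (l2 := w (lam s))); last by rewrite dual_normBC.
  apply: (oa i ni); first by rewrite -h2 (time_change_le tl).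
    by rewrite (time_change_lt tl).
  by rewrite -h4 (time_change_lt tl).
- have [h1 h2] := bP i (ltnW ni); have [h3 h4] := bP i.+1 ni.
  have [q1' _] := hl _ h1; have [q2 _] := hl _ h3.
  move: q1' q2; rewrite h2 h4 !ler_norml => /andP[z1 z2] /andP[z3 z4].
  lra.
Qed.

Lemma good_lim C1 C2 D u v : (forall p, 0 < D p) ->
  (forall t, 0 <= t <= T -> dual (u t)) -> (forall t, ~~ (0 <= t <= T) -> u t = 0) ->
  (forall k, good C1 C2 D (v k)) -> (forall k, close u (v k) k.+1%:R^-1) ->
  good C1 C2 (fun p => D (2 * p).+1 / 2) u.
Proof.
move=> D0 du u0 gv cuv.
have osc (p : nat) : exists n a, subdivision T (D (2 * p).+1 / 2) n a /\ osc_le u p.+1%:R^-1 n a.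
  (* At index [2p+1] the oscillation is half of [1/(p+1)]. A radius [r] below both numbers makes
     [2 r] at most the other half, and also at most half of the gap. *)
  have g0 : 0 < Num.min (D (2 * p).+1 / 4) (4^-1 * p.+1%:R^-1).
    by rewrite lt_min divr_gt0 ?D0//= mulr_gt0// invr_gt0.
  have [k] := exists_natSinv_lt g0; rewrite lt_min => /andP[k1 k2].
  have [n [a [sa oa]]] := good_osc (gv k) (2 * p).+1.
  have [lam tl hl] := cuv k.
  have ri : 0 <= (k.+1%:R^-1 : R) by rewrite invr_ge0.
  have [b [sb ob gb]] := osc_transfer tl ri hl (subdivision_strict sa) oa.
  exists n, b; split.
    have [b0 bn hb] := sb; split => // i ni; split; first exact: hb.
    have [_ _ /(_ i ni)[_ ha]] := sa.
    have := gb i ni => {}gb; move: (k.+1%:R^-1) gb k1 => z gb k1; lra.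
  move=> i ni s t h1 h2 h3; apply: le_trans (ob i ni s t h1 h2 h3) _; rewrite lee_fin.
  have -> : (2 * p).+2%:R^-1 = 2^-1 * p.+1%:R^-1 :> R.
    by rewrite -invfM -natrM mulnS addnC addn2.
  by move: (k.+1%:R^-1) k2 => z k2; move: p.+1%:R^-1 k2 => y k2; lra.
have ru : regulated u := osc_regulated osc.
have rcu : rc u by apply: cadlag_rc; exact: regulated_cadlag.
have lu s : 0 <= s <= T -> linear_form (u s) by move=> /du[].
have lv k s : 0 <= s <= T -> linear_form (v k s) by move=> /(good_dual (gv k))[].
split=> //.
- move=> t tT; have [s sT hs] := close_pointwise lu lv tT cuv.
  by apply: (QH_closed oOm m1 dce) hs => k; exact: (good_QH (gv k)).
- apply: (energy_fatou (N := 0) T0 q1 qQV cQV (v := v)) => //.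
  + by move=> k; exact: good_rc (gv k).
  + apply: (ae_leb_imp (ae_close T0 ru cuv)) => t h tT.
    apply: dual_cvg_pointwise => [k||]; [exact: lv|exact: lu|exact: h].
  + by move=> k _; exact: good_energy (gv k).
Qed.

Lemma QH_dual_net (C e : R) : 0 < e -> exists s : seq U, forall l l' (b : R),
  (QH l <= C%:E)%E -> (QH l' <= C%:E)%E -> (forall y, y \in s -> `|l y - l' y| <= b) ->
  (dn (l - l')%R <= (b + e)%:E)%E.
Proof.
move=> e0; have [s [_ hs]] := dual_norm_finite oOm m1 dce (2 * C + 2 * C) e0.
exists s => l l' b lC lC' hb.
have /(QH_in_H (Om := Om) (j := j) oOm m1 dce)[h Hh Eh] := le_lt_trans lC (ltry C).
have /(QH_in_H (Om := Om) (j := j) oOm m1 dce)[h' Hh' Eh'] := le_lt_trans lC' (ltry C).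
rewrite Eh Eh' -(emb_sub oOm m1 dce); [|exact: Hsp_L2..].
apply: hs.
- by apply: subspaceB; [exact: subspace_L2|exact: Hsp_L2..].
- apply: (quadB_le (subspace_L2 oOm) (quadratic_L2 oOm (@subset_refl _ Om) (measurable_Om oOm))).
  + exact: Hsp_L2.
  + exact: Hsp_L2.
  + by move: lC; rewrite Eh (QH_emb oOm m1 dce).
  + by move: lC'; rewrite Eh' (QH_emb oOm m1 dce).
- by move=> y /hb; rewrite (emb_sub oOm m1 dce) ?Eh ?Eh'//; exact: Hsp_L2.
Qed.

Lemma QH_eval_bound (C : R) x : exists M : R, forall l, (QH l <= C%:E)%E -> `|l x| <= M.
Proof.
have [b Eb b0] : exists2 b : R, L2sq Om (j x) = b%:E & 0 <= b.
  apply: fin_lt; first exact: quad_ge0 (quadratic_L2 oOm (@subset_refl _ Om) (measurable_Om oOm)) _.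
  by have [] := j_L2 oOm m1 dce x.
exists (Num.sqrt (C * b)) => l lC.
have /(QH_in_H (Om := Om) (j := j) oOm m1 dce)[h Hh Eh] := le_lt_trans lC (ltry C).
rewrite Eh; apply: L2ip_bound => //; [exact: Hsp_L2|exact: j_L2 oOm m1 dce x| |by rewrite Eb].
by move: lC; rewrite Eh (QH_emb oOm m1 dce).
Qed.

(** Each evaluation is bounded, so it converges along the ultrafilter. Convergence in U' follows by
    comparing two members of the filter on a finite net, which controls all of the unit ball at
    once. *)
Lemma ultra_QH_lim {X : Type} (F : set_system X) (C : R) (f : X -> U -> R) : UltraFilter F ->
  F [set v | (QH (f v) <= C%:E)%E] -> exists g, (QH g <= C%:E)%E /\
    forall e, 0 < e -> F [set v | (dn (f v - g)%R <= e%:E)%E].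
Proof.
move=> UF FC.
have /choice[g gP] : forall x, exists y, forall e, 0 < e -> F [set v | `|f v x - y| <= e].
  move=> x; have [M hM] := QH_eval_bound C x; apply: (ultra_bounded_lim (M := M)).
  by apply: filterS FC => v; exact: hM.
have lf (v : X) : (QH (f v) <= C%:E)%E -> linear_form (f v) by move=> /QH_dual[].
have lg : linear_form g.
  move=> a x y; apply/eqP; rewrite -subr_eq0 -normr_eq0 eq_le normr_ge0 andbT.
  apply/ler_addgt0Pr => e e0; rewrite add0r.
  have a3 : 0 < `|a| + 2 by rewrite ltr_wpDl.
  have e1 : 0 < e / (`|a| + 2) by rewrite divr_gt0.
  have [v [[[h1 h2] h3] h4]] := filter_ex (filterI (filterI (filterI (gP x _ e1) (gP y _ e1))
    (gP (a *: x + y) _ e1)) FC).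
  rewrite /= in h1 h2 h3 h4; rewrite (lf _ h4) in h3.
  rewrite (_ : _ - _ = - (a * f v x + f v y - g (a *: x + y)) + (a * (f v x - g x) + (f v y - g y))); last by ring.
  apply: le_trans (ler_normD _ _) _; rewrite normrN.
  have h5 : `|a * (f v x - g x)| <= `|a| * (e / (`|a| + 2)) by rewrite normrM; exact: ler_wpM2l.
  apply: le_trans (lerD h3 (le_trans (ler_normD _ _) (lerD h5 h2))) _.
  rewrite le_eqVlt; apply/orP; left; apply/eqP; field; exact: lt0r_neq0.
have key e : 0 < e -> F [set v | (dn (f v - g)%R <= e%:E)%E].
  move=> e0; have e4 : 0 < e / 4 by rewrite divr_gt0.
  have [s hs] := QH_dual_net C e4.
  have FA : F [set v | forall y, y \in s -> `|f v y - g y| <= e / 4].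
    by apply: filter_all_mem => y _; exact: gP.
  apply: filterS (filterI FA FC) => v [/= vA vC]; apply: dual_norm_le => x x1.
  (* The intermediate [w] depends on [x] and is close to [g] there, while the bound on [f v - f w]
     is uniform in [x]: three quarters of [e] from the net and one from [w]. *)
  have [w [[wA wC] wx]] := filter_ex (filterI (filterI FA FC) (gP x _ e4)); rewrite /= in wA wC wx.
  have : (dn (f v - f w)%R <= (e / 4 + e / 4 + e / 4)%:E)%E.
    apply: hs => // y ys; rewrite (_ : _ - _ = (f v y - g y) - (f w y - g y)); last by ring.
    by apply: le_trans (ler_normB _ _) _; apply: lerD; [exact: vA|exact: wA].
  move=> h; have := le_trans (dual_norm_ge _ x1) h; rewrite lee_fin !fctE => h'.
  rewrite (_ : f v x - g x = (f v x - f w x) + (f w x - g x)); last by ring.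
  apply: le_trans (ler_normD _ _) _; lra.
exists g; split => //.
have /choice[v vP] : forall k : nat, exists v : X, (QH (f v) <= C%:E)%E /\ (dn (f v - g)%R <= (k.+1%:R^-1)%:E)%E.
  move=> k; have k0 : (0 : R) < k.+1%:R^-1 by rewrite invr_gt0.
  by have [v [h1 h2]] := filter_ex (filterI FC (key _ k0)); exists v.
apply: (QH_closed oOm m1 dce (l := fun k => f (v k))); first by move=> k; have [] := vP k.
apply: dual_cvg_pointwise => [k||e e0]; [by apply: lf; have [] := vP k|exact: lg|].
have [K HK] := exists_natSinv_lt e0; exists K => k Kk.
have [_ h] := vP k; apply: le_trans h _; rewrite lee_fin; apply: ltW; apply: le_lt_trans HK.
by rewrite lef_pV2 ?posrE// ler_nat.
Qed.

Lemma good_ultra C1 C2 D (F : set_system (R -> U -> R)) : (forall p, 0 < D p) -> UltraFilter F ->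
  F [set v | good C1 C2 D v] -> exists u, good C1 C2 (fun p => D (2 * p).+1 / 2) u /\
    forall e, 0 < e -> F [set v | close u v e].
Proof.
move=> D0 UF Fg.
have /choice[g gP] : forall t, exists g, 0 <= t <= T -> (QH g <= C1%:E)%E /\
    forall e, 0 < e -> F [set v | (dn (v t - g)%R <= e%:E)%E].
  move=> t; have [tT|] := boolP (0 <= t <= T); last by exists 0.
  have [|g gP] := ultra_QH_lim (F := F) (C := C1) (f := fun v : R -> U -> R => v t) UF _; last by exists g.
  by apply: filterS Fg => v hv; exact: (good_QH hv).
(* Gaps of at least [D p] leave at most [T / D p] cells. The number of cells is therefore constant
   on a set of the filter, and the partition points, finite in number and bounded, converge along
   it. *)
have part (p : nat) : exists n a, subdivision T (D p) n a /\ forall e, 0 < e ->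
    F [set v | exists b, [/\ subdivision T (D p) n b, osc_le v p.+1%:R^-1 n b &
      forall i, (i <= n)%N -> `|b i - a i| <= e]].
  have /choice[A AP] : forall w : R -> U -> R, exists A : nat * (nat -> R), good C1 C2 D w ->
      subdivision T (D p) A.1 A.2 /\ osc_le w p.+1%:R^-1 A.1 A.2.
    move=> w; have [gw|] := pselect (good C1 C2 D w); last by exists (0%N, fun=> 0).
    by have [n [a h]] := good_osc gw p; exists (n, a).
  have An w : good C1 C2 D w -> (A w).1%:R * D p <= T.
    move=> /AP[[a0 an ha] _]; rewrite -an.
    have : forall i, (i <= (A w).1)%N -> i%:R * D p <= (A w).2 i.
      elim=> [|i IH] ni; first by rewrite mul0r a0.
      have [_ h] := ha i ni; have := IH (ltnW ni); rewrite mulrS mulrDl mul1r; lra.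
    exact.
  have [|l lP] := @ultra_bounded_lim _ F R (fun w => (A w).1%:R) (T / D p) UF.
    by apply: filterS Fg => w /An h; rewrite /= ger0_norm// ler_pdivlMr.
  (* Two integers within 1/3 of the same limit are equal. *)
  have t0 : 0 < (3^-1 : R) by rewrite invr_gt0.
  have [w0 w0P] := filter_ex (lP _ t0); set n := (A w0).1 in w0P.
  have Fn : F [set w | (A w).1 = n].
    apply: filterS (lP _ t0) => w /= wP; apply/eqP; rewrite -(eqr_nat R).
    have h : `|(A w).1%:R - n%:R| <= (3^-1 + 3^-1 : R).
      rewrite (_ : _ - _ = ((A w).1%:R - l) - (n%:R - l)); last by ring.
      by apply: le_trans (ler_normB _ _) _; exact: lerD.
    rewrite -subr_eq0 -normr_le0; case: (ltngtP (A w).1 n) => nn.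
    - exfalso; move: h; rewrite distrC -natrB ?(ltnW nn)// normr_nat.
      have : (1 : R) <= (n - (A w).1)%:R by rewrite ler1n subn_gt0.
      lra.
    - exfalso; move: h; rewrite -natrB ?(ltnW nn)// normr_nat.
      have : (1 : R) <= ((A w).1 - n)%:R by rewrite ler1n subn_gt0.
      lra.
    - by rewrite nn subrr normr0.
  have FnA : F [set w | [/\ (A w).1 = n, subdivision T (D p) n (A w).2 & osc_le w p.+1%:R^-1 n (A w).2]].
    by apply: filterS (filterI Fn Fg) => w [/= nw /AP[]]; rewrite nw.
  have /choice[a aP] : forall i, exists y : R, (i <= n)%N -> forall e, 0 < e -> F [set w | `|(A w).2 i - y| <= e].
    move=> i; have [ni|] := leqP i n; last by exists 0.
    have [|y yP] := @ultra_bounded_lim _ F R (fun w => (A w).2 i) T UF; last by exists y.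
    apply: filterS FnA => w [_ sw _] /=.
    by have /andP[h1 h2] := subdivision_range (subdivision_strict sw) ni; rewrite ger0_norm.
  have eq0 (x : R) : (forall e, 0 < e -> `|x| <= e) -> x = 0.
    move=> h; apply/eqP; rewrite -normr_eq0 eq_le normr_ge0 andbT.
    by apply/ler_addgt0Pr => e e0; rewrite add0r h.
  have sa : subdivision T (D p) n a.
    split.
    - apply: eq0 => e e0; have [w [h [_ [h1 _ _] _]]] := filter_ex (filterI (aP 0%N (leq0n n) e e0) FnA).
      by move: h; rewrite /= h1 sub0r normrN.
    - apply/eqP; rewrite -subr_eq0; apply/eqP; apply: eq0 => e e0.
      have [w [h [_ [_ h1 _] _]]] := filter_ex (filterI (aP n (leqnn n) e e0) FnA).
      by move: h; rewrite /= h1 distrC.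
    - move=> i ni; suff h : D p <= a i.+1 - a i by split => //; have := D0 p; lra.
      apply/ler_addgt0Pr => e e0; have e2 : 0 < e / 2 by rewrite divr_gt0.
      have [w [[/= h1 h2] [_ [_ _ /(_ i ni)[_ h3]] _]]] :=
        filter_ex (filterI (filterI (aP i (ltnW ni) _ e2) (aP i.+1 ni _ e2)) FnA).
      move: h1 h2; rewrite !ler_norml => /andP[h1 h1'] /andP[h2 h2']; lra.
  exists n, a; split => // e e0.
  have FA : F [set w | forall i, (i <= n)%N -> `|(A w).2 i - a i| <= e].
    by apply: filter_all_leq => i ni; exact: aP.
  by apply: filterS (filterI FA FnA) => w [/= h [_ h1 h2]]; exists (A w).2.
have /choice[B BP] : forall p : nat, exists B : nat * (nat -> R), subdivision T (D p) B.1 B.2 /\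
    forall e, 0 < e -> F [set v | exists b, [/\ subdivision T (D p) B.1 b, osc_le v p.+1%:R^-1 B.1 b &
      forall i, (i <= B.1)%N -> `|b i - B.2 i| <= e]].
  by move=> p; have [n [a h]] := part p; exists (n, a).
have sB p : strict_subdivision (T := T) (B p).1 (B p).2 by have [/subdivision_strict] := BP p.
have p0 (p : nat) : 0 <= p.+1%:R^-1 :> R by rewrite invr_ge0.
have inT p i c : (i < (B p).1)%N -> (B p).2 i < c < (B p).2 i.+1 -> 0 <= c <= T.
  move=> ni /andP[h1 h2]; have /andP[h3 _] := subdivision_range (sB p) (ltnW ni).
  have /andP[_ h4] := subdivision_range (sB p) ni.
  by rewrite (le_trans h3 (ltW h1)) (le_trans (ltW h2) h4).
have gd t : 0 <= t <= T -> dual (g t) by move=> /gP[/QH_dual].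
(* Only for points strictly inside a limit cell: such points lie in the corresponding cell of nearby
   paths, whereas a limit partition point may fall on either side. The margin [eta] expresses
   this. *)
have gosc p i s t : (i < (B p).1)%N -> (B p).2 i < s < (B p).2 i.+1 -> (B p).2 i < t < (B p).2 i.+1 ->
    (dn (g t - g s)%R <= (p.+1%:R^-1)%:E)%E.
  move=> ni hs ht; apply/lee_addgt0Pr => e e0; rewrite -EFinD.
  have e2 : 0 < e / 2 by rewrite divr_gt0.
  have [_ sT] := gP s (inT p i s ni hs); have [_ tT] := gP t (inT p i t ni ht).
  case/andP: (hs) => s1 s2; case/andP: (ht) => t1 t2.
  set eta := Num.min (Num.min (s - (B p).2 i) ((B p).2 i.+1 - s)) (Num.min (t - (B p).2 i) ((B p).2 i.+1 - t)).
  have eta0 : 0 < eta by rewrite !lt_min !subr_gt0 s1 s2 t1 t2.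
  have [_ /(_ (eta / 2) (divr_gt0 eta0 (ltr0n _ 2)))FB] := BP p.
  have [w [[ws wt] [b [_ ob hb]]]] := filter_ex (filterI (filterI (sT _ e2) (tT _ e2)) FB).
  have etal : eta / 2 < eta by rewrite ltr_pdivrMr// ltr_pMr// ltr1n.
  rewrite /= in ws wt.
  have {}hb (i' : nat) : (i' <= (B p).1)%N -> `|b i' - (B p).2 i'| < eta.
    by move=> /hb h; exact: le_lt_trans h etal.
  have := hb i (ltnW ni); have := hb i.+1 ni; rewrite /eta !lt_min !ltr_norml.
  move=> /andP[/andP[_ /andP[z1 _]] /andP[_ /andP[z2 _]]].
  move=> /andP[/andP[/andP[_ z3] _] /andP[/andP[_ z4] _]].
  have bs : b i <= s < b i.+1 by apply/andP; split; lra.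
  have bt : b i <= t < b i.+1 by apply/andP; split; lra.
  have := osc_le_sym (p0 p) ob ni bs bt => h.
  rewrite (_ : p.+1%:R^-1 + e = e / 2 + (p.+1%:R^-1 + e / 2)); last by rewrite addrCA -splitr.
  apply: (dual_norm_tri (l2 := w t)); first by rewrite dual_normBC.
  exact: (dual_norm_tri h ws).
pose tk t (k : nat) := t + (T - t) / k.+2%:R.
(* The pointwise limit [g] need not be right-continuous at the limit partition points. The path [u]
   is therefore taken as its limit along these points, which decrease to [t]. *)
have tkT t k : 0 <= t < T -> 0 <= tk t k <= T.
  move=> /andP[t0 tT]; have d0 : 0 <= T - t by rewrite subr_ge0 ltW.
  rewrite /tk addr_ge0 ?divr_ge0//=; rewrite addrC -lerBrDr ler_pdivrMr//.
  by rewrite ler_peMr// ler1n.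
have tk_near p i t : (i < (B p).1)%N -> (B p).2 i <= t < (B p).2 i.+1 -> exists K : nat, forall k, (K <= k)%N ->
    (B p).2 i < tk t k < (B p).2 i.+1.
  move=> ni /andP[h1 h2]; have /andP[_ h3] := subdivision_range (sB p) ni.
  have d0 : 0 < T - t by rewrite subr_gt0 (lt_le_trans h2).
  have d1 : 0 < (B p).2 i.+1 - t by rewrite subr_gt0.
  have [K HK] := exists_natSinv_lt (divr_gt0 d1 d0).
  exists K => k Kk; rewrite /tk; apply/andP; split.
    by apply: (le_lt_trans h1); rewrite ltrDl divr_gt0.
  rewrite addrC -ltrBrDr mulrC -ltr_pdivlMr//; apply: le_lt_trans HK.
  by rewrite lef_pV2 ?posrE// ler_nat; exact: leq_trans Kk (leqnSn _).
have /choice[u uP] : forall t, exists l, [/\ 0 <= t < T -> dual l /\ forall e, 0 < e -> exists K : nat,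
      forall k, (K <= k)%N -> (dn (g (tk t k) - l)%R <= e%:E)%E,
    t = T -> l = g T & ~~ (0 <= t <= T) -> l = 0].
  move=> t; have [tT|ntT] := boolP (0 <= t < T).
    have [|l [dl hl]] := @dual_complete _ _ (fun k => g (tk t k)) (fun k => gd _ (tkT t k tT)).
      move=> e e0; have [p hp] := exists_natSinv_lt e0.
      have [i ni hi] := subdivision_locate (sB p) tT.
      have [K HK] := tk_near p i t ni hi; exists K => k k' /HK h /HK h'.
      by apply: le_trans (gosc p i _ _ ni h' h) _; rewrite lee_fin ltW.
    case/andP: (tT) => t0 tT'; exists l; split => // [E|].
      by move: tT'; rewrite E ltxx.
    by rewrite t0 ltW.
  have [E|E] := eqVneq t T.
    by exists (g T); split => //; rewrite E lexx ltW.
  by exists 0; split => // E'; move: E; rewrite E' eqxx.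
have uapp p i s e : (i < (B p).1)%N -> (B p).2 i <= s < (B p).2 i.+1 -> 0 < e ->
    exists2 c, (B p).2 i < c < (B p).2 i.+1 & (dn (u s - g c)%R <= e%:E)%E.
  move=> ni hs e0; have [K HK] := tk_near p i s ni hs.
  have sT : 0 <= s < T.
    have /andP[h1 _] := subdivision_range (sB p) (ltnW ni); have /andP[_ h2] := subdivision_range (sB p) ni.
    by case/andP: hs => h3 h4; rewrite (le_trans h1 h3) (lt_le_trans h4 h2).
  have [/(_ sT)[_ /(_ e e0)[K' HK']] _ _] := uP s.
  exists (tk s (maxn K K')); first by apply: HK; rewrite leq_maxl.
  by rewrite dual_normBC; apply: HK'; rewrite leq_maxr.
have ug p i s c : (i < (B p).1)%N -> (B p).2 i <= s < (B p).2 i.+1 -> (B p).2 i < c < (B p).2 i.+1 ->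
    (dn (u s - g c)%R <= (p.+1%:R^-1)%:E)%E.
  move=> ni hs hc; apply/lee_addgt0Pr => e e0; rewrite -EFinD (addrC _ e).
  have [c' hc' h] := uapp p i s e ni hs e0.
  by apply: (dual_norm_tri (l2 := g c')) => //; exact: gosc ni hc hc'.
have uosc p : osc_le u p.+1%:R^-1 (B p).1 (B p).2.
  move=> i ni s t h1 h2 h3; apply/lee_addgt0Pr => e e0; rewrite -EFinD (addrC _ e).
  have ht : (B p).2 i <= t < (B p).2 i.+1 by rewrite h3 (le_trans h1 (ltW h2)).
  have hs : (B p).2 i <= s < (B p).2 i.+1 by rewrite h1 (lt_trans h2 h3).
  have [c hc h] := uapp p i t e ni ht e0.
  by apply: (dual_norm_tri (l2 := g c)) => //; rewrite dual_normBC; exact: ug ni hs hc.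
have ud t : 0 <= t <= T -> dual (u t).
  move=> /andP[t0]; rewrite le_eqVlt => /orP[/eqP tE|tT]; last first.
    by have [/(_ (introT andP (conj t0 tT)))[]] := uP t.
  by have [_ /(_ tE) -> _] := uP t; apply: gd; rewrite lexx ltW.
have Fclose e : 0 < e -> F [set v | close u v e].
  move=> e0; have e4 : 0 < e / 4 by rewrite divr_gt0.
  have [p hp] := exists_natSinv_lt e4.
  (* Testing [v] against [g] at the midpoints and at [T] is a finite set of conditions. The chain is
     [u t], [g (c i)], [v (c i)], [v (lam t)], each step costing at most [e / 4]. *)
  pose c i := ((B p).2 i + (B p).2 i.+1) / 2.
  have lB i : (i < (B p).1)%N -> (B p).2 i < (B p).2 i.+1 by move=> ni; have [_ _] := sB p; exact.
  have hc i : (i < (B p).1)%N -> (B p).2 i < c i < (B p).2 i.+1.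
    by move=> /lB h; rewrite /c ltr_pdivlMr// ltr_pdivrMr//; apply/andP; split; lra.
  have [BD FB] := BP p.
  have Fc : F [set v | forall i, (i <= (B p).1)%N -> (i < (B p).1)%N -> (dn (v (c i) - g (c i))%R <= (e / 4)%:E)%E].
    apply: (filter_all_leq (P := fun i => [set v : R -> U -> R | (i < (B p).1)%N ->
      (dn (v (c i) - g (c i))%R <= (e / 4)%:E)%E])) => i _.
    have [ni|_] := boolP (i < (B p).1)%N; last by apply: filterS filterT.
    have [_ h] := gP (c i) (inT p i _ ni (hc i ni)).
    by apply: filterS (h _ e4) => v hv _; exact: hv.
  have TT : 0 <= T <= T by rewrite lexx ltW.
  have FT : F [set v | (dn (v T - g T)%R <= (e / 4)%:E)%E] by have [_] := gP T TT; exact.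
  (* Displacements of at most a quarter of the gap keep each midpoint [c i] inside the cell of the
     partition [b] of [v]. *)
  pose eta := Num.min e (D p / 4); have eta0 : 0 < eta by rewrite lt_min e0 divr_gt0.
  apply: filterS (filterI (filterI Fc FT) (FB _ eta0)) => v [[/= vc vT] [b [sb ob hb]]].
  have hab i : (i <= (B p).1)%N -> `|b i - (B p).2 i| <= eta by exact: hb.
  have [lam [tl lt li]] := piecewise_time_change T0 (sB p) (subdivision_strict sb) hab.
  have ee : eta <= e by rewrite ge_min lexx.
  have eD : eta <= D p / 4 by rewrite ge_min lexx orbT.
  exists lam => // t tT; split; first exact: le_trans (lt t tT) ee.
  case/andP: (tT) => t0; rewrite le_eqVlt => /orP[/eqP tE|tT'].
    rewrite tE (time_changeT T0 tl); have [_ /(_ erefl) -> _] := uP T.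
    by rewrite dual_normBC; apply: le_trans vT _; rewrite lee_fin; lra.
  have [i ni hi] := subdivision_locate (sB p) (introT andP (conj t0 tT')).
  have /andP[l1 l2] := li i t ni hi.
  have h1 := le_trans (ug p i t (c i) ni hi (hc i ni)) (_ : _ <= (e / 4)%:E)%E.
  have {}h1 := h1 (_ : is_true _); rewrite lee_fin (ltW hp) in h1; have {}h1 := h1 isT.
  have h2 := vc i (ltnW ni) ni; rewrite dual_normBC in h2.
  have cb : b i <= c i < b i.+1.
    have [_ _ /(_ i ni)[_ BDi]] := BD.
    have := hab i (ltnW ni); have := hab i.+1 ni; rewrite !ler_norml => /andP[z1 z2] /andP[z3 z4].
    rewrite /c ler_pdivlMr// ltr_pdivrMr//; have := D0 p => D0p; apply/andP; split; lra.
  have h3 := osc_le_sym (p0 p) ob ni (_ : b i <= lam t < b i.+1) cb.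
  rewrite l1 l2 in h3; have {}h3 := le_trans (h3 isT) (_ : _ <= (e / 4)%:E)%E.
  rewrite lee_fin (ltW hp) in h3; have {}h3 := h3 isT.
  apply: le_trans (dual_norm_tri h1 (dual_norm_tri h2 h3)) _.
  by rewrite lee_fin; lra.
exists u; split => //.
have /choice[v vP] : forall k : nat, exists w : R -> U -> R, good C1 C2 D w /\ close u w k.+1%:R^-1.
  move=> k; have k0 : (0 : R) < k.+1%:R^-1 by rewrite invr_gt0.
  by have [w [h1 h2]] := filter_ex (filterI Fg (Fclose _ k0)); exists w.
apply: (@good_lim C1 C2 D u v) => // [t tT|k|k]; [|by have [] := vP k|by have [] := vP k].
by have [_ _] := uP t; apply.
Qed.

End good_paths.

Lemma ae_lt_pinfty {d} {X : measurableType d} {R : realType} (mu : measure X R) (D : set X)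
  (f : X -> \bar R) : measurable D -> measurable_fun D f -> (forall x, D x -> (0 <= f x)%E) ->
  (\int[mu]_(x in D) f x < +oo)%E -> {ae mu, forall x, D x -> (f x < +oo)%E}.
Proof.
move=> mD mf f0 fi; have If : mu.-integrable D f.
  apply/integrableP; split => //; rewrite (eq_integral f) // => x; rewrite inE => Dx.
  by rewrite gee0_abs// f0.
apply: filterS (integrable_ae mD If) => x h Dx; by have := h Dx; rewrite fin_numElt => /andP[].
Qed.

(** * Borel measurability, and membership of limit paths in Z_q *)

Section separable.
Context {R : realType} {d : nat} {T : R}.
Variables (S : set (vfield R d)) (Q : vfield R d -> \bar R) (D : nat -> vfield R d).
Hypotheses (sS : subspace S) (qQ : quadratic S Q) (DS : forall k, S (D k)).
Hypothesis dD : forall h, S h -> forall e : R, 0 < e -> exists k, (Q (h - D k)%R < e%:E)%E.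

Lemma lt_sqrt_quad (e : R) h : 0 < e -> (Q h < (e ^+ 2)%:E)%E -> (Q h `^ 2^-1 < e%:E)%E.
Proof.
move=> e0 h1; have [r Er r0] := fin_lt (quad_ge0 qQ h) (lt_trans h1 (ltry _)).
move: h1; rewrite Er poweR_EFin powR12_sqrt// !lte_fin => h1.
by rewrite -(@ltr_pXn2r _ 2) ?nnegrE ?sqrtr_ge0 ?(ltW e0)// sqr_sqrtr.
Qed.

(** By separability an open set is, within [S], the union of the balls of radius [1/(n+1)] around
    the [D k] that it contains; so balls alone need to be tested. *)
Lemma borel_valued_separable (v : R -> vfield R d) : (forall t, 0 <= t <= T -> S (v t)) ->
  (forall k (r : R), 0 < r -> measurable ([set t | 0 <= t <= T /\
     (Q (v t - D k)%R `^ 2^-1 < r%:E)%E] : set (measurableTypeR R))) ->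
  borel_valued T S (fun h => Q h `^ 2^-1)%E v.
Proof.
move=> vS mv; split=> // A oA.
pose B (kn : nat * nat) : set (measurableTypeR R) := [set t | 0 <= t <= T /\
  (Q (v t - D kn.1)%R `^ 2^-1 < (kn.2.+1%:R^-1)%:E)%E].
pose ok (kn : nat * nat) := forall g, S g ->
  (Q (g - D kn.1)%R `^ 2^-1 < (kn.2.+1%:R^-1)%:E)%E -> A g.
rewrite (_ : [set t | _] = \bigcup_(kn in ok) B kn).
  rewrite bigcup_mkcond; apply: countable_bigcupT_measurable => [|kn]; first exact: countableP.
  by case: ifPn => _ //; apply: mv; rewrite invr_gt0.
apply/seteqP; split=> [t [tT At]|t [kn okn [tT ht]]]; last first.
  by split => //; apply: okn => //; exact: vS.
have St := vS t tT.
have [r r0 hr] := oA _ St At; have r2 : 0 < r / 2 by rewrite divr_gt0.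
have [n hn] := exists_natSinv_lt r2.
have n0 : 0 < (n.+1%:R^-1 : R) by rewrite invr_gt0.
have n20 : 0 < (n.+1%:R^-1 ^+ 2 : R) by rewrite exprn_gt0.
have [k hk] := dD St n20; have {}hk := lt_sqrt_quad n0 hk.
exists (k, n); last by split.
move=> g Sg /= hg; apply: hr => //.
have -> : (g \- v t)%R = (g - D k) + (D k - v t).
  by rewrite (_ : (g \- v t) = g - v t)// addrA subrK.
have S1 : S (g - D k) by exact: subspaceB.
have S2 : S (D k - v t) by exact: subspaceB.
apply: le_lt_trans (quad_triangle qQ S1 S2) _.
rewrite [X in (_ + X `^ _)%E](quadBC sS qQ) //.
apply: lt_le_trans (lteD hg hk) _; rewrite -EFinD lee_fin.
by move: (n.+1%:R^-1) hn => z hn; lra.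
Qed.

End separable.

Section good_Zq.
Context {R : realType} {d : nat} {Om : set 'rV[R]_d} {Om_ : nat -> set 'rV[R]_d} {m : R}
  {U : normedModType R} {T q : R}.
Variable j : U -> vfield R d.
Hypotheses (oOm : open Om) (m1 : 1 < m) (dce : dense_compact_embedding Om m j).
Hypotheses (T0 : 0 < T) (q1 : 1 < q).
Hypothesis OmP : forall n, [/\ open (Om_ n), bounded_set (Om_ n) & Om_ n `<=` Om].
Implicit Types (l : U -> R) (w u : R -> U -> R) (x : U) (h : vfield R d).
Local Notation leb := (@lebesgue_measure R).
Local Notation QH := (@QH R d Om U j).
Local Notation QV := (@QV R d Om U j).
Local Notation QA := (@QA R d Om U j).
Local Notation dn := (@dual_norm R U).
Local Notation energy := (@energy R U T q QV).
Local Notation close := (skorokhod_within (T := T) dn).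
Local Notation rc := (rc (T := T)).
Local Notation good := (@good R d Om U T q j).
Let q0 : 0 < q := lt_trans ltr01 q1.
Let qQV : quadratic setT QV := quadratic_QV oOm m1 dce.
Let qQH : quadratic setT QH := quadratic_QH oOm m1 dce.
Let cQV := QV_closed oOm m1 dce.
Let cQH := QH_closed oOm m1 dce.
Let qL2 : quadratic (Hsp Om) (L2sq Om).
Proof.
apply: quadratic_sub (quadratic_L2 oOm (@subset_refl _ Om) (measurable_Om oOm)).
exact: Hsp_L2.
Qed.
Let qH1 : quadratic (Vsp Om) (H1sq Om).
Proof. by apply: quadratic_sub (quadratic_H1sq oOm); exact: Vsp_L2. Qed.
Let J : set (measurableTypeR R) := `[0, T]%classic.
Let mJ : measurable J. Proof. exact: measurable_itv. Qed.

Let JE t : J t = (0 <= t <= T). Proof. by rewrite /J/= in_itv. Qed.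

Lemma measurable_path_dist (Q : (U -> R) -> \bar R) w l0 (r : R) : rc w -> quadratic setT Q ->
  (forall (l : nat -> U -> R) l0 (r : R), (forall k, (Q (l k) <= r%:E)%E) ->
    pointwise_cvg l l0 -> (Q l0 <= r%:E)%E) ->
  measurable (J `&` [set t | (Q (w t - l0)%R `^ 2^-1 < r%:E)%E]).
Proof.
move=> rw qQ cQ; apply: emeasurable_fun_infty_o => //.
apply: (measurableT_comp (measurable_poweR 2^-1)).
apply: (measurable_path T0 (phi := fun l => Q (l - l0)) rw) => [l|l l' s ls ll].
  exact: (quad_ge0 qQ).
apply: cQ ls _ => x e /(ll x)[K HK]; exists K => k /HK; rewrite !fctE.
by rewrite (_ : _ - _ - _ = l k x - l' x)//; ring.
Qed.

Lemma Hnorm_rep_dist l h : in_H Om j l -> Hsp Om h -> L2sq Om (rep Om j l - h) = QH (l - emb Om j h).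
Proof.
move=> /repP[Hr Er] Hh; rewrite -{2}Er -(emb_sub oOm m1 dce); [|exact: Hsp_L2..].
by rewrite (QH_emb oOm m1 dce)//; exact: subspaceB (subspace_Hsp oOm) _ _.
Qed.

Lemma borel_Hsp w : rc w -> (forall t, 0 <= t <= T -> in_H Om j (w t)) ->
  borel_valued T (Hsp Om) (Hnorm Om) (fun t => rep Om j (w t)).
Proof.
move=> rw Hw; have [D [_ dD]] := j_separable oOm m1 dce.
apply: (borel_valued_separable (subspace_Hsp oOm) qL2 (D := fun k => j (D k))) => //.
- by move=> k; exact: (j_Hsp oOm m1 dce).
- by move=> t /Hw /repP[].
- move=> k r r0; rewrite (_ : [set t | _] = J `&` [set t | (QH (w t - emb Om j (j (D k)))%R `^ 2^-1 < r%:E)%E]).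
    exact: measurable_path_dist.
  apply/seteqP; split=> t; rewrite /= -/(J t) JE => -[tT]; rewrite Hnorm_rep_dist //;
    [exact: Hw|exact: (j_Hsp oOm m1 dce)|exact: Hw|exact: (j_Hsp oOm m1 dce)].
Qed.

Lemma measurable_QV_fin w : rc w -> measurable (J `&` [set t | (QV (w t) < +oo)%E]).
Proof.
move=> rw; apply: emeasurable_fun_infty_o => //.
by apply: (measurable_path T0 rw) => [l|]; [exact: quad_ge0 qQV l|exact: cQV].
Qed.

(** The default 0 makes the path V-valued at all times. For a path of finite energy it is taken only
    on a null set. *)
Definition repV l : vfield R d := if `[< (QV l < +oo)%E >] then rep Om j l else 0.

Lemma repV_Vsp l : Vsp Om (repV l).
Proof.
rewrite /repV; case: asboolP => [/(rep_Vsp oOm m1 dce)[]//|_].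
by have [] := subspace_Vsp oOm.
Qed.

Lemma repV_emb l : (QV l < +oo)%E -> emb Om j (repV l) = l.
Proof.
move=> h; rewrite /repV; case: asboolP => // _; have [h' Vh ->] := QV_in_V h.
by apply: (repP _).2; exists h' => //; exact: Vsp_Hsp.
Qed.

Lemma Vnorm_repV l : (Vnorm Om (repV l) <= QV l `^ 2^-1)%E.
Proof.
rewrite /repV; case: asboolP => [_|_]; first exact: (Vnorm_rep_le oOm m1 dce).
by rewrite /Vnorm (quad0 qH1) poweR_EFin powR0 ?invr_eq0 ?pnatr_eq0// poweR_ge0.
Qed.

Lemma borel_Vsp w : rc w -> borel_valued T (Vsp Om) (Vnorm Om) (fun t => repV (w t)).
Proof.
move=> rw; have [D [dD _]] := j_separable oOm m1 dce.
apply: (borel_valued_separable (subspace_Vsp oOm) qH1 (D := fun k => j (D k))) => //.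
- by move=> k; exact: (j_Vsp oOm m1 dce).
- by move=> t _; exact: repV_Vsp.
- move=> k r r0; set c := emb Om j (j (D k)).
  have mc (P : Prop) (M : set (measurableTypeR R)) : measurable M -> measurable [set t | M t /\ P].
    move=> mM; have [p|np] := pselect P.
      by rewrite (_ : [set t | _] = M)//; apply/seteqP; split=> t // [].
    by rewrite (_ : [set t | _] = set0)//; apply/seteqP; split=> t // [].
  set Fin := J `&` [set t | (QV (w t) < +oo)%E].
  have mF : measurable Fin by exact: measurable_QV_fin.
  (* Where [QV] is finite, the distance is a value of [QV] along a shifted path; elsewhere [repV] is
     0 and the condition does not depend on [t]. *)
  rewrite (_ : [set t | _] = (Fin `&` (J `&` [set t | (QV (w t - c)%R `^ 2^-1 < r%:E)%E])) `|`
      [set t | (J `\` Fin) t /\ (H1sq Om (0 - j (D k))%R `^ 2^-1 < r%:E)%E]).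
    apply: measurableU; last by apply: mc; exact: measurableD.
    by apply: measurableI => //; exact: measurable_path_dist.
  have E t : (QV (w t) < +oo)%E -> H1sq Om (repV (w t) - j (D k)) = QV (w t - c).
    move=> h; rewrite -{2}(repV_emb h) /c -(emb_sub oOm m1 dce); last 2 first.
    - exact: Vsp_L2 (repV_Vsp _).
    - exact: (j_L2 oOm m1 dce).
    rewrite (QV_emb oOm m1 dce)//; apply: subspaceB (subspace_Vsp oOm) (repV_Vsp _) _.
    exact: (j_Vsp oOm m1 dce).
  have E0 t : ~ (QV (w t) < +oo)%E -> repV (w t) = 0 by move=> h; rewrite /repV; case: asboolP.
  apply/seteqP; split=> t.
    move=> /= [tT]; have [f|nf] := pselect (QV (w t) < +oo)%E.
      by rewrite (E _ f) => h; left; rewrite /Fin /= -/(J t) JE.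
    by rewrite (E0 _ nf) => h; right; split => //; split; [rewrite JE|move=> [_]].
  case.
    by move=> [[+ f] [_ h]]; rewrite JE => tT; split => //; rewrite (E _ f).
  move=> [[+ nf] h]; rewrite JE => tT; split => //; rewrite E0// => f; apply: nf.
  by split; rewrite ?JE.
Qed.

Lemma LqV_of w : rc w -> (energy w < +oo)%E -> LqV Om j T q w.
Proof.
move=> rw Ew; exists (fun t => repV (w t)); split.
- exact: borel_Vsp.
- have mw := density_measurable T0 q1 qQV cQV rw.
  apply: (ae_leb_imp (ae_lt_pinfty mJ mw (fun t _ => density_ge0 _ _) Ew)) => t h tT.
  rewrite repV_emb//; rewrite ltey; apply/eqP => E.
  have := h; rewrite JE => /(_ tT); rewrite /density E poweRyr ?invr_eq0 ?pnatr_eq0//.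
  by rewrite poweRyr ?gt_eqF// ltxx.
- apply: le_lt_trans Ew; apply: le_integral_ge0 => t _; first exact: poweR_ge0.
  by apply: le_poweR; [exact: ltW|exact: poweR_ge0|exact: Vnorm_repV].
Qed.

Lemma LqV_norm_energy w : (LqV_norm Om j T q w <= energy w `^ q^-1)%E.
Proof.
apply: le_poweR; first by rewrite invr_ge0 ltW.
  by apply: integral_ge0 => t _; exact: poweR_ge0.
apply: le_integral_ge0 => t _; first exact: poweR_ge0.
by apply: le_poweR; [exact: ltW|exact: poweR_ge0|exact: (Vnorm_rep_le oOm m1 dce)].
Qed.

Lemma ipH_close h (C e : R) : Hsp Om h -> 0 < e -> exists2 eta, 0 < eta & forall l l',
  (QH l <= C%:E)%E -> (QH l' <= C%:E)%E -> (dn (l - l')%R <= eta%:E)%E ->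
  `|ipH Om j l h - ipH Om j l' h| <= e.
Proof.
move=> Hh e0; have e3 : 0 < e / 3 by rewrite divr_gt0.
have C1 : 0 < `|C| + 1 by rewrite ltr_wpDl.
have a0 : 0 < (e / 3) ^+ 2 / (`|C| + 1) by rewrite divr_gt0// exprn_gt0.
have [x hx] := ipH_approx oOm m1 dce Hh a0.
have x1 : 0 < `|x| + 1 by rewrite ltr_wpDl.
have {}hx l : (QH l <= C%:E)%E -> `|ipH Om j l h - l x| <= e / 3.
  move=> lC; have Hl : in_H Om j l by apply/(QH_in_H oOm m1 dce); exact: le_lt_trans lC (ltry _).
  apply: le_trans (hx l C Hl lC) _.
  rewrite (_ : e / 3 = Num.sqrt ((e / 3) ^+ 2)); last by rewrite sqrtr_sqr ger0_norm// ltW.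
  rewrite ler_sqrt ?sqr_ge0// sqrtr_sqr ger0_norm ?(ltW e3)//.
  rewrite mulrCA ler_piMr ?sqr_ge0// ler_pdivrMr// mul1r.
  by have := ler_norm C; lra.
exists (e / 3 / (`|x| + 1)); first by rewrite divr_gt0.
move=> l l' lC lC' ll; have h1 := hx l lC; have h2 := hx l' lC'.
have lin : linear_form (l - l').
  by apply: linear_formB; [case: (QH_dual oOm m1 dce lC)|case: (QH_dual oOm m1 dce lC')].
have h3 : `|l x - l' x| <= e / 3.
  have := dual_norm_bound x lin ll; rewrite fctE => h3; apply: le_trans h3 _.
  by rewrite mulrAC ler_pdivrMr// ler_pM2l// lerDl.
rewrite (_ : _ - _ = (ipH Om j l h - l x) + (l x - l' x) - (ipH Om j l' h - l' x)); last by ring.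
apply: le_trans (ler_normB _ _) _; have := ler_normD (ipH Om j l h - l x) (l x - l' x); lra.
Qed.

Lemma mOm_ n : measurable (Om_ n).
Proof. by have [op _ _] := OmP n; exact: measurable_Om op. Qed.

Lemma L2norm_rep_le n l (C : R) : 0 <= C -> (QH l <= C%:E)%E ->
  (L2norm (Om_ n) (rep Om j l) <= (Num.sqrt C)%:E)%E.
Proof.
move=> C0 lC; have Hl : in_H Om j l by apply/(QH_in_H oOm m1 dce); exact: le_lt_trans lC (ltry _).
have [Hr Er] := repP Hl; have [_ _ sub] := OmP n.
have h : (L2sq (Om_ n) (rep Om j l) <= C%:E)%E.
  apply: (le_trans _ lC); rewrite -{2}Er (QH_emb oOm m1 dce)//.
  apply: (L2sqS oOm) => //; [exact: mOm_|exact: measurable_Om|].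
  by have [] := Hsp_L2 Hr.
have := @le_poweR _ 2^-1 _ _ _ _ h; rewrite poweR_EFin powR12_sqrt//; apply.
  by rewrite invr_ge0.
by apply: integral_ge0 => x _; rewrite lee_fin dot_ge0.
Qed.

Lemma p_TR_lty n w (C : R) : 0 <= C -> (forall t, 0 <= t <= T -> (QH (w t) <= C%:E)%E) ->
  (p_TR Om Om_ j T q n w < +oo)%E.
Proof.
move=> C0 wC; apply: poweR_lty.
apply: (@le_lt_trans _ _ (\int[leb]_(t in J) (Num.sqrt C `^ q)%:E)%E).
  apply: le_integral_ge0 => t Jt; first exact: poweR_ge0.
  rewrite -poweR_EFin; apply: le_poweR; [exact: ltW|exact: poweR_ge0|].
  by apply: L2norm_rep_le => //; apply: wC; rewrite -JE.
rewrite integral_cst//= lebesgue_measure_itv/= lte_fin T0 -EFinD -EFinM; exact: ltry.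
Qed.

Lemma good_Zq C1 C2 D w : 0 <= C1 -> good C1 C2 D w -> Zq_set Om Om_ j T q w.
Proof.
move=> C10 gw; have rw := good_rc oOm m1 dce T0 gw.
have Hw t : 0 <= t <= T -> in_H Om j (w t) by exact: (good_in_H oOm m1 dce) gw.
have wC t : 0 <= t <= T -> (QH (w t) <= C1%:E)%E by move=> tT; exact: (good_QH gw tT).
have cw := good_cadlag oOm m1 dce T0 gw.
split.
- apply: LqV_of => //; exact: le_lt_trans (good_energy gw) (ltry _).
- split; last by move=> n; exact: p_TR_lty wC.
  exists (fun t => rep Om j (w t)); first exact: borel_Hsp.
  apply: aeW => t tT; by have [_ ->] := repP (Hw t tT).
- exact: cw.
- have [_ cr cl] := cw; split => //.
  + move=> t tT h Hh; apply/cvgrPdist_le => e e0.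
    have [eta eta0 H] := ipH_close C1 Hh e0.
    have /(cvg_ereal0P (fun s => dual_norm_ge0 _))/(_ _ eta0) cr' := cr t tT.
    have /andP[t0 tT'] := tT.
    near=> s; rewrite distrC; apply: H.
    - apply: wC; apply/andP; split; last by near: s; exact: nbhs_right_le.
      by apply: (le_trans t0); near: s; exact: nbhs_right_ge.
    - by apply: wC; rewrite t0 ltW.
    - by apply: ltW; near: s; exact: cr'.
  + move=> t /andP[t0 tT]; have [l dl hl] := cl t (introT andP (conj t0 tT)).
    have /(cvg_ereal0P (fun s => dual_norm_ge0 _)) hl' := hl.
    (* The left limit is given in U' only. It belongs to H because it is a limit of values bounded
       in H and the sublevels of [QH] are closed. *)
    have lC : (QH l <= C1%:E)%E.
      have /choice[s sP] : forall k : nat, exists s, 0 <= s <= T /\ (dn (w s - l)%R <= (k.+1%:R^-1)%:E)%E.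
        move=> k; have k0 : (0 : R) < k.+1%:R^-1 by rewrite invr_gt0.
        have := hl' _ k0 => nk.
        have [s [h1 [h2 h3]]] : exists s, (dn (w s - l)%R < (k.+1%:R^-1)%:E)%E /\ 0 <= s /\ s <= t.
          apply: (@filter_ex _ (t^'-)); near=> s; split; first by near: s; exact: nk.
          by split; near: s; [exact: nbhs_left_ge|exact: nbhs_left_le].
        by exists s; split; [rewrite h2 (le_trans h3)|exact: ltW].
      apply: (cQH (l := fun k => w (s k))) => [k|]; first by apply: wC; have [] := sP k.
      apply: dual_cvg_pointwise => [k||e e0]; last first.
      - have [K HK] := exists_natSinv_lt e0; exists K => k Kk; have [_ h] := sP k.
        apply: le_trans h _; rewrite lee_fin; apply: ltW; apply: le_lt_trans HK.
        by rewrite lef_pV2 ?posrE// ler_nat.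
      - by case: dl.
      - by have [sT _] := sP k; case: (QH_dual oOm m1 dce (wC _ sT)).
    have Hl : in_H Om j l by apply/(QH_in_H oOm m1 dce); exact: le_lt_trans lC (ltry _).
    exists (rep Om j l); first by have [] := repP Hl.
    move=> h Hh; apply/cvgrPdist_le => e e0.
    have [eta eta0 H] := ipH_close C1 Hh e0.
    near=> s; rewrite distrC; apply: (H (w s) l) => //.
    - apply: wC; apply/andP; split; first by near: s; exact: nbhs_left_ge.
      by apply: le_trans tT; near: s; exact: nbhs_left_le.
    - by apply: ltW; near: s; exact: hl'.
- exact: (good_off gw).
Unshelve. all: by end_near. Qed.

End good_Zq.

Lemma mul_frac_le {R : realFieldType} (c k e : R) : 0 <= c -> 0 < k -> 0 <= e ->
  c * (e / (k * (c + 1))) <= e / k.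
Proof.
move=> c0 k0 e0; rewrite mulrA ler_pdivrMr ?mulr_gt0// ?ltr_wpDl//.
rewrite (_ : e / k * _ = e * (c + 1)); last by field; exact: lt0r_neq0.
by rewrite mulrC ler_wpM2l// lerDl.
Qed.

(** * Skorokhod convergence controls the topology of Z_q *)

Section tame_paths.
Context {R : realType} {d : nat} {Om : set 'rV[R]_d} {Om_ : nat -> set 'rV[R]_d} {m : R}
  {U : normedModType R} {T q : R}.
Variable j : U -> vfield R d.
Hypotheses (oOm : open Om) (m1 : 1 < m) (dce : dense_compact_embedding Om m j).
Hypotheses (T0 : 0 < T) (q1 : 1 < q).
Hypothesis OmP : forall n, [/\ open (Om_ n), bounded_set (Om_ n) & Om_ n `<=` Om].
Implicit Types (l : U -> R) (w u : R -> U -> R) (x : U) (h : vfield R d).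
Local Notation leb := (@lebesgue_measure R).
Local Notation QH := (@QH R d Om U j).
Local Notation QV := (@QV R d Om U j).
Local Notation QA := (@QA R d Om U j).
Local Notation dn := (@dual_norm R U).
Local Notation energy := (@energy R U T q QV).
Local Notation density := (@density R U q).
Local Notation close := (skorokhod_within (T := T) dn).
Local Notation rc := (rc (T := T)).
Local Notation regulated := (regulated (T := T)).
Let q0 : 0 < q := lt_trans ltr01 q1.
Let qQV : quadratic setT QV := quadratic_QV oOm m1 dce.
Let qQH : quadratic setT QH := quadratic_QH oOm m1 dce.
Let cQV := QV_closed oOm m1 dce.
Let J : set (measurableTypeR R) := `[0, T]%classic.
Let mJ : measurable J. Proof. exact: measurable_itv. Qed.
Let JE t : J t = (0 <= t <= T). Proof. by rewrite /J/= in_itv. Qed.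

(** What is asked of the paths near a given one. Oscillation control is asked of the central path
    [u] alone, in the form [regulated]. *)
Record tame (C1 C2 : R) w : Prop := Tame {
  tame_QH : forall t, 0 <= t <= T -> (QH (w t) <= C1%:E)%E;
  tame_energy : (energy w <= C2%:E)%E;
  tame_rc : rc w }.

Lemma tame_linear C1 C2 w t : tame C1 C2 w -> 0 <= t <= T -> linear_form (w t).
Proof. by move=> [h _ _] tT; case: (QH_dual oOm m1 dce (h t tT)). Qed.

Lemma energyB C1 C2 w u : 0 <= C2 -> tame C1 C2 w -> tame C1 C2 u ->
  (energy (w - u)%R <= (2 `^ q * (2 * C2))%:E)%E.
Proof.
move=> C20 [_ Ew rw] [_ Eu ru].
have rN : rc (- u) by rewrite -scaleN1r; exact: rcZ.
apply: le_trans (energyD T0 q1 qQV cQV rw rN) _; apply: lee_fin_mul; first exact: powR_ge0.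
rewrite mulrDl mul1r EFinD; apply: leeD => //; rewrite -scaleN1r.
apply: le_trans (energyZ T0 q1 qQV cQV (-1) ru) _.
by rewrite normrN normr1 powR1 mul1e.
Qed.

Lemma QH_dual_bound (C : R) : 0 <= C -> exists2 M : R, 0 <= M & forall l, (QH l <= C%:E)%E -> (dn l <= M%:E)%E.
Proof.
move=> C0; have [B B0 hB] := j_bounded oOm m1 dce.
exists (Num.sqrt (C * B)); first exact: sqrtr_ge0.
move=> l lC; have /(QH_in_H (Om := Om) (j := j) oOm m1 dce)[h Hh Eh] := le_lt_trans lC (ltry C).
apply: dual_norm_le => x x1; rewrite Eh; apply: (L2ip_bound oOm).
- exact: Hsp_L2.
- exact: (j_L2 oOm m1 dce).
- by move: lC; rewrite Eh (QH_emb oOm m1 dce).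
- exact: hB.
Qed.

Lemma dual_norm_sublevel (l : nat -> U -> R) l0 (r : R) : (forall k, (dn (l k) <= r%:E)%E) ->
  pointwise_cvg l l0 -> (dn l0 <= r%:E)%E.
Proof. exact: dual_norm_closed. Qed.

Lemma QH_sub_bound (C : R) l l' : (QH l <= C%:E)%E -> (QH l' <= C%:E)%E -> (QH (l - l')%R <= (4 * C)%:E)%E.
Proof.
move=> h h'; have := quadB_le (S := setT) _ qQH Logic.I Logic.I h h'.
by move=> /(_ (conj Logic.I (fun _ _ _ _ _ => Logic.I))); rewrite -mulrDl -natrD.
Qed.

Lemma dual_integral_cvg C1 C2 u (v : nat -> R -> U -> R) (e : R) : 0 <= C1 -> 0 < e ->
  regulated u -> tame C1 C2 u -> (forall k, tame C1 C2 (v k)) ->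
  (forall k, close u (v k) k.+1%:R^-1) ->
  exists k, (\int[leb]_(t in J) (dn (v k t - u t)%R `^ q) <= e%:E)%E.
Proof.
move=> C10 e0 ru tu tv cuv.
have [M M0 hM] := QH_dual_bound (mulr_ge0 (ler0n _ 4) C10).
pose f (k : nat) (t : measurableTypeR R) := (dn (v k t - u t)%R `^ q)%E.
have fM k t : J t -> (f k t <= (M `^ q)%:E)%E.
  rewrite JE => tT; rewrite -poweR_EFin; apply: le_poweR; [exact: ltW|exact: dual_norm_ge0|].
  by apply: hM; apply: QH_sub_bound; [exact: (tame_QH (tv k))|exact: (tame_QH tu)].
have f0 k t : (0 <= f k t)%E by exact: poweR_ge0.
have mf k : measurable_fun J (f k).
  apply: (measurableT_comp (measurable_poweR q)).
  apply: (measurable_path T0 (phi := dn) (w := v k - u)) => [|l|].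
  - by apply: rcB; [exact: (tame_rc (tv k))|exact: (tame_rc tu)].
  - exact: dual_norm_ge0.
  - exact: dual_norm_sublevel.
have fc : {ae leb, forall t, J t -> f ^~ t @ \oo --> 0%E}.
  apply: (ae_leb_imp (ae_close T0 ru cuv)) => t h; rewrite JE => tT.
  apply/(cvg_ereal0P (fun k => f0 k t)) => z z0.
  have z1 : 0 < (z / 2) `^ q^-1 by rewrite powR_gt0// divr_gt0.
  have [K HK] := h tT _ z1; exists K => // k /= Kk.
  have := @le_poweR _ q _ _ (ltW q0) (dual_norm_ge0 _) (HK k Kk).
  rewrite poweR_EFin -powRrM mulVf ?gt_eqF// powRr1 ?divr_ge0 ?(ltW z0)// => h1.
  by apply: le_lt_trans h1 _; rewrite lte_fin ltr_pdivrMr// ltr_pMr// ltr1n.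
have ig : leb.-integrable J (EFin \o cst (M `^ q)).
  apply/integrableP; split; first by apply/measurable_EFinP; exact: measurable_cst.
  rewrite (eq_integral (cst (M `^ q)%:E)); last first.
    by move=> t _ /=; rewrite ger0_norm ?powR_ge0.
  rewrite integral_cst//= lebesgue_measure_itv/= lte_fin T0 -EFinD -EFinM; exact: ltry.
have fg : {ae leb, forall t, forall k, J t -> (`|f k t| <= (EFin \o cst (M `^ q)%R) t)%E}.
  by apply: aeW => t k Jt; rewrite gee0_abs//; exact: fM.
have [_ _] := dominated_convergence mJ mf (@measurable_cst _ _ _ _ J 0%E) fc ig fg.
have F0 (k : nat) : (0 <= \int[leb]_(t in J) f k t)%E by apply: integral_ge0 => t _; exact: f0.
rewrite integral0 => /(cvg_ereal0P F0)/(_ _ e0)[K _ HK].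
by exists K; apply: ltW; exact: (HK K (leqnn K)).
Qed.

(** Lions' inequality bounds a square by a sum of two terms. The larger of the two dominates up to a
    factor, and raising to the power [q / 2] produces [2^q]. *)
Lemma density_lions (A : set 'rV[R]_d) (a C : R) l : 0 <= a -> 0 <= C ->
  (forall (r D : R), (QV l <= r%:E)%E -> (dn l <= D%:E)%E -> (QA A l <= (a * r + C * D ^+ 2)%:E)%E) ->
  (QH l < +oo)%E -> (0 <= QA A l)%E -> 0 < a ->
  (density (QA A) l <= (2 `^ q * Num.sqrt a `^ q)%:E * density QV l +
     (2 `^ q * Num.sqrt C `^ q)%:E * dn l `^ q)%E.
Proof.
move=> a0 C0 lions lH QA0 ap.
have k1 : 0 < 2 `^ q * Num.sqrt a `^ q by rewrite mulr_gt0// powR_gt0// sqrtr_gt0.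
have k2 : (0 <= (2 `^ q * Num.sqrt C `^ q)%:E * dn l `^ q)%E.
  by apply: mule_ge0; [rewrite lee_fin mulr_ge0// powR_ge0|exact: poweR_ge0].
have [fl|] := boolP (QV l < +oo)%E; last first.
  rewrite -leNgt leye_eq => /eqP El; rewrite {2}/density El poweRyr ?invr_eq0 ?pnatr_eq0//.
  rewrite poweRyr ?gt_eqF// gt0_muley ?lte_fin// addye ?leey//.
  by rewrite gt_eqF// (lt_le_trans (ltNyr 0)).
have [r Er r0] := fin_lt (quad_ge0 qQV l) fl.
have dl : (dn l < +oo)%E.
  have [h _ _] := fin_lt (quad_ge0 qQH l) lH; have [z Ez _] := fin_lt (quad_ge0 qQH l) lH.
  by have [] := QH_dual oOm m1 dce (_ : (QH l <= z%:E)%E); rewrite ?Ez.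
have [D ED D0] := fin_lt (dual_norm_ge0 l) dl.
have lrD : (QA A l <= (a * r + C * D ^+ 2)%:E)%E by apply: lions; rewrite ?Er ?ED.
have [s Es s0] := fin_lt QA0 (le_lt_trans lrD (ltry _)).
rewrite (density_fin s0 Es) (density_fin r0 Er) ED poweR_EFin.
change ((Num.sqrt s `^ q)%:E <= (2 `^ q * Num.sqrt a `^ q * (Num.sqrt r `^ q) +
  2 `^ q * Num.sqrt C `^ q * (D `^ q))%:E)%E.
have {}lrD : s <= a * r + C * D ^+ 2 by rewrite -lee_fin -Es.
rewrite lee_fin -!mulrA -mulrDr -!powRM ?sqrtr_ge0// -sqrtrM//.
have -> : Num.sqrt C * D = Num.sqrt (C * D ^+ 2) by rewrite sqrtrM// sqrtr_sqr ger0_norm.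
have x0 : 0 <= a * r by exact: mulr_ge0.
have y0 : 0 <= C * D ^+ 2 by rewrite mulr_ge0// sqr_ge0.
move: (a * r) (C * D ^+ 2) x0 y0 lrD => x y x0 y0 sxy.
have half z z' : 0 <= z' -> z' <= z -> s <= z + z' -> Num.sqrt s `^ q <= 2 `^ q * Num.sqrt z `^ q.
  move=> z'0 zz h; have z0 := le_trans z'0 zz.
  rewrite -powRM ?sqrtr_ge0//; apply: ge0_ler_powR; rewrite ?nnegrE ?mulr_ge0 ?sqrtr_ge0 ?(ltW q0)//.
  rewrite -(@ler_pXn2r _ 2) ?nnegrE ?mulr_ge0 ?sqrtr_ge0// exprMn !sqr_sqrtr//; lra.
have p2 : 0 <= 2 `^ q :> R by exact: powR_ge0.
rewrite mulrDr; have [xy|yx] := leP x y.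
  by apply: le_trans (half y x x0 xy _) _; rewrite 1?addrC// lerDl mulr_ge0// powR_ge0.
by apply: le_trans (half x y y0 (ltW yx) sxy) _; rewrite lerDl mulr_ge0// powR_ge0.
Qed.

Lemma bounded_box n : exists M : R, forall x : 'rV[R]_d, Om_ n x -> forall i, `|x ord0 i| <= M.
Proof.
have [_ b _] := OmP n; have [M [_ /(_ (M + 1))hM]] := b; exists (M + 1) => x Ax i.
by apply: le_trans (rV_coord_le_norm x i) _; apply: hM => //; rewrite ltrDl.
Qed.

Lemma tame_Hloc C1 C2 u n (e : R) : 0 <= C1 -> 0 <= C2 -> 0 < e -> regulated u -> tame C1 C2 u ->
  exists2 eta, 0 < eta & forall v, tame C1 C2 v -> close u v eta ->
  (p_TR Om Om_ j T q n (v - u)%R < e%:E)%E.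
Proof.
move=> C10 C20 e0 ru tu; apply: contrapT => nH.
have /choice[v vP] : forall k : nat, exists v, [/\ tame C1 C2 v, close u v k.+1%:R^-1 &
    ~ (p_TR Om Om_ j T q n (v - u)%R < e%:E)%E].
  move=> k; apply: contrapT => nv; apply: nH; exists k.+1%:R^-1; first by rewrite invr_gt0.
  by move=> v tv cv; apply: contrapT => h; apply: nv; exists v.
have tv k : tame C1 C2 (v k) by case: (vP k).
have cv k : close u (v k) k.+1%:R^-1 by case: (vP k).
have [opn _ AO] := OmP n; have mA : measurable (Om_ n) := measurable_Om opn.
have [M hM] := bounded_box n.
have eq0 : 0 < e `^ q by rewrite powR_gt0.
(* [E0] bounds the energy of [v - u]. Then [dl] makes [2^q * dl * E0] at most a quarter of [e^q],
   and [a] is chosen so that its root to the power [q] is [dl]; the dual norm term takes another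
   quarter. *)
pose E0 := 2 `^ q * (2 * C2); have E00 : 0 <= E0 by rewrite !mulr_ge0// powR_ge0.
have b1 : 0 < 4 * (2 `^ q * E0 + 1) by rewrite mulr_gt0// ltr_wpDl// mulr_ge0// powR_ge0.
pose dl := e `^ q / (4 * (2 `^ q * E0 + 1)); have dl0 : 0 < dl by rewrite divr_gt0.
pose a := (dl `^ q^-1) ^+ 2; have a0 : 0 < a by rewrite exprn_gt0// powR_gt0.
have sa : Num.sqrt a `^ q = dl.
  by rewrite /a sqrtr_sqr ger0_norm ?powR_ge0// -powRrM mulVf ?gt_eqF// powRr1// ltW.
have [C C0 lions] := QA_lions oOm m1 dce mA AO hM a0.
pose c2 := 2 `^ q * Num.sqrt C `^ q; have c20 : 0 <= c2 by rewrite mulr_ge0// powR_ge0.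
have b2 : 0 < 4 * (c2 + 1) by rewrite mulr_gt0// ltr_wpDl.
have e1 : 0 < e `^ q / (4 * (c2 + 1)) by rewrite divr_gt0.
have [k hk] := dual_integral_cvg C10 e1 ru tu tv cv.
have [_ _] := vP k; apply.
set w := v k - u; have rw : rc w by apply: rcB; [exact: (tame_rc (tv k))|exact: (tame_rc tu)].
have wH t : J t -> (QH (w t) <= (4 * C1)%:E)%E.
  by rewrite JE => tT; apply: QH_sub_bound; [exact: (tame_QH (tv k))|exact: (tame_QH tu)].
have I1 : (\int[leb]_(t in J) (L2norm (Om_ n) (rep Om j (w t)) `^ q) <=
    \int[leb]_(t in J) ((2 `^ q * Num.sqrt a `^ q)%:E * density QV (w t) + c2%:E * dn (w t) `^ q))%E.
  apply: le_integral_ge0 => t Jt; first exact: poweR_ge0.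
  have Hw : (QH (w t) < +oo)%E := le_lt_trans (wH t Jt) (ltry _).
  rewrite (L2norm_rep oOm m1 dce AO mA); last by apply/(QH_in_H oOm m1 dce).
  apply: density_lions => //; [exact: ltW|exact: lions|exact: quad_ge0 (quadratic_QA oOm m1 dce AO mA) _].
have mV : measurable_fun J (fun t => density QV (w t)) := density_measurable T0 q1 qQV cQV rw.
have mD : measurable_fun J (fun t => dn (w t) `^ q)%E.
  apply: (measurableT_comp (measurable_poweR q)).
  apply: (measurable_path T0 (phi := dn) rw) => [l|]; first exact: dual_norm_ge0.
  exact: dual_norm_sublevel.
have d0 t : (0 <= density QV (w t))%E := density_ge0 _ _.
have n0 t : (0 <= dn (w t) `^ q)%E := poweR_ge0 _ _.
have c10 : 0 <= 2 `^ q * Num.sqrt a `^ q by rewrite mulr_ge0// powR_ge0.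
have I2 : (\int[leb]_(t in J) ((2 `^ q * Num.sqrt a `^ q)%:E * density QV (w t) + c2%:E * dn (w t) `^ q) =
    (2 `^ q * Num.sqrt a `^ q)%:E * energy w + c2%:E * \int[leb]_(t in J) (dn (w t) `^ q))%E.
  rewrite ge0_integralD//.
  - by rewrite !ge0_integralZl ?lee_fin.
  - by move=> t _; rewrite mule_ge0// lee_fin.
  - by apply: emeasurable_funM => //; exact: measurable_cst.
  - by move=> t _; rewrite mule_ge0// lee_fin.
  - by apply: emeasurable_funM => //; exact: measurable_cst.
have I3 := lee_fin_comb c10 c20 (energyB C20 (tv k) tu) hk.
rewrite -/w in I3.
have key : (\int[leb]_(t in J) (L2norm (Om_ n) (rep Om j (w t)) `^ q) <= (e `^ q / 2)%:E)%E.
  apply: le_trans I1 _; rewrite I2; apply: le_trans I3 _; rewrite lee_fin sa -/E0.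
  have h1 : 2 `^ q * dl * E0 <= e `^ q / 4.
    rewrite mulrAC; apply: mul_frac_le; [by rewrite mulr_ge0// powR_ge0|exact: ltr0n|exact: ltW].
  have h2 : c2 * (e `^ q / (4 * (c2 + 1))) <= e `^ q / 4.
    by apply: mul_frac_le; [|exact: ltr0n|exact: ltW].
  lra.
rewrite /p_TR; apply: (@le_lt_trans _ _ ((e `^ q / 2)%:E `^ q^-1)%E).
  apply: le_poweR => //; first by rewrite invr_ge0 ltW.
  by apply: integral_ge0 => t _; exact: poweR_ge0.
rewrite poweR_EFin lte_fin.
have {2}-> : e = (e `^ q) `^ q^-1 by rewrite -powRrM mulfV ?gt_eqF// powRr1// ltW.
apply: gt0_ltr_powR; rewrite ?nnegrE ?invr_gt0 ?divr_ge0 ?(ltW eq0)//.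
by rewrite ltr_pdivrMr// ltr_pMr// ltr1n.
Qed.

Lemma tame_LqV C1 C2 w : tame C1 C2 w -> LqV Om j T q w.
Proof.
move=> [_ Ew rw]; apply: (LqV_of oOm m1 dce T0 q1) => //.
exact: le_lt_trans Ew (ltry _).
Qed.

(** One-sided because the condition [Phi v <= Phi u - e] is convex: it would pass to the
    combinations of [energy_mazur], which converge to [u] in norm, against the continuity of [Phi].
    The other side follows by applying this to [- Phi]. *)
Lemma tame_weak C1 C2 u (Phi : (R -> U -> R) -> R) (e : R) : 0 < e -> regulated u -> tame C1 C2 u ->
  LqV_dual Om j T q Phi -> exists2 eta, 0 < eta & forall v, tame C1 C2 v -> close u v eta ->
  Phi u - e < Phi v.
Proof.
move=> e0 ru tu [lPhi [C bPhi]]; apply: contrapT => nH.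
have /choice[v vP] : forall k : nat, exists v, [/\ tame C1 C2 v, close u v k.+1%:R^-1 &
    Phi v <= Phi u - e].
  move=> k; apply: contrapT => nv; apply: nH; exists k.+1%:R^-1; first by rewrite invr_gt0.
  by move=> v tv cv; rewrite ltNge; apply/negP => h; apply: nv; exists v.
have tv k : tame C1 C2 (v k) by case: (vP k).
have cv k : close u (v k) k.+1%:R^-1 by case: (vP k).
have Cp : 0 < 2 * (`|C| + 1) by rewrite mulr_gt0// ltr_wpDl.
have z0 : 0 < e / (2 * (`|C| + 1)) by rewrite divr_gt0.
pose z := e / (2 * (`|C| + 1)).
have zq0 : 0 < z `^ q by rewrite powR_gt0.
have vu : {ae leb, forall t, 0 <= t <= T -> pointwise_cvg (v ^~ t) (u t)}.
  apply: (ae_leb_imp (ae_close T0 ru cv)) => t h tT.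
  apply: dual_cvg_pointwise => [k||]; [exact: tame_linear (tv k) tT|exact: tame_linear tu tT|exact: h].
have [y [hy ry Ey]] := energy_mazur T0 q1 qQV cQV (fun k => tame_rc (tv k)) (tame_rc tu) vu
  (fun k => tame_energy (tv k)) zq0.
have LqV0 : LqV Om j T q 0.
  apply: (LqV_of oOm m1 dce T0 q1); first exact: rc_cst.
  rewrite /energy (eq_integral (cst 0%E)); first by rewrite integral0.
  by move=> t _; rewrite (density0 q1 qQV).
have Phi0 : Phi 0 = 0.
  have := lPhi 1 0 0 LqV0 LqV0; rewrite scaler0 addr0 mul1r => h.
  by apply/eqP; have := h; rewrite -{1}[Phi 0]addr0 => /addrI/esym ->.
have [[Ely rly] Py] : ((energy y <= C2%:E)%E /\ rc y) /\ Phi y <= Phi u - e.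
  apply: (hull_ind_pred (P := fun a => ((energy a <= C2%:E)%E /\ rc a) /\ Phi a <= Phi u - e) _ _ hy).
    by move=> k _; split; [split; [exact: (tame_energy (tv k))|exact: (tame_rc (tv k))]|case: (vP k)].
  move=> a b [[Ea ra] Pa] [[Eb rb] Pb].
  have La : LqV Om j T q a by apply: (LqV_of oOm m1 dce T0 q1 ra); exact: le_lt_trans Ea (ltry _).
  have Lb : LqV Om j T q b by apply: (LqV_of oOm m1 dce T0 q1 rb); exact: le_lt_trans Eb (ltry _).
  have Lb2 : LqV Om j T q (2^-1 *: b).
    apply: (LqV_of oOm m1 dce T0 q1); first exact: rcZ.
    apply: le_lt_trans (energyZ T0 q1 qQV cQV _ rb) _.
    by apply: lte_mul_pinfty; [rewrite lee_fin powR_ge0| |exact: le_lt_trans Eb (ltry _)].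
  split; first split.
  - apply: le_trans (energy_mid T0 q1 qQV cQV ra rb) _; rewrite (_ : C2%:E = (2^-1 * C2 + 2^-1 * C2)%:E).
      by apply: lee_fin_comb; rewrite ?invr_ge0.
    by congr EFin; field.
  - by apply: rcZ; exact: rcD.
  - rewrite scalerDr (lPhi 2^-1 a) //.
    have -> : Phi (2^-1 *: b) = 2^-1 * Phi b.
      by have := lPhi 2^-1 b 0 Lb LqV0; rewrite !addr0 Phi0 addr0.
    lra.
have Ly : LqV Om j T q y by apply: (LqV_of oOm m1 dce T0 q1 ry); exact: le_lt_trans Ely (ltry _).
have Lu := tame_LqV tu.
have Lyu : LqV Om j T q (y - u).
  apply: (LqV_of oOm m1 dce T0 q1); first by apply: rcB => //; exact: (tame_rc tu).
  exact: le_lt_trans Ey (ltry _).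
have Eyu : Phi (y - u) = Phi y - Phi u.
  by rewrite addrC -scaleN1r lPhi// mulN1r addrC.
have := bPhi _ Lyu; rewrite Eyu.
have nyu : (LqV_norm Om j T q (y - u)%R <= z%:E)%E.
  apply: le_trans (LqV_norm_energy oOm m1 dce q1 _) _.
  have := @le_poweR _ q^-1 _ _ _ (energy_ge0 _ _) Ey.
  rewrite invr_ge0 (ltW q0) poweR_EFin -powRrM mulfV ?gt_eqF// powRr1 ?(ltW z0)//; exact.
have [r Er r0] := fin_le (poweR_ge0 _ _ : (0 <= LqV_norm Om j T q (y - u)%R)%E) nyu.
rewrite Er -EFinM lee_fin => h.
have h1 : C * r <= `|C| * z.
  case/andP: r0 => r0 rz; apply: le_trans (ler_norm _) _; rewrite normrM (ger0_norm r0).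
  exact: ler_wpM2l.
have h2 : `|C| * z <= e / 2.
  apply: mul_frac_le; [exact: normr_ge0|exact: ltr0n|exact: ltW].
have h3 := ler_norm (- (Phi y - Phi u)); rewrite normrN in h3; lra.
Qed.

Lemma tame_ipH C1 C2 u h (e : R) : 0 < e -> tame C1 C2 u -> Hsp Om h ->
  exists2 eta, 0 < eta & forall v, tame C1 C2 v -> close u v eta ->
  skorokhod_within (T := T) (fun x : R => `|x|%:E) (fun t => ipH Om j (u t) h) (fun t => ipH Om j (v t) h) e.
Proof.
move=> e0 tu Hh; have [eta eta0 H] := ipH_close oOm m1 dce C1 Hh e0.
exists (Num.min eta e); first by rewrite lt_min eta0.
move=> v tv [lam tl hl]; exists lam => // t tT; have [h1 h2] := hl t tT; split.
  by apply: le_trans h1 _; rewrite ge_min lexx orbT.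
rewrite lee_fin; apply: H; [exact: (tame_QH tu)|apply: (tame_QH tv)|].
  exact: time_change_range.
by apply: le_trans h2 _; rewrite lee_fin ge_min lexx.
Qed.

End tame_paths.

(** [h] is only dominated by [f + g], which covers the local norm of a difference of paths;
    measurability is asked of the two bounds. *)
Lemma minkowski_on {d} {X : measurableType d} {R : realType} (mu : {measure set X -> \bar R}) (D : set X)
  (f g : X -> R) (h : X -> \bar R) (p : R) : 1 <= p -> measurable D ->
  measurable_fun D f -> measurable_fun D g -> (forall x, D x -> 0 <= f x) -> (forall x, D x -> 0 <= g x) ->
  (forall x, D x -> (0 <= h x)%E) -> (forall x, D x -> (h x <= (f x + g x)%:E)%E) ->
  ((\int[mu]_(x in D) (h x `^ p)) `^ p^-1 <=
   (\int[mu]_(x in D) ((f x)%:E `^ p)) `^ p^-1 + (\int[mu]_(x in D) ((g x)%:E `^ p)) `^ p^-1)%E.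
Proof.
move=> p1 mD mf mg f0 g0 h0 hfg; have p0 : 0 < p := lt_le_trans ltr01 p1.
have NE (k : X -> R) : (forall x, D x -> 0 <= k x) ->
    ('N[mu]_p%:E[EFin \o (k \_ D)%R] = (\int[mu]_(x in D) ((k x)%:E `^ p)) `^ p^-1)%E.
  move=> k0; rewrite unlock /=; congr (_ `^ _)%E.
  rewrite [RHS]integral_mkcond; apply: eq_integral => x _; rewrite /= !patchE.
  case: ifPn => xD; first by rewrite /= ger0_norm// k0//; exact: set_mem xD.
  by rewrite /= -[point in LHS]/(0 : R) normr0 powR0// gt_eqF.
have fg0 x : D x -> 0 <= f x + g x by move=> Dx; rewrite addr_ge0 ?f0 ?g0.
rewrite -(NE f f0) -(NE g g0).
apply: le_trans (minkowski_EFin mu _ _ p1); last 2 first.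
- exact/(measurable_restrictT _ _).1.
- exact/(measurable_restrictT _ _).1.
rewrite (_ : (f \_ D \+ g \_ D)%R = (f \+ g) \_ D); last first.
  by apply/funext => x; rewrite /= !patchE; case: ifPn => // _; exact: addr0.
rewrite (NE (f \+ g) fg0); apply: le_poweR; first by rewrite invr_ge0 ltW.
  by apply: integral_ge0 => x _; exact: poweR_ge0.
apply: le_integral_ge0 => x Dx; first exact: poweR_ge0.
by apply: le_poweR; [exact: ltW|exact: h0|exact: hfg].
Qed.

Lemma ultra_image_fmap {X Y : Type} (f : X -> Y) (F : set_system X) : UltraFilter F -> UltraFilter (f @ F).
Proof.
move=> UF; split; first exact: fmap_proper_filter.
move=> G PG FG; apply/seteqP; split=> // A GA.
have [//|h] := in_ultra_setVsetC (f @^-1` A) UF.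
have GC : G (~` A) by exact: FG.
by have [y [? ?]] := filter_ex (filterI GA GC).
Qed.

Lemma generated_cvg {X : choiceType} (B : set (set X)) (F : set_system X) (x : X) : Filter F ->
  (forall b, B b -> b x -> F b) -> F --> (x : generated_topology B).
Proof.
move=> FF h A; rewrite /= (@nbhsE (generated_topology B)).
move=> [_ [[E sE <-] [C EC Cx] sUA]]; rewrite nbhs_filterE.
apply: filterS sUA _; apply: (@filterS _ _ _ C); first by move=> y Cy; exists C.
have /sE [D sD IDC] := EC; rewrite -IDC; apply: filter_bigI => b Db.
have /sD/set_mem Bb := Db; apply: h => //.
by move: Cx; rewrite -IDC => /(_ _ Db).
Qed.

Lemma generated_nbhs {X : choiceType} (B : set (set X)) (b : set X) (x : X) : B b -> b x ->
  nbhs (x : generated_topology B) b.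
Proof.
move=> Bb bx; exists b; split=> //.
exists [set b]; last first.
  by rewrite predeqE => ?; split=> [[_ ->]|] //; exists b.
move=> _ ->; exists (finmap.fset1 b); first by move=> c /finmap.fset1P ->; exact: mem_set.
apply/seteqP; split=> [y /(_ b)|y By c]; first by apply; exact/finmap.fset1P.
by move=> /finmap.fset1P ->.
Qed.

Lemma initial_cvg {S : choiceType} {Y : topologicalType} (f : S -> Y) (F : set_system S) (s : S) :
  Filter F -> f @ F --> f s -> F --> (s : initial_topology f).
Proof.
move=> FF h A /= [_ [[B oB <-] Bs sA]]; rewrite nbhs_filterE; apply: filterS sA _.
by apply: h; exact: open_nbhs_nbhs.
Qed.

(** * Convergence in each of the four topologies *)

Section Zq_convergence.
Context {R : realType} {d : nat} {Om : set 'rV[R]_d} {Om_ : nat -> set 'rV[R]_d} {m : R}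
  {U : normedModType R} {T q : R}.
Variable j : U -> vfield R d.
Hypotheses (oOm : open Om) (m1 : 1 < m) (dce : dense_compact_embedding Om m j).
Hypotheses (T0 : 0 < T) (q1 : 1 < q).
Hypothesis OmP : forall n, [/\ open (Om_ n), bounded_set (Om_ n) & Om_ n `<=` Om].
Implicit Types (l : U -> R) (w : R -> U -> R) (x : U) (h : vfield R d).
Local Notation leb := (@lebesgue_measure R).
Local Notation QH := (@QH R d Om U j).
Local Notation QV := (@QV R d Om U j).
Local Notation QA := (@QA R d Om U j).
Local Notation QHA := (@QHA R d Om U j).
Local Notation dn := (@dual_norm R U).
Local Notation energy := (@energy R U T q QV).
Local Notation close := (skorokhod_within (T := T) dn).
Local Notation rc := (rc (T := T)).
Local Notation regulated := (regulated (T := T)).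
Local Notation good := (@good R d Om U T q j).
Local Notation tame := (@tame R d Om U T q j).
Local Notation Zq_elt := (Zq_elt Om Om_ j T q).
Local Notation Zq := (Zq Om Om_ j T q).
Let q0 : 0 < q := lt_trans ltr01 q1.
Let qQH : quadratic setT QH := quadratic_QH oOm m1 dce.
Let J : set (measurableTypeR R) := `[0, T]%classic.
Let mJ : measurable J. Proof. exact: measurable_itv. Qed.
Let JE t : J t = (0 <= t <= T). Proof. by rewrite /J/= in_itv. Qed.

Lemma in_HB l l' : in_H Om j l -> in_H Om j l' -> in_H Om j (l - l').
Proof.
move=> /(QH_in_H oOm m1 dce) h /(QH_in_H oOm m1 dce) h'; apply/(QH_in_H oOm m1 dce).
have [r Er _] := fin_lt (quad_ge0 qQH l) h; have [r' Er' _] := fin_lt (quad_ge0 qQH l') h'.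
apply: (le_lt_trans _ (ltry (2 * r + 2 * r'))).
by apply: (quadB_le (S := setT)) => //; rewrite ?Er ?Er'.
Qed.

(** Expresses the local seminorm through two functions with closed sublevels, which are measurable
    along right-continuous paths; the local norms of such paths are measurable for this reason. *)
Lemma QA_fin n l : in_H Om j l -> QA (Om_ n) l = (fine (QHA (Om_ n) l) - fine (QH l))%:E.
Proof.
have [opn _ AO] := OmP n; have mA := measurable_Om opn.
move=> Hl; have [Hr Er] := repP Hl.
have qL := quadratic_L2 oOm AO mA; have qL' := quadratic_L2 oOm (@subset_refl _ Om) (measurable_Om oOm).
rewrite -Er (QA_emb oOm m1 dce AO mA Hr) (QHA_emb oOm m1 dce AO mA Hr) (QH_emb oOm m1 dce Hr).
have [r Er' _] := fin_lt (quad_ge0 qL' _) (Hsp_L2 Hr).2.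
have h : (L2sq (Om_ n) (rep Om j l) <= r%:E)%E.
  rewrite -Er'; apply: (L2sqS oOm) => //; first exact: measurable_Om.
  by have [] := Hsp_L2 Hr.
have [s Es _] := fin_le (quad_ge0 qL _) h.
by rewrite Er' Es -EFinD /= addrAC subrr add0r.
Qed.

Lemma p_TRE n w (f : R -> \bar R) : (forall t, 0 <= t <= T ->
    L2norm (Om_ n) (rep Om j (w t)) = f t) ->
  p_TR Om Om_ j T q n w = ((\int[leb]_(t in J) (f t `^ q)) `^ q^-1)%E.
Proof.
by move=> wf; congr (_ `^ _)%E; apply: eq_integral => t; rewrite inE -/J JE => tT; rewrite wf.
Qed.

Lemma p_TRD n (a b : R -> U -> R) : rc a -> rc b -> (forall t, 0 <= t <= T -> in_H Om j (a t)) ->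
  (forall t, 0 <= t <= T -> in_H Om j (b t)) ->
  (p_TR Om Om_ j T q n (a - b)%R <= p_TR Om Om_ j T q n a + p_TR Om Om_ j T q n b)%E.
Proof.
move=> ra rb Ha Hb; have [opn _ AO] := OmP n; have mA := measurable_Om opn.
have qQA := quadratic_QA oOm m1 dce AO mA.
pose f w (t : R) : R := (fine (QHA (Om_ n) (w t)) - fine (QH (w t))) `^ 2^-1.
have fE w t : in_H Om j (w t) -> L2norm (Om_ n) (rep Om j (w t)) = (f w t)%:E.
  by move=> Hw; rewrite (L2norm_rep oOm m1 dce AO mA Hw) QA_fin// poweR_EFin.
have mf w : rc w -> measurable_fun J (f w).
  move=> rw; apply: (measurableT_comp (measurable_powR 2^-1)); apply: measurable_funB.
    apply: (measurableT_comp (fine_measurable measurableT)).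
    apply: (measurable_path T0 rw) => [l|l l0 r]; first exact: (quad_ge0 (quadratic_QHA oOm m1 dce AO mA)).
    exact: (QHA_closed oOm m1 dce AO mA).
  apply: (measurableT_comp (fine_measurable measurableT)).
  by apply: (measurable_path T0 rw) => [l|]; [exact: (quad_ge0 qQH)|exact: (QH_closed oOm m1 dce)].
rewrite (p_TRE (f := fun t => (f a t)%:E) (fun t tT => fE a t (Ha t tT))).
rewrite (p_TRE (f := fun t => (f b t)%:E) (fun t tT => fE b t (Hb t tT))).
apply: minkowski_on => //; [exact: ltW|exact: mf|exact: mf|..].
- by move=> t _; exact: powR_ge0.
- by move=> t _; exact: powR_ge0.
- by move=> t _; exact: poweR_ge0.
move=> t Jt; have tT : 0 <= t <= T by rewrite -JE.
rewrite EFinD -(fE a t (Ha t tT)) -(fE b t (Hb t tT)) (_ : (a - b) t = a t - b t)//.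
rewrite !(L2norm_rep oOm m1 dce AO mA); [|exact: Hb|exact: Ha|by apply: in_HB; [exact: Ha|exact: Hb]].
have := quad_triangle qQA (Logic.I : setT (a t)) (Logic.I : setT (- b t)).
by rewrite (quadN _ qQA).
Qed.

Lemma p_TRBC n (a b : R -> U -> R) : (forall t, 0 <= t <= T -> in_H Om j (a t)) ->
  (forall t, 0 <= t <= T -> in_H Om j (b t)) -> p_TR Om Om_ j T q n (a - b) = p_TR Om Om_ j T q n (b - a).
Proof.
move=> Ha Hb; have [opn _ AO] := OmP n; have mA := measurable_Om opn.
rewrite (p_TRE (f := fun t => (QA (Om_ n) (b t - a t)%R `^ 2^-1)%E)); last first.
  move=> t tT; rewrite (_ : (a - b) t = a t - b t)// (L2norm_rep oOm m1 dce AO mA).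
    by rewrite (quadBC (S := setT) _ (quadratic_QA oOm m1 dce AO mA)).
  by apply: in_HB; [exact: Ha|exact: Hb].
rewrite (p_TRE (f := fun t => (QA (Om_ n) (b t - a t)%R `^ 2^-1)%E))//.
move=> t tT; rewrite (_ : (b - a) t = b t - a t)// (L2norm_rep oOm m1 dce AO mA)//.
by apply: in_HB; [exact: Hb|exact: Ha].
Qed.

Lemma LqV_dualN (Phi : (R -> U -> R) -> R) : LqV_dual Om j T q Phi -> LqV_dual Om j T q (fun w => - Phi w).
Proof.
move=> [lPhi [C bPhi]]; split; first by move=> a u v Lu Lv; rewrite lPhi//; ring.
by exists C => u Lu; rewrite normrN; exact: bPhi.
Qed.

Lemma Zq_cvg C1 C2 (u : Zq_elt) (F : set_system Zq_elt) : Filter F -> 0 <= C1 -> 0 <= C2 ->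
  regulated (val u) -> tame C1 C2 (val u) ->
  (forall e, 0 < e -> F [set v : Zq_elt | tame C1 C2 (val v) /\ close (val u) (val v) e]) -> F --> (u : Zq).
Proof.
move=> FF C10 C20 ru tu Fu; apply/cvg_sup => -[].
- apply/cvg_sup => -[Phi dPhi]; apply: initial_cvg; apply/cvgrPdist_lt => e e0.
  have [eta1 eta10 h1] := tame_weak oOm m1 dce T0 q1 e0 ru tu dPhi.
  have [eta2 eta20 h2] := tame_weak oOm m1 dce T0 q1 e0 ru tu (LqV_dualN dPhi).
  apply: filterS (filterI (Fu _ eta10) (Fu _ eta20)) => v [[tv c1] [_ c2]].
  have := h1 _ tv c1; have := h2 _ tv c2; rewrite /= ltr_norml => p1 p2.
  by apply/andP; split; lra.
- apply: generated_cvg => _ [n [c [r [r0 ->]]]] /= ucr.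
  have [s Es s0] := fin_lt (poweR_ge0 _ _ : (0 <= p_TR Om Om_ j T q n (val u - val c)%R)%E) (lt_trans ucr (ltry _)).
  have e0 : 0 < r - s by rewrite subr_gt0 -lte_fin -Es.
  have [eta eta0 h] := tame_Hloc oOm m1 dce T0 q1 OmP n C10 C20 e0 ru tu.
  apply: filterS (Fu _ eta0) => v [tv cv] /=; have {}h := h _ tv cv.
  have zH (z : Zq_elt) t : 0 <= t <= T -> in_H Om j (val z t).
    by have := valP z; rewrite inE => -[_ _ _ [H _ _] _]; exact: H.
  have zrc (z : Zq_elt) : rc (val z).
    by have := valP z; rewrite inE => -[_ _ H _ _]; exact: cadlag_rc.
  rewrite (_ : val v - val c = (val v - val u) - (val c - val u)); last by rewrite opprB addrA subrK.
  apply: le_lt_trans (p_TRD n _ _ _ _) _.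
  + by apply: rcB; exact: zrc.
  + by apply: rcB; exact: zrc.
  + by move=> t tT; apply: in_HB; exact: zH.
  + by move=> t tT; apply: in_HB; exact: zH.
  rewrite [X in (_ + X)%E]p_TRBC; [|exact: zH|exact: zH].
  rewrite Es (_ : r%:E = ((r - s)%:E + s%:E)%E); last by rewrite -EFinD subrK.
  by rewrite lteD2rE.
- apply: initial_cvg; apply: generated_cvg => _ [c [r [r0 ->]]] /= ucr.
  have [e e0 h] := ball_close T0 (@dual_normD _ _) ucr.
  by apply: filterS (Fu _ e0) => v [_ cv]; exact: h.
- apply/cvg_sup => -[h Hh]; apply: initial_cvg; apply: generated_cvg => _ [c [r [r0 ->]]] /= ucr.
  have ND (z y : R) : (`|z + y|%:E <= `|z|%:E + `|y|%:E)%E by rewrite -EFinD lee_fin ler_normD.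
  have [e e0 H] := ball_close T0 ND ucr.
  have [eta eta0 H'] := tame_ipH oOm m1 dce e0 tu Hh.
  by apply: filterS (Fu _ eta0) => v [tv cv]; apply: H; exact: H'.
Qed.

(** Only the factor D([0,T];U') of the topology is used: Skorokhod closeness is all that [good_lim]
    needs to carry the bounds over to the closure. *)
Lemma Zq_near_close (K : set Zq) (u : Zq) (e : R) : closure K u -> 0 < e ->
  exists2 v, K v & close (Zq_fun u) (Zq_fun v) e.
Proof.
move=> Ku e0.
have h0 : (nbhs u : set_system Zq_elt) --> (u : Zq) by [].
have /cvg_sup/(_ F_DU') h1 := h0.
have h2 : nbhs (Zq_fun u : skorokhod T dn) [set v | (skorokhod_dist T dn (Zq_fun u) v < e%:E)%E].
  apply: generated_nbhs; first by exists (Zq_fun u), e.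
  apply: le_lt_trans (_ : (skorokhod_dist T dn (Zq_fun u) (Zq_fun u) <= 0%:E)%E) _; last by rewrite lte_fin.
  apply: close_skorokhod; exists id; first exact: time_change_id.
  move=> t tT; rewrite !subrr normr0; split => //.
  by apply: dual_norm_le => x _; rewrite normr0.
have h3 := initial_continuous h2.
have [v [Kv vu]] := Ku _ (h1 _ h3).
exists v => //; have [r' r'e c] := skorokhod_close T0 vu.
by apply: close_le c; exact: ltW.
Qed.

End Zq_convergence.

Lemma ereal_le_fin {R : realType} (x : \bar R) : (x < +oo)%E -> exists2 c : R, 0 <= c & (x <= c%:E)%E.
Proof.
case: x => [r _||_].
- by exists (Num.max r 0); rewrite ?lee_fin le_max lexx ?orbT.
- by rewrite ltxx.
- by exists 0; rewrite ?leNye.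
Qed.

Section relative_compactness.
Context {R : realType} {d : nat} {Om : set 'rV[R]_d} {Om_ : nat -> set 'rV[R]_d} {m : R}
  {U : normedModType R} {T q : R}.
Variable j : U -> vfield R d.
Hypotheses (oOm : open Om) (m1 : 1 < m) (dce : dense_compact_embedding Om m j).
Hypotheses (T0 : 0 < T) (q1 : 1 < q).
Hypothesis OmP : forall n, [/\ open (Om_ n), bounded_set (Om_ n) & Om_ n `<=` Om].
Implicit Types (l : U -> R) (w : R -> U -> R) (x : U) (h : vfield R d).
Local Notation leb := (@lebesgue_measure R).
Local Notation QH := (@QH R d Om U j).
Local Notation QV := (@QV R d Om U j).
Local Notation dn := (@dual_norm R U).
Local Notation energy := (@energy R U T q QV).
Local Notation close := (skorokhod_within (T := T) dn).
Local Notation rc := (rc (T := T)).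
Local Notation good := (@good R d Om U T q j).
Local Notation tame := (@tame R d Om U T q j).
Local Notation Zq := (Zq Om Om_ j T q).
Let q0 : 0 < q := lt_trans ltr01 q1.
Let qQH : quadratic setT QH := quadratic_QH oOm m1 dce.
Let qQV : quadratic setT QV := quadratic_QV oOm m1 dce.
Let cQV := QV_closed oOm m1 dce.
Let J : set (measurableTypeR R) := `[0, T]%classic.
Let mJ : measurable J. Proof. exact: measurable_itv. Qed.
Let JE t : J t = (0 <= t <= T). Proof. by rewrite /J/= in_itv. Qed.

Lemma Zq_in_H (u : Zq) t : 0 <= t <= T -> in_H Om j (Zq_fun u t).
Proof. by have := valP (u : Zq_elt Om Om_ j T q); rewrite inE => -[_ _ _ [H _ _] _]; exact: H. Qed.

Lemma Zq_rc (u : Zq) : rc (Zq_fun u).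
Proof. by have := valP (u : Zq_elt Om Om_ j T q); rewrite inE => -[_ _ H _ _]; exact: cadlag_rc. Qed.

Lemma Zq_LqV (u : Zq) : LqV Om j T q (Zq_fun u).
Proof. by have := valP (u : Zq_elt Om Om_ j T q); rewrite inE => -[]. Qed.

Lemma Zq_off (u : Zq) t : ~~ (0 <= t <= T) -> Zq_fun u t = 0.
Proof. by have := valP (u : Zq_elt Om Om_ j T q); rewrite inE => -[_ _ _ _]; exact. Qed.

Lemma Zq_QH_le (u : Zq) t (c : R) : 0 <= c -> 0 <= t <= T ->
  (Hnorm Om (rep Om j (Zq_fun u t)) <= c%:E)%E -> (QH (Zq_fun u t) <= (c ^+ 2)%:E)%E.
Proof.
move=> c0 tT; rewrite (Hnorm_rep oOm m1 dce (Zq_in_H u tT)) => h.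
have [r Er r0] := fin_lt (quad_ge0 qQH _) ((QH_in_H oOm m1 dce _).2 (Zq_in_H u tT)).
move: h; rewrite Er poweR_EFin powR12_sqrt// !lee_fin => h.
by rewrite -(sqr_sqrtr r0) ler_pXn2r// nnegrE ?sqrtr_ge0.
Qed.

(** Off V, [QV] is infinite by definition, while the H^1 norm of the representative could be
    smaller. Membership in L^q(0,T;V) puts almost every value in V, where the two agree. *)
Lemma Zq_energy_le (u : Zq) :
  (energy (Zq_fun u) <= \int[leb]_(s in `[0%R, T]) (Vnorm Om (rep Om j (Zq_fun u s)) `^ q))%E.
Proof.
have [v [[Vv _] uv _]] := Zq_LqV u.
have fin : {ae leb, forall t, 0 <= t <= T -> (QV (Zq_fun u t) < +oo)%E}.
  apply: (ae_leb_imp uv) => t h tT; rewrite (h tT) (QV_emb oOm m1 dce (Vv t tT)).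
  by have [] := Vv t tT.
have [N [mN N0 hN]] := fin.
have md := density_measurable T0 q1 qQV cQV (Zq_rc u).
have d0 t : (0 <= density (q:=q) QV (Zq_fun u t))%E := density_ge0 _ _.
have -> : energy (Zq_fun u) = (\int[leb]_(t in J `\` N) density (q:=q) QV (Zq_fun u t))%E.
  by apply: ge0_negligible_integral.
rewrite integral_mkcond [X in (_ <= X)%E]integral_mkcond.
apply: le_integral_ge0 => t _; rewrite !patchE.
  by case: ifPn => // _; exact: d0.
case: ifPn => [/set_mem[Jt nN]|_]; last by case: ifPn => // _; exact: poweR_ge0.
rewrite mem_set//; apply: le_poweR; [exact: ltW|exact: poweR_ge0|].
have f : (QV (Zq_fun u t) < +oo)%E.
  by apply: contrapT => nf; apply: nN; apply: hN => /= H; apply: nf; apply: H; rewrite -JE.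
by have [_ E] := rep_Vsp oOm m1 dce f; rewrite /Vnorm E.
Qed.

Lemma modulus_lt_osc w (delta e : R) : (cadlag_modulus T dn w delta < e%:E)%E ->
  exists n a, subdivision T delta n a /\ osc_le w e n a.
Proof.
move=> /ereal_inf_lt[_ [n [a [sa ->]]] h]; exists n, a; split => // i ni s t s1 st t2.
apply: ltW; apply: le_lt_trans h.
apply: (@le_trans _ _ (ereal_sup [set dn (w p.2 - w p.1) | p in
  [set p : R * R | a i <= p.1 /\ p.1 < p.2 /\ p.2 < a i.+1]])).
  by apply: ereal_sup_ubound; exists (s, t).
exact: (le_bigmax _ (fun i : 'I_n => ereal_sup [set dn (w p.2 - w p.1) | p in
  [set p : R * R | a i <= p.1 /\ p.1 < p.2 /\ p.2 < a i.+1]]) (Ordinal ni)).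
Qed.

Lemma good_of_bounds (K : set Zq) :
  (ereal_sup [set ereal_sup [set Hnorm Om (rep Om j (Zq_fun u s))
                            | s in `[0%R, T]] | u in K] < +oo)%E ->
  (ereal_sup [set \int[leb]_(s in `[0%R, T])
                    (Vnorm Om (rep Om j (Zq_fun u s)) `^ q) | u in K] < +oo)%E ->
  ereal_sup (0%E |` [set cadlag_modulus T dn (Zq_fun u) delta | u in K])
    @[delta --> 0^'+] --> 0%E ->
  exists C1 C2 D, [/\ 0 <= C1, 0 <= C2, forall p : nat, 0 < D p &
    forall u, K u -> good C1 C2 D (Zq_fun u)].
Proof.
move=> /ereal_le_fin[c1 c10 h1] /ereal_le_fin[c2 c20 h2] h3.
have S0 (delta : R) : (0 <= ereal_sup (0%E |` [set cadlag_modulus T dn (Zq_fun u) delta | u in K]))%E.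
  by apply: ereal_sup_ubound; left.
(* Condition (c) supplies, for each level [1/(p+1)], one gap valid for all of [K]. *)
have /choice[D DP] : forall p : nat, exists delta, 0 < delta /\
    forall u, K u -> (cadlag_modulus T dn (Zq_fun u) delta < (p.+1%:R^-1)%:E)%E.
  move=> p; have p0 : (0 : R) < p.+1%:R^-1 by rewrite invr_gt0.
  have /(cvg_ereal0P S0)/(_ _ p0) np := h3.
  have [delta [d1 d2]] : exists delta : R, (ereal_sup (0%E |`
      [set cadlag_modulus T dn (Zq_fun u) delta | u in K]) < (p.+1%:R^-1)%:E)%E /\ 0 < delta.
    by apply: (@filter_ex _ (0^'+)); apply: filterI np _; exact: nbhs_right_gt.
  exists delta; split => // u Ku; apply: le_lt_trans d1.
  by apply: ereal_sup_ubound; right; exists u.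
exists (c1 ^+ 2), c2, D; split => //; [exact: sqr_ge0|by move=> p; have [] := DP p|].
move=> u Ku; split.
- move=> t tT; apply: Zq_QH_le => //; apply: le_trans h1.
  apply: (@le_trans _ _ (ereal_sup [set Hnorm Om (rep Om j (Zq_fun u s)) | s in `[0%R, T]])).
    by apply: ereal_sup_ubound; exists t => //=; rewrite in_itv.
  by apply: ereal_sup_ubound; exists u.
- by move=> p; apply: modulus_lt_osc; have [_] := DP p; apply.
- apply: le_trans (Zq_energy_le u) _; apply: le_trans h2.
  by apply: ereal_sup_ubound; exists u.
- by move=> t; exact: Zq_off.
Qed.

(** Limits are taken twice: paths in the closure of [K] obey the bounds with the gaps [D'], and the
    limit of an ultrafilter on that closure with gaps derived from [D'] in the same way. The
    constants [C1] and [C2] never change. *)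
Lemma compact_closure_good (K : set Zq) C1 C2 D : 0 <= C1 -> 0 <= C2 -> (forall p : nat, 0 < D p) ->
  (forall u, K u -> good C1 C2 D (Zq_fun u)) -> compact (closure K).
Proof.
move=> C10 C20 D0 Kg.
pose D' (p : nat) := D (2 * p).+1 / 2; have D'0 p : 0 < D' p by rewrite divr_gt0.
have cKg u : closure K u -> good C1 C2 D' (Zq_fun u).
  move=> Ku; have /choice[v vP] : forall k : nat, exists v, K v /\ close (Zq_fun u) (Zq_fun v) k.+1%:R^-1.
    move=> k; have k0 : (0 : R) < k.+1%:R^-1 by rewrite invr_gt0.
    by have [v Kv c] := Zq_near_close T0 Ku k0; exists v.
  apply: (good_lim (v := fun k => Zq_fun (v k)) oOm m1 dce T0 q1 D0).
  - by move=> t tT; case: (Zq_in_H u tT) => h Hh ->; apply: (emb_dual oOm m1 dce); exact: Hsp_L2.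
  - by move=> t; exact: Zq_off.
  - by move=> k; apply: Kg; have [] := vP k.
  - by move=> k; have [] := vP k.
have gt D1 w : good C1 C2 D1 w -> tame C1 C2 w.
  by move=> g; split; [exact: (good_QH g)|exact: (good_energy g)|exact: (good_rc oOm m1 dce T0 g)].
rewrite compact_ultra => F UF FK.
have UG := ultra_image_fmap (@Zq_fun R d Om Om_ U j T q) UF.
have [|u [gu Fu]] := good_ultra oOm m1 dce T0 q1 D'0 UG (C1 := C1) (C2 := C2).
  change (F [set v | good C1 C2 D' (Zq_fun v)]).
  by apply: filterS FK => v; exact: cKg.
have Zu : u \in Zq_set Om Om_ j T q by apply: mem_set; exact: (good_Zq oOm m1 dce T0 q1 OmP C10 gu).
pose z : Zq_elt Om Om_ j T q := exist _ u Zu.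
have Fz : F --> (z : Zq).
  apply: (Zq_cvg oOm m1 dce T0 q1 OmP (C1 := C1) (C2 := C2)) => //.
  - exact: (good_regulated gu).
  - exact: (gt _ _ gu).
  - move=> e e0; have Fe : F [set v | close u (Zq_fun v) e] := Fu e e0.
    apply: filterS (filterI FK Fe) => v [cv c]; split => //.
    exact: (gt _ _ (cKg v cv)).
exists (z : Zq); split => //.
apply: closed_closure => B nB; have FB : F B by exact: Fz.
by have [v [cv Bv]] := filter_ex (filterI FK FB); exists v.
Qed.

End relative_compactness.

Theorem theorem3p4 (R : realType) (d : nat) (Om : set 'rV[R]_d)
    (Om_ : nat -> set 'rV[R]_d) (m : R) (U : completeNormedModType R)
    (j : U -> 'rV[R]_d -> 'rV[R]_d) (T q : R) (K : set (Zq Om Om_ j T q)) :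
  d = 2%N \/ d = 3%N ->
  open Om -> connected Om -> smooth_boundary Om ->
  (forall n, [/\ open (Om_ n), bounded_set (Om_ n), lipschitz_boundary (Om_ n),
                 Om_ n `<=` Om & Om_ n `<=` Om_ n.+1]) ->
  \bigcup_n Om_ n = Om ->
  1 < m -> is_hilbert U -> dense_compact_embedding Om m j ->
  0 < T -> 1 < q ->
  (* (a) *)
  (forall u, K u -> forall t : R, 0 <= t <= T -> in_H Om j (Zq_fun u t)) ->
  (ereal_sup [set ereal_sup [set Hnorm Om (rep Om j (Zq_fun u s))
                            | s in `[0%R, T]] | u in K] < +oo)%E ->
  (* (b) *)
  (ereal_sup [set \int[lebesgue_measure]_(s in `[0%R, T])
                    (Vnorm Om (rep Om j (Zq_fun u s)) `^ q) | u in K] < +oo)%E ->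
  (* (c); the supremum is taken in [0, +oo] *)
  ereal_sup (0%E |` [set cadlag_modulus T (@dual_norm R U) (Zq_fun u) delta | u in K])
    @[delta --> 0^'+] --> 0%E ->
  compact (closure K).
Proof.
move=> _ oOm _ _ OmP _ m1 _ dce T0 q1 _ ha hb hc.
have OmP' n : [/\ open (Om_ n), bounded_set (Om_ n) & Om_ n `<=` Om] by have [] := OmP n.
have [C1 [C2 [D [C10 C20 D0 Kg]]]] := good_of_bounds oOm m1 dce T0 q1 ha hb hc.
exact: (compact_closure_good oOm m1 dce T0 q1 OmP' C10 C20 D0 Kg).
Qed.
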